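(* Let $k$ be a number field, $i\ge1$, and $K^{(i+1)}$ a $\mathbb{Z}_p^{i+1}$-extension of $k$. Suppose $X(K^{(i+1)})\sim\bigoplus_{l=1}^t\Lambda(K^{(i+1)}/k)/(f_l)$ (pseudo-isomorphism of $\Lambda(K^{(i+1)}/k)$-modules) with nonzero $f_l\in\Lambda(K^{(i+1)}/k)$. (1) For generic $\mathbb{Z}_p^i$-extensions $K^{(i)}\subset K^{(i+1)}$ of $k$, there is a $\Lambda^{\dagger}(K^{(i)}/k)$-homomorphism $\bigoplus_{l=1}^t\Lambda^{\dagger}(K^{(i)}/k)/(\overline{f_l})\to X(K^{(i)})^{\dagger}$ with pseudo-null cokernel. In particular, if $X(K^{(i+1)})$ is pseudo-null, then $X(K^{(i)})^{\dagger}$ is pseudo-null for generic $K^{(i)}\subset K^{(i+1)}$. (2) If $\mathrm{rank}_{\mathbb{Z}_p}D_{\mathfrak{p}}(K^{(i+1)}/k)\ge2$ for every prime $\mathfrak{p}$ of $k$ above $p$, then for generic $\mathbb{Z}_p^i$-extensions $K^{(i)}\subset K^{(i+1)}$ of $k$, $X(K^{(i)})^{\dagger}\sim\bigoplus_{l=1}^t\Lambda^{\dagger}(K^{(i)}/k)/(\overline{f_l})$.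
   Context: $p$ is a fixed prime. For an algebraic extension $F/\mathbb{Q}$, $X(F)$ is the Galois group of the maximal unramified abelian pro-$p$ extension of $F$. For a $\mathbb{Z}_p^d$-extension $K/k$, $\Lambda(K/k)=\mathbb{Z}_p[[\mathrm{Gal}(K/k)]]$ acting on $X(K)$ by conjugation. Over a noetherian integrally closed domain, a module is pseudo-null if finitely generated with annihilator of height $\ge2$, and $X\sim Y$ means there is a homomorphism $X\to Y$ with pseudo-null kernel and cokernel. For a $\mathbb{Z}_p$-extension $K/k$, $\Lambda^{\dagger}(K/k)=\Lambda(K/k)[1/(\gamma-1)\mid\gamma\in\mathrm{Gal}(K/k),\gamma\ne1]$ (a one-dimensional ring, over which pseudo-null means zero and pseudo-isomorphism means isomorphism); for a $\mathbb{Z}_p^i$-extension with $i\ge2$, $\Lambda^{\dagger}(K^{(i)}/k)=\Lambda(K^{(i)}/k)$. For a $\Lambda(K^{(i)}/k)$-module $X$, $X^{\dagger}=\Lambda^{\dagger}(K^{(i)}/k)\otimes_{\Lambda(K^{(i)}/k)}X$. $\overline{f_l}$ is the image of $f_l$ under the map $\Lambda(K^{(i+1)}/k)\to\Lambda(K^{(i)}/k)$ induced by restriction. $D_{\mathfrak{p}}(K^{(i+1)}/k)\subset\mathrm{Gal}(K^{(i+1)}/k)$ is the decomposition group of $\mathfrak{p}$. Measure: for a free $\mathbb{Z}_p$-module $M$ of rank $d$, $\mathrm{Gr}(i,M)$ is the set of submodules $N$ with $M/N$ free of rank $i$, with the quotient topology and the pushforward of normalized Haar measure from $\mathrm{Aut}(M)\cong\mathrm{GL}_d(\mathbb{Z}_p)$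 via $g\mapsto g(N_0)$ (any fixed $N_0$; $\mathrm{Aut}(M)$ acts transitively). $\mathbb{Z}_p^i$-extensions $K^{(i)}\subset K^{(d)}$ of $k$ are identified with $\mathrm{Gr}(i,\mathrm{Gal}(K^{(d)}/k))$ via $K^{(i)}\leftrightarrow\mathrm{Gal}(K^{(d)}/K^{(i)})$. ''Generic $K^{(i)}$ satisfy $P$'' means a closed measure-zero set contains all $K^{(i)}$ failing $P$. *)

(* Defs.v *)
From HB Require Import structures.
From mathcomp Require Import all_boot all_order all_algebra all_field ring.
From mathcomp Require Import all_classical all_reals all_analysis.
Set Implicit Arguments.
Unset Strict Implicit.
Unset Printing Implicit Defensive.
Import GRing.Theory.
Local Open Scope classical_set_scope.
Local Open Scope ring_scope.
Local Open Scope quotient_scope.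

(* All algebraic extensions of Q are taken inside algC, where subfields are
   predicates of type divringClosed algC. Rings are only assumed
   to be comPzRingType because 1 != 0 is not proved for the rings built below
   (it fails for padic p when p = 1). *)

Section SubQuot.
Variables (R : pzRingType) (M : lmodType R) (N : submodClosed M).

(* Over a ring (not just a semiring) a submodule is also a subgroup, which is
   what {ideal_quot _} requires. *)
Definition sub_pred : {pred M} := N.
Fact sub_pred_closed : GRing.submod_closed sub_pred.
Proof.
split=> [|a x y Nx Ny]; first exact: rpred0.
by apply: rpredD => //; apply: rpredZ.
Qed.
HB.instance Definition _ := GRing.isSubmodClosed.Build R M sub_pred
  sub_pred_closed.

Definition submod_type := {x : M | x \in sub_pred}.
HB.instance Definition _ := SubChoice.on submod_type.
HB.instance Definition _ := [SubChoice_isSubLmodule of submod_type by <:].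

Definition quot_mod := {ideal_quot sub_pred}.
HB.instance Definition _ := GRing.Zmodule.on quot_mod.

Definition quot_pi (x : M) : quot_mod := \pi_({ideal_quot sub_pred}) x.

Lemma quot_mod_elim (P : quot_mod -> Prop) : (forall x, P (quot_pi x)) -> forall u, P u.
Proof. by move=> Ppi u; rewrite -[u]reprK; apply: Ppi. Qed.

Lemma quot_piP (x y : M) : (quot_pi x = quot_pi y) <-> (x - y \in sub_pred).
Proof.
by rewrite Quotient.idealrBE; split=> [e|/eqP //]; apply/eqP; exact: e.
Qed.

Lemma quot_piD x y : quot_pi (x + y) = quot_pi x + quot_pi y.
Proof. exact: (Quotient.pi_add _ x y). Qed.

Definition quot_scale a (u : quot_mod) : quot_mod := quot_pi (a *: repr u).

Lemma quot_scaleE a x : quot_scale a (quot_pi x) = quot_pi (a *: x).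
Proof.
apply/quot_piP; rewrite -scalerBr; apply/rpredZ/quot_piP.
by rewrite /quot_pi reprK.
Qed.

Fact quot_scaleA a b u : quot_scale a (quot_scale b u) = quot_scale (a * b) u.
Proof. by elim/quot_mod_elim: u => x; rewrite !quot_scaleE scalerA. Qed.
Fact quot_scale1 : left_id 1 quot_scale.
Proof. by elim/quot_mod_elim=> x; rewrite quot_scaleE scale1r. Qed.
Fact quot_scaleDr : right_distributive quot_scale +%R.
Proof.
move=> a; elim/quot_mod_elim=> x; elim/quot_mod_elim=> y.
by rewrite -quot_piD !quot_scaleE -quot_piD scalerDr.
Qed.
Fact quot_scaleDl u : {morph quot_scale^~ u : a b / a + b}.
Proof.
elim/quot_mod_elim: u => x a b.
by rewrite !quot_scaleE -quot_piD scalerDl.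
Qed.
HB.instance Definition _ := GRing.Zmodule_isLmodule.Build R quot_mod
  quot_scaleA quot_scale1 quot_scaleDr quot_scaleDl.
End SubQuot.

Section KerCoker.
Variables (R : pzRingType) (M M' : lmodType R) (h : {linear M -> M'}).

Definition ker_pred : {pred M} := fun x => h x == 0.
Fact ker_pred_closed : GRing.submod_closed ker_pred.
Proof.
split=> [|a x y]; rewrite !unfold_in ?linear0 // => /eqP hx /eqP hy.
by rewrite linearP hx hy scaler0 addr0.
Qed.
HB.instance Definition _ := GRing.isSubmodClosed.Build R M ker_pred
  ker_pred_closed.

Definition im_pred : {pred M'} := fun y => `[< range h y >].
Fact im_pred_closed : GRing.submod_closed im_pred.
Proof.
split=> [|a x y]; rewrite ?unfold_in.
  by apply/asboolP; exists 0 => //; rewrite linear0.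
move=> /asboolP[x' _ <-] /asboolP[y' _ <-]; apply/asboolP.
by exists (a *: x' + y') => //; rewrite linearP.
Qed.
HB.instance Definition _ := GRing.isSubmodClosed.Build R M' im_pred
  im_pred_closed.

Definition ker : lmodType R := submod_type ker_pred.
Definition coker : lmodType R := quot_mod im_pred.
End KerCoker.

Section DirectSum.
Variables (R : pzRingType) (t : nat) (M : 'I_t -> lmodType R).

Definition dsum := forall l, M l.
HB.instance Definition _ := gen_eqMixin dsum.
HB.instance Definition _ := gen_choiceMixin dsum.

Let add (u v : dsum) : dsum := fun l => u l + v l.
Let zero : dsum := fun l => 0.
Let opp (u : dsum) : dsum := fun l => - u l.
Let scale a (u : dsum) : dsum := fun l => a *: u l.
Let ext (u v : dsum) : (forall l, u l = v l) -> u = v.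
Proof. exact: functional_extensionality_dep. Qed.

Fact dsum_addA : associative add.
Proof. by move=> u v w; apply: ext => l; apply: addrA. Qed.
Fact dsum_addC : commutative add.
Proof. by move=> u v; apply: ext => l; apply: addrC. Qed.
Fact dsum_add0 : left_id zero add.
Proof. by move=> u; apply: ext => l; apply: add0r. Qed.
Fact dsum_addN : left_inverse zero opp add.
Proof. by move=> u; apply: ext => l; apply: addNr. Qed.
HB.instance Definition _ :=
  GRing.isZmodule.Build dsum dsum_addA dsum_addC dsum_add0 dsum_addN.

Fact dsum_scaleA a b u : scale a (scale b u) = scale (a * b) u.
Proof. by apply: ext => l; apply: scalerA. Qed.
Fact dsum_scale1 : left_id 1 scale.
Proof. by move=> u; apply: ext => l; apply: scale1r. Qed.
Fact dsum_scaleDr : right_distributive scale +%R.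
Proof. by move=> a u v; apply: ext => l; apply: scalerDr. Qed.
Fact dsum_scaleDl u : {morph scale^~ u : a b / a + b}.
Proof. by move=> a b; apply: ext => l; apply: scalerDl. Qed.
HB.instance Definition _ := GRing.Zmodule_isLmodule.Build R dsum
  dsum_scaleA dsum_scale1 dsum_scaleDr dsum_scaleDl.
End DirectSum.

Section PseudoNull.
Variable R : comPzRingType.

Definition is_ideal (I : set R) :=
  [/\ I 0, forall a b, I a -> I b -> I (a + b) & forall a b, I b -> I (a * b)].

Definition is_prime (P : set R) :=
  [/\ is_ideal P, ~ P 1 & forall a b, P (a * b) -> P a \/ P b].

(* ht I >= 2, where ht I is the infimum of the heights of the primes above I; in
   particular the unit ideal qualifies. *)
Definition height_ge2 (I : set R) := forall P, is_prime P -> I `<=` P ->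
  exists P0 P1, [/\ is_prime P0, is_prime P1, P0 `<` P1 & P1 `<` P].

Definition fin_gen (M : lmodType R) := exists (n : nat) (g : 'I_n -> M),
  forall x, exists c : 'I_n -> R, x = \sum_j c j *: g j.

Definition annihilator (M : lmodType R) : set R :=
  [set a | forall x : M, a *: x = 0].

Definition pseudo_null (M : lmodType R) :=
  fin_gen M /\ height_ge2 (annihilator M).

Definition pseudo_iso (M M' : lmodType R) :=
  exists h : {linear M -> M'}, pseudo_null (ker h) /\ pseudo_null (coker h).

Definition principal (f : R) : {pred R^o} := fun a => `[< exists b, a = b * f >].
Fact principal_closed f : GRing.submod_closed (principal f).
Proof.
split=> [|a x y]; rewrite ?unfold_in.
  by apply/asboolP; exists 0; rewrite mul0r.
move=> /asboolP[b ->] /asboolP[c ->]; apply/asboolP.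
by exists (a * b + c); rewrite mulrDl -mulrA.
Qed.
HB.instance Definition _ f := GRing.isSubmodClosed.Build R R^o (principal f)
  (principal_closed f).

Definition sum_cyclic (t : nat) (f : 'I_t -> R) : lmodType R :=
  dsum (fun l => quot_mod (principal (f l))).
End PseudoNull.

Section BaseChange.
Variables (R A : comPzRingType) (j : {rmorphism R -> A}) (X : lmodType R).

Definition balanced (Y : zmodType) (b : A * X -> Y) :=
  [/\ forall a a' x, b (a + a', x) = b (a, x) + b (a', x),
      forall a x x', b (a, x + x') = b (a, x) + b (a, x') &
      forall a r x, b (a * j r, x) = b (a, r *: x)].

(* A (x)_R X consists of formal sums of pure tensors, two sums being equal iff no
   balanced biadditive map separates them. *)
Definition tens_rel (s s' : seq (A * X)) : bool :=
  `[< forall (Y : zmodType) (b : A * X -> Y), balanced b ->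
      \sum_(z <- s) b z = \sum_(z <- s') b z >].

Fact tens_equiv : equiv_class_of tens_rel.
Proof.
split=> [s|s s'|s' s s''].
- exact/asboolP.
- by apply/asboolP/asboolP => E Y b bb; rewrite (E Y b bb).
- by move=> /asboolP E /asboolP E'; apply/asboolP => Y b bb; rewrite (E Y b bb) E'.
Qed.
Canonical tens_equiv_rel := EquivRelPack tens_equiv.

Definition tens := {eq_quot tens_rel}.
HB.instance Definition _ := Choice.on tens.
HB.instance Definition _ := EqQuotient.on tens.

Lemma tens_elim (P : tens -> Prop) :
  (forall s, P (\pi_tens s)) -> forall u, P u.
Proof. by move=> Ppi u; rewrite -[u]reprK; apply: Ppi. Qed.

Lemma tensP s s' : (\pi_tens s = \pi_tens s') <->
  (forall (Y : zmodType) (b : A * X -> Y), balanced b ->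
      \sum_(z <- s) b z = \sum_(z <- s') b z).
Proof. by split=> [/eqmodP/asboolP|E] //; apply/eqmodP/asboolP. Qed.

Lemma tens_repr s (Y : zmodType) (b : A * X -> Y) : balanced b ->
  \sum_(z <- repr (\pi_tens s)) b z = \sum_(z <- s) b z.
Proof. by move: Y b; apply/tensP; rewrite reprK. Qed.

Definition mull_seq a (s : seq (A * X)) := [seq (a * z.1, z.2) | z <- s].

Lemma balanced_mull a (Y : zmodType) (b : A * X -> Y) :
  balanced b -> balanced (fun z => b (a * z.1, z.2)).
Proof.
move=> [b1 b2 b3]; split=> [c c' x|c x x'|c r x] /=.
- by rewrite mulrDr b1.
- by rewrite b2.
- by rewrite mulrA b3.
Qed.

Definition tens_zero : tens := \pi_tens [::].
Definition tens_add (u v : tens) : tens := \pi_tens (repr u ++ repr v).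
Definition tens_scale a (u : tens) : tens := \pi_tens (mull_seq a (repr u)).

Lemma tens_addE s s' : tens_add (\pi_tens s) (\pi_tens s') = \pi_tens (s ++ s').
Proof. by apply/tensP => Y b bb; rewrite !big_cat /= !tens_repr. Qed.
Lemma tens_scaleE a s : tens_scale a (\pi_tens s) = \pi_tens (mull_seq a s).
Proof.
apply/tensP => Y b bb; rewrite !big_map.
exact: (tens_repr _ (balanced_mull a bb)).
Qed.

Fact tens_addA : associative tens_add.
Proof.
by elim/tens_elim=> x; elim/tens_elim=> y; elim/tens_elim=> z; rewrite !tens_addE catA.
Qed.
Fact tens_addC : commutative tens_add.
Proof.
elim/tens_elim=> x; elim/tens_elim=> y; rewrite !tens_addE.
by apply/tensP => Y b bb; rewrite !big_cat /= addrC.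
Qed.
Fact tens_add0 : left_id tens_zero tens_add.
Proof. by elim/tens_elim=> x; rewrite tens_addE. Qed.
Fact tens_addN : left_inverse tens_zero (tens_scale (-1)) tens_add.
Proof.
elim/tens_elim=> x; rewrite tens_scaleE tens_addE; apply/tensP => Y b bb.
rewrite big_cat big_map big_nil /= -big_split /= big1 // => -[a y] _ /=.
have [b1 _ _] := bb; rewrite -b1 mulN1r addNr.
by apply: (addIr (b (0, y))); rewrite -b1 !add0r.
Qed.
HB.instance Definition _ :=
  GRing.isZmodule.Build tens tens_addA tens_addC tens_add0 tens_addN.

Fact tens_scaleA a b u : tens_scale a (tens_scale b u) = tens_scale (a * b) u.
Proof.
elim/tens_elim: u => s; rewrite !tens_scaleE; apply/tensP => Y c cb.
by rewrite !big_map; apply: eq_bigr => z _ /=; rewrite mulrA.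
Qed.
Fact tens_scale1 : left_id 1 tens_scale.
Proof.
elim/tens_elim=> s; rewrite tens_scaleE; apply/tensP => Y c cb.
by rewrite big_map; apply: eq_bigr => -[a x] _ /=; rewrite mul1r.
Qed.
Fact tens_scaleDr : right_distributive tens_scale +%R.
Proof.
move=> a; elim/tens_elim=> x; elim/tens_elim=> y.
change (tens_scale a (tens_add (\pi_tens x) (\pi_tens y)) =
  tens_add (tens_scale a (\pi_tens x)) (tens_scale a (\pi_tens y))).
by rewrite tens_addE !tens_scaleE tens_addE /mull_seq map_cat.
Qed.
Fact tens_scaleDl u : {morph tens_scale^~ u : a b / a + b}.
Proof.
elim/tens_elim: u => x a b.
rewrite -[RHS]/(tens_add _ _) !tens_scaleE !tens_addE; apply/tensP => Y c [c1 _ _].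
rewrite big_cat !big_map /= -big_split; apply: eq_bigr => z _ /=.
by rewrite mulrDl c1.
Qed.
HB.instance Definition _ := GRing.Zmodule_isLmodule.Build A tens
  tens_scaleA tens_scale1 tens_scaleDr tens_scaleDl.
End BaseChange.

Section Localization.
Variables (R : comPzRingType) (S : set R).

Inductive mult_closure : R -> Prop :=
| mult_closure1 : mult_closure 1
| mult_closureM s u : S s -> mult_closure u -> mult_closure (s * u).

Lemma mult_closure_mul u v :
  mult_closure u -> mult_closure v -> mult_closure (u * v).
Proof.
move=> mu mv; elim: mu => [|s w Ss _ IH]; first by rewrite mul1r.
by rewrite -mulrA; apply: mult_closureM.
Qed.

Record denom := Denom { den : R; denP : mult_closure den }.
HB.instance Definition _ := gen_eqMixin denom.
HB.instance Definition _ := gen_choiceMixin denom.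
Definition den1 := Denom mult_closure1.
Definition denM (s u : denom) := Denom (mult_closure_mul (denP s) (denP u)).

Definition loc_rel (x y : R * denom) : bool :=
  `[< exists u : denom, den u * (x.1 * den y.2) = den u * (y.1 * den x.2) >].

Fact loc_equiv : equiv_class_of loc_rel.
Proof.
split=> [x|x y|y x z].
- by apply/asboolP; exists den1.
- by apply/asboolP/asboolP => -[u e]; exists u.
- move=> /asboolP[u e] /asboolP[v e']; apply/asboolP.
  exists (denM (denM u v) y.2) => /=.
  have -> : den u * den v * den y.2 * (x.1 * den z.2) = den v * den z.2 * (den u * (x.1 * den y.2)) by ring.
  rewrite e.
  have -> : den v * den z.2 * (den u * (y.1 * den x.2)) = den u * den x.2 * (den v * (y.1 * den z.2)) by ring.
  by rewrite e'; ring.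
Qed.
Canonical loc_equiv_rel := EquivRelPack loc_equiv.

Definition loc := {eq_quot loc_rel}.
HB.instance Definition _ := Choice.on loc.
HB.instance Definition _ := EqQuotient.on loc.

Lemma loc_elim (P : loc -> Prop) :
  (forall x, P (\pi_loc x)) -> forall u, P u.
Proof. by move=> Ppi u; rewrite -[u]reprK; apply: Ppi. Qed.

Lemma locP x y : (\pi_loc x = \pi_loc y) <->
  (exists u : denom, den u * (x.1 * den y.2) = den u * (y.1 * den x.2)).
Proof. by split=> [/eqmodP/asboolP|E] //; apply/eqmodP/asboolP. Qed.

Lemma loc_repr x : exists u : denom,
  den u * ((repr (\pi_loc x)).1 * den x.2) = den u * (x.1 * den (repr (\pi_loc x)).2).
Proof. by apply/locP; rewrite reprK. Qed.

Definition frac_add (x y : R * denom) :=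
  (x.1 * den y.2 + y.1 * den x.2, denM x.2 y.2).
Definition frac_mul (x y : R * denom) := (x.1 * y.1, denM x.2 y.2).
Definition frac_opp (x : R * denom) := (- x.1, x.2).

Definition loc_zero : loc := \pi_loc (0, den1).
Definition loc_one : loc := \pi_loc (1, den1).
Definition loc_add (a b : loc) : loc := \pi_loc (frac_add (repr a) (repr b)).
Definition loc_mul (a b : loc) : loc := \pi_loc (frac_mul (repr a) (repr b)).
Definition loc_opp (a : loc) : loc := \pi_loc (frac_opp (repr a)).

Lemma loc_addE x y : loc_add (\pi_loc x) (\pi_loc y) = \pi_loc (frac_add x y).
Proof.
apply/locP; have [u ex] := loc_repr x; have [v ey] := loc_repr y.
move: ex ey; set x' := repr _; set y' := repr _ => ex ey.
exists (denM u v) => /=.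
have -> : den u * den v * ((x'.1 * den y'.2 + y'.1 * den x'.2) * (den x.2 * den y.2)) =
  den v * den y'.2 * den y.2 * (den u * (x'.1 * den x.2)) + den u * den x'.2 * den x.2 * (den v * (y'.1 * den y.2)).
  by ring.
by rewrite ex ey; ring.
Qed.

Lemma loc_mulE x y : loc_mul (\pi_loc x) (\pi_loc y) = \pi_loc (frac_mul x y).
Proof.
apply/locP; have [u ex] := loc_repr x; have [v ey] := loc_repr y.
move: ex ey; set x' := repr _; set y' := repr _ => ex ey.
exists (denM u v) => /=.
have -> : den u * den v * (x'.1 * y'.1 * (den x.2 * den y.2)) =
  (den u * (x'.1 * den x.2)) * (den v * (y'.1 * den y.2)) by ring.
by rewrite ex ey; ring.
Qed.

Lemma loc_oppE x : loc_opp (\pi_loc x) = \pi_loc (frac_opp x).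
Proof.
apply/locP; have [u ex] := loc_repr x; move: ex; set x' := repr _ => ex.
by exists u => /=; rewrite !mulNr !mulrN ex.
Qed.

Ltac loc_ring := rewrite ?(loc_addE, loc_mulE, loc_oppE);
  apply/locP; exists den1 => /=; ring.

Fact loc_addA : associative loc_add.
Proof. by elim/loc_elim=> x; elim/loc_elim=> y; elim/loc_elim=> z; loc_ring. Qed.
Fact loc_addC : commutative loc_add.
Proof. by elim/loc_elim=> x; elim/loc_elim=> y; loc_ring. Qed.
Fact loc_add0 : left_id loc_zero loc_add.
Proof. by elim/loc_elim=> x; rewrite /loc_zero; loc_ring. Qed.
Fact loc_addN : left_inverse loc_zero loc_opp loc_add.
Proof. by elim/loc_elim=> x; rewrite /loc_zero; loc_ring. Qed.
HB.instance Definition _ :=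
  GRing.isZmodule.Build loc loc_addA loc_addC loc_add0 loc_addN.

Fact loc_mulA : associative loc_mul.
Proof. by elim/loc_elim=> x; elim/loc_elim=> y; elim/loc_elim=> z; loc_ring. Qed.
Fact loc_mulC : commutative loc_mul.
Proof. by elim/loc_elim=> x; elim/loc_elim=> y; loc_ring. Qed.
Fact loc_mul1 : left_id loc_one loc_mul.
Proof. by elim/loc_elim=> x; rewrite /loc_one; loc_ring. Qed.
Fact loc_mulDl : left_distributive loc_mul +%R.
Proof.
elim/loc_elim=> x; elim/loc_elim=> y; elim/loc_elim=> z.
change (loc_mul (loc_add (\pi_loc x) (\pi_loc y)) (\pi_loc z) =
  loc_add (loc_mul (\pi_loc x) (\pi_loc z)) (loc_mul (\pi_loc y) (\pi_loc z))).
by loc_ring.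
Qed.
HB.instance Definition _ := GRing.Zmodule_isComPzRing.Build loc
  loc_mulA loc_mulC loc_mul1 loc_mulDl.

Definition to_loc (a : R) : loc := \pi_loc (a, den1).
Fact to_loc_additive : {morph to_loc : a b / a - b}.
Proof.
move=> a b; change (to_loc (a - b) = loc_add (to_loc a) (loc_opp (to_loc b))).
by rewrite /to_loc; loc_ring.
Qed.
Fact to_loc_monoid : monoid_morphism to_loc.
Proof.
split=> // a b; change (to_loc (a * b) = loc_mul (to_loc a) (to_loc b)).
by rewrite /to_loc; loc_ring.
Qed.
HB.instance Definition _ := GRing.isZmodMorphism.Build R loc to_loc
  to_loc_additive.
HB.instance Definition _ := GRing.isMonoidMorphism.Build R loc to_loc
  to_loc_monoid.
End Localization.

Section PadicIntegers.
Variable p : nat.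
Local Notation q n := ((p ^ n)%N : int).

(* A p-adic integer is given by its residues zp_res n in [0, p ^ n[. *)
Record padic := Padic {
  zp_res :> nat -> int;
  zp_coh : forall n, zp_res n = (zp_res n.+1 %% q n)%Z }.
HB.instance Definition _ := gen_eqMixin padic.
HB.instance Definition _ := gen_choiceMixin padic.

Lemma padic_eq (x y : padic) : (forall n, x n = y n) -> x = y.
Proof.
case: x y => x hx [y hy] /= /funext exy; move: hx hy; rewrite exy => hx hy.
by congr Padic; apply: Prop_irrelevance.
Qed.

Lemma modz_expS m n : ((m %% q n.+1)%Z = m %[mod q n])%Z.
Proof.
apply/eqP; rewrite eqz_mod_dvd.
have dvd1 : (q n %| q n.+1)%Z by rewrite expnS PoszM dvdz_mull.
apply: dvdz_trans dvd1 _; rewrite -eqz_mod_dvd; apply/eqP; exact: modz_mod.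
Qed.

Lemma zp_mod (x : padic) n : (x n %% q n)%Z = x n.
Proof. by rewrite zp_coh modz_mod. Qed.

Lemma zp_step (x : padic) n : (x n.+1 = x n %[mod q n])%Z.
Proof. by rewrite [in RHS]zp_coh modz_mod. Qed.

Program Definition zp_mk (f : nat -> int)
    (fP : forall n, (f n.+1 = f n %[mod q n])%Z) : padic :=
  @Padic (fun n => (f n %% q n)%Z) _.
Next Obligation. by move=> f fP n /=; rewrite modz_expS fP. Qed.

Fact zp_const_coh (m : int) n : (m = m %[mod q n])%Z. Proof. by []. Qed.
Fact zp_add_coh (x y : padic) n : (x n.+1 + y n.+1 = x n + y n %[mod q n])%Z.
Proof. by rewrite -modzDm !zp_step modzDm. Qed.
Fact zp_opp_coh (x : padic) n : (- x n.+1 = - x n %[mod q n])%Z.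
Proof. by rewrite -modzNm zp_step modzNm. Qed.
Fact zp_mul_coh (x y : padic) n : (x n.+1 * y n.+1 = x n * y n %[mod q n])%Z.
Proof. by rewrite -modzMm !zp_step modzMm. Qed.

Definition zp_zero := zp_mk (zp_const_coh 0).
Definition zp_one := zp_mk (zp_const_coh 1).
Definition zp_add x y := zp_mk (zp_add_coh x y).
Definition zp_opp x := zp_mk (zp_opp_coh x).
Definition zp_mul x y := zp_mk (zp_mul_coh x y).

Fact zp_addA : associative zp_add.
Proof. by move=> x y z; apply: padic_eq => n /=; rewrite modzDmr modzDml addrA. Qed.
Fact zp_addC : commutative zp_add.
Proof. by move=> x y; apply: padic_eq => n /=; rewrite addrC. Qed.
Fact zp_add0 : left_id zp_zero zp_add.
Proof. by move=> x; apply: padic_eq => n /=; rewrite modzDml add0r zp_mod. Qed.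
Fact zp_addN : left_inverse zp_zero zp_opp zp_add.
Proof. by move=> x; apply: padic_eq => n /=; rewrite modzDml addNr. Qed.
HB.instance Definition _ :=
  GRing.isZmodule.Build padic zp_addA zp_addC zp_add0 zp_addN.
Fact zp_mulA : associative zp_mul.
Proof. by move=> x y z; apply: padic_eq => n /=; rewrite modzMmr modzMml mulrA. Qed.
Fact zp_mulC : commutative zp_mul.
Proof. by move=> x y; apply: padic_eq => n /=; rewrite mulrC. Qed.
Fact zp_mul1 : left_id zp_one zp_mul.
Proof. by move=> x; apply: padic_eq => n /=; rewrite modzMml mul1r zp_mod. Qed.
Fact zp_mulDl : left_distributive zp_mul +%R.
Proof.
by move=> x y z; apply: padic_eq => n /=; rewrite modzMml modzDm mulrDl.
Qed.
HB.instance Definition _ := GRing.Zmodule_isComPzRing.Build padic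
  zp_mulA zp_mulC zp_mul1 zp_mulDl.
End PadicIntegers.

Section FiniteSums.
Variables (R : comPzRingType) (T : choiceType).
Hypothesis finT : finite_set [set: T].

Lemma fin_sub (A : set T) : finite_set A.
Proof. exact: sub_finite_set finT. Qed.

Lemma fsum_if (A : set T) (F : T -> R) :
  \sum_(x \in A) F x = \sum_(x \in [set: T]) (if x \in A then F x else 0).
Proof. by rewrite fsbig_mkcond; apply: eq_fsbigr. Qed.

Lemma fsum_mulr a (F : T -> R) (A : set T) :
  a * \sum_(x \in A) F x = \sum_(x \in A) a * F x.
Proof. exact/fsbig_distrr/fin_sub. Qed.

Lemma fsum_add (F F' : T -> R) (A : set T) :
  \sum_(x \in A) (F x + F' x) = \sum_(x \in A) F x + \sum_(x \in A) F' x.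
Proof. exact/fsbig_split/fin_sub. Qed.

Lemma fsum_delta c (F : T -> R) :
  \sum_(x \in [set: T]) (if x == c then F x else 0) = F c.
Proof.
transitivity (\sum_(x \in [set c]) F x); last by rewrite fsbig_set1.
rewrite [RHS]fsum_if; apply: eq_fsbigr => x _; congr (if _ then _ else _).
by apply/eqP/idP => [->|]; rewrite inE.
Qed.

End FiniteSums.

Lemma fsum_fibre (R : comPzRingType) (T T' : choiceType) (h : T -> T')
  (finT : finite_set [set: T]) (finT' : finite_set [set: T']) (F : T -> R)
  (A : set T') :
  \sum_(y \in A) \sum_(x \in [set x | h x = y]) F x =
  \sum_(x \in [set x | A (h x)]) F x.
Proof.
transitivity (\sum_(y \in [set: T']) \sum_(x \in [set: T])
    (if y == h x then (if h x \in A then F x else 0) else 0)).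
  rewrite fsum_if; apply: eq_fsbigr => y _; rewrite fsum_if.
  have [yA|yA] := boolP (y \in A); last first.
    by rewrite fsbig1 // => x _; case: eqP => // <-; rewrite (negPf yA).
  apply: eq_fsbigr => x _; rewrite eq_sym; case: eqP => [hxy|hxy].
    by rewrite hxy yA mem_set.
  by rewrite memNset.
rewrite exchange_fsbig // [RHS]fsum_if; apply: eq_fsbigr => x _.
by rewrite (fsum_delta _ (fun=> _)).
Qed.

Section Convolution.
Variables (R : comPzRingType) (Q : zmodType).
Hypothesis finQ : finite_set [set: Q].

Definition conv (a b : Q -> R) (c : Q) : R :=
  \sum_(d \in [set: Q]) a d * b (c - d).

Lemma fsum_bij (h h' : Q -> Q) (F : Q -> R) : cancel h h' -> cancel h' h ->
  \sum_(d \in [set: Q]) F d = \sum_(d \in [set: Q]) F (h d).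
Proof. by move=> hK h'K; apply: reindex_fsbigT; exists h'. Qed.

Lemma convC a b c : conv a b c = conv b a c.
Proof.
rewrite /conv (@fsum_bij (fun d => c - d) (fun d => c - d)); last 2 first.
- by move=> d; rewrite subKr.
- by move=> d; rewrite subKr.
by apply: eq_fsbigr => d _; rewrite subKr mulrC.
Qed.

Lemma convA a b e c : conv a (conv b e) c = conv (conv a b) e c.
Proof.
rewrite /conv; transitivity (\sum_(d \in [set: Q]) \sum_(x \in [set: Q])
    a d * b (x - d) * e (c - x)).
  apply: eq_fsbigr => d _; rewrite fsum_mulr //.
  rewrite (@fsum_bij (fun x => x - d) (fun x => x + d)); last 2 first.
  - by move=> x; rewrite subrK.
  - by move=> x; rewrite addrK.
  by apply: eq_fsbigr => x _; rewrite mulrA opprB addrA subrK.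
rewrite exchange_fsbig //; apply: eq_fsbigr => x _.
by rewrite mulrC fsum_mulr //; apply: eq_fsbigr => d _; rewrite mulrC.
Qed.

Lemma conv1 a c : conv (fun d => (d == 0)%:R) a c = a c.
Proof.
transitivity (a (c - 0)); last by rewrite subr0.
rewrite -(fsum_delta 0 (fun d => a (c - d))); apply: eq_fsbigr => d _.
by case: eqP => _; rewrite ?mul1r ?mul0r.
Qed.

Lemma convDl a b e c :
  conv (fun d => a d + b d) e c = conv a e c + conv b e c.
Proof.
by rewrite /conv -fsum_add //; apply: eq_fsbigr => d _; rewrite mulrDl.
Qed.
End Convolution.

(* The completed group algebra R[[G]], the inverse limit of R[G/U] over the open
   subgroups U of finite index of the (additively written) abelian group G; O is
   the family of open sets of G. An element of R[G/U] is a function G/U -> R. *)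
Section CompletedGroupAlgebra.
Variables (R : comPzRingType) (G : zmodType) (O : set (set G)).

Record open_sub := OpenSub {
  osub : set G;
  osub_open : O osub;
  osub0 : osub 0;
  osubB : forall g h, osub g -> osub h -> osub (g - h);
  osub_fin : exists s : seq G, forall g, exists2 h, h \in s & osub (g - h) }.

Definition osub_pred (U : open_sub) : {pred G} := fun g => `[< osub U g >].
Fact osub_closed (U : open_sub) : zmod_closed (osub_pred U).
Proof.
split=> [|g h]; first by apply/asboolP/osub0.
by move=> /asboolP Ug /asboolP Uh; apply/asboolP/osubB.
Qed.
HB.instance Definition _ (U : open_sub) :=
  GRing.isZmodClosed.Build G (osub_pred U) (osub_closed U).

Definition oquot (U : open_sub) : zmodType := {ideal_quot (osub_pred U)}.
Definition opi (U : open_sub) (g : G) : oquot U :=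
  \pi_({ideal_quot (osub_pred U)}) g.

Lemma opiD (U : open_sub) g h : opi U (g + h) = opi U g + opi U h.
Proof. exact: (Quotient.pi_add (osub_pred U) g h). Qed.
Lemma opiN (U : open_sub) g : opi U (- g) = - opi U g.
Proof. exact: (Quotient.pi_opp (osub_pred U) g). Qed.
Lemma opi0 (U : open_sub) : opi U 0 = 0.
Proof. by apply: (addrI (opi U 0)); rewrite -opiD !addr0. Qed.
Lemma opiP (U : open_sub) g h : opi U g = opi U h <-> osub U (g - h).
Proof.
have E : (g - h \in osub_pred U) = (opi U g == opi U h) := Quotient.idealrBE _ _ _.
split=> [/eqP|Ugh]; first by rewrite -E => /asboolP.
by apply/eqP; rewrite -E; apply/asboolP.
Qed.
Lemma opi_repr (U : open_sub) c : opi U (repr c) = c.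
Proof. exact: reprK. Qed.

Definition oproj (U V : open_sub) (d : oquot V) : oquot U := opi U (repr d).
Arguments oproj : clear implicits.

Lemma oproj_pi (U V : open_sub) g : osub V `<=` osub U ->
  oproj U V (opi V g) = opi U g.
Proof. by move=> VU; apply/opiP/VU/opiP; rewrite opi_repr. Qed.

Lemma oprojB (U V : open_sub) c d : osub V `<=` osub U ->
  oproj U V (c - d) = oproj U V c - oproj U V d.
Proof.
move=> VU; rewrite -[c]opi_repr -[d]opi_repr -opiN -opiD !oproj_pi //.
by rewrite opiD opiN.
Qed.

Definition coherent (a : forall U, oquot U -> R) :=
  forall U V : open_sub, osub V `<=` osub U -> forall c : oquot U,
    a U c = \sum_(d \in [set d | oproj U V d = c]) a V d.

Record cga := Cga {
  cga_coef :> forall U, oquot U -> R;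
  cga_coh : coherent cga_coef }.
HB.instance Definition _ := gen_eqMixin cga.
HB.instance Definition _ := gen_choiceMixin cga.

Lemma cga_ext (a b : cga) : (forall U c, a U c = b U c) -> a = b.
Proof.
case: a b => a ha [b hb] /= ab.
have E : a = b by apply: functional_extensionality_dep => U; apply/funext/ab.
by move: ha hb; rewrite E => ha hb; congr Cga; apply: Prop_irrelevance.
Qed.

Lemma oquot_fin (U : open_sub) : finite_set [set: oquot U].
Proof.
have [s sP] := osub_fin U; pose A : set G := [set` s].
apply: sub_finite_set (finite_image (opi U) (finite_seq s : finite_set A)) => c _.
have [h hs ch] := sP (repr c); exists h => //.
by rewrite -[RHS]opi_repr; apply/esym/opiP.
Qed.
Let fin U := @oquot_fin U.

Program Definition cga_zero := @Cga (fun _ _ => 0) _.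
Next Obligation. by move=> U V _ c; rewrite fsbig1. Qed.
Program Definition cga_add (a b : cga) := @Cga (fun U c => a U c + b U c) _.
Next Obligation.
move=> a b U V VU c; rewrite (cga_coh a VU) (cga_coh b VU).
by rewrite -fsum_add //; apply: fin.
Qed.
Program Definition cga_opp (a : cga) := @Cga (fun U c => - a U c) _.
Next Obligation.
move=> a U V VU c; rewrite (cga_coh a VU) -mulN1r fsum_mulr; last exact: fin.
by apply: eq_fsbigr => d _; rewrite mulN1r.
Qed.
Program Definition cga_delta (g : G) :=
  @Cga (fun U c => (c == opi U g)%:R) _.
Next Obligation.
move=> g U V VU c; rewrite fsum_if.
transitivity (\sum_(d \in [set: oquot V])
    (if d == opi V g then (c == opi U g)%:R else 0 : R)).
  by rewrite (fsum_delta _ (fun=> _)).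
apply: eq_fsbigr => d _; case: (eqVneq d (opi V g)) => [->|_]; last first.
  by case: ifP.
case: ifP => [/set_mem/= <-|/negP h]; first by rewrite oproj_pi // eqxx.
case: eqP => // cE; case: h; apply/mem_set => /=; rewrite oproj_pi //.
Qed.
Program Definition cga_mul (a b : cga) :=
  @Cga (fun U => conv (a U) (b U)) _.
Next Obligation.
move=> a b U V VU c; rewrite /conv exchange_fsbig; last 2 first.
- exact: fin_sub (@fin V) _.
- exact: fin.
transitivity (\sum_(e \in [set: oquot V]) a V e * b U (c - oproj U V e)).
  transitivity (\sum_(x \in [set: oquot U])
    \sum_(e \in [set e | oproj U V e = x]) a V e * b U (c - oproj U V e)).
    apply: eq_fsbigr => x _; rewrite (cga_coh a VU) mulrC fsum_mulr; last exact: fin.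
    by apply: eq_fsbigr => e /set_mem <-; rewrite mulrC.
  rewrite (fsum_fibre (oproj U V) (@fin V) (@fin U)).
  by apply: eq_fsbigl; apply/seteqP.
apply: eq_fsbigr => e _; rewrite (cga_coh b VU) fsum_mulr; last exact: fin.
rewrite (reindex_fsbig (fun d => d - e) [set d | oproj U V d = c]) //.
split.
- by move=> d /= <-; rewrite oprojB.
- by move=> d d' _ _ /addIr.
- move=> d /= dE; exists (d + e); rewrite ?addrK //=.
  by apply: (addIr (- oproj U V e)); rewrite -oprojB // addrK.
Qed.

Fact cga_addA : associative cga_add.
Proof. by move=> a b e; apply: cga_ext => U c /=; apply: addrA. Qed.
Fact cga_addC : commutative cga_add.
Proof. by move=> a b; apply: cga_ext => U c /=; apply: addrC. Qed.
Fact cga_add0 : left_id cga_zero cga_add.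
Proof. by move=> a; apply: cga_ext => U c /=; apply: add0r. Qed.
Fact cga_addN : left_inverse cga_zero cga_opp cga_add.
Proof. by move=> a; apply: cga_ext => U c /=; apply: addNr. Qed.
HB.instance Definition _ :=
  GRing.isZmodule.Build cga cga_addA cga_addC cga_add0 cga_addN.
Fact cga_mulA : associative cga_mul.
Proof. by move=> a b e; apply: cga_ext => U c; apply: (convA (@fin U)). Qed.
Fact cga_mulC : commutative cga_mul.
Proof. by move=> a b; apply: cga_ext => U c; apply: convC. Qed.
Fact cga_mul1 : left_id (cga_delta 0) cga_mul.
Proof.
by move=> a; apply: cga_ext => U c /=; rewrite opi0; exact: conv1.
Qed.
Fact cga_mulDl : left_distributive cga_mul +%R.
Proof. by move=> a b e; apply: cga_ext => U c; apply: (convDl (@fin U)). Qed.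
HB.instance Definition _ := GRing.Zmodule_isComPzRing.Build cga
  cga_mulA cga_mulC cga_mul1 cga_mulDl.
End CompletedGroupAlgebra.
Arguments oproj {G O} U V d.

(* The ring map R[[G]] -> R[[H]] induced by a continuous r : G -> H: at level U it
   is the component at r^-1(U) followed by R[G/r^-1(U)] -> R[H/U]. *)
Section PushForward.
Variables (R : comPzRingType) (G H : zmodType) (O : set (set G))
  (O' : set (set H)) (r : {additive G -> H}).
Hypothesis rO : forall U, O' U -> O (r @^-1` U).

Program Definition preim_sub (U : open_sub O') : open_sub O :=
  @OpenSub G O (r @^-1` (osub U)) _ _ _ _.
Next Obligation. by move=> U; apply: rO; apply: osub_open. Qed.
Next Obligation. by move=> U; rewrite /preimage /= raddf0; apply: osub0. Qed.
Next Obligation.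
by move=> U g h; rewrite /preimage /= raddfB; apply: osubB.
Qed.
Next Obligation.
move=> U; have [s sP] := osub_fin U.
pose f h : G := xget 0 [set g | osub U (r g - h)].
exists [seq f h | h <- s] => g; have [h hs Ugh] := sP (r g).
exists (f h); first exact: map_f.
have /= Ufh : osub U (r (f h) - h) by apply: (@xgetPex _ 0 [set x | osub U (r x - h)]); exists g.
rewrite /preimage /= raddfB -[r g](subrK h) -addrA -[h - _]opprB.
exact: osubB.
Qed.

Definition preim_map (U : open_sub O') (d : oquot (preim_sub U)) : oquot U :=
  opi U (r (repr d)).

Program Definition cga_push (a : cga R O) : cga R O' :=
  @Cga R H O' (fun U c => \sum_(d \in [set d | preim_map d = c]) a (preim_sub U) d) _.
Next Obligation.
move=> a U V VU c.
have VU' : osub (preim_sub V) `<=` osub (preim_sub U) by move=> g; apply: VU.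
have E : forall d, preim_map (oproj (preim_sub U) (preim_sub V) d) =
    oproj U V (preim_map d).
  move=> d; rewrite -[d]opi_repr oproj_pi //.
  have pE W g : preim_map (opi (preim_sub W) g) = opi W (r g).
    apply/opiP; rewrite -raddfB.
    have /opiP := @opi_repr _ _ (preim_sub W) (opi (preim_sub W) g); exact.
  by rewrite !pE oproj_pi.
rewrite (fsum_fibre (@preim_map V) (@oquot_fin _ _ _) (@oquot_fin _ _ _)).
transitivity (\sum_(d \in [set d | preim_map d = c])
  \sum_(e \in [set e | oproj (preim_sub U) (preim_sub V) e = d]) a (preim_sub V) e).
  by apply: eq_fsbigr => d _; apply: (cga_coh a VU').
rewrite (fsum_fibre (oproj (preim_sub U) (preim_sub V)) (@oquot_fin _ _ _)
  (@oquot_fin _ _ _)).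
by apply: eq_fsbigl; apply/seteqP; split=> e /=; rewrite E.
Qed.
End PushForward.

Section Galois.
Variables F L : {pred algC}.

(* Gal(L/F) is realized by functions on algC that are the identity outside L, so
   that the group law is composition of functions. *)
Definition is_gal (s : algC -> algC) :=
  [/\ {in F, s =1 id}, {in L &, {morph s : x y / x + y}},
      {in L &, {morph s : x y / x * y}}, s @` [set` L] = [set` L] &
      forall x, x \notin L -> s x = x].

Record galT := GalT { gal_fun :> algC -> algC; galP : is_gal gal_fun }.
HB.instance Definition _ := gen_eqMixin galT.
HB.instance Definition _ := gen_choiceMixin galT.

Lemma gal_eq (s u : galT) : s =1 u -> s = u.
Proof.
case: s u => s hs [u hu] /= /funext su; move: hs hu; rewrite su => hs hu.
by congr GalT; apply: Prop_irrelevance.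
Qed.

Lemma gal_stable (s : galT) x : x \in L -> s x \in L.
Proof.
have [_ _ _ sL _] := galP s => xL.
have : (s @` [set` L]) (s x) by exists x.
by rewrite sL.
Qed.

Lemma gal_out (s : galT) x : x \notin L -> s x = x.
Proof. by have [_ _ _ _] := galP s; apply. Qed.

Fact gal_id_subproof : is_gal id.
Proof. by split=> //; rewrite image_id. Qed.
Definition gal_id := GalT gal_id_subproof.

Fact gal_comp_subproof (s u : galT) : is_gal (s \o u).
Proof.
have [sF sD sM sL sN] := galP s; have [uF uD uM uL uN] := galP u.
split=> [x xF|x y xL yL|x y xL yL||x xL] /=.
- by rewrite uF // sF.
- by rewrite uD // sD //; apply: gal_stable.
- by rewrite uM // sM //; apply: gal_stable.
- by rewrite -image_comp uL.
- by rewrite uN // sN.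
Qed.
Definition gal_comp (s u : galT) := GalT (gal_comp_subproof s u).

Definition krull_open : set (set galT) := [set U : set galT | forall s : galT, U s ->
  exists2 xs : seq algC, {subset xs <= L} &
    forall u : galT, {in xs, u =1 s} -> U u].

End Galois.

(* K/k is normal: every element of K is a root of a nonzero polynomial over k that
   splits in K. Separability is automatic in characteristic 0. *)
Definition galois_ext (k K : {pred algC}) :=
  {subset k <= K} /\ forall x, x \in K -> exists q : {poly algC},
    [/\ q \is a polyOver k, q != 0, root q x & forall y, root q y -> y \in K].

Definition number_field (k : divringClosed algC) :=
  exists (n : nat) (b : 'I_n -> algC),
    forall x, x \in k -> exists c : 'I_n -> rat, x = \sum_j ratr (c j) * b j.

Definition ppow_dvd (p n : nat) (M : lmodType (padic p)) (x : M) :=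
  exists y : M, x = (p ^ n)%:R *: y.

(* theta is an isomorphism of topological groups, for the Krull topology on
   Gal(L/F) and the p-adic topology on Zp^d. *)
Definition top_iso (p d : nat) (F L : {pred algC})
    (theta : galT F L -> 'rV[padic p]_d) :=
  [/\ bijective theta,
      forall s u, theta (gal_comp s u) = theta s + theta u,
      forall (s : galT F L) n, exists2 xs : seq algC, {subset xs <= L} &
        forall u : galT F L, {in xs, u =1 s} -> ppow_dvd n (theta u - theta s) &
      forall (s : galT F L) (xs : seq algC), {subset xs <= L} -> exists n,
        forall u : galT F L, ppow_dvd n (theta u - theta s) -> {in xs, u =1 s}].

Record zp_ext (p d : nat) (k : divringClosed algC) := ZpExt {
  ztop :> divringClosed algC;
  zgalois : galois_ext k ztop;
  ziso : exists theta : galT k ztop -> 'rV[padic p]_d, top_iso theta }.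

Section ZpGal.
Variables (p d : nat) (k : divringClosed algC) (K : zp_ext p d k).

Definition gal := galT k K.
HB.instance Definition _ := Choice.on gal.

(* Zp-module structure of Gal(K/k), transported from Zp^d. It does not depend on
   the chosen theta: continuous homomorphisms Zp^d -> Zp^d are Zp-linear. *)
Definition theta : gal -> 'rV[padic p]_d := projT1 (cid (ziso K)).
Lemma thetaP : top_iso theta. Proof. exact: (projT2 (cid (ziso K))). Qed.
Lemma theta_bij : bijective theta. Proof. by have [] := thetaP. Qed.
Lemma thetaD s u : theta (gal_comp s u) = theta s + theta u.
Proof. by have [_ + _ _] := thetaP; apply. Qed.
Lemma theta_inj : injective theta. Proof. exact/bij_inj/theta_bij. Qed.
Lemma theta1 : theta (gal_id _ _) = 0.
Proof.
apply: (addIr (theta (gal_id _ _))); rewrite add0r -thetaD.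
by congr theta; apply: gal_eq.
Qed.
Lemma theta_surj v : exists s, theta s = v.
Proof. by have [h _ hK] := theta_bij; exists (h v). Qed.
Definition theta_inv v : gal := projT1 (cid (theta_surj v)).
Lemma theta_invK v : theta (theta_inv v) = v.
Proof. exact: (projT2 (cid (theta_surj v))). Qed.

Definition gal_add (s u : gal) : gal := gal_comp s u.
Definition gal_opp (s : gal) : gal := theta_inv (- theta s).
Fact gal_addA : associative gal_add.
Proof. by move=> s u v; apply: gal_eq. Qed.
Fact gal_addC : commutative gal_add.
Proof. by move=> s u; apply: theta_inj; rewrite !thetaD addrC. Qed.
Fact gal_add0 : left_id (gal_id _ _ : gal) gal_add.
Proof. by move=> s; apply: gal_eq. Qed.
Fact gal_addN : left_inverse (gal_id _ _ : gal) gal_opp gal_add.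
Proof.
by move=> s; apply: theta_inj; rewrite thetaD theta_invK theta1 addNr.
Qed.
HB.instance Definition _ :=
  GRing.isZmodule.Build gal gal_addA gal_addC gal_add0 gal_addN.

Lemma theta_add (s u : gal) : theta (s + u) = theta s + theta u.
Proof. exact: thetaD. Qed.

Definition gal_scale (a : padic p) (s : gal) : gal := theta_inv (a *: theta s).
Fact gal_scaleA a b s : gal_scale a (gal_scale b s) = gal_scale (a * b) s.
Proof. by apply: theta_inj; rewrite !theta_invK scalerA. Qed.
Fact gal_scale1 : left_id 1 gal_scale.
Proof. by move=> s; apply: theta_inj; rewrite theta_invK scale1r. Qed.
Fact gal_scaleDr : right_distributive gal_scale +%R.
Proof.
move=> a s u; apply: theta_inj.
by rewrite theta_add !theta_invK theta_add scalerDr.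
Qed.
Fact gal_scaleDl s : {morph gal_scale^~ s : a b / a + b}.
Proof.
by move=> a b; apply: theta_inj; rewrite theta_add !theta_invK scalerDl.
Qed.
HB.instance Definition _ := GRing.Zmodule_isLmodule.Build (padic p) gal
  gal_scaleA gal_scale1 gal_scaleDr gal_scaleDl.

Definition Lambda : comPzRingType := cga (padic p) (@krull_open k K : set (set gal)).
Definition group_elt (g : gal) : Lambda := cga_delta _ _ g.

Definition dagger_set : set Lambda :=
  [set x | exists2 g : gal, g != 0 & x = group_elt g - 1].

Definition Lambda_loc : comPzRingType := loc dagger_set.
Definition Lambda_dagger : comPzRingType :=
  if d == 1%N then Lambda_loc else Lambda.
Definition to_dagger : {rmorphism Lambda -> Lambda_dagger} :=
  match d == 1%N as b
    return {rmorphism Lambda -> (if b then Lambda_loc else Lambda)}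
  with
  | true => @to_loc Lambda dagger_set
  | false => idfun
  end.

Definition dagger (X : lmodType Lambda) : lmodType Lambda_dagger :=
  tens to_dagger X.
End ZpGal.

Section Restriction.
Variables (p d d' : nat) (k : divringClosed algC).
Variables (K : zp_ext p d k) (K' : zp_ext p d' k) (K'K : {subset K' <= K}).

Lemma gal_normal (s : gal K) x : x \in K' -> s x \in K'.
Proof.
have [kK _] := zgalois K; have [_ nK'] := zgalois K'.
have [sk sD sM _ _] := galP s => xK'.
have [q [qk _ qx qK']] := nK' x xK'; apply: qK'.
have xK : x \in K by apply: K'K.
suff E : s q.[x] = q.[s x] by move: qx; rewrite !rootE -E => /eqP ->; rewrite sk ?rpred0.
suff [] : q.[x] \in K /\ s q.[x] = q.[s x] by [].
elim/poly_ind: q qk {qx} => [|q c IH] qk.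
  by rewrite !horner0 rpred0 sk ?rpred0.
have ck : c \in k.
  by have /polyOverP/(_ 0%N) := qk; rewrite coefD coefMX coefC add0r.
have qk' : q \is a polyOver k.
  apply/polyOverP => i; have /polyOverP/(_ i.+1) := qk.
  by rewrite coefD coefMX coefC addr0.
have [qxK sq] := IH qk'; rewrite !hornerMXaddC.
have cK : c \in K by apply: kK.
have qxxK : q.[x] * x \in K by apply: rpredM.
split; first exact: rpredD.
by rewrite (sD _ _ qxxK cK) (sM _ _ qxK xK) sq (sk c ck).
Qed.

Fact gal_res_subproof (s : gal K) :
  is_gal k K' (fun x => if x \in K' then s x else x).
Proof.
have [kK' _] := zgalois K'; have [sk sD sM sK sN] := galP s.
split=> [x xk|x y xK yK|x y xK yK||x /negPf -> //].
- by rewrite kK' // sk.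
- by rewrite xK yK rpredD // sD // K'K.
- by rewrite xK yK rpredM // sM // K'K.
apply/seteqP; split=> [_ [x xK <-]|y yK] /=.
  by rewrite ifT //; apply: gal_normal.
have yK' : y \in K' by [].
exists ((- s : gal K) y); first exact: gal_normal.
rewrite ifT; last exact: gal_normal.
by have /(congr1 (fun u : gal K => u y)) := subrr s.
Qed.

Definition gal_res (s : gal K) : gal K' := GalT (gal_res_subproof s).

Fact gal_res_additive : {morph gal_res : s u / s - u}.
Proof.
have D s u : gal_res (s + u) = gal_res s + gal_res u.
  apply: gal_eq => x /=; case: (boolP (x \in K')) => [xK'|/negPf -> //].
  by rewrite gal_normal.
by move=> s u; apply: (addIr (gal_res u)); rewrite -D !subrK.
Qed.
HB.instance Definition _ := GRing.isZmodMorphism.Build (gal K) (gal K') gal_res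
  gal_res_additive.

Fact gal_res_open (U : set (gal K')) :
  krull_open U -> @krull_open k K (gal_res @^-1` U).
Proof.
move=> oU s /oU [xs xsK' xsU]; exists xs => [x /xsK'|u us]; first exact: K'K.
by apply: xsU => x xxs /=; rewrite xsK' // us.
Qed.

Definition Lambda_res : Lambda K -> Lambda K' := cga_push gal_res_open.

End Restriction.

(* P is a nonzero prime ideal of the ring of integers of F. *)
Definition prime_of_integers (F : divringClosed algC) (P : set algC) :=
  [/\ (forall x, P x -> x \in F /\ x \in Aint) /\ (exists2 x, P x & x != 0),
      forall x y, P x -> P y -> P (x + y),
      forall a x, a \in F -> a \in Aint -> P x -> P (a * x),
      ~ P 1 &
      forall a b, a \in F -> a \in Aint -> b \in F -> b \in Aint ->
        P (a * b) -> P a \/ P b].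

(* Unramified at all places of L: the inertia groups in Gal(L/F) are trivial.
   The archimedean places of L are given by embeddings into the complex numbers,
   each of which is the restriction to L of some nu : algC -> algC; the inertia
   group at nu consists of 1 and of those s with nu \o s = conj \o nu on L. *)
Definition unramified (F L : divringClosed algC) :=
  (forall P, prime_of_integers L P -> forall s : galT F L,
     (forall x, x \in L -> x \in Aint -> P (s x - x)) -> s =1 id) /\
  (forall (nu : {rmorphism algC -> algC}) (s : galT F L),
     (forall x, x \in L -> nu (s x) = (nu x)^*%C) -> s =1 id).

(* Gal(L/F) is the inverse limit of the Gal(M/F) with M/F finite Galois. *)
Definition pro_p_ext (p : nat) (F L : divringClosed algC) :=
  forall M : divringClosed algC, {subset M <= L} -> galois_ext F M ->
    finite_set [set: galT F M] ->
    exists n : nat, ([set: galT F M] #= `I_(p ^ n))%card.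

Definition unramified_abelian_pro_p (p : nat) (F L : divringClosed algC) :=
  [/\ galois_ext F L, forall s u : galT F L, s \o u =1 u \o s,
      pro_p_ext p F L & unramified F L].

(* The compositum of two unramified abelian pro-p extensions of F is again one, so
   their union is the maximal one. *)
Definition Lmax (p : nat) (F : divringClosed algC) : {pred algC} :=
  fun x => `[< exists2 L, unramified_abelian_pro_p p F L & x \in L >].

Section IwasawaModule.
Variables (p d : nat) (k : divringClosed algC) (K : zp_ext p d k).

(* a and b have the same image in (Z/p^n)[Gal(K/k)/U]. *)
Definition Lambda_near (U : open_sub (@krull_open k K : set (set (gal K))))
    (n : nat) (a b : Lambda K) :=
  forall c : oquot U, exists e : padic p, a U c - b U c = (p ^ n)%:R * e.

(* X(K) as a Lambda-module: the group Gal(Lmax/K), written additively, with the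
   only continuous action of Lambda for which g in Gal(K/k) acts by conjugation
   by (any) lift s of g to Gal(Lmax/k). The last field is the continuity of the
   action, for the Krull topology on Gal(Lmax/K) and the profinite topology on
   Lambda. *)
Record iwasawa_module := IwasawaModule {
  iw_mod :> lmodType (Lambda K);
  iw_gal : iw_mod -> galT K (Lmax p K);
  iw_bij : bijective iw_gal;
  iw_add : forall x y, iw_gal (x + y) = gal_comp (iw_gal x) (iw_gal y);
  iw_conj : forall (g : gal K) (s : galT k (Lmax p K)) (x : iw_mod),
    {in K, s =1 g} -> iw_gal (group_elt g *: x) \o s =1 s \o iw_gal x;
  iw_cont : forall (a : Lambda K) (x : iw_mod) (z : algC), z \in Lmax p K ->
    exists U n (zs : seq algC), {subset zs <= Lmax p K} /\
      forall b y, Lambda_near U n b a -> {in zs, iw_gal y =1 iw_gal x} ->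
        iw_gal (b *: y) z = iw_gal (a *: x) z }.

(* Gal(K/k) being abelian, this only depends on the prime of k below P. *)
Definition decomposition_group (P : set algC) : set (gal K) :=
  [set s | s @` P = P].

Definition rank_ge (r : nat) (D : set (gal K)) :=
  exists v : 'I_r -> gal K, (forall j, D (v j)) /\
    forall c : 'I_r -> padic p, \sum_j c j *: v j = 0 -> forall j, c j = 0.

End IwasawaModule.
Arguments decomposition_group {p d k} K P.

Section Grassmannian.
Variables (p : nat) (M : lmodType (padic p)).

Record aut := Aut {
  aut_fun :> {linear M -> M};
  aut_bij : bijective aut_fun }.
HB.instance Definition _ := gen_eqMixin aut.
HB.instance Definition _ := gen_choiceMixin aut.
Definition aut_id := @Aut idfun (Bijective (@erefl M) (@erefl M)).
HB.instance Definition _ := isPointed.Build aut aut_id.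

(* The topology of Aut(M) = GL_d(Zp): g and h are close if g = h mod p^n. *)
Definition aut_open : set (set aut) := [set V : set aut | forall g : aut, V g ->
  exists n : nat, forall h : aut, (forall x, ppow_dvd n (h x - g x)) -> V h].
Fact aut_openT : aut_open setT. Proof. by move=> g _; exists 0%N. Qed.
Fact aut_openI V W : aut_open V -> aut_open W -> aut_open (V `&` W).
Proof.
move=> oV oW g [/oV[n nP] /oW[m mP]]; exists (n + m)%N => h gh.
split; [apply: nP => x|apply: mP => x]; have [y ->] := gh x.
  by exists ((p ^ m)%:R *: y); rewrite scalerA -natrM -expnD.
by exists ((p ^ n)%:R *: y); rewrite scalerA -natrM -expnD addnC.
Qed.
Fact aut_open_bigU (I : Type) (V : I -> set aut) :
  (forall j, aut_open (V j)) -> aut_open (\bigcup_j V j).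
Proof.
move=> oV g [j _ /(oV j)[n nP]]; exists n => h /nP Vh; by exists j.
Qed.
HB.instance Definition _ := isOpenTopological.Build aut aut_openT aut_openI
  aut_open_bigU.

Definition borel_aut := g_sigma_algebraType (@open aut).

Definition is_haar (R : realType) (mu : probability borel_aut R) :=
  forall (g : aut) (A : set borel_aut), measurable A ->
    mu [set h : borel_aut | exists2 a : aut, A a & forall x, (h : aut) x = g (a x)] = mu A.

Definition Gr (i : nat) : set (set M) :=
  [set N | exists2 S : submodClosed M, N = [set` S] &
    exists f : {linear quot_mod S -> 'rV[padic p]_i}, bijective f].

(* Preimage of Z under Aut(M) -> Gr(i, M), g |-> g(N0): Z is closed, resp. null,
   in Gr(i, M) iff this preimage is closed, resp. null, in Aut(M). *)
Definition orbit_preim (N0 : set M) (Z : set (set M)) : set aut :=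
  [set g : aut | Z (g @` N0)].

Definition closed_null (R : realType) (i : nat) (Z : set (set M)) :=
  exists (mu : probability borel_aut R) (N0 : set M),
    [/\ is_haar mu, Gr i N0, closed (orbit_preim N0 Z) &
        mu (orbit_preim N0 Z) = 0%E].
End Grassmannian.

(* K' corresponds to the point Gal(K/K') of Gr(i, Gal(K/k)). *)
Definition generic (R : realType) (p d i : nat) (k : divringClosed algC)
    (K : zp_ext p d k)
    (P : forall K' : zp_ext p i k, {subset K' <= K} -> Prop) :=
  exists Z : set (set (gal K)),
    [/\ Z `<=` Gr i, closed_null R i Z &
      forall (K' : zp_ext p i k) (sK : {subset K' <= K}), ~ P K' sK ->
        Z [set s : gal K | {in K', s =1 id}]].

(* Main.v *)
(* Let G = Gal(K/k), isomorphic to Zp^(i+1). The Galois group of K over a Zp^i-extension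
   K' of k is a line Zp g0 in G, and Lambda(K') is the quotient of Lambda(K) by g0 - 1.
   Lambda(K) is noetherian and completely integrally closed, so an ideal A of it has
   height at least 2 iff it has grade at least 2: x divides y as soon as x divides A y.
   Noetherian induction shows that the image of such an A in Lambda(K') again has grade
   at least 2 (or, for i = 1, contains one of the elements that Lambda^dagger inverts),
   provided that g0 avoids finitely many hyperplanes of G. The lines in a hyperplane
   form a closed null set: infinitely many translates of it by unipotent elements are
   disjoint off a smaller set.

   Restriction of automorphisms gives a semilinear map rho : X(K) -> X(K'), and
   (g - 1) X(K') is contained in its image for all g. If b kills, modulo (g0 - 1) X(K),
   all commutators [t, s] with s in an inertia group above p, then b (g - 1) maps the
   kernel of rho into (g0 - 1) X(K). Products of elements d - 1, with one d in the
   decomposition group of each prime above p, are such b; if these groups have rank at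
   least 2, the b generate an ideal of grade at least 2.

   A pseudo-isomorphism with a sum of cyclic modules can be reversed. Composing rho with
   the reversed map gives the homomorphism of part (1); its cokernel and, in part (2),
   its kernel are killed by products of images of ideals of grade at least 2. *)
From HB Require Import structures.
Require Import Defs.
From mathcomp Require Import all_boot all_order all_algebra all_field ring zify.
From mathcomp Require fingroup cyclic pgroup.
From mathcomp Require Import all_classical all_reals all_analysis.
Set Implicit Arguments.
Unset Strict Implicit.
Unset Printing Implicit Defensive.
Import Order.TTheory GRing.Theory Num.Theory.
Local Open Scope classical_set_scope.
Local Open Scope ring_scope.
Local Open Scope quotient_scope.

(** * Ideals of grade two *)

Section Ideals.
Variable R : comPzRingType.
Implicit Types (A B I J P : set R) (a b c x y : R).

(** The Iwasawa algebras are never identified with power series rings. [complete_along] isolates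
    what is needed: if [B] is complete along a regular element [T] with quotient [B'], then being a
    noetherian, completely integrally closed domain lifts from [B'] to [B]. Lifting from F_p to Zp
    along [p], and then along g - 1 one rank at a time, covers every Lambda, and the same record
    relates Lambda(K) to Lambda(K').

    Compactness enters only through limits along a free ultrafilter on [nat]: in Zp, in Lambda,
    among automorphisms of [algC], and in X(K).

    Galois elements are represented by automorphisms of [algC] and places by primes of the ring of
    all algebraic integers; no class field theory is involved. The obstacle in part (2) is the
    inertia of Lmax(K) over K', which enlarges the kernel of rho beyond (g0 - 1) X(K). Away from p
    it vanishes by a tame argument, and at infinity because Gal(K/k) has no torsion, so only the
    places above p remain.

    A null set of the Grassmannian is certified by a Haar measure on Aut(M), which has to be
    constructed: the residues modulo powers of p form a regular tree, onto whose branches Lebesgue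
    measure is transported. *)

Definition dvr a b := exists c, b = c * a.

Lemma dvr_mull a b c : dvr a b -> dvr a (c * b).
Proof. by case=> d ->; exists (c * d); rewrite mulrA. Qed.
Lemma dvrD a b c : dvr a b -> dvr a c -> dvr a (b + c).
Proof. by case=> d -> [e ->]; exists (d + e); rewrite mulrDl. Qed.
Lemma dvr0 a : dvr a 0. Proof. by exists 0; rewrite mul0r. Qed.
Lemma dvr_refl a : dvr a a. Proof. by exists 1; rewrite mul1r. Qed.
Lemma dvr_trans a b c : dvr a b -> dvr b c -> dvr a c.
Proof. by case=> d -> [e ->]; exists (e * d); rewrite mulrA. Qed.
Hint Resolve dvr0 dvr_refl : core.

Lemma ideal0 I : is_ideal I -> I 0. Proof. by case. Qed.
Lemma idealD I a b : is_ideal I -> I a -> I b -> I (a + b).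
Proof. by case=> _ + _; apply. Qed.
Lemma idealM I a b : is_ideal I -> I b -> I (a * b).
Proof. by case=> _ _; apply. Qed.
Lemma idealMr I a b : is_ideal I -> I b -> I (b * a).
Proof. by rewrite mulrC; apply: idealM. Qed.
Lemma idealN I a : is_ideal I -> I a -> I (- a).
Proof. by rewrite -mulN1r; apply: idealM. Qed.
Lemma idealB I a b : is_ideal I -> I a -> I b -> I (a - b).
Proof. by move=> ? ? ?; apply: idealD => //; apply: idealN. Qed.
Lemma ideal_sum I (J : finType) (F : J -> R) : is_ideal I ->
  (forall j, I (F j)) -> I (\sum_j F j).
Proof. by move=> iI IF; elim/big_ind: _ => *; [apply: ideal0|apply: idealD|]. Qed.

Lemma princ_ideal a : is_ideal (dvr a).
Proof. by split=> [|x y|x y]; [apply: dvr0|apply: dvrD|apply: dvr_mull]. Qed.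

Definition adj I a : set R := [set x | exists i r, I i /\ x = i + r * a].

Lemma adj_ideal I a : is_ideal I -> is_ideal (adj I a).
Proof.
move=> iI; split.
- by exists 0, 0; rewrite mul0r addr0; split=> //; apply: ideal0.
- move=> _ _ [i [r [Ii ->]]] [j [s [Ij ->]]]; exists (i + j), (r + s).
  by split; [apply: idealD|rewrite mulrDl addrACA].
- move=> b _ [i [r [Ii ->]]]; exists (b * i), (b * r).
  by split; [apply: idealM|rewrite mulrDr mulrA].
Qed.
Lemma sub_adj I a : I `<=` adj I a.
Proof. by move=> x Ix; exists x, 0; rewrite mul0r addr0. Qed.
Lemma mem_adj I a : is_ideal I -> adj I a a.
Proof. by move=> iI; exists 0, 1; rewrite mul1r add0r; split=> //; apply: ideal0. Qed.

Definition colon I a : set R := [set x | I (x * a)].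
Lemma colon_ideal I a : is_ideal I -> is_ideal (colon I a).
Proof.
move=> iI; split; rewrite /colon /= ?mul0r; first exact: ideal0.
- by move=> x y Ix Iy; rewrite mulrDl; apply: idealD.
- by move=> x y Ix; rewrite -mulrA; apply: idealM.
Qed.

Definition fgen I := exists n (g : 'I_n -> R), (forall j, I (g j)) /\
  forall x, I x -> exists c : 'I_n -> R, x = \sum_j c j * g j.

Lemma fgen_fin I (J : finType) (g : J -> R) : (forall j, I (g j)) ->
  (forall x, I x -> exists c : J -> R, x = \sum_j c j * g j) -> fgen I.
Proof.
move=> Ig gI; exists #|J|, (fun j => g (enum_val j)); split=> // x /gI[c ->].
exists (fun j => c (enum_val j)).
rewrite [RHS](reindex (@enum_rank J)) /=; last exact/onW_bij/enum_rank_bij.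
by apply: eq_bigr => j _; rewrite enum_rankK.
Qed.

Definition noeth := forall I, is_ideal I -> fgen I.

Lemma ideal_zorn (Q : set R -> Prop) I0 : is_ideal I0 -> Q I0 ->
  (forall F : set (set R), F !=set0 -> (forall I, F I -> is_ideal I /\ Q I) ->
    total_on F subset -> Q (\bigcup_(X in F) X)) ->
  exists I, [/\ is_ideal I, Q I, I0 `<=` I &
    forall J, is_ideal J -> Q J -> I `<=` J -> J `<=` I].
Proof.
move=> iI0 QI0 QF; pose ok I := [/\ is_ideal I, Q I & I0 `<=` I].
have [|I [+ maxI]] := @Zorn_bigcup R [set I | I = set0 \/ ok I].
  move=> F FP totF; have [[I [FI okI]]|noI] := pselect (exists I, F I /\ ok I); last first.
    left; apply/seteqP; split=> // x [I FI Ix]; have [I0E|okI] := FP I FI; first by rewrite I0E in Ix.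
    by case: noI; exists I.
  pose F' := [set J | F J /\ ok J].
  have -> : \bigcup_(X in F) X = \bigcup_(X in F') X.
    apply/seteqP; split=> x [J FJ Jx]; exists J => //; last by case: FJ.
    by split=> //; have [J0|//] := FP J FJ; rewrite J0 in Jx.
  right; split; last 1 first.
  - by move=> x I0x; exists I => //; case: okI => _ _; apply.
  - split.
    + by exists I => //; case: okI => /ideal0.
    + move=> x y [J [FJ okJ] Jx] [L [FL okL] Ly]; have [JL|LJ] := totF J L FJ FL.
        by exists L => //; apply: idealD => //; [case: okL|apply: JL].
      by exists J => //; apply: idealD => //; [case: okJ|apply: LJ].
    + by move=> x y [J [FJ okJ] Jx]; exists J => //; apply: idealM => //; case: okJ.
  - apply: QF; first by exists I.
      by move=> J [_ []].
    by move=> J L [FJ _] [FL _]; apply: totF.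
move=> Iok; have {Iok} [iI QI I0I] : ok I.
  case: Iok => // I0E; case: (maxI I0); last by right; split.
  by rewrite I0E; split=> // /(_ 0 (ideal0 iI0)).
exists I; split=> // J iJ QJ IJ x Jx; apply: contrapT => nIx; apply: (maxI J).
  by split=> // JI; apply/nIx/JI.
by right; split=> //; apply: subset_trans I0I IJ.
Qed.

Lemma chain_fin (F : set (set R)) n (g : 'I_n -> R) : F !=set0 ->
  total_on F subset -> (forall j, (\bigcup_(X in F) X) (g j)) ->
  exists2 I, F I & forall j, I (g j).
Proof.
move=> F0 totF; elim: n g => [|n IH] g gF.
  by case: F0 => I FI; exists I => // -[].
have [j|I FI Ig] := IH (fun j => g (lift ord0 j)); first exact: gF.
have [J FJ Jg] := gF ord0; have [IJ|JI] := totF I J FI FJ; [exists J|exists I] => //.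
  by move=> j; case: (unliftP ord0 j) => [j' ->|->] //; apply: IJ.
by move=> j; case: (unliftP ord0 j) => [j' ->|->] //; apply: JI.
Qed.

(** The union of a chain is finitely generated, so one member contains the generators and equals the
    union; [Q] is therefore inherited. *)
Lemma noeth_max (Q : set R -> Prop) I0 : noeth -> is_ideal I0 -> Q I0 ->
  exists I, [/\ is_ideal I, Q I &
    forall J, is_ideal J -> Q J -> I `<=` J -> J `<=` I].
Proof.
move=> nR iI0 QI0; have [|I [iI QI _ mI]] := @ideal_zorn Q I0 iI0 QI0; last by exists I.
move=> F F0 FQ totF.
have iU : is_ideal (\bigcup_(X in F) X).
  split.
  - by case: F0 => I FI; exists I => //; have [/ideal0] := FQ I FI.
  - move=> x y [J FJ Jx] [L FL Ly]; have [iJ _] := FQ J FJ; have [iL _] := FQ L FL.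
    by have [JL|LJ] := totF J L FJ FL; [exists L|exists J] => //; apply: idealD => //; [apply: JL|apply: LJ].
  - by move=> x y [J FJ Jy]; exists J => //; apply: idealM => //; case: (FQ J FJ).
have [n [g [Ug gU]]] := nR _ iU; have [I FI Ig] := chain_fin F0 totF Ug.
suff <- : I = \bigcup_(X in F) X by case: (FQ I FI).
apply/seteqP; split=> x; first by exists I.
by move=> /gU[c ->]; have [iI _] := FQ I FI; apply: ideal_sum => // j; apply: idealM.
Qed.

Lemma max_disjoint_prime (S I : set R) : S 1 -> (forall a b, S a -> S b -> S (a * b)) ->
  is_ideal I -> (forall x, I x -> ~ S x) ->
  exists P, [/\ is_prime P, I `<=` P & forall x, P x -> ~ S x].
Proof.
move=> S1 SM iI IS; have [|P [iP PS IP mP]] := @ideal_zorn (fun I => forall x, I x -> ~ S x) I iI IS.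
  by move=> F _ FQ _ x [J FJ Jx]; have [_] := FQ J FJ; apply.
exists P; split=> //; split=> // [/PS //|a b Pab].
apply: contrapT => /not_orP[nPa nPb].
have hit c : ~ P c -> exists2 s, S s & adj P c s.
  move=> nPc; apply: contrapT => no; apply: nPc; apply: (mP (adj P c)).
  - exact: adj_ideal.
  - by move=> x Px Sx; apply: no; exists x.
  - exact: sub_adj.
  - exact: mem_adj.
have [s Ss [i [r [Pi sE]]]] := hit a nPa; have [t St [j [q [Pj tE]]]] := hit b nPb.
apply: (PS (s * t)); last exact: SM.
rewrite sE tE mulrDl !mulrDr -!addrA; do ?[apply: idealD => //].
- exact: idealMr.
- exact: idealMr.
- exact: idealM.
- by rewrite mulrACA; apply: idealM.
Qed.

(** Cohen's theorem: an ideal [I] maximal among those not finitely generated is prime. If [a * b] is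
    in [I] with neither factor in [I], generators of I + (a) and of (I : a) combine into generators
    of [I]. *)
Lemma cohen : (forall P, is_prime P -> fgen P) -> noeth.
Proof.
move=> fgP I0 iI0; apply: contrapT => nfg.
have [|I [iI nI _ mI]] := @ideal_zorn (fun I => ~ fgen I) I0 iI0 nfg.
  move=> F F0 FQ totF [n [g [Ug gU]]]; have [I FI Ig] := chain_fin F0 totF Ug.
  have [iI []] := FQ I FI; exists n, g; split=> // x Ix; apply: gU; by exists I.
have max J : is_ideal J -> I `<=` J -> (exists2 x, J x & ~ I x) -> fgen J.
  by move=> iJ IJ [x Jx nIx]; apply: contrapT => nJ; apply/nIx/(mI J).
apply/nI/fgP; split=> // [I1|a b Iab].
  apply/nI; exists 1%N, (fun=> 1); split=> // x _; exists (fun=> x).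
  by rewrite big_ord1 mulr1.
apply: contrapT => /not_orP[nIa nIb]; apply: nI.
have [||n [g [Ig gI]]] := max (adj I a) _ (@sub_adj _ _); first exact: adj_ideal.
  by exists a => //; apply: mem_adj.
have [|||m [h [Ih hI]]] := max (colon I a); first exact: colon_ideal.
- by move=> x Ix; rewrite /colon /=; apply: idealMr.
- by exists b => //; rewrite /colon /= mulrC.
have [g' g'P] := choice Ig; have [r rP] := choice g'P.
apply: (@fgen_fin _ ('I_n + 'I_m)%type
   (fun j => match j with inl j => g' j | inr j => h j * a end)).
  by case=> j; [case: (rP j)|apply: Ih].
move=> x Ix; have [c xE] := gI x (sub_adj a Ix).
pose w := \sum_j c j * r j.
have xE2 : x = \sum_j c j * g' j + w * a.
  rewrite {1}xE /w mulr_suml -big_split; apply: eq_bigr => j _ /=.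
  by case: (rP j) => _ {1}->; rewrite mulrDr mulrA.
have [d wE] : exists d : 'I_m -> R, w = \sum_j d j * h j.
  apply: hI; rewrite /colon /=.
  have -> : w * a = x - \sum_j c j * g' j by rewrite xE2 addrC addKr.
  apply: idealB => //; apply: ideal_sum => // j; apply: idealM => //.
  by case: (rP j).
exists (fun j => match j with inl j => c j | inr j => d j end).
rewrite big_sumType /= {1}xE2 wE; congr (_ + _).
by rewrite mulr_suml; apply: eq_bigr => j _; rewrite mulrA.
Qed.
End Ideals.
#[global] Hint Resolve dvr0 dvr_refl : core.

Lemma subsetPn_ex (T : Type) (A B : set T) : ~ A `<=` B -> exists x, A x /\ ~ B x.
Proof.
by move=> AB; apply: contrapT => no; apply: AB => x Ax; apply: contrapT => nB; apply: no; exists x.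
Qed.

(** * Grade two and height two *)

Section GradeTwo.
Variable R : comPzRingType.
Implicit Types (A B I J P Q : set R) (a b c x y : R).

Definition is_domain := (1 : R) != 0 /\ forall a b, a * b = 0 -> a = 0 \/ b = 0.

(* Complete integral closedness, with denominators cleared. *)
Definition cic := forall a b c, b != 0 -> c != 0 ->
  (forall n, dvr (b ^+ n) (c * a ^+ n)) -> dvr b a.

(* Equivalent to [height_ge2 A] in the rings considered here: [height_grade] and
   [grade_height]. *)
Definition grade2 A := forall x y, x != 0 -> (forall a, A a -> dvr x (a * y)) -> dvr x y.

Lemma grade2S A B : A `<=` B -> grade2 A -> grade2 B.
Proof. by move=> AB gA x y x0 Bxy; apply: gA => // a /AB; apply: Bxy. Qed.

Lemma grade2M A B C : grade2 A -> grade2 B ->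
  (forall a b, A a -> B b -> C (a * b)) -> grade2 C.
Proof.
move=> gA gB ABC x y x0 Cxy; apply: gA => // a Aa; apply: gB => // b Bb.
by rewrite mulrA [b * a]mulrC; apply/Cxy/ABC.
Qed.

Lemma prime_ideal P : is_prime P -> is_ideal P. Proof. by case. Qed.

Hypotheses (domR : is_domain) (nR : noeth R).

Lemma dom_cancel x a b : x != 0 -> x * a = x * b -> a = b.
Proof.
move=> x0 /eqP; rewrite -subr_eq0 -mulrBr => /eqP /domR.2[x00|].
  by rewrite x00 eqxx in x0.
by move/eqP; rewrite subr_eq0 => /eqP.
Qed.

Lemma dom_mul0 a b : a != 0 -> b != 0 -> a * b != 0.
Proof. by move=> /eqP a0 /eqP b0; apply/eqP => /domR.2[]. Qed.

Lemma dom_exp0 a n : a != 0 -> a ^+ n != 0.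
Proof.
move=> a0; elim: n => [|n IH]; first by rewrite expr0; case: domR.
by rewrite exprS dom_mul0.
Qed.

(** A maximal element among the ideals (I : z) with z outside [I] is an associated prime. *)
Lemma colon_prime I : is_ideal I -> ~ I 1 -> exists z, ~ I z /\ is_prime (colon I z).
Proof.
move=> iI nI1; have [||J [iJ [z [nIz JE]] mJ]] :=
  @noeth_max R (fun J => exists z, ~ I z /\ J = colon I z) (colon I 1) nR.
- exact: colon_ideal.
- by exists 1.
exists z; split=> //; rewrite -JE; split=> //; first by rewrite JE /colon /= mul1r.
move=> a b Jab; apply: contrapT => /not_orP[nJa nJb].
have JJ : J `<=` colon I (b * z).
  by move=> x; rewrite JE /colon /= mulrCA => Ixz; apply: idealM.
apply: nJa; apply: (mJ _ _ _ JJ).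
- exact: colon_ideal.
- by exists (b * z); split=> // Ibz; apply: nJb; rewrite JE.
- by move: Jab; rewrite JE /colon /= mulrA.
Qed.

(** A certificate, without localizing, that the maximal ideal of the local ring at [Q] is generated
    by [c]: there [u] is a unit, and u Q lies in (c). *)
Definition height1_at Q c u := [/\ is_prime Q, Q c, ~ Q u, c != 0 &
  forall a, Q a -> dvr c (u * a)].

Hypothesis cicR : cic.

(** The fraction y/x multiplies P = (x : y) into R. If it maps P into P, it is almost integral and
    [x] divides [y]. Otherwise c (y/x) = u falls outside P for some [c] in P, and u a = c (a y/x)
    for all [a] in P. *)
Lemma associated_height1 x y : x != 0 -> ~ dvr x y ->
  is_prime (colon (dvr x) y) -> exists c u, height1_at (colon (dvr x) y) c u.
Proof.
set P := colon _ _ => x0 nxy pP; have iP := prime_ideal pP.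
have Px : P x by rewrite /P /colon /=; exists y; rewrite mulrC.
have [stab|/existsNP[c /existsNP[u /not_implyP[Pc /not_implyP[cE nPu]]]]] :=
    pselect (forall c v, P c -> c * y = v * x -> P v).
  case: nxy; apply: (cicR x0 x0) => n.
  suff [v [_ ->]] : exists v, P v /\ x * y ^+ n = v * x ^+ n by exists v.
  elim: n => [|n [v [Pv vE]]]; first by exists x; rewrite !expr0.
  have [w wE] := Pv; exists w; split; first exact: stab wE.
  by rewrite exprSr mulrA vE mulrAC wE -mulrA -exprS.
have key a : P a -> dvr c (u * a).
  move=> [v vE]; exists v; apply: (dom_cancel x0).
  have E : u * x * a = c * (v * x) by rewrite -cE -vE; ring.
  by rewrite mulrA [x * u]mulrC E; ring.
exists c, u; split=> //; apply/eqP => c0.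
have [d] := key x Px; rewrite c0 mulr0 => /domR.2[u0|x00]; last by rewrite x00 eqxx in x0.
by apply: nPu; rewrite u0; apply: ideal0.
Qed.

(** If [x] divides A y but not [y], then A lies in (x : y), which is enlarged to an associated prime
    (x : z y). *)
Lemma not_grade2 A : ~ grade2 A -> exists Q c u, A `<=` Q /\ height1_at Q c u.
Proof.
move=> /existsNP[x /existsNP[y /not_implyP[x0 /not_implyP[Axy nxy]]]].
have [||z [nz pz]] := @colon_prime (colon (dvr x) y).
- exact/colon_ideal/princ_ideal.
- by rewrite /colon /= mul1r.
have E : colon (colon (dvr x) y) z = colon (dvr x) (z * y).
  by apply/seteqP; split=> a; rewrite /colon /= mulrA.
rewrite E in pz; have [c [u h]] := associated_height1 x0 nz pz.
by exists (colon (dvr x) (z * y)), c, u; split=> // a /Axy; rewrite /colon /= mulrCA; apply: dvr_mull.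
Qed.

(** If [c] is in [P], then u Q lies in (c), hence in [P], and [u] is outside. If not, u/c maps [P]
    into itself, so it is in R by complete integral closedness, and [u] would lie in (c), hence in
    [Q]. *)
Lemma height1_min Q c u P w : height1_at Q c u -> is_prime P -> P w -> w != 0 ->
  P `<=` Q -> Q `<=` P.
Proof.
move=> [pQ Qc nQu c0 Qcu] pP Pw w0 PQ a Qa; have iP := prime_ideal pP.
have nPu : ~ P u by move/PQ.
have [Pc|nPc] := pselect (P c).
  have [d dE] := Qcu a Qa; have : P (u * a) by rewrite dE; apply: idealM.
  by case: pP => _ _ pP /pP[].
case: nQu; suff [d ->] : dvr c u by apply: idealM => //; exact: prime_ideal.
apply: (cicR c0 w0) => n.
suff [v [_ ->]] : exists v, P v /\ w * u ^+ n = v * c ^+ n by exists v.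
elim: n => [|n [v [Pv vE]]]; first by exists w; rewrite !expr0.
have [d dE] := Qcu v (PQ v Pv); exists d; split.
  by have : P (d * c) by [rewrite -dE; apply: idealM]; case: pP => _ _ pP /pP[].
by rewrite exprSr mulrA vE mulrAC [v * u]mulrC dE -mulrA -exprS.
Qed.

Lemma height_grade A : height_ge2 A -> grade2 A.
Proof.
move=> hA; apply: contrapT => /not_grade2[Q [c [u [AQ h]]]].
have [pQ _ _ _ _] := h; have [P0 [P1 [pP0 pP1 [P01 n10] [P1Q nQ1]]]] := hA Q pQ AQ.
have [w [P1w nP0w]] := subsetPn_ex n10.
apply: nQ1; apply: (height1_min h pP1 P1w) => //; apply/eqP => w0.
by apply: nP0w; rewrite w0; apply: ideal0; case: pP0.
Qed.

(** The nonunit [t] shows that a prime [P] of grade 2 is nonzero. If its height were one, [P] would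
    be minimal over some [a], hence associated to (a) after localization at [P]; as [P] is finitely
    generated, one denominator suffices to get [a] dividing s z P but not s z. *)
Lemma grade_height A (t : R) : t != 0 -> ~ dvr t (1 : R) -> grade2 A -> height_ge2 A.
Proof.
move=> t0 nt gA P pP /grade2S/(_ gA) gP; have iP := prime_ideal pP.
have pr0 : is_prime [set (0 : R)].
  split; first by split=> //= a b; [move=> -> ->; rewrite addr0|move=> ->; rewrite mulr0].
    by move=> /= /eqP; case: domR => /negPf ->.
  by move=> a b /= /domR.2.
have [a [Pa a0]] : exists a, P a /\ a != 0.
  apply: contrapT => no; apply/nt/gP => // a Pa; have [->|a0] := eqVneq a 0.
    by rewrite mul0r.
  by case: no; exists a.
apply: contrapT => no.
have min Q : is_prime Q -> Q a -> Q `<=` P -> P `<=` Q.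
  move=> pQ Qa QP; apply: contrapT => nPQ; apply: no; exists [set 0], Q; split=> //.
  split; first by move=> _ ->; apply: ideal0; case: pQ.
  by move=> /(_ a Qa) /eqP; apply/negP.
pose I : set R := [set z | exists2 s, ~ P s & dvr a (s * z)].
have nPM s s' : ~ P s -> ~ P s' -> ~ P (s * s').
  by move=> ns ns'; case: pP => _ _ pP /pP[].
have iI : is_ideal I.
  split; first by exists 1; [case: pP|rewrite mulr0].
    move=> x y [s ns sx] [s' ns' sy]; exists (s * s'); first exact: nPM.
    rewrite mulrDr; apply: dvrD; last by rewrite -mulrA; apply: dvr_mull.
    by rewrite mulrAC mulrC; apply: dvr_mull.
  by move=> x y [s ns sy]; exists s => //; rewrite mulrCA; apply: dvr_mull.
have [|z [nIz pz]] := @colon_prime I iI.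
  by case=> s ns; rewrite mulr1 => -[d dE]; apply: ns; rewrite dE; apply: idealM.
have Pz : P `<=` colon I z.
  apply: min => //; first by exists 1; [case: pP|exists z; rewrite mul1r mulrC].
  move=> s [s' ns' sz]; apply: contrapT => ns; apply: nIz; exists (s' * s); first exact: nPM.
  by rewrite -mulrA.
have [n [g [Pg gP']]] := nR iP.
have [s sP] := choice (fun j => let: ex_intro2 s ns h := Pz _ (Pg j) in
  ex_intro (fun s => ~ P s /\ dvr a (s * (g j * z))) s (conj ns h)).
apply: nIz; exists (\prod_j s j).
  by apply: (big_ind (fun z => ~ P z)) => // [|j _]; [case: pP|case: (sP j)].
apply: gP => // x /gP'[c ->]; rewrite mulr_suml; apply: ideal_sum; first exact: princ_ideal.
move=> j; rewrite (bigD1 j) //=; have [_ h] := sP j.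
have -> : c j * g j * (s j * \prod_(i < n | i != j) s i * z) =
  c j * \prod_(i < n | i != j) s i * (s j * (g j * z)) by ring.
exact: dvr_mull.
Qed.

(** Says that the product of the sets in [s] lies in [I], through iterated colons so that product
    ideals need not be formed. *)
Fixpoint prodin I (s : seq (set R)) : Prop :=
  match s with [::] => I 1 | P :: s' => forall a, P a -> prodin (colon I a) s' end.

Lemma prodin_sub I J s : I `<=` J -> prodin I s -> prodin J s.
Proof.
elim: s I J => [|P s IH] I J IJ /=; first exact: IJ.
by move=> h a Pa; apply: IH (h a Pa) => x; apply: IJ.
Qed.

Lemma prodin_cat I J s1 s2 : prodin J s1 ->
  (forall j, J j -> prodin (colon I j) s2) -> prodin I (s1 ++ s2).
Proof.
elim: s1 I J => [|P s IH] I J /= h1 h2.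
  by apply: prodin_sub (h2 1 h1) => x; rewrite /colon /= mulr1.
move=> a Pa; apply: IH (h1 a Pa) _ => j Jja.
by apply: prodin_sub (h2 _ Jja) => x; rewrite /colon /= mulrA.
Qed.

Lemma prime_product I : is_ideal I -> exists s, prodin I s /\
  forall P, List.In P s -> is_prime P /\ I `<=` P.
Proof.
move=> iI; apply: contrapT => bad.
have [J [iJ nJ mJ]] := @noeth_max R (fun I => ~ exists s, prodin I s /\
  forall P, List.In P s -> is_prime P /\ I `<=` P) I nR iI bad.
have max a : ~ J a -> exists s, prodin (adj J a) s /\
    forall P, List.In P s -> is_prime P /\ J `<=` P.
  move=> nJa; apply: contrapT => no; apply: nJa; apply: (mJ (adj J a)).
  - exact: adj_ideal.
  - move=> [s [sP sI]]; apply: no; exists s; split=> // P /sI[pP JP]; split=> //.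
    by move=> x Jx; apply/JP/sub_adj.
  - exact: sub_adj.
  - exact: mem_adj.
apply: nJ; have [J1|nJ1] := pselect (J 1); first by exists [::].
have [pJ|npJ] := pselect (is_prime J).
  exists [:: J]; split=> [a Ja|P [<-|//]]; last by split.
  by rewrite /= /colon /= mul1r.
have [a [b [Jab na nb]]] : exists a b, [/\ J (a * b), ~ J a & ~ J b].
  apply: contrapT => no; apply: npJ; split=> // a b Jab.
  by apply: contrapT => /not_orP[na nb]; apply: no; exists a, b.
have [s1 [s1P s1J]] := max a na; have [s2 [s2P s2J]] := max b nb.
exists (s1 ++ s2); split=> [|P Ps]; last first.
  by case: (List.in_app_or _ _ _ Ps) => [/s1J|/s2J].
apply: prodin_cat s1P _ => _ [i [r [Ji ->]]]; apply: prodin_sub s2P.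
move=> _ [j [q [Jj ->]]]; rewrite /colon /= mulrDl mulrDr -addrA.
do ?[apply: idealD => //]; [exact: idealMr|exact: idealMr|].
by rewrite mulrDr; apply: idealD => //; [exact: idealM|rewrite mulrACA [b * a]mulrC; apply: idealM].
Qed.

Lemma prodin_prime I s Q : prodin I s -> is_prime Q -> I `<=` Q ->
  exists P, List.In P s /\ P `<=` Q.
Proof.
move=> + pQ; elim: s I => [|P s IH] I /= h IQ; first by case: pQ => _ /(_ (IQ _ h)).
have [PQ|nPQ] := pselect (P `<=` Q); first by exists P; split=> //; left.
have [a [Pa nQa]] : exists a, P a /\ ~ Q a.
  by apply: contrapT => no; apply: nPQ => a Pa; apply: contrapT => na; apply: no; exists a.
have [|P' [sP' P'Q]] := IH _ (h a Pa); last by exists P'; split=> //; right.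
by move=> x /IQ; case: pQ => _ _ pQ /pQ[].
Qed.

Lemma In_filter (T : Type) (q : pred T) (s : seq T) z :
  List.In z (seq.filter q s) -> List.In z s /\ q z.
Proof.
elim: s => //= w s IH; case: ifP => [qw [<-|/IH[]]|_ /IH[]]; by intuition.
Qed.

(** Factors of grade 2 can be cancelled: [F] divides z as soon as it divides P z. *)
Lemma prodin_grade2 (F y : R) s : F != 0 -> prodin (colon (dvr F) y) s ->
  prodin (colon (dvr F) y) [seq P <- s | `[< ~ grade2 P >]].
Proof.
move=> F0.
have del P s0 y0 : grade2 P -> prodin (colon (dvr F) y0) (P :: s0) ->
    prodin (colon (dvr F) y0) s0.
  move=> gP; elim: s0 y0 => [|P' s0 IH] y0 /= h.
    apply: gP => // a Pa; have := h a Pa; rewrite /colon /= !mul1r //.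
  move=> a' P'a'; apply: (prodin_sub (I := colon (dvr F) (a' * y0))).
    by move=> x; rewrite /colon /= mulrA.
  apply: IH => a Pa; apply: prodin_sub (h a Pa a' P'a') => x.
  by rewrite /colon /= !mulrA [x * a' * a]mulrAC.
elim: s y => [|P s IH] y h //=; case: asboolP => [ngP a Pa|/contrapT gP]; last first.
  exact/IH/(del P).
apply: (prodin_sub (I := colon (dvr F) (a * y))).
  by move=> x; rewrite /colon /= mulrA.
by apply: IH; apply: prodin_sub (h a Pa) => x; rewrite /colon /= mulrA.
Qed.

(** If the element [c] found for the other primes lies in [P], add to it an element [e] of [A] that
    lies in all the others but not in [P]; incomparability provides it. *)
Lemma prime_avoidance A s : is_ideal A ->
  (forall P, List.In P s -> is_prime P /\ ~ (A `<=` P)) ->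
  (forall P P', List.In P s -> List.In P' s -> P' `<=` P -> P `<=` P') ->
  exists2 c, A c & forall P, List.In P s -> ~ P c.
Proof.
move=> iA; elim: s => [|P s IH] sP anti; first by exists 0 => //; apply: ideal0.
have [|P' Q' hP hQ|c Ac sc] := IH; first by move=> P' sP'; apply: sP; right.
  by apply: anti; right.
have [pP /subsetPn_ex[a [Aa nPa]]] := sP P (or_introl erefl).
have [Pc|nPc] := pselect (P c); last by exists c => // P' [<-|/sc].
have nsub P' : List.In P' s -> ~ P' `<=` P.
  move=> sP' P'P; apply: (sc P') => //; apply: (anti P P') => //; by [left|right].
have [e [Ae nPe se]] : exists e, [/\ A e, ~ P e & forall P', List.In P' s -> P' e].
  have {}sP P' : List.In P' s -> is_prime P' by move=> sP'; case: (sP P' (or_intror sP')).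
  elim: (s) nsub sP => [|P' s' IHs] nsub sP; first by exists a.
  have [P0 h0|P0 h0|e [Ae nPe se]] := IHs; [by apply: nsub; right|by apply: sP; right|].
  have /subsetPn_ex[f [P'f nPf]] := nsub P' (or_introl erefl).
  exists (f * e); split; first exact: idealM.
    by case: pP => _ _ pP /pP[].
  move=> P0 [<-|sP0]; first by apply: idealMr => //; apply/prime_ideal/sP; left.
  by apply: idealM (se P0 sP0); apply: prime_ideal; apply: sP; right.
exists (c + e); first exact: idealD.
move=> P' [<-|sP'] P'ce.
  apply: nPe; have -> : e = (c + e) - c by rewrite addrC addKr.
  by apply: idealB => //; apply: prime_ideal.
apply: (sc P') => //; have -> : c = (c + e) - e by rewrite addrK.
have iP' : is_ideal P' by apply: prime_ideal; case: (sP P' (or_intror sP')).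
by apply: idealB => //; apply: se.
Qed.

(** Of finitely many primes with product inside (F), those of grade 2 are dropped; the rest have
    height one and do not contain [A], so some [c] in [A] avoids them all. A zero divisor modulo [F]
    lies in an associated prime of (F), which contains one of these primes and, having height one,
    equals it. *)
Lemma grade2_regular A (F : R) : F != 0 -> is_ideal A -> grade2 A ->
  exists2 c, A c & forall y, dvr F (c * y) -> dvr F y.
Proof.
move=> F0 iA gA; have iF := princ_ideal F.
have [s0 [s0P s0F]] := prime_product iF.
pose s := [seq P <- s0 | `[< ~ grade2 P >]].
have sF : prodin (colon (dvr F) 1) s.
  apply: prodin_grade2 => //; apply: prodin_sub s0P => x; by rewrite /colon /= mulr1.
have sP P : List.In P s -> [/\ is_prime P, P F & ~ grade2 P].
  by move=> h; have [/s0F[pP FP] /asboolP ngP] := In_filter h; split=> //; apply: FP.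
have anti P P' : List.In P s -> List.In P' s -> P' `<=` P -> P `<=` P'.
  move=> /sP[pP PF /not_grade2[Q [c [u [PQ h]]]]] /sP[pP' P'F _] P'P.
  by apply: subset_trans PQ (height1_min h pP' P'F F0 (subset_trans P'P PQ)).
have [|c Ac sc] := prime_avoidance iA _ anti.
  by move=> P /sP[pP _ ngP]; split=> // AP; apply: ngP; apply: grade2S gA.
exists c => // y cy; apply: contrapT => nFy.
have [||z [nz pz]] := @colon_prime (colon (dvr F) y).
- exact: colon_ideal.
- by rewrite /colon /= mul1r.
have E : colon (colon (dvr F) y) z = colon (dvr F) (z * y).
  by apply/seteqP; split=> a; rewrite /colon /= mulrA.
rewrite E in pz; have [d [u h]] := associated_height1 F0 nz pz.
have [|P [Ps PQ]] := prodin_prime sF pz.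
  by move=> x; rewrite /colon /= mulr1 => Fx; rewrite mulrC; apply: dvr_mull.
have [pP PF _] := sP P Ps; apply: (sc P) => //.
by apply: (height1_min h pP PF F0 PQ); rewrite /colon /= mulrCA; apply: dvr_mull.
Qed.
End GradeTwo.

(** From c y = w x and F y = z x follows c z = w F, so [F] divides [z], and cancelling [F] gives [x]
    dividing [y]. *)
Lemma regular_grade2 (R : comPzRingType) (A : set R) (c F : R) : is_domain R ->
  A c -> A F -> F != 0 -> (forall y, dvr F (c * y) -> dvr F y) -> grade2 A.
Proof.
move=> dR Ac AF F0 reg x y x0 h; have [w wE] := h c Ac; have [z zE] := h F AF.
have [v vE] : dvr F z.
  apply: reg; exists w; apply: (dom_cancel dR x0).
  by transitivity (c * (z * x)); [ring|rewrite -zE; transitivity (F * (c * y)); [ring|rewrite wE; ring]].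
by exists v; apply: (dom_cancel dR F0); rewrite zE vE; ring.
Qed.

(** * Lifting along a complete quotient *)

Record normal_ring (R : comPzRingType) : Prop := NormalRing {
  normal_dom : is_domain R;
  normal_noeth : noeth R;
  normal_cic : cic R }.

(** The properties of B'[[T]] over B' that are used, without requiring a copy of B' inside B: this
    admits Zp over F_p with T = p. [ca_sum] is completeness, stated for series. *)
Record complete_along (B B' : comPzRingType) (pi : {rmorphism B -> B'}) (T : B) : Prop :=
  CompleteAlong {
  ca_surj : forall y, exists x, pi x = y;
  ca_ker : forall x, pi x = 0 <-> dvr T x;
  ca_reg : forall x, T * x = 0 -> x = 0;
  ca_sep : forall x, (forall n, dvr (T ^+ n) x) -> x = 0;
  ca_sum : forall a : nat -> B, exists s, forall n,
    dvr (T ^+ n) (s - \sum_(k < n) a k * T ^+ k) }.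

Section Lift.
Variables (B B' : comPzRingType) (pi : {rmorphism B -> B'}) (T : B).
Hypothesis H : complete_along pi T.

Lemma ca_T : pi T = 0. Proof. exact/(ca_ker H). Qed.

Lemma ca_eq x y : pi x = pi y -> exists z, x = y + T * z.
Proof.
move=> xy; have /(ca_ker H)[z zE] : pi (x - y) = 0 by rewrite rmorphB xy subrr.
by exists z; rewrite [T * z]mulrC -zE addrC subrK.
Qed.

(** Successive approximation: the remainder of each step again satisfies [Q], and the coefficients
    of all steps sum up T-adically. *)
Lemma complete_span n (g : 'I_n -> B) (Q : set B) :
  (forall y, Q y -> exists c y', Q y' /\ y = \sum_j c j * g j + T * y') ->
  forall y, Q y -> exists c : 'I_n -> B, y = \sum_j c j * g j.
Proof.
move=> step y0 Qy0.
have /choice[f fP] : forall y, exists z : ('I_n -> B) * B,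
    Q y -> Q z.2 /\ y = \sum_j z.1 j * g j + T * z.2.
  move=> y; have [Qy|nQ] := pselect (Q y); last by exists (fun=> 0, 0).
  by have [c [y' h]] := step y Qy; exists (c, y').
pose yk k := iter k (fun y => (f y).2) y0.
have Qk k : Q (yk k) by elim: k => //= k IH; have [] := fP _ IH.
have /choice[c cP] : forall j, exists s, forall m,
    dvr (T ^+ m) (s - \sum_(k < m) (f (yk k)).1 j * T ^+ k).
  by move=> j; apply: (ca_sum H (fun k => (f (yk k)).1 j)).
exists c; apply/eqP; rewrite -subr_eq0; apply/eqP/(ca_sep H) => m.
have -> : y0 = \sum_j (\sum_(k < m) (f (yk k)).1 j * T ^+ k) * g j + T ^+ m * yk m.
  elim: m => [|m IH].
    rewrite expr0 mul1r big1 ?add0r // => j _; by rewrite big_ord0 mul0r.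
  rewrite {1}IH; have [_ {1}->] := fP _ (Qk m).
  rewrite mulrDr mulrA -exprSr addrA; congr (_ + _).
  rewrite mulr_sumr -big_split; apply: eq_bigr => j _ /=.
  by rewrite big_ord_recr /= mulrDl; congr (_ + _); ring.
rewrite addrAC; apply: dvrD; last by rewrite mulrC; apply/dvr_mull.
rewrite -sumrB; apply: ideal_sum; first exact: princ_ideal.
move=> j; rewrite -mulrBl mulrC; apply: dvr_mull.
rewrite -opprB -mulN1r; exact/dvr_mull/cP.
Qed.

Lemma T_order x : x != 0 -> exists n y, x = T ^+ n * y /\ ~ dvr T y.
Proof.
move=> /eqP x0; apply: contrapT => no; apply/x0/(ca_sep H).
elim=> [|n [y yE]]; first by exists x; rewrite expr0 mulr1.
have [[z zE]|nTy] := pselect (dvr T y); last by case: no; exists n, y; rewrite mulrC.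
by exists z; rewrite yE zE exprS mulrA.
Qed.

Lemma T_cancel n x y : T ^+ n * x = T ^+ n * y -> x = y.
Proof.
elim: n x y => [|n IH] x y; first by rewrite !mul1r.
rewrite exprSr -!mulrA => /IH /eqP; rewrite -subr_eq0 -mulrBr => /eqP /(ca_reg H) /eqP.
by rewrite subr_eq0 => /eqP.
Qed.

Hypothesis dom' : is_domain B'.

Lemma T_prime x y : dvr T (x * y) -> dvr T x \/ dvr T y.
Proof.
by move/(ca_ker H); rewrite rmorphM => /dom'.2[]; rewrite (ca_ker H); [left|right].
Qed.

Lemma T_prime_exp k b e : ~ dvr T b -> dvr (T ^+ k) (b * e) -> dvr (T ^+ k) e.
Proof.
move=> nTb; elim: k e => [|k IH] e; first by exists e; rewrite mulr1.
move=> [d dE]; have [//|[f fE]] : dvr T b \/ dvr T e.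
  by apply: T_prime; exists (d * T ^+ k); rewrite dE exprSr mulrA.
rewrite fE exprSr; have [|h hE] := IH f.
  exists d; apply: (@T_cancel 1); rewrite expr1 [T * (b * f)]mulrC -mulrA -fE dE.
  by rewrite exprS; ring.
by exists h; rewrite hE mulrA.
Qed.

Lemma ndvr_exp b n : ~ dvr T b -> ~ dvr T (b ^+ n).
Proof.
move=> nb; elim: n => [|n IH]; last by rewrite exprS => /T_prime[].
by rewrite expr0 => /(ca_ker H); rewrite rmorph1; apply/eqP; case: dom'.
Qed.

Lemma lift_dom : is_domain B.
Proof.
split; first by apply/eqP => /(congr1 pi); rewrite rmorph1 rmorph0; apply/eqP; case: dom'.
move=> a b ab0; apply: contrapT => /not_orP[/eqP /T_order[n [a' [aE na]]] /eqP /T_order[m [b' [bE nb]]]].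
have : T ^+ (n + m) * (a' * b') = T ^+ (n + m) * 0.
  by rewrite mulr0 -ab0 aE bE exprD; ring.
by move/T_cancel => E; have [] := @T_prime a' b'; rewrite ?E.
Qed.

(** By Cohen's theorem only primes [P] matter. Lift generators of the image of [P]. If [T] is in
    [P], adding [T] to them suffices; if not, the remainder of an approximation, being divided by
    [T], stays in [P], and the lifts alone generate. *)
Lemma lift_noeth : noeth B' -> noeth B.
Proof.
move=> nB'; apply: cohen => P pP; have iP := prime_ideal pP.
have iP' : is_ideal (pi @` P).
  split; first by exists 0; [apply: ideal0|rewrite rmorph0].
    by move=> _ _ [x Px <-] [y Py <-]; exists (x + y); [apply: idealD|rewrite rmorphD].
  move=> a _ [y Py <-]; have [x <-] := ca_surj H a.
  by exists (x * y); [apply: idealM|rewrite rmorphM].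
have [n [g' [Pg' g'P]]] := nB' _ iP'.
have [g [Pg gE]] : exists g : 'I_n -> B, (forall j, P (g j)) /\ forall j, pi (g j) = g' j.
  have /choice[h hP] : forall j, exists x, P x /\ pi x = g' j.
    by move=> j; case: (Pg' j) => x; exists x.
  by exists h; split=> j; case: (hP j).
have red y : P y -> exists (c : 'I_n -> B) y', y = \sum_j c j * g j + T * y'.
  move=> Py; have [c' c'E] : exists c', pi y = \sum_j c' j * g' j.
    by apply: g'P; exists y.
  have [c cE] := choice (fun j => ca_surj H (c' j)).
  have [|z zE] := @ca_eq y (\sum_j c j * g j); last by exists c, z.
  by rewrite rmorph_sum c'E; apply: eq_bigr => j _; rewrite rmorphM cE gE.
have [PT|nPT] := pselect (P T).
  apply: (@fgen_fin _ _ ('I_n + 'I_1)%type (fun j => if j is inl j then g j else T)).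
    by case.
  move=> y /red[c [z ->]]; exists (fun j => if j is inl j then c j else z).
  by rewrite big_sumType /= big_ord1 [T * z]mulrC.
exists n, g; split=> //; apply: complete_span => y Py; have [c [z zE]] := red y Py.
exists c, z; split=> //; case: pP => _ _ /(_ T z); case=> //.
have -> : T * z = y - \sum_j c j * g j by rewrite zE addrC addKr.
by apply: idealB => //; apply: ideal_sum => // j; apply: idealM.
Qed.

(** Write b = T^m b' and c = T^k c' with [T] dividing neither b' nor c'. Complete integral
    closedness of B' gives divisibility by b' modulo [T], hence by approximation a = d b'; comparing
    T-orders then shows that T^m divides d. *)
Lemma lift_cic : cic B' -> cic B.
Proof.
move=> cB' a b c b0 c0 bca; have dB := lift_dom.
have [k [c' [cE nc']]] := T_order c0; have [m [b' [bE nb']]] := T_order b0.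
have b'0 : b' != 0 by apply/eqP => b'0; apply: nb'; rewrite b'0.
have {}bca n : dvr (T ^+ (m * n) * b' ^+ n) (T ^+ k * (c' * a ^+ n)).
  by have := bca n; rewrite bE cE exprMn -exprM mulrA.
have b'a n : dvr (b' ^+ n) (c' * a ^+ n).
  have [e eE] := bca n; have [||f fE] := @T_prime_exp k (b' ^+ n) (T ^+ (m * n) * e).
  - exact: ndvr_exp.
  - by exists (c' * a ^+ n); rewrite [RHS]mulrC eE; ring.
  exists f; apply: (@T_cancel k); rewrite eE.
  have -> : e * (T ^+ (m * n) * b' ^+ n) = (T ^+ (m * n) * e) * b' ^+ n by ring.
  by rewrite fE; ring.
have [h hE] : exists h : 'I_1 -> B, a = \sum_j h j * b'.
  (* The property carried along is almost divisibility by b'. The remainder inherits it because b'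
     is prime to [T], so that powers of [T] can be cancelled. *)
  apply: (@complete_span 1 (fun=> b') [set x | forall n, dvr (b' ^+ n) (c' * x ^+ n)]) => //.
  move=> x xP; have [h hE] : dvr (pi b') (pi x).
    apply: (cB' _ _ (pi c')) => [||n].
    - by apply/eqP => /(ca_ker H).
    - by apply/eqP => /(ca_ker H).
    - by have [e eE] := xP n; exists (pi e); rewrite -!rmorphXn -!rmorphM eE.
  have [h' h'E] := ca_surj H h.
  have [|y yE] := @ca_eq x (h' * b'); first by rewrite rmorphM h'E.
  exists (fun=> h'), y; rewrite big_ord1; split=> // n.
  suff : dvr (b' ^+ n) (T ^+ n * (c' * y ^+ n)).
    move=> [e eE]; have [||f fE] := @T_prime_exp n (b' ^+ n) e; first exact: ndvr_exp.
      by exists (c' * y ^+ n); rewrite [RHS]mulrC eE mulrC.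
    by exists f; apply: (@T_cancel n); rewrite eE fE; ring.
  have -> : T ^+ n * (c' * y ^+ n) = c' * (x - h' * b') ^+ n.
    by rewrite yE addrC addKr exprMn; ring.
  rewrite exprBn mulr_sumr; apply: ideal_sum; first exact: princ_ideal.
  move=> j; rewrite -mulr_natr !mulrA mulrC; apply: dvr_mull.
  have [e eE] := xP (n - j)%N.
  rewrite exprMn; exists (e * (-1) ^+ j * h' ^+ j).
  have -> : b' ^+ n = b' ^+ (n - j) * b' ^+ j by rewrite -exprD subnK // -ltnS.
  transitivity (c' * x ^+ (n - j) * ((-1) ^+ j * (h' ^+ j * b' ^+ j))); first by ring.
  by rewrite eE; ring.
rewrite big_ord1 in hE; rewrite bE hE; set d := h ord0 in hE *.
suff [e ->] : dvr (T ^+ m) d by exists e; ring.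
have [->//|d0] := eqVneq d 0.
have [l [d' [dE nd']]] := T_order d0.
rewrite dE; have [ml|lm] := leqP m l.
  by exists (T ^+ (l - m) * d'); rewrite -[in LHS](subnK ml) exprD; ring.
(* If d had T-order l < m, exponent k + 1 would give m (k + 1) <= k + l (k + 1), which is false. *)
exfalso; have [e eE] := bca k.+1.
have : dvr (T ^+ (m * k.+1)) (c' * d' ^+ k.+1 * (T ^+ k * T ^+ (l * k.+1))).
  exists e; apply: (@dom_cancel _ dB (b' ^+ k.+1)); first exact: dom_exp0.
  move: eE; rewrite hE dE !exprMn -!exprM => E.
  transitivity (T ^+ k * (c' * (T ^+ (l * k.+1) * d' ^+ k.+1 * b' ^+ k.+1))); first by ring.
  by rewrite E; ring.
have nu : ~ dvr T (c' * d' ^+ k.+1) by move=> /T_prime[//|]; apply: ndvr_exp.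
move=> /(T_prime_exp nu)[f fE]; have := ndvr_exp (n := 0) nu; apply.
rewrite expr0; have lt : (k + l * k.+1 < m * k.+1)%N.
  by apply: (@leq_trans (l.+1 * k.+1)); rewrite ?leq_mul2r ?lm ?orbT // mulSn addSn.
pose e0 := (m * k.+1 - (k + l * k.+1)).-1.
have mE : (m * k.+1 = k + l * k.+1 + e0.+1)%N by rewrite /e0 prednK ?subn_gt0 // subnKC // ltnW.
exists (f * T ^+ e0); apply: (@T_cancel (k + l * k.+1)).
by rewrite mulr1 [LHS]exprD fE mE exprD exprS; ring.
Qed.
End Lift.

Lemma lift_normal (B B' : comPzRingType) (pi : {rmorphism B -> B'}) (T : B) :
  complete_along pi T -> normal_ring B' -> normal_ring B.
Proof.
move=> H [d n c]; split; [exact: lift_dom H d|exact: lift_noeth H n|exact: lift_cic H d c].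
Qed.

(** * Iwasawa algebras *)

Section Ultra.
Variables (I : Type) (F : set_system I).
Hypothesis FU : UltraFilter F.

Lemma ultraU (A B : set I) : F (A `|` B) -> F A \/ F B.
Proof.
move=> FAB; case: (in_ultra_setVsetC A FU) => [|FnA]; [by left|right].
by apply: filterS (filterI FAB FnA) => x [[]].
Qed.

Lemma ultra_nonempty (A : set I) : F A -> exists i, A i.
Proof. by move=> /filter_ex[i]; exists i. Qed.

Lemma ultra_fin (T : eqType) (f : I -> T) (s : seq T) :
  F [set i | f i \in s] -> exists v, v \in s /\ F [set i | f i = v].
Proof.
elim: s => [|v s IH] h; first by have [] := ultra_nonempty h.
have [|Fv|/IH[w [ws Fw]]] := @ultraU [set i | f i = v] [set i | f i \in s].
- by apply: filterS h => i /=; rewrite inE => /orP[/eqP|]; [left|right].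
- by exists v; rewrite mem_head.
- by exists w; rewrite inE ws orbT.
Qed.

Lemma filter_all (T : eqType) (s : seq T) (A : T -> set I) :
  (forall x, x \in s -> F (A x)) -> F [set i | forall x, x \in s -> A x i].
Proof.
elim: s => [|x s IH] h; first by apply: filterS filterT.
have Fx := h x (mem_head _ _); have {}IH := IH (fun y ys => h y (mem_behead (s := x :: s) ys)).
apply: filterS (filterI Fx IH) => i [Axi sAi] y; rewrite inE => /orP[/eqP->//|]; exact: sAi.
Qed.
End Ultra.

(** Limits along such an ultrafilter replace compactness: finitely many conditions that hold in the
    limit hold together at some large index. *)
Lemma free_ultra : exists F : set_system nat, UltraFilter F /\
  forall m, F [set k | (m <= k)%N].
Proof.
have [F [FU FF]] := @ultraFilterLemma _ (\oo : set_system nat) _.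
by exists F; split=> // m; apply: FF; exists m.
Qed.

(** * The p-adic integers *)

Section Padic.
Variable p : nat.
Hypothesis pp : prime p.
Local Notation zp := (padic p).
Local Notation q n := ((p ^ n)%N : int).
Implicit Types x y z : zp.

Lemma q_gt0 n : (0 < q n)%R. Proof. by rewrite ltz_nat expn_gt0 prime_gt0. Qed.

Lemma zpD x y n : (x + y) n = ((x n + y n) %% q n)%Z. Proof. by []. Qed.
Lemma zpM x y n : (x * y) n = ((x n * y n) %% q n)%Z. Proof. by []. Qed.
Lemma zp0 n : (0 : zp) n = 0. Proof. exact: mod0z. Qed.
Lemma zp_nat m n : (m%:R : zp) n = (m%:Z %% q n)%Z.
Proof.
elim: m => [|m IH]; first by rewrite zp0 mod0z.
by rewrite mulrSr zpD IH /= modzDm -addn1 PoszD.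
Qed.

Lemma zp_range x n : 0 <= x n < q n.
Proof. by rewrite -zp_mod modz_ge0 ?ltz_pmod // ?gt_eqF ?q_gt0. Qed.

Lemma zp_le x m n : (m <= n)%N -> x m = (x n %% q m)%Z.
Proof.
elim: n => [|n IH]; first by rewrite leqn0 => /eqP->; rewrite zp_mod.
rewrite leq_eqVlt => /orP[/eqP->|]; first by rewrite zp_mod.
rewrite ltnS => mn; rewrite (IH mn) (zp_coh x n).
have d : (q m %| q n)%Z by rewrite -(subnK mn) expnD PoszM dvdz_mull.
by apply/eqP; rewrite eqz_mod_dvd; apply: dvdz_trans d _; rewrite -eqz_mod_dvd modz_mod.
Qed.

(** The quotient is read off [n] levels higher: its residue at level k is the residue of [x] at
    level n + k divided by p^n. *)
Lemma zp_dvdP x n : x n = 0 <-> dvr ((p ^ n)%:R : zp) x.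
Proof.
split=> [xn0|[y ->]]; last by rewrite zpM zp_nat modzz mulr0 mod0z.
have dvd k : (q n %| x (n + k)%N)%Z.
  by apply/dvdz_mod0P; rewrite -(zp_le x (leq_addr k n)) xn0.
pose f k := (x (n + k)%N %/ q n)%Z.
have fE k : x (n + k)%N = q n * f k by rewrite mulrC divzK.
have fP k : (f k.+1 = f k %[mod q k])%Z.
  apply/eqP; rewrite eqz_mod_dvd -(@dvdz_mul2l (q n)) ?gt_eqF ?q_gt0 // mulrBr -!fE.
  by rewrite -PoszM -expnD addnS -eqz_mod_dvd; apply/eqP; apply: zp_step.
exists (zp_mk fP); apply: padic_eq => k.
rewrite mulrC zpM zp_nat /= modzMm -fE; exact: zp_le (leq_addl _ _).
Qed.

Lemma zp_sub0 x y n : x n = y n <-> (x - y) n = 0.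
Proof.
split=> [e|e]; last by rewrite -[x](subrK y) zpD e add0r zp_mod.
by rewrite -(zp0 n) -(subrr y) !zpD e.
Qed.

Lemma zp_sepP x : (forall n, dvr ((p ^ n)%:R : zp) x) -> x = 0.
Proof. by move=> h; apply: padic_eq => n; rewrite zp0; apply/zp_dvdP. Qed.

Lemma zp_reg x n : (p ^ n)%:R * x = 0 -> x = 0.
Proof.
move=> px; apply: padic_eq => k; rewrite zp0.
have := congr1 (fun y : zp => y (n + k)%N) px; rewrite zpM zp_nat zp0 modzMml.
move=> /dvdz_mod0P; rewrite expnD PoszM dvdz_mul2l ?gt_eqF ?q_gt0 // => d.
by rewrite (zp_le x (leq_addl n k)); apply/dvdz_mod0P.
Qed.

Lemma zp_limit (f : nat -> zp) : (forall n, f n.+1 n = f n n) ->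
  exists y, forall n, y n = f n n.
Proof.
move=> fP; have h n : (f n.+1 n.+1 = f n n %[mod q n])%Z by have := zp_step (f n.+1) n; rewrite fP.
by exists (zp_mk h) => n /=; rewrite zp_mod.
Qed.

Definition zp_Fp x : 'F_p := (x 1%N)%:~R.

Lemma Fp_mod (m : int) : (m %% q 1)%Z%:~R = m%:~R :> 'F_p.
Proof.
have /(congr1 (fun z : int => z%:~R : 'F_p)) := divz_eq m (q 1).
rewrite intrD => ->; rewrite -[LHS]add0r; congr (_ + _).
rewrite intrM.
by rewrite expn1 -pmulrn (pchar_Fp_0 pp) mulr0.
Qed.

Fact zp_Fp_additive : {morph zp_Fp : x y / x - y}.
Proof.
have D : {morph zp_Fp : x y / x + y} by move=> x y; rewrite /zp_Fp zpD Fp_mod rmorphD.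
by move=> x y; apply: (addIr (zp_Fp y)); rewrite -D !subrK.
Qed.
Fact zp_Fp_monoid : monoid_morphism zp_Fp.
Proof.
split; last by move=> x y; rewrite /zp_Fp zpM Fp_mod rmorphM.
by rewrite /zp_Fp (zp_nat 1) Fp_mod.
Qed.
HB.instance Definition _ := GRing.isZmodMorphism.Build zp 'F_p zp_Fp zp_Fp_additive.
HB.instance Definition _ := GRing.isMonoidMorphism.Build zp 'F_p zp_Fp zp_Fp_monoid.

Lemma zp_Fp0 x : zp_Fp x = 0 <-> dvr (p%:R : zp) x.
Proof.
rewrite -[p in p%:R]expn1 -zp_dvdP /zp_Fp; split=> [/eqP|->//].
have := zp_range x 1; case: (x 1%N) => m /andP[//] _; rewrite expn1 ltz_nat => mp.
rewrite -pmulrn -(dvdn_pcharf (pchar_Fp pp)) => /dvdnP[k mE].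
by move: mp; rewrite mE; case: k {mE} => [|k] //; rewrite mulSn ltnNge leq_addr.
Qed.

Lemma zp_complete : complete_along zp_Fp (p%:R : zp).
Proof.
have pX n : p%:R ^+ n = (p ^ n)%:R :> zp by rewrite natrX.
split.
- by move=> y; exists (y : nat)%:R; rewrite rmorph_nat natr_Zp.
- exact: zp_Fp0.
- by move=> x; rewrite -[p in p%:R]expn1 => /zp_reg.
- by move=> x h; apply: zp_sepP => n; rewrite -pX.
- move=> a; pose f n := \sum_(k < n) a k * p%:R ^+ k.
  have [n|y yP] := @zp_limit f.
    rewrite /f big_ord_recr; apply: (proj2 (zp_sub0 _ _ n)); rewrite addrAC subrr add0r.
    by apply/zp_dvdP; rewrite pX; exists (a n).
  by exists y => n; rewrite pX; apply/zp_dvdP/zp_sub0/yP.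
Qed.

Lemma field_normal (K : fieldType) : normal_ring K.
Proof.
split.
- split; first exact: oner_neq0.
  by move=> a b /eqP; rewrite mulf_eq0 => /orP[] /eqP; [left|right].
- move=> I iI; have [[a [Ia a0]]|no] := pselect (exists a, I a /\ a != 0).
    exists 1%N, (fun=> a); split=> // x Ix; exists (fun=> x / a).
    by rewrite big_ord1 divfK.
  exists 0%N, (fun=> 0); split=> [[]//|x Ix]; exists (fun=> 0); rewrite big_ord0.
  by apply: contrapT => /eqP x0; apply: no; exists x.
- by move=> a b c b0 _ _; exists (a / b); rewrite divfK.
Qed.

Lemma zp_normal : normal_ring zp.
Proof. exact: lift_normal zp_complete (field_normal _). Qed.

Lemma zp_unit x : x 1%N != 0 -> exists y, y * x = 1.
Proof.
move=> x1; have [|c cE] := @complete_span _ _ _ _ zp_complete 1 (fun=> x) setT _ 1 I.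
  move=> y _; have u : zp_Fp x != 0.
    by apply: contra x1 => /eqP /zp_Fp0; rewrite -[p in p%:R]expn1 => /zp_dvdP/eqP.
  have [c cE] := ca_surj zp_complete (zp_Fp y / zp_Fp x).
  have [|z zE] := @ca_eq _ _ _ _ zp_complete y (c * x); first by rewrite rmorphM cE divfK.
  by exists (fun=> c), z; rewrite big_ord1.
by exists (c ord0); rewrite cE big_ord1.
Qed.

Lemma zp_val x : x != 0 -> exists n u v, x = (p ^ n)%:R * u /\ v * u = 1.
Proof.
move=> x0; have [n [u [-> nu]]] := T_order zp_complete x0.
have [|v vu] := @zp_unit u; last by exists n, u, v; rewrite natrX.
by apply/eqP => u1; apply: nu; rewrite -[p in p%:R]expn1; apply/zp_dvdP.
Qed.

Lemma zp_dvr_total x y : dvr x y \/ dvr y x.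
Proof.
have [->|x0] := eqVneq x 0; first by right.
have [->|y0] := eqVneq y 0; first by left.
have [n [u [v [-> vu]]]] := zp_val x0; have [m [w [z [-> zw]]]] := zp_val y0.
have key k l u' w' v' : v' * u' = 1 -> (k <= l)%N ->
    dvr ((p ^ k)%:R * u' : zp) ((p ^ l)%:R * w').
  move=> vu' kl; exists ((p ^ (l - k))%:R * v' * w').
  transitivity ((p ^ (l - k))%:R * (p ^ k)%:R * w' * (v' * u') : zp); last by ring.
  by rewrite vu' mulr1 -natrM -expnD subnK.
by have [nm|/ltnW mn] := leqP n m; [left; apply: key vu nm|right; apply: key zw mn].
Qed.

Lemma zp_pid (I : set zp) : is_ideal I -> exists2 c, I c & forall x, I x -> dvr c x.
Proof.
move=> iI; have [n [g [Ig gI]]] := normal_noeth zp_normal iI.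
suff [c Ic cg] : exists2 c, I c & forall j, dvr c (g j).
  by exists c => // x /gI[e ->]; apply: ideal_sum => [|j]; [apply: princ_ideal|apply/dvr_mull].
elim: n g Ig {gI} => [|n IH] g Ig; first by exists 0 => [|[]//]; apply: ideal0.
have [c Ic cg] := IH (fun j => g (lift ord0 j)) (fun j => Ig _).
have [h|h] := zp_dvr_total c (g ord0).
  by exists c => // j; case: (unliftP ord0 j) => [j' ->|->].
by exists (g ord0) => // j; case: (unliftP ord0 j) => [j' ->|->] //; apply: dvr_trans h (cg _).
Qed.

Lemma zp_ulim (I : Type) (F : set_system I) (x : I -> zp) : UltraFilter F ->
  exists y, forall n, F [set i | x i n = y n].
Proof.
move=> FU; have /choice[v vP] : forall n, exists v : int, F [set i | x i n = v].
  move=> n; have [|v [_ Fv]] := @ultra_fin _ _ FU _ (fun i => x i n) [seq Posz j | j <- iota 0 (p ^ n)].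
    apply: filterS filterT => i _ /=; have := zp_range (x i) n.
    case: (x i n) => // m /andP[_]; rewrite ltz_nat => mp.
    by apply/mapP; exists m; rewrite // mem_iota.
  by exists v.
have h n : (v n.+1 = v n %[mod q n])%Z.
  have [i [/= <- <-]] := ultra_nonempty FU (filterI (vP n.+1) (vP n)); exact: zp_step.
exists (zp_mk h) => n; apply: filterS (vP n) => i /= <-; by rewrite zp_mod.
Qed.

End Padic.

Lemma binomial_prime (R : comPzRingType) p (a b : R) : prime p ->
  exists w, (a + b) ^+ p = a ^+ p + b ^+ p + p%:R * w.
Proof.
move=> pp; have [q pE] : exists q, p = q.+2 by case: p pp => [|[|q]] // _; exists q.
rewrite {1}pE exprDn big_ord_recr big_ord_recl /= subn0 subnn mulr1 mul1r bin0 binn !mulr1n -pE.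
exists (\sum_(i < q.+1) a ^+ (p - i.+1) * b ^+ i.+1 *+ ('C(p, i.+1) %/ p)).
rewrite addrAC mulr_sumr; congr (_ + _); apply: eq_bigr => i _.
rewrite /bump leq0n add1n; have /divnK E : (p %| 'C(p, i.+1))%N.
  by apply: prime_dvd_bin; rewrite //= pE; apply: (ltn_ord i).
by rewrite mulr_natl -mulrnA E.
Qed.

(** * Topology and ideals of completed group algebras *)

Section Lattice.
Variables (p : nat) (G : lmodType (padic p)) (O : set (set G)).

Record is_lat : Prop := IsLat {
  lat_fin : forall n, exists s : seq G, forall g, exists2 h, h \in s & ppow_dvd n (g - h);
  lat_sep : forall g : G, (forall n, ppow_dvd n g) -> g = 0;
  lat_tf : forall (g : G) n, g *+ p ^ n = 0 -> g = 0;
  lat_open : forall U, O U <-> forall g, U g -> exists n, forall u, ppow_dvd n (u - g) -> U u }.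

Hypotheses (pp : prime p) (L : is_lat).
Local Notation Lam := (cga (padic p) O).
Local Notation delta := (cga_delta (padic p) O).
Implicit Types (U V : open_sub O) (a b y : Lam) (g h : G).

Lemma ppow0 n : ppow_dvd n (0 : G). Proof. by exists 0; rewrite scaler0. Qed.
Lemma ppowD n g h : ppow_dvd n g -> ppow_dvd n h -> ppow_dvd n (g + h).
Proof. by move=> [x ->] [y ->]; exists (x + y); rewrite scalerDr. Qed.
Lemma ppowN n g : ppow_dvd n g -> ppow_dvd n (- g).
Proof. by move=> [x ->]; exists (- x); rewrite scalerN. Qed.
Lemma ppowB n g h : ppow_dvd n g -> ppow_dvd n h -> ppow_dvd n (g - h).
Proof. by move=> ? /ppowN; apply: ppowD. Qed.
Lemma ppow_le m n g : (m <= n)%N -> ppow_dvd n g -> ppow_dvd m g.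
Proof.
move=> mn [x ->]; exists ((p ^ (n - m))%:R *: x).
by rewrite scalerA -natrM -expnD subnKC.
Qed.
Lemma ppow_mul n g : ppow_dvd n (g *+ p ^ n). Proof. by exists g; rewrite scaler_nat. Qed.

Lemma mk_osub (A : set G) : A 0 -> (forall g h, A g -> A h -> A (g - h)) ->
  (exists n, forall g, ppow_dvd n g -> A g) -> exists U, osub U = A.
Proof.
move=> A0 AB [n nA].
have oA : O A.
  apply/(lat_open L) => g Ag; exists n => u /nA Aug.
  by have := AB _ _ Aug (AB _ _ A0 Ag); rewrite sub0r opprK subrK.
have fA : exists s : seq G, forall g, exists2 h, h \in s & A (g - h).
  by have [s sP] := lat_fin L n; exists s => g; have [h hs /nA] := sP g; exists h.
by exists (OpenSub oA A0 AB fA).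
Qed.

Lemma osubD U g h : osub U g -> osub U h -> osub U (g + h).
Proof.
by move=> Ug Uh; rewrite -[h]opprK; apply: osubB => //; rewrite -sub0r; apply: osubB => //; apply: osub0.
Qed.
Lemma osubMn U g n : osub U g -> osub U (g *+ n).
Proof.
by move=> Ug; elim: n => [|n IH]; rewrite ?mulr0n ?mulrS; [apply: osub0|apply: osubD].
Qed.

Lemma pn_osub n : exists U, osub U = [set g | ppow_dvd n g].
Proof. by apply: mk_osub; [apply: ppow0|move=> g h; apply: ppowB|exists n]. Qed.

Definition pn n : open_sub O := projT1 (cid (pn_osub n)).
Lemma pnE n g : osub (pn n) g <-> ppow_dvd n g.
Proof. by rewrite /pn; case: cid => U /= ->. Qed.

Lemma osub_pn U : exists n, forall g, ppow_dvd n g -> osub U g.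
Proof.
have [n nU] := (lat_open L _).1 (osub_open U) 0 (osub0 U).
by exists n => g gn; apply: nU; rewrite subr0.
Qed.

Lemma osub_exp U g : exists m, osub U (g *+ p ^ m).
Proof. by have [n nU] := osub_pn U; exists n; apply/nU/ppow_mul. Qed.

Lemma gen_osub V g0 : exists U, osub U = [set g | exists j, osub V (g - g0 *+ j)].
Proof.
apply: mk_osub.
- by exists 0%N; rewrite mulr0n subr0; apply: osub0.
- move=> g h [j Vg] [k Vh]; have [m Vm] := osub_exp V g0.
  (* Modulo [V] the element [g0] is killed by p^m, so - k g0 is the natural multiple k (p^m - 1)
     g0. *)
  exists (j + k * (p ^ m).-1)%N.
  have -> : g - h - g0 *+ (j + k * (p ^ m).-1) =
      (g - g0 *+ j) - (h - g0 *+ k) - (g0 *+ p ^ m) *+ k.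
    have : (0 < p ^ m)%N by rewrite expn_gt0 prime_gt0.
    case: (p ^ m)%N => //= e _; rewrite -mulrnA mulSn !mulrnDr [(k * e)%N]mulnC.
    rewrite opprB !opprD [RHS]addrA -[g - _ + _ + _]addrA [_ - h - _]addrAC subrr add0r.
    by rewrite [LHS]addrA [g - h - _]addrAC.
  apply: osubB; [exact: osubB|exact: osubMn].
- by have [n nV] := osub_pn V; exists n => g /nV Vg; exists 0%N; rewrite mulr0n subr0.
Qed.

Lemma fsum_ideal (T : choiceType) (A : set T) (I : set (padic p)) (F : T -> padic p) :
  is_ideal I -> finite_set A -> (forall x, A x -> I (F x)) -> I (\sum_(x \in A) F x).
Proof.
move=> iI fA IF; rewrite fsbig_finite // big_seq; apply: big_ind => [|x y|x].
- exact: ideal0.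
- exact: idealD.
- by rewrite in_fset_set // inE; apply: IF.
Qed.

(** [lvn U n] is the kernel of Lambda -> (Z/p^n)[G/U], and [lev U] that of Lambda -> Zp[G/U]; the
    first kernels are the basic neighbourhoods of 0. *)
Definition lvn U n : set Lam := [set a | forall c, dvr ((p ^ n)%:R : padic p) (a U c)].
Definition lev U : set Lam := [set a | forall c, a U c = 0].

Lemma lvn_ideal U n : is_ideal (lvn U n).
Proof.
split=> [c|a b ha hb c|a b hb c]; first exact: dvr0.
- exact: dvrD.
- apply: fsum_ideal => [||d _]; [exact: princ_ideal|exact: oquot_fin|exact/dvr_mull].
Qed.

Lemma lev_ideal U : is_ideal (lev U).
Proof.
split=> [c|a b ha hb c|a b hb c] //; first by rewrite /= ha hb addr0.
by apply: fsbig1 => d _; rewrite hb mulr0.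
Qed.

Lemma lev_lvn U n a : lev U a -> lvn U n a.
Proof. by move=> h c; rewrite h; apply: dvr0. Qed.

Lemma lvn_le U V n a : osub V `<=` osub U -> lvn V n a -> lvn U n a.
Proof.
move=> VU h c; rewrite (cga_coh a VU); apply: fsum_ideal => //; first exact: princ_ideal.
exact/fin_sub/oquot_fin.
Qed.
Lemma lev_le U V a : osub V `<=` osub U -> lev V a -> lev U a.
Proof. by move=> VU h c; rewrite (cga_coh a VU) fsbig1. Qed.

Lemma lvn_sep a : (forall U n, lvn U n a) -> a = 0.
Proof. by move=> h; apply: cga_ext => U c; apply: (zp_sepP pp) => n; apply: h. Qed.

Definition elts U : seq (oquot U) :=
  finmap.enum_fset (fset_set [set: oquot U]).
Lemma mem_elts U c : c \in elts U.
Proof. by rewrite in_fset_set ?inE //; apply: oquot_fin. Qed.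
Lemma fsum_elts U (F : oquot U -> padic p) :
  \sum_(c \in [set: oquot U]) F c = \sum_(c <- elts U) F c.
Proof. by rewrite fsbig_finite //; apply: oquot_fin. Qed.

Lemma cga_sumE (T : Type) (s : seq T) (F : T -> Lam) U c :
  (\sum_(x <- s) F x) U c = \sum_(x <- s) F x U c.
Proof. by elim: s => [|x s IH]; rewrite ?big_nil // !big_cons -IH. Qed.

Program Definition cscale (z : padic p) (a : Lam) : Lam := @Cga _ _ _ (fun U c => z * a U c) _.
Next Obligation.
move=> z a U V VU c; rewrite (cga_coh a VU) fsum_mulr //; exact: oquot_fin.
Qed.

Lemma cscaleB z a b : cscale z (a - b) = cscale z a - cscale z b.
Proof. by apply: cga_ext => U c /=; rewrite mulrBr. Qed.
Lemma cscaleMr z a b : cscale z (a * b) = a * cscale z b.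
Proof.
apply: cga_ext => U c /=; rewrite /conv fsum_mulr; last exact: oquot_fin.
by apply: eq_fsbigr => d _; rewrite mulrCA.
Qed.
Lemma lev_cscale z a U : lev U a -> lev U (cscale z a).
Proof. by move=> h c /=; rewrite h mulr0. Qed.

Lemma delta_mulE g a U c : (delta g * a) U c = a U (c - opi U g).
Proof.
transitivity (\sum_(d \in [set: oquot U]) (if d == opi U g then a U (c - d) else 0)).
  by apply: eq_fsbigr => d _ /=; case: eqP; rewrite ?mul1r ?mul0r.
exact: (fsum_delta (opi U g) (fun d => a U (c - d))).
Qed.

Lemma deltaD g h : delta (g + h) = delta g * delta h.
Proof.
apply: cga_ext => U c; rewrite delta_mulE /= opiD.
by rewrite -[c - _ == _](inj_eq (addIr (opi U g))) subrK addrC.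
Qed.
Lemma delta0 : delta 0 = 1. Proof. by []. Qed.
Lemma deltaMn g n : delta (g *+ n) = delta g ^+ n.
Proof. by elim: n => [|n IH]; rewrite ?mulr0n // mulrS deltaD IH exprS. Qed.

Lemma delta_lev g h U : osub U (g - h) -> lev U (delta g - delta h).
Proof. by move=> /opiP E c /=; rewrite E subrr. Qed.

Definition ulimto (I : Type) (F : set_system I) (b : I -> Lam) (l : Lam) :=
  forall U n, F [set i | lvn U n (b i - l)].

(** Coefficients converge in Zp one by one; coherence survives because modulo p^n it compares
    finitely many coefficients. *)
Lemma ulim_ex (I : Type) (F : set_system I) (b : I -> Lam) : UltraFilter F ->
  exists l, ulimto F b l.
Proof.
move=> FU; pose l U c := projT1 (cid (zp_ulim pp (fun i => b i U c) FU)).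
have lP U c n : F [set i | b i U c n = l U c n] by rewrite /l; case: cid.
have lE U n : F [set i | forall c, dvr ((p ^ n)%:R : padic p) (b i U c - l U c)].
  apply: filterS (filter_all FU (fun c _ => lP U c n)) => i h c.
  by apply/zp_dvdP => //; apply/zp_sub0/h/mem_elts.
have lc : coherent l.
  move=> U V VU c; apply/eqP; rewrite -subr_eq0; apply/eqP/(zp_sepP pp) => n.
  have [i [hU hV]] := ultra_nonempty FU (filterI (lE U n) (lE V n)).
  have fB (A : set (oquot V)) : \sum_(d \in A) (b i V d - l V d) =
      \sum_(d \in A) b i V d - \sum_(d \in A) l V d.
    have fin := @oquot_fin _ _ V.
    rewrite -[in RHS]mulN1r fsum_mulr // -fsum_add //.
    by apply: eq_fsbigr => d _; rewrite mulN1r.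
  have -> : l U c - \sum_(d \in [set d | oproj U V d = c]) l V d =
     \sum_(d \in [set d | oproj U V d = c]) (b i V d - l V d) - (b i U c - l U c).
    by rewrite fB -(cga_coh (b i) VU) opprB [RHS]addrC addrA subrK.
  apply: idealB (hU c); first exact: princ_ideal.
  apply: fsum_ideal => [||d _]; [exact: princ_ideal|exact/fin_sub/oquot_fin|exact: hV].
by exists (Cga lc) => U n; apply: filterS (lE U n) => i h c; apply: h.
Qed.

Lemma ulim_divides (I : Type) (F : set_system I) (b : I -> Lam) (l y z : Lam) :
  UltraFilter F -> ulimto F b l ->
  (forall U n, F [set i | lvn U n (y - z * b i)]) -> y = z * l.
Proof.
move=> FU bl h; apply/eqP; rewrite -subr_eq0; apply/eqP/lvn_sep => U n.
have [i [hi li]] := ultra_nonempty FU (filterI (h U n) (bl U n)).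
have -> : y - z * l = (y - z * b i) + z * (b i - l) by rewrite mulrBr addrA subrK.
by apply: (idealD (lvn_ideal U n)) => //; apply: idealM (lvn_ideal U n) li.
Qed.

Lemma free_cofinal (F : set_system nat) U (A : set nat) : UltraFilter F ->
  (forall m, F [set k | (m <= k)%N]) ->
  (forall k, osub (pn k) `<=` osub U -> A k) -> F A.
Proof.
move=> FU Fm h; have [n nU] := osub_pn U.
by apply: filterS (Fm n) => k nk; apply: h => g /pnE gk; apply: nU; apply: ppow_le gk.
Qed.

(** At a finite level [V], vanishing at V + Zg0 says that the coefficients of [y] sum to 0 over each
    coset of the group generated by [g0], so [y] is a combination of differences inside such cosets,
    which delta g0 - 1 divides. The quotients at all levels have a limit. *)
Lemma delta_kernel y g0 : (forall U, osub U g0 -> lev U y) -> dvr (delta g0 - 1) y.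
Proof.
move=> y0.
have fin V : exists b, lev V (y - (delta g0 - 1) * b).
  have [U UE] := gen_osub V g0.
  have VU : osub V `<=` osub U.
    by move=> g Vg; rewrite UE; exists 0%N; rewrite mulr0n subr0.
  have yU : lev U y.
    by apply: y0; rewrite UE; exists 1%N; rewrite mulr1n subrr; apply: osub0.
  pose rho (c : oquot V) : G := repr (oproj U V c).
  have /choice[j jP] : forall c : oquot V, exists j, osub V (repr c - rho c - g0 *+ j).
    move=> c; have : osub U (repr c - rho c).
      by apply/opiP; rewrite /rho opi_repr.
    by rewrite UE.
  have iV := lev_ideal V.
  (* With [rho c] representing the coset of [c] and [c] equal to rho c + j g0, the summand is (delta
     c - delta (rho c)) / (delta g0 - 1), a geometric sum. *)
  exists (\sum_(c <- elts V) cscale (y V c) (delta (rho c) * \sum_(i < j c) delta g0 ^+ i)).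
  have -> : (delta g0 - 1) * (\sum_(c <- elts V)
        cscale (y V c) (delta (rho c) * \sum_(i < j c) delta g0 ^+ i)) =
      \sum_(c <- elts V) cscale (y V c) (delta (rho c) * (delta g0 ^+ (j c) - 1)).
    rewrite mulr_sumr; apply: eq_bigr => c _; rewrite -cscaleMr; congr cscale.
    by rewrite mulrCA subrX1.
  have sum0 (F : oquot V -> Lam) : (forall c, lev V (F c)) -> lev V (\sum_(c <- elts V) F c).
    by move=> h; apply: (big_ind (lev V)) => // x z; apply: (idealD iV).
  pose Y : Lam := \sum_(c <- elts V) cscale (y V c) (delta (repr c)).
  have yY : lev V (y - Y).
    move=> c0; change (y V c0 - Y V c0 = 0); rewrite cga_sumE -fsum_elts.
    rewrite -[X in X - _](fsum_delta c0 (fun c => y V c)); apply/eqP; rewrite subr_eq0; apply/eqP.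
    apply: eq_fsbigr => c _ /=; rewrite opi_repr [c0 == c]eq_sym.
    by case: eqP; rewrite ?mulr1 ?mulr0.
  have -> : y - \sum_(c <- elts V) cscale (y V c) (delta (rho c) * (delta g0 ^+ j c - 1)) =
     (y - Y) + (\sum_(c <- elts V) cscale (y V c) (delta (repr c) - delta (rho c + g0 *+ j c))
     + \sum_(c <- elts V) cscale (y V c) (delta (rho c))).
    have sumD (F F' : oquot V -> Lam) : \sum_(c <- elts V) F c + \sum_(c <- elts V) F' c =
      \sum_(c <- elts V) (F c + F' c) by rewrite big_split.
    rewrite sumD -addrA; congr (_ + _); apply: (addrI Y); rewrite addNKr -sumrB.
    apply: eq_bigr => c _; rewrite deltaD deltaMn mulrBr mulr1 !cscaleB opprB.
    by rewrite [LHS]addrA [LHS]addrAC.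
  apply: (idealD iV) => //; apply: (idealD iV).
    apply: sum0 => c; apply/lev_cscale/delta_lev; by rewrite opprD addrA.
  move=> c0; rewrite cga_sumE -fsum_elts.
  transitivity (\sum_(c \in [set c | [set e : oquot U | c0 = opi V (repr e)] (oproj U V c)]) y V c).
    rewrite [RHS]fsum_if; apply: eq_fsbigr => c _ /=; case: eqP => e.
      by rewrite mulr1 mem_set.
    by rewrite mulr0 memNset.
  rewrite -(fsum_fibre (oproj U V) (@oquot_fin _ _ V) (@oquot_fin _ _ U)).
  by apply: fsbig1 => e _; rewrite -(cga_coh y VU) yU.
have /choice[b bP] := fin; have [F [FU Fm]] := free_ultra.
have [l lP] := ulim_ex (fun k => b (pn k)) FU.
exists l; rewrite mulrC; apply: (ulim_divides FU lP) => U n.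
by apply: (free_cofinal (U := U) FU Fm) => k kU; apply/lev_lvn/(lev_le kU)/bP.
Qed.

Lemma fsum_const (T : choiceType) (A : set T) (e : nat) (f : 'I_e -> T) (F : T -> padic p) z :
  injective f -> A = range f -> (forall x, A x -> F x = z) ->
  \sum_(x \in A) F x = e%:R * z.
Proof.
move=> fI -> Fz; rewrite fsbig_image; last by move=> x y _ _ /fI.
transitivity (\sum_(i \in [set: 'I_e]) z).
  by apply: eq_fsbigr => i _; apply: Fz; exists i.
have -> : [set: 'I_e] = [set` enum 'I_e] by apply/seteqP; split=> // i _ /=; rewrite mem_enum.
by rewrite -fsbig_seq ?enum_uniq // big_enum sumr_const card_ord mulr_natl.
Qed.

(* The cosets of V in V + <p^m g1> number a multiple of p^n, and y has the same
   coefficient on all of them; hence its coefficients at U are divisible by p^n. *)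
Lemma delta_regular y g1 g2 :
  (forall N, exists k, forall j, ~ ppow_dvd k (g1 *+ p ^ N - g2 *+ j)) ->
  (forall U, osub U g2 -> forall c, y U (c + opi U g1) = y U c) ->
  forall U, osub U g2 -> lev U y.
Proof.
move=> ind inv U Ug2 c; apply: (zp_sepP pp) => n.
have [m Um] := osub_exp U g1; pose g0 := g1 *+ p ^ m.
have [k kP] := ind (m + n)%N.
have [V VE] : exists V, osub V = [set g | osub U g /\ exists j, ppow_dvd k (g - g2 *+ j)].
  have [W WE] := gen_osub (pn k) g2.
  apply: mk_osub.
  - split; first exact: osub0.
    by exists 0%N; rewrite mulr0n subr0; apply: ppow0.
  - have WE' g : osub W g <-> exists j, ppow_dvd k (g - g2 *+ j).
      by rewrite WE; split=> -[j /pnE h]; exists j => //; apply/pnE.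
    move=> g h [Ug /WE' Wg] [Uh /WE' Wh]; split; first exact: osubB.
    by apply/WE'/osubB.
  - have [l lU] := osub_pn U; exists (l + k)%N => g glk; split.
      by apply: lU; apply: ppow_le glk; apply: leq_addr.
    by exists 0%N; rewrite mulr0n subr0; apply: ppow_le glk; apply: leq_addl.
have Vg2 : osub V g2 by rewrite VE; split=> //; exists 1%N; rewrite subrr; apply: ppow0.
have nV : ~ osub V (g0 *+ p ^ n).
  by rewrite VE => -[_ [j]]; rewrite /g0 -mulrnA -expnD; apply: kP.
have invV j d : y V (d + opi V (g0 *+ j)) = y V d.
  rewrite /g0 -mulrnA; elim: (_ * _)%N => [|i IH]; first by rewrite mulr0n opi0 addr0.
  by rewrite mulrSr opiD addrA inv.
have Ug0 : osub U g0 by [].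
clearbody g0; have [M VM] := osub_exp V g0.
have exM : exists e, `[< osub V (g0 *+ p ^ e) >] by exists M; apply/asboolP.
pose a : nat := ex_minn exM; have [aP amin] : osub V (g0 *+ p ^ a) /\
    forall e, osub V (g0 *+ p ^ e) -> (a <= e)%N.
  rewrite /a; case: ex_minnP => a' /asboolP ha' mn; split=> // b hb; apply: mn; exact/asboolP.
have na : (n <= a)%N.
  by rewrite leqNgt; apply/negP => an; apply: nV; rewrite -(subnK (ltnW an)) addnC expnD mulrnA; apply: osubMn.
have dvd j : osub V (g0 *+ j) -> (p ^ a %| j)%N.
  move=> Vj; have [->|j0] := posnP j; first exact: dvdn0.
  pose d := gcdn (p ^ a) j; have [l lE] : exists l, d = (p ^ l)%N.
    by have /dvdn_pfactor := dvdn_gcdl (p ^ a) j; case=> // l _; exists l.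
  suff : (p ^ a %| d)%N by move/dvdn_trans; apply; apply: dvdn_gcdr.
  rewrite lE dvdn_exp2l //; apply: amin; rewrite -lE /d.
  have pa : (0 < p ^ a)%N by rewrite expn_gt0 prime_gt0.
  have [u v uv _] := egcdnP (p ^ a) j0; rewrite gcdnC.
  have -> : g0 *+ gcdn j (p ^ a) = g0 *+ j *+ u - g0 *+ p ^ a *+ v.
    by rewrite -!mulrnA [(j * u)%N]mulnC uv mulrnDr [(v * _)%N]mulnC addrAC subrr add0r.
  by apply: osubB; apply: osubMn.
have [V' V'E] := gen_osub V g0.
have VV' : osub V `<=` osub V'.
  by move=> g Vg; rewrite V'E; exists 0%N; rewrite mulr0n subr0.
have V'U : osub V' `<=` osub U.
  move=> g; rewrite V'E => -[j]; rewrite VE => -[Ugj _].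
  by rewrite -[g](subrK (g0 *+ j)); apply: osubD => //; apply: osubMn.
suff : lvn V' n y by move/(lvn_le V'U); apply.
move=> c'; rewrite (cga_coh y VV').
pose d0 := opi V (repr c').
have d0c : oproj V' V d0 = c' by rewrite /d0 oproj_pi // opi_repr.
rewrite (@fsum_const _ _ (p ^ a) (fun j : 'I_(p ^ a) => d0 + opi V (g0 *+ j)) _ (y V d0)).
- by rewrite mulrC; apply: dvr_mull; rewrite -(subnK na) expnD natrM; apply/dvr_mull.
- move=> i j /addrI /opiP; wlog ij : i j / (i <= j)%N => [hw|] h.
    have [ij|/ltnW ji] := leqP i j; first exact: hw h.
    by apply/esym/(hw j i) => //; rewrite -opprB -sub0r; apply: osubB => //; apply: osub0.
  apply/val_inj/eqP; rewrite eqn_leq ij -subn_eq0 /=.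
  have : (p ^ a %| j - i)%N.
    by apply: dvd; rewrite mulrnBr // -opprB -sub0r; apply: osubB => //; apply: osub0.
  by rewrite /dvdn modn_small // (leq_ltn_trans (leq_subr _ _)).
- apply/seteqP; split=> [d /= dc|_ [j _ <-]] /=.
    have : osub V' (repr d - repr c').
      by apply/opiP; rewrite opi_repr -dc.
    rewrite V'E => -[j Vj]; have pa : (0 < p ^ a)%N by rewrite expn_gt0 prime_gt0.
    exists (Ordinal (ltn_pmod j pa)) => //=.
    rewrite -[RHS](opi_repr d) /d0 -opiD; apply/opiP.
    rewrite (divn_eq j (p ^ a)) mulrnDr in Vj.
    have -> : repr c' + g0 *+ (j %% p ^ a) - repr d =
       - (repr d - repr c' - (g0 *+ (j %/ p ^ a * p ^ a) + g0 *+ (j %% p ^ a))) - g0 *+ p ^ a *+ (j %/ p ^ a).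
      rewrite -mulrnA [(p ^ a * _)%N]mulnC; set w := g0 *+ (_ * _).
      by rewrite opprB opprB [w + _]addrC [RHS]addrAC addrK addrAC addrC.
    apply: osubB; last exact: osubMn.
    by rewrite -sub0r; apply: osubB => //; apply: osub0.
  rewrite -[d0]opi_repr -opiD oproj_pi // opiD.
  have /opiP -> : osub V' (g0 *+ j - 0).
    by rewrite subr0 V'E; exists j => //; rewrite subrr; apply: osub0.
  by rewrite opi0 addr0; exact: d0c.
- move=> d dc; have : osub V' (repr d - repr c').
    by apply/opiP; rewrite opi_repr -dc.
  rewrite V'E => -[j Vj]; rewrite -(invV j d0) /d0 -opiD -[d]opi_repr; congr (y V _).
  by apply/opiP; rewrite opprD addrA.
Qed.
End Lattice.

Lemma opp1_pow_prime (R : comPzRingType) p : prime p ->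
  exists w : R, (-1) ^+ p = -1 + p%:R * w.
Proof.
move=> pp; have [->|po] := even_prime pp.
  by exists 1; rewrite expr2 mulrNN !mulr1 mulr2n addrA addNr add0r.
by exists 0; rewrite mulr0 addr0 -signr_odd po expr1.
Qed.

Section TAdic.
Variables (p : nat) (G : lmodType (padic p)) (O : set (set G)).
Hypotheses (pp : prime p) (L : is_lat O).
Local Notation Lam := (cga (padic p) O).
Local Notation delta := (cga_delta (padic p) O).
Implicit Types (U V : open_sub O) (g : G).

Lemma augmentation_power g m : exists w : Lam,
  (delta g - 1) ^+ (p ^ m) = delta (g *+ p ^ m) - 1 + p%:R * w.
Proof.
elim: m => [|m [w IH]]; first by exists 0; rewrite expr1 mulr1n mulr0 addr0.
have [w1 E1] := binomial_prime (delta (g *+ p ^ m) - 1) (p%:R * w) pp.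
have [w2 E2] := binomial_prime (delta (g *+ p ^ m)) (-1) pp.
have [w3 E3] := opp1_pow_prime Lam pp.
exists (w2 + w3 + p%:R ^+ p.-1 * w ^+ p + w1).
have ppr : (p%:R : Lam) ^+ p = p%:R * p%:R ^+ p.-1 by rewrite -exprS prednK ?prime_gt0.
have -> : delta (g *+ p ^ m.+1) = delta (g *+ p ^ m) ^+ p by rewrite -deltaMn -mulrnA -expnSr.
rewrite expnSr exprM IH E1 E2 E3 exprMn ppr; ring.
Qed.

(** Modulo p, (delta g - 1)^(p^m) is delta (p^m g) - 1, which vanishes at level [U] for large m; its
    n-th power is then divisible by p^n there. *)
Lemma augmentation_sep g (x : Lam) : (forall n, dvr ((delta g - 1) ^+ n) x) -> x = 0.
Proof.
move=> h; apply: (lvn_sep pp) => U n; have [m Um] := osub_exp L U g.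
have [w wE] := augmentation_power g m.
have [b ->] := h (p ^ m * n)%N; apply: (idealM _ (lvn_ideal U n)).
have [e ->] : exists e : Lam, (delta g - 1) ^+ (p ^ m * n) =
    e * (delta (g *+ p ^ m) - 1) + p%:R ^+ n * w ^+ n.
  rewrite exprM wE; elim: n => [|n [e IH]].
    by exists 0; rewrite !expr0 mul0r add0r mulr1.
  rewrite exprSr IH; set D := delta _ - 1.
  exists (e * D + e * (p%:R * w) + p%:R ^+ n * w ^+ n); rewrite !exprSr; ring.
apply: (idealD (lvn_ideal U n)).
  apply/(idealM _ (lvn_ideal U n))/lev_lvn/delta_lev; by rewrite subr0.
move=> c; have -> : (p%:R ^+ n * w ^+ n : Lam) = w ^+ n *+ p ^ n.
  by rewrite -natrX mulr_natl.
have -> : forall (a : Lam) k, (a *+ k) U c = a U c *+ k.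
  by move=> a; elim=> [|k IH]; rewrite ?mulr0n // !mulrS -IH.
by exists ((w ^+ n : Lam) U c); rewrite mulr_natr.
Qed.

Lemma augmentation_sum g (a : nat -> Lam) : exists s, forall n,
  dvr ((delta g - 1) ^+ n) (s - \sum_(k < n) a k * (delta g - 1) ^+ k).
Proof.
have [F [FU Fm]] := free_ultra; set T := delta g - 1.
pose sn n := \sum_(k < n) a k * T ^+ k.
have [s sP] := ulim_ex pp sn FU; exists s => m; rewrite -/(sn m).
have /choice[c cE] : forall n, exists c, (m <= n)%N -> sn n - sn m = T ^+ m * c.
  elim=> [|n [c cE]]; first by exists 0; rewrite leqn0 => /eqP->; rewrite subrr mulr0.
  have [mn|nm] := leqP m n; last first.
    exists 0 => mn; have -> : m = n.+1 by apply/eqP; rewrite eqn_leq mn nm.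
    by rewrite subrr mulr0.
  exists (c + a n * T ^+ (n - m)) => _.
  rewrite /sn big_ord_recr /= -/(sn n) addrAC cE // mulrDr; congr (_ + _).
  by rewrite mulrCA -exprD subnKC.
have [c' c'P] := ulim_ex pp c FU; exists c'; rewrite mulrC.
apply: (ulim_divides pp FU c'P) => U n; apply: filterS (filterI (Fm m) (sP U n)) => i [mi si].
have E : s - sn m - T ^+ m * c i = - (sn i - s).
  by rewrite -cE // !opprB addrA subrK.
by change (lvn U n (s - sn m - T ^+ m * c i)); rewrite E; apply: idealN (lvn_ideal U n) si.
Qed.

Lemma indep0 g : g != 0 ->
  forall N, exists k, forall j, ~ ppow_dvd k (g *+ p ^ N - 0 *+ j).
Proof.
move=> g0 N; apply: contrapT => no; move/eqP: g0; apply; apply: (lat_tf L (n := N)).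
apply: (lat_sep L) => k; apply: contrapT => nk; apply: no; exists k => j.
by rewrite mul0rn subr0.
Qed.

Lemma lev_eq0 (y : Lam) : (forall U, lev U y) -> y = 0.
Proof. by move=> h; apply: (lvn_sep pp) => U n; apply: lev_lvn. Qed.

Lemma augmentation_reg g (x : Lam) : g != 0 -> (delta g - 1) * x = 0 -> x = 0.
Proof.
move=> g0 Tx; apply: lev_eq0 => U.
apply: (delta_regular pp L (indep0 g0)); last exact: osub0.
move=> V _ c; have := congr1 (fun a : Lam => a V (c + opi V g)) Tx.
rewrite mulrBl mul1r => /eqP; rewrite -[_ == _]/((delta g * x) V _ - x V _ == 0).
by rewrite delta_mulE addrK subr_eq0 => /eqP.
Qed.

(** At the levels containing [g2], the hypothesis makes [y] invariant under [g1]; since [g1]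
    generates subgroups of unbounded order modulo [g2], invariance forces [y] to vanish at these
    levels. *)
Lemma augmentation_regular_mod g1 g2 (y : Lam) :
  (forall N, exists k, forall j, ~ ppow_dvd k (g1 *+ p ^ N - g2 *+ j)) ->
  dvr (delta g2 - 1) ((delta g1 - 1) * y) -> dvr (delta g2 - 1) y.
Proof.
move=> ind [z zE]; apply: (delta_kernel pp L); apply: (delta_regular pp L ind) => V Vg2 c.
have lev2 : lev V ((delta g1 - 1) * y).
  by rewrite zE; apply: (idealM _ (lev_ideal V)); apply: delta_lev; rewrite subr0.
have := lev2 (c + opi V g1); rewrite mulrBl mul1r.
by rewrite -[LHS]/((delta g1 * y) V _ - y V _) delta_mulE addrK => /eqP; rewrite subr_eq0 => /eqP.
Qed.
End TAdic.

(** * Maps of group algebras induced by quotients *)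

Section Push.
Variables (p : nat) (G H : lmodType (padic p)) (O : set (set G)) (O' : set (set H)).
Variables (r : {additive G -> H}) (rO : forall U, O' U -> O (r @^-1` U)).
Hypothesis pp : prime p.
Local Notation push := (@cga_push (padic p) _ _ _ _ r rO).
Local Notation preim := (@preim_sub _ _ _ _ r rO).
Local Notation pmap := (@preim_map _ _ _ _ r rO).

Lemma preim_mapE (W : open_sub O') g : pmap (opi (preim W) g) = opi W (r g).
Proof.
apply/opiP; rewrite -raddfB.
have /opiP := @opi_repr _ _ (preim W) (opi (preim W) g); exact.
Qed.

Lemma preim_mapB (W : open_sub O') (c d : oquot (preim W)) : pmap (c - d) = pmap c - pmap d.
Proof.
by rewrite -[c]opi_repr -[d]opi_repr -opiN -opiD !preim_mapE raddfB opiD opiN.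
Qed.

Fact push_additive : {morph push : a b / a - b}.
Proof.
have D : {morph push : a b / a + b}.
  move=> a b; apply: cga_ext => U c /=; rewrite fsum_add //; exact: oquot_fin.
by move=> a b; apply: (addIr (push b)); rewrite -D !subrK.
Qed.

Lemma push_delta g : push (cga_delta _ _ g) = cga_delta _ _ (r g).
Proof.
apply: cga_ext => U c /=; rewrite fsum_if.
transitivity (\sum_(d \in [set: oquot (preim U)])
    (if d == opi (preim U) g then (c == opi U (r g))%:R else 0 : padic p)).
  apply: eq_fsbigr => d _; case: (eqVneq d (opi (preim U) g)) => [->|_]; last by case: ifP.
  rewrite -preim_mapE; case: ifP => [/set_mem <-|/negP h]; first by rewrite eqxx.
  by case: eqP => // cE; case: h; apply/mem_set.
by rewrite (fsum_delta _ (fun=> _)).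
Qed.

Fact push_monoid : monoid_morphism push.
Proof.
split; first by rewrite -[1]/(cga_delta (padic p) O 0) push_delta raddf0.
move=> a b; apply: cga_ext => U c; set V := preim U.
have finV := @oquot_fin _ _ V; have finU := @oquot_fin _ _ U.
rewrite /= /conv exchange_fsbig //; last exact: fin_sub finV _.
transitivity (\sum_(e \in [set: oquot V]) a V e * push b U (c - pmap e)); last first.
  symmetry; transitivity (\sum_(x \in [set: oquot U])
    \sum_(e \in [set e | pmap e = x]) a V e * push b U (c - pmap e)).
    apply: eq_fsbigr => x _; rewrite mulrC fsum_mulr //.
    by apply: eq_fsbigr => e /set_mem <-; rewrite mulrC.
  rewrite (fsum_fibre (@preim_map _ _ _ _ r rO U) finV finU).
  by apply: eq_fsbigl; apply/seteqP.
apply: eq_fsbigr => e _; rewrite /= fsum_mulr //.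
rewrite [RHS](reindex_fsbig (fun d => d - e) [set d | pmap d = c]) //; split.
- by move=> d /= <-; rewrite preim_mapB.
- by move=> d d' _ _ /addIr.
- move=> d /= dE; exists (d + e); rewrite ?addrK //=.
  by apply: (addIr (- pmap e)); rewrite -preim_mapB // addrK.
Qed.
HB.instance Definition _ := GRing.isZmodMorphism.Build _ _ push push_additive.
HB.instance Definition _ := GRing.isMonoidMorphism.Build _ _ push push_monoid.

Lemma push_lvn U n (a : cga (padic p) O) : lvn (preim U) n a -> lvn U n (push a).
Proof.
move=> h c; apply: fsum_ideal => //; first exact: princ_ideal.
exact/fin_sub/oquot_fin.
Qed.

Hypotheses (L : is_lat O) (L' : is_lat O').
Hypothesis rsurj : forall h, exists g, r g = h.

(** Each level is lifted through representatives; a limit of these lifts maps to [b]. *)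
Lemma push_surj (b : cga (padic p) O') : exists a, push a = b.
Proof.
have /choice[s sE] := rsurj.
pose lift V : cga (padic p) O :=
  \sum_(c <- elts V) cscale (b V c) (cga_delta (padic p) O (s (repr c))).
have pscale z (a : cga (padic p) O) : push (cscale z a) = cscale z (push a).
  apply: cga_ext => U c /=; rewrite fsum_mulr //; exact: oquot_fin.
have lP V : lev V (b - push (lift V)).
  move=> c0; change (b V c0 - push (lift V) V c0 = 0).
  rewrite /lift rmorph_sum cga_sumE -fsum_elts.
  rewrite -[X in X - _](fsum_delta c0 (fun c => b V c)); apply/eqP; rewrite subr_eq0; apply/eqP.
  apply: eq_fsbigr => c _; rewrite -[X in _ = X]/(push (cscale _ _) V c0) pscale push_delta sE /= opi_repr [c0 == c]eq_sym.
  by case: eqP; rewrite ?mulr1 ?mulr0.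
have [F [FU Fm]] := free_ultra.
have [a aP] := ulim_ex pp (fun k => lift (pn L' k)) FU.
exists a; apply/esym/eqP; rewrite -subr_eq0; apply/eqP/(lvn_sep pp) => U n.
have h : F [set k | osub (pn L' k) `<=` osub U] by exact: (free_cofinal (U := U) FU Fm).
have [k [kU ak]] := ultra_nonempty FU (filterI h (aP (preim U) n)).
have -> : b - push a = (b - push (lift (pn L' k))) + push (lift (pn L' k) - a).
  by rewrite rmorphB addrA subrK.
apply: (idealD (lvn_ideal U n)); first exact/lev_lvn/(lev_le kU).
exact: push_lvn.
Qed.

Variable g0 : G.
Hypotheses (rg0 : r g0 = 0) (rker : forall g, r g = 0 -> forall U : open_sub O, osub U g0 -> osub U g).
Hypothesis rlin : forall n g, r ((p ^ n)%:R *: g) = (p ^ n)%:R *: r g.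

(** An open subgroup containing [g0] contains the kernel of [r], so it is the preimage of its image.
    Hence an element with zero image vanishes at all levels containing [g0]. *)
Lemma push_kernel a : push a = 0 <-> dvr (cga_delta (padic p) O g0 - 1) a.
Proof.
split=> [a0|[b ->]]; last by rewrite rmorphM rmorphB rmorph1 /= push_delta rg0 delta0 subrr mulr0.
apply: (delta_kernel pp L) => U Ug0.
have [V VE] : exists V : open_sub O', osub V = r @` osub U.
  apply: (mk_osub L').
  - by exists 0; [apply: osub0|rewrite raddf0].
  - by move=> _ _ [g Ug <-] [h Uh <-]; exists (g - h); [apply: osubB|rewrite raddfB].
  - have [n nU] := osub_pn L U; exists n => _ [h ->]; have [g <-] := rsurj h.
    by exists ((p ^ n)%:R *: g); [apply: nU; exists g|rewrite rlin].
have VU : osub (preim V) `<=` osub U.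
  move=> g; rewrite /= VE => -[u Uu ug].
  have : osub U (g - u) by apply: rker => //; rewrite raddfB ug subrr.
  by move/osubD/(_ Uu); rewrite subrK.
apply: (lev_le VU) => d.
have := congr1 (fun b : cga (padic p) O' => b V (pmap d)) a0 => /=.
have -> : [set d' | pmap d' = pmap d] = [set d].
  apply/seteqP; split=> [d' /= e|_ -> //]; rewrite -[d']opi_repr -[d]opi_repr; apply/opiP.
  by move: e; rewrite -[d']opi_repr -[d]opi_repr !preim_mapE => /opiP; rewrite -raddfB !opi_repr.
by rewrite fsbig_set1.
Qed.

Lemma push_complete : g0 != 0 ->
  complete_along push (cga_delta (padic p) O g0 - 1).
Proof.
move=> g00; split.
- exact: push_surj.
- exact: push_kernel.
- by move=> x; apply: augmentation_reg.
- exact: augmentation_sep.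
- exact: augmentation_sum.
Qed.
End Push.

(** * Linear algebra over a domain *)

Section LinearAlgebra.
Variable R : comPzRingType.
Hypothesis domR : is_domain R.

Lemma dependent_family n (v : 'I_n.+1 -> 'I_n -> R) : exists c : 'I_n.+1 -> R,
  (exists j, c j != 0) /\ forall k, \sum_j c j * v j k = 0.
Proof.
elim: n v => [|n IH] v.
  by exists (fun=> 1); split; [exists ord0; case: domR|case].
have [[j0 vj0]|no] := pselect (exists j0, v j0 ord0 != 0); last first.
  have [c [[j cj] c0]] := IH (fun j k => v (lift ord0 j) (lift ord0 k)).
  exists (fun j => oapp c 0 (unlift ord0 j)); split.
    by exists (lift ord0 j); rewrite liftK.
  move=> k; rewrite big_ord_recl unlift_none /= mul0r add0r.
  case: (unliftP ord0 k) => [k' ->|->].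
    by rewrite -[RHS](c0 k'); apply: eq_bigr => i _; rewrite liftK.
  apply: big1 => i _; have [->|vi] := eqVneq (v (lift ord0 i) ord0) 0; first by rewrite mulr0.
  by case: no; exists (lift ord0 i).
have [c [[j cj] c0]] := IH (fun j k => v j0 ord0 * v (lift j0 j) (lift ord0 k) -
  v (lift j0 j) ord0 * v j0 (lift ord0 k)).
exists (fun j => if unlift j0 j is Some j' then c j' * v j0 ord0
  else - \sum_j' c j' * v (lift j0 j') ord0); split.
  by exists (lift j0 j); rewrite liftK; apply: dom_mul0.
move=> k; rewrite (bigD1_ord j0) //= unlift_none.
rewrite [X in _ + X](eq_bigr (fun i => c i * v j0 ord0 * v (lift j0 i) k)); last first.
  by move=> i _; rewrite liftK.
rewrite mulNr addrC; apply/eqP; rewrite subr_eq0; apply/eqP; rewrite mulr_suml.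
case: (unliftP ord0 k) => [k' ->|->]; last by apply: eq_bigr => i _; ring.
apply/eqP; rewrite -subr_eq0 -sumrB; apply/eqP; rewrite -[RHS](c0 k').
by apply: eq_bigr => i _; ring.
Qed.

Definition dual n (l : 'I_n -> R) (v : 'rV[R]_n) := \sum_j l j * v 0 j.

Lemma dualD n l (v w : 'rV[R]_n) : dual l (v + w) = dual l v + dual l w.
Proof. by rewrite -big_split; apply: eq_bigr => j _; rewrite mxE mulrDr. Qed.
Lemma dualZ n l a (v : 'rV[R]_n) : dual l (a *: v) = a * dual l v.
Proof. by rewrite mulr_sumr; apply: eq_bigr => j _; rewrite mxE mulrCA. Qed.

Definition cons_row n (a : R) (w : 'rV[R]_n) : 'rV[R]_n.+1 :=
  \row_j oapp (w 0) a (unlift ord0 j).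

Lemma cons_rowE n (v : 'rV[R]_n.+1) : v = cons_row (v 0 ord0) (\row_j v 0 (lift ord0 j)).
Proof. by apply/rowP => j; rewrite mxE; case: unliftP => [j' ->|->] /=; rewrite ?mxE. Qed.

(** Elimination: a vector of [H] with nonzero first coordinate clears that coordinate from the
    others, up to a scalar, and reduces to rank n. If there is no such vector, the first coordinate
    is the functional. *)
Lemma sub_or_full n (H : set 'rV[R]_n) : H 0 -> (forall v w, H v -> H w -> H (v + w)) ->
  (forall a v, H v -> H (a *: v)) ->
  (exists l : 'I_n -> R, (exists j, l j != 0) /\ forall v, H v -> dual l v = 0) \/
  (exists2 c : R, c != 0 & forall v : 'rV[R]_n, H (c *: v)).
Proof.
elim: n H => [|n IH] H H0 HD HZ.
  by right; exists 1 => [|v]; [case: domR|rewrite scale1r (_ : v = 0) //; apply/rowP => -[]].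
have [[h [Hh h0]]|no] := pselect (exists h, H h /\ h 0 ord0 != 0); last first.
  left; exists (fun j => (j == ord0)%:R); split; first by exists ord0; rewrite eqxx; case: domR.
  move=> v Hv; rewrite /dual big_ord_recl eqxx mul1r big1 ?addr0; last by move=> j _; rewrite mul0r.
  by apply: contrapT => /eqP v0; apply: no; exists v.
set a := h 0 ord0 in h0; pose h' := \row_j h 0 (lift ord0 j).
pose tl (v : 'rV[R]_n.+1) : 'rV[R]_n := \row_j v 0 (lift ord0 j).
have elimE (v : 'rV[R]_n.+1) : a *: v - v 0 ord0 *: h = cons_row 0 (a *: tl v - v 0 ord0 *: h').
  rewrite [LHS]cons_rowE !mxE [v _ _ * _]mulrC subrr; congr cons_row.
  by apply/rowP => j; rewrite !mxE.
have consD (u w : 'rV[R]_n) : cons_row 0 (u + w) = cons_row 0 u + cons_row 0 w :> 'rV[R]_n.+1.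
  by apply/rowP => j; rewrite !mxE; case: unliftP => [j' _|_] /=; rewrite ?mxE ?addr0.
have consZ b (w : 'rV[R]_n) : cons_row 0 (b *: w) = b *: cons_row 0 w :> 'rV[R]_n.+1.
  by apply/rowP => j; rewrite !mxE; case: unliftP => [j' _|_] /=; rewrite ?mxE ?mulr0.
have HB (v w : 'rV[R]_n.+1) : H v -> H w -> H (v - w).
  by move=> Hv Hw; rewrite -scaleN1r; apply: HD => //; apply: HZ.
have [|||[l [[j lj] lH]]|[c c0 cH]] := IH [set w | H (cons_row 0 w)].
- by rewrite /= (_ : cons_row 0 0 = 0) //; apply/rowP => j; rewrite !mxE; case: unliftP => [j' _|_] /=; rewrite ?mxE.
- by move=> u w /=; rewrite consD; apply: HD.
- by move=> b w /=; rewrite consZ; apply: HZ.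
- left; exists (fun j => if unlift ord0 j is Some j' then a * l j' else - dual l h'); split.
    by exists (lift ord0 j); rewrite liftK; apply: dom_mul0.
  move=> v Hv; rewrite /dual big_ord_recl unlift_none.
  rewrite [X in _ + X](eq_bigr (fun i => a * l i * v 0 (lift ord0 i))); last by move=> i _; rewrite liftK.
  have /= : dual l (a *: tl v - v 0 ord0 *: h') = 0.
    by apply: lH; rewrite /= -elimE; apply: HB; apply: HZ.
  rewrite -scaleN1r !dualD !dualZ mulN1r addrC => E; rewrite -[RHS]E mulNr [_ * v 0 ord0]mulrC.
  by congr (_ + _); rewrite mulr_sumr; apply: eq_bigr => i _; rewrite !mxE mulrA.
- right; exists (c * a); first exact: dom_mul0.
  move=> v; have : H (c *: (a *: v - v 0 ord0 *: h)) by rewrite elimE -consZ; apply: cH.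
  rewrite scalerBr !scalerA => /HD /(_ (HZ (c * v 0 ord0) h Hh)); by rewrite subrK.
Qed.
End LinearAlgebra.

Lemma normal_iso (B B' : comPzRingType) (j : {rmorphism B' -> B}) :
  bijective j -> normal_ring B' -> normal_ring B.
Proof.
move=> [i iK jK] [d n c]; have ji := can_inj iK.
have iD x y : i (x + y) = i x + i y by apply: ji; rewrite rmorphD !jK.
have iM x y : i (x * y) = i x * i y by apply: ji; rewrite rmorphM !jK.
have i0 : i 0 = 0 by apply: ji; rewrite rmorph0 jK.
have iX x k : i (x ^+ k) = i x ^+ k by apply: ji; rewrite rmorphXn !jK.
have i0E x : (i x != 0) = (x != 0).
  by congr (~~ _); apply/eqP/eqP => [h|->] //; rewrite -[x]jK h rmorph0.
split.
- split; first by rewrite -i0E (_ : i 1 = 1); [case: d|apply: ji; rewrite rmorph1 jK].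
  by move=> a b /(congr1 i); rewrite iM i0 => /d.2[] /(congr1 j); rewrite rmorph0 jK; [left|right].
- move=> I iI; have [|m [g [Ig gI]]] := n [set x | I (j x)].
    split; rewrite /= ?rmorph0; first exact: ideal0.
      by move=> x y; rewrite /= rmorphD; apply: idealD.
    by move=> x y; rewrite /= rmorphM; apply: idealM.
  exists m, (fun k => j (g k)); split=> // x Ix; have [|e eE] := gI (i x); first by rewrite /= jK.
  exists (fun k => j (e k)); rewrite -[x in LHS]jK eE rmorph_sum.
  by apply: eq_bigr => k _; rewrite rmorphM.
- move=> x y z x0 y0 h; have [|||e eE] := c (i x) (i y) (i z).
  + by rewrite i0E.
  + by rewrite i0E.
  + by move=> k; have [e eE] := h k; exists (i e); rewrite -!iX -!iM eE.
  + by exists (j e); apply: (can_inj jK); rewrite iM iK.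
Qed.

(** * Iwasawa algebras of free Zp-modules *)

Section Lattices.
Variable p : nat.
Hypothesis pp : prime p.
Local Notation zp := (padic p).

Definition pad_open (M : lmodType zp) : set (set M) := [set U | forall g, U g ->
  exists n, forall u, ppow_dvd n (u - g) -> U u].

Record lattice d (G : lmodType zp) (O : set (set G)) : Prop := Lattice {
  lt_iso : exists theta : {linear G -> 'rV[zp]_d}, bijective theta;
  lt_open : forall U, O U <-> @pad_open G U }.

Lemma ppow_linear (M N : lmodType zp) (f : {linear M -> N}) n x :
  ppow_dvd n x -> ppow_dvd n (f x).
Proof. by move=> [y ->]; exists (f y); rewrite linearZ. Qed.

Lemma ppow_row d n (v : 'rV[zp]_d) : ppow_dvd n v <-> forall j, dvr ((p ^ n)%:R : zp) (v 0 j).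
Proof.
split=> [[w ->] j|h]; first by exists (w 0 j); rewrite mxE mulrC.
have /choice[w wE] : forall j, exists w, v 0 j = w * (p ^ n)%:R by move=> j; apply: h.
by exists (\row_j w j); apply/rowP => j; rewrite !mxE wE mulrC.
Qed.

Lemma zp_approx (z : zp) n : exists m : nat, dvr ((p ^ n)%:R : zp) (z - m%:R) /\ (m < p ^ n)%N.
Proof.
have := zp_range pp z n; case E : (z n) => [m|//] /andP[_ mp].
exists m; split=> //; apply/zp_dvdP => //; apply/zp_sub0; rewrite zp_nat E.
by rewrite modz_small // mp andbT.
Qed.

Lemma lattice_is_lat d (G : lmodType zp) (O : set (set G)) : lattice d O -> is_lat O.
Proof.
move=> [[th thb] oO]; have [ht thK htK] := thb; have thI := can_inj thK.
have pth n g : ppow_dvd n (th g) -> ppow_dvd n g.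
  by move=> [w wE]; exists (ht w); apply: thI; rewrite linearZ /= htK.
split=> //.
- move=> n; exists [seq ht (\row_j (f j : nat)%:R) | f : {ffun 'I_d -> 'I_(p ^ n)}] => g.
  have /choice[m mP] : forall j, exists m : 'I_(p ^ n), dvr ((p ^ n)%:R : zp) (th g 0 j - (m : nat)%:R).
    by move=> j; have [m [h mp]] := zp_approx (th g 0 j) n; exists (Ordinal mp).
  exists (ht (\row_j ([ffun j => m j] j : nat)%:R)); first by apply/mapP; exists [ffun j => m j]; rewrite ?mem_enum.
  by apply: pth; rewrite linearB /= htK; apply/ppow_row => j; rewrite !mxE ffunE.
- move=> g h; apply: thI; rewrite linear0; apply/rowP => j; rewrite mxE.
  by apply: (zp_sepP pp) => n; have /(ppow_linear th)/ppow_row := h n; apply.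
- move=> g n gn; apply: thI; rewrite linear0; apply/rowP => j; rewrite mxE.
  apply: (zp_reg pp (n := n)); have := congr1 (fun g => th g 0 j) gn.
  by rewrite -scaler_nat linearZ linear0 !mxE.
Qed.

Lemma linear_preim (M N : lmodType zp) (f : {linear M -> N}) U :
  pad_open U -> pad_open (f @^-1` U).
Proof.
move=> oU g /oU[n nU]; exists n => u h; apply: nU; rewrite -linearB; exact: ppow_linear.
Qed.

Lemma row_lattice d : lattice d (@pad_open 'rV[zp]_d).
Proof. by split=> //; exists idfun; exists id. Qed.

Section OneLattice.
Variables (d : nat) (G : lmodType zp) (O : set (set G)).
Hypothesis L : lattice d O.

Lemma osub_scale (U : open_sub O) g z : osub U g -> osub U (z *: g).
Proof.
move=> Ug; have [n nU] := osub_pn (lattice_is_lat L) U; have [m [mz _]] := zp_approx z n.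
rewrite -[z](subrK m%:R) scalerDl; apply: osubD; last by rewrite scaler_nat; apply: osubMn.
by case: mz => w ->; apply: nU; exists (w *: g); rewrite scalerA mulrC.
Qed.

(** Otherwise natural multiples j g2 approach p^N g1, and a p-adic limit of the j yields a linear
    relation between [g1] and [g2]. *)
Lemma indep_far (g1 g2 : G) : (forall a b : zp, a *: g1 + b *: g2 = 0 -> a = 0) ->
  forall N, exists k, forall j, ~ ppow_dvd k (g1 *+ p ^ N - g2 *+ j).
Proof.
move=> ind N; apply: contrapT => no.
have /choice[j jP] : forall k, exists j, ppow_dvd k (g1 *+ p ^ N - g2 *+ j).
  by move=> k; apply: contrapT => nj; apply: no; exists k => j hj; apply: nj; exists j.
have [F [FU Fm]] := free_ultra; have [b bP] := zp_ulim pp (fun k => (j k)%:R : zp) FU.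
have pN0 : (p ^ N)%:R = 0 :> zp.
  apply: (ind _ (- b)); apply: (lat_sep (lattice_is_lat L)) => k.
  have [i [ki /= bi]] := ultra_nonempty FU (filterI (Fm k) (bP k)).
  have -> : (p ^ N)%:R *: g1 + - b *: g2 = (g1 *+ p ^ N - g2 *+ j i) + ((j i)%:R - b) *: g2.
    by rewrite scaler_nat scalerBl scaler_nat addrA subrK scaleNr.
  apply: ppowD; first exact: ppow_le ki (jP i).
  have /zp_dvdP[//|w ->] : ((j i)%:R - b) k = 0 by apply/zp_sub0.
  by exists (w *: g2); rewrite scalerA mulrC.
have /zp_reg : (p ^ N)%:R * (1 : zp) = 0 by rewrite pN0 mul0r.
by move=> /(_ pp) /eqP; apply/negP; case: (normal_dom (zp_normal pp)).
Qed.
End OneLattice.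

Section Quotient.
Variables (d d' : nat) (G H : lmodType zp) (O : set (set G)) (O' : set (set H)).
Hypotheses (L : lattice d O) (L' : lattice d' O').
Variables (r : {linear G -> H}) (rO : forall U, O' U -> O (r @^-1` U)) (g0 : G).
Hypotheses (g00 : g0 != 0) (rsurj : forall h, exists g, r g = h)
  (rker : forall g, r g = 0 <-> exists z, g = z *: g0).

Lemma quotient_complete :
  complete_along (@cga_push zp _ _ _ _ r rO) (cga_delta zp O g0 - 1).
Proof.
apply: push_complete => //; first exact: lattice_is_lat L.
- exact: lattice_is_lat L'.
- by apply/rker; exists 1; rewrite scale1r.
- by move=> g /rker[z ->] U; apply: (osub_scale L).
- by move=> n g; exact: (linearZ_LR r).
Qed.
End Quotient.

Lemma lattice0_iso (G : lmodType zp) (O : set (set G)) : lattice 0 O ->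
  exists j : {rmorphism zp -> cga zp O}, bijective j.
Proof.
move=> L; have La := lattice_is_lat L; have [[th [ht thK htK]] oO] := L.
have G0 (g : G) : g = 0 by apply: (can_inj thK); apply/rowP => -[].
pose cst (z : zp) : cga zp O := cscale z 1.
have cB : {morph cst : x y / x - y}.
  by move=> x y; apply: cga_ext => U c /=; rewrite mulrBl.
have cM : monoid_morphism cst.
  split; first by apply: cga_ext => U c /=; rewrite mul1r.
  move=> x y; rewrite /cst -cscaleMr mulr1; apply: cga_ext => U c /=.
  by rewrite [RHS]mulrCA mulrA.
pose cR : {rmorphism zp -> cga zp O} := HB.pack cst (GRing.isZmodMorphism.Build _ _ _ cB) (GRing.isMonoidMorphism.Build _ _ _ cM).
exists cR.
have osubT (U : open_sub O) g : osub U g by rewrite (G0 g); apply: osub0.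
have oq0 (U : open_sub O) (c : oquot U) : c = opi U 0 by rewrite -[c]opi_repr (G0 (repr c)).
exists (fun a : cga zp O => a (pn La 0) (opi (pn La 0) 0)) => [z|a] /=; first by rewrite eqxx mulr1.
apply: cga_ext => U c /=; rewrite (oq0 U c) eqxx mulr1.
have VU : osub (pn La 0) `<=` osub U by move=> g _; apply: osubT.
rewrite (cga_coh a VU) (_ : [set d | _] = [set opi (pn La 0) 0]) ?fsbig_set1 //.
by apply/seteqP; split=> [e _|e ->] /=; [apply: oq0|rewrite oproj_pi].
Qed.

Definition quotient_by (G H : lmodType zp) (g0 : G) (r : {linear G -> H}) :=
  [/\ g0 != 0, forall h, exists g, r g = h & forall g, r g = 0 <-> exists z, g = z *: g0].

Lemma lattice_tail d (G : lmodType zp) (O : set (set G)) : lattice d.+1 O ->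
  exists g0 (r : {linear G -> 'rV[zp]_d}), quotient_by g0 r /\
    forall U, @pad_open 'rV[zp]_d U -> O (r @^-1` U).
Proof.
move=> [[th [ht thK htK]] oO].
pose r : {linear G -> 'rV[zp]_d} := (col' ord0 \o th)%FUN.
have rO U : @pad_open 'rV[zp]_d U -> O (r @^-1` U) by move=> oU; apply/oO; exact: (@linear_preim _ _ r U oU).
pose g0 := ht (delta_mx 0 ord0).
have dm0 : (delta_mx 0 ord0 : 'rV[zp]_d.+1) 0 ord0 = 1 by rewrite mxE !eqxx.
have one0 : (1 : zp) != 0 by case: (normal_dom (zp_normal pp)).
exists g0, r; split=> //; split.
- apply/eqP => /(congr1 (fun g => th g 0 ord0)); rewrite htK dm0 linear0 mxE; exact/eqP.
- move=> h; exists (ht (cons_row 0 h)); rewrite /r /= htK; apply/rowP => j.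
  by rewrite !mxE liftK.
- move=> g; split=> [rg|[z ->]].
    exists (th g 0 ord0); apply: (can_inj thK); rewrite linearZ /= htK; apply/rowP => j.
    rewrite !mxE eqxx /=; case: (unliftP ord0 j) => [j' ->|->]; last by rewrite eqxx mulr1.
    by rewrite mulr0; have := congr1 (fun w : 'rV_d => w 0 j') rg; rewrite !mxE.
  rewrite linearZ /= htK; apply/rowP => j; rewrite !mxE /=; exact: mulr0.
Qed.

(** Induction on the rank: killing one basis vector is a complete quotient, and in rank 0 the
    algebra is Zp. *)
Lemma lattice_normal d (G : lmodType zp) (O : set (set G)) : lattice d O -> normal_ring (cga zp O).
Proof.
elim: d G O => [|d IH] G O L.
  by have [j jb] := lattice0_iso L; apply: normal_iso jb (zp_normal pp).
have [g0 [r [[g00 rs rk] rO]]] := lattice_tail L.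
exact: lift_normal (quotient_complete L (row_lattice d) rO g00 rs rk) (IH _ _ (row_lattice d)).
Qed.
End Lattices.

Lemma adj_mul (R : comPzRingType) (I : set R) (a b x y : R) : is_ideal I -> I (a * b) ->
  adj I a x -> adj I b y -> I (x * y).
Proof.
move=> iI Iab [i [r [Ii ->]]] [j [q [Ij ->]]]; rewrite mulrDl mulrDr -addrA.
apply: (idealD iI); first exact: idealMr.
apply: (idealD iI); first exact: idealMr.
rewrite mulrDr; apply: (idealD iI); first exact: idealM.
by rewrite mulrACA; apply: idealM.
Qed.

(** * Images of primes of grade two *)

Section HeightOneImages.
Variables (B B' : comPzRingType) (pi : {rmorphism B -> B'}) (T : B).
Hypotheses (H : complete_along pi T) (gB : normal_ring B) (gB' : normal_ring B').
Variable P : set B.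
Hypotheses (pP : is_prime P) (gP : grade2 P) (nPT : ~ P T).

Lemma prime_Tdiv x : P (T * x) -> P x.
Proof. by case: pP => _ _ pP' /pP'[]. Qed.

(** If [P] lay in (T), it would equal T P because [T] is outside [P], hence be 0 by separatedness;
    but the zero ideal has grade 2 only if [T] divides 1. *)
Lemma prime_image_neq0 : exists2 g, P g & pi g != 0.
Proof.
apply: contrapT => no; have iP := prime_ideal pP.
have div x : P x -> exists2 y, P y & x = T * y.
  move=> Px; have /(ca_ker H)[y yE] : pi x = 0.
    by apply: contrapT => /eqP px; apply: no; exists x.
  by exists y; [apply: prime_Tdiv; rewrite mulrC -yE|rewrite mulrC].
have P0 x : P x -> x = 0.
  move=> Px; apply: (ca_sep H) => n; suff [y Py ->] : exists2 y, P y & x = T ^+ n * y.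
    by rewrite mulrC; apply/dvr_mull.
  elim: n => [|n [y Py yE]]; first by exists x; rewrite ?mul1r.
  by have [z Pz zE] := div y Py; exists z => //; rewrite yE zE exprSr mulrA.
have T0 : T != 0 by apply/eqP => T0; apply: nPT; rewrite T0; apply: ideal0.
have /(ca_ker H) : dvr T 1 by apply: gP => // a /P0 ->; rewrite mul0r.
by rewrite rmorph1; apply/eqP; case: (normal_dom gB').
Qed.

(* At the height one prime Q the localization of B' is a discrete valuation ring,
   so an element g of P of least Q-order generates P up to T P; Nakayama then gives
   e P inside (g) for some e outside P, contradicting the grade of P. *)
Lemma height1_image (Q : set B') c u : height1_at Q c u ->
  (forall x, P x -> Q (pi x)) -> False.
Proof.
move=> [pQ Qc nQu c0 Qcu] PQ; have iP := prime_ideal pP; have iQ := prime_ideal pQ.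
have dB' := normal_dom gB'; have [_ nQ1 Qmul] := pQ.
have nQM a b : ~ Q a -> ~ Q b -> ~ Q (a * b) by move=> na nb /Qmul[].
have nQX a n : ~ Q a -> ~ Q (a ^+ n).
  by move=> na; elim: n => // n IH; rewrite exprS; apply: nQM.
(* The Q-adic order: it is finite because otherwise c^n divides z u^n for all n, and complete
   integral closedness puts [u] in (c). *)
have order z : z != 0 -> exists n w, u ^+ n * z = c ^+ n * w /\ ~ Q w.
  move=> z0; apply: contrapT => no; apply: nQu.
  suff [d ->] : dvr c u by apply: idealM.
  apply: (normal_cic gB' c0 z0) => n.
  suff [w [wE _]] : exists w, u ^+ n * z = c ^+ n * w /\ Q w.
    by exists w; rewrite mulrC wE mulrC.
  elim: n => [|n [w [wE Qw]]].
    by exists z; split; rewrite ?expr0 //; apply: contrapT => nz; apply: no; exists 0%N, z; rewrite !expr0.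
  have [v vE] := Qcu w Qw; exists v.
  have E : u ^+ n.+1 * z = c ^+ n.+1 * v.
    by rewrite exprS -mulrA wE mulrCA vE exprSr [v * c]mulrC mulrA.
  by split=> //; apply: contrapT => nv; apply: no; exists n.+1, v.
pose N n := exists g w, [/\ P g, ~ Q w & u ^+ n * pi g = c ^+ n * w].
have exN : exists n, `[< N n >].
  have [g Pg g0] := prime_image_neq0; have [n [w [E nw]]] := order _ g0.
  by exists n; apply/asboolP; exists g, w.
have [n [g [w [Pg nw gE]]] minN] : exists2 n, N n & forall m, N m -> (n <= m)%N.
  by case: (ex_minnP exN) => n /asboolP Nn mn; exists n => // m Nm; apply: mn; apply/asboolP.
have step x : P x -> exists e b y, [/\ ~ Q (pi e), P y & e * x = b * g + T * y].
  move=> Px; have [px|px] := eqVneq (pi x) 0.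
    have /(ca_ker H)[y yE] := px; exists 1, 0, y; rewrite rmorph1; split=> //.
      by apply: prime_Tdiv; rewrite mulrC -yE.
    by rewrite mul0r add0r mul1r mulrC.
  have [m [w' [E nw']]] := order _ px.
  have nm : (n <= m)%N by apply: minN; exists x, w'.
  have [e eE] := ca_surj H (w * u ^+ m).
  have [b bE] := ca_surj H (c ^+ (m - n) * w' * u ^+ n).
  have [|y yE] := @ca_eq _ _ _ _ H (e * x) (b * g).
    rewrite !rmorphM eE bE -mulrA E -!mulrA gE -[in LHS](subnK nm) exprD; ring.
  exists e, b, y; split=> //; first by rewrite eE; apply: nQM => //; apply: nQX.
  apply: prime_Tdiv; have -> : T * y = e * x - b * g by rewrite yE addrC addKr.
  by apply: idealB => //; apply: idealM.
have [k [x [Px xP]]] := normal_noeth gB iP.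
have /choice[e /choice[b /choice[y ebyP]]] : forall j, exists e b y,
    [/\ ~ Q (pi e), P y & e * x j = b * g + T * y] by move=> j; apply: step.
have /choice[C CE] : forall j, exists C : 'I_k -> B, y j = \sum_i C i * x i.
  by move=> j; apply: xP; case: (ebyP j).
(* The determinant trick: [M] sends the generators [x] to multiples of [g], so its adjugate shows
   that det M times [P] lies in (g). Modulo [T] the matrix is diagonal with entries outside [Q], so
   det M is the factor wanted. *)
pose M : 'M[B]_k := diag_mx (\row_j e j) - T *: \matrix_(i, j) C i j.
have ME : M *m (\col_j x j) = \col_j (b j * g).
  apply/colP => j; rewrite mulmxBl -scalemxAl !mxE.
  rewrite (bigD1 j) //= !mxE eqxx mulr1n big1 ?addr0; last first.
    by move=> i ij; rewrite !mxE eq_sym (negPf ij) mulr0n mul0r.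
  have [_ _ ->] := ebyP j; rewrite CE; apply/eqP; rewrite subr_eq; apply/eqP; congr (_ + _ * _).
  by apply: eq_bigr => i _; rewrite !mxE.
have detx j : dvr g (\det M * x j).
  have : \adj M *m (M *m \col_j x j) = \adj M *m \col_j (b j * g) by rewrite ME.
  rewrite mulmxA mul_adj_mx mul_scalar_mx => /colP/(_ j); rewrite !mxE => ->.
  by apply: ideal_sum; [exact: princ_ideal|move=> i; rewrite [X in _ * X]mxE mulrA; exact/dvr_mull].
have ndet : ~ Q (pi (\det M)).
  rewrite -det_map_mx; have -> : map_mx pi M = diag_mx (\row_j pi (e j)).
    apply/matrixP => i j; rewrite !mxE rmorphB rmorphM (ca_T H) mul0r subr0 rmorphMn.
    by congr (_ *+ _).
  rewrite det_diag; apply: (big_ind (fun z => ~ Q z)) => // j _; rewrite mxE.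
  by case: (ebyP j).
have g0 : g != 0.
  apply/eqP => g0; have : c ^+ n * w = 0 by rewrite -gE g0 rmorph0 mulr0.
  apply/eqP/(dom_mul0 dB'); first exact: dom_exp0.
  by apply/eqP => w0; apply: nw; rewrite w0; apply: ideal0.
apply/ndet/PQ; have [d ->] : dvr g (\det M); last exact: idealM.
apply: gP => // a /xP[f ->]; rewrite mulr_suml; apply: ideal_sum; first exact: princ_ideal.
by move=> j; rewrite -mulrA; apply: dvr_mull; rewrite mulrC.
Qed.
End HeightOneImages.

Section Small.
Variable p : nat.
Hypothesis pp : prime p.
Local Notation zp := (padic p).

Definition augmentations (G : lmodType zp) (O : set (set G)) : set (cga zp O) :=
  [set x | exists2 g : G, g != 0 & x = cga_delta zp O g - 1].

(* A finitely generated X with a small annihilator has a pseudo-null X^dagger. *)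
Definition small d (G : lmodType zp) (O : set (set G)) (I : set (cga zp O)) : Prop :=
  if d == 1%N then exists2 s, mult_closure (@augmentations G O) s & I s else grade2 I.

Lemma smallM d (G : lmodType zp) (O : set (set G)) (I J K : set (cga zp O)) :
  small d I -> small d J -> (forall a b, I a -> J b -> K (a * b)) -> small d K.
Proof.
rewrite /small; case: (d == 1%N) => [[s ms Is] [t mt Jt] h|]; last exact: grade2M.
by exists (s * t); [apply: mult_closure_mul|apply: h].
Qed.

Lemma small1 d (G : lmodType zp) (O : set (set G)) (I : set (cga zp O)) : I 1 -> small d I.
Proof.
rewrite /small; case: (d == 1%N) => I1; first by exists 1 => //; apply: mult_closure1.
by move=> x y _ /(_ 1 I1); rewrite mul1r.
Qed.

Lemma indep_grade2 d (G : lmodType zp) (O : set (set G)) (I : set (cga zp O)) g1 g2 :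
  lattice d O -> (forall a b : zp, a *: g1 + b *: g2 = 0 -> a = 0) -> g2 != 0 ->
  I (cga_delta zp O g1 - 1) -> I (cga_delta zp O g2 - 1) -> grade2 I.
Proof.
move=> L ind g20 I1 I2; have dL := normal_dom (lattice_normal pp L).
have La := lattice_is_lat pp L.
apply: (regular_grade2 dL I1 I2).
  apply/eqP => T0; case: dL => + _; apply/negP; rewrite negbK; apply/eqP.
  by apply: (augmentation_reg pp La g20); rewrite T0 mul0r.
by move=> y; apply: (augmentation_regular_mod pp La); apply: (indep_far pp L).
Qed.

(** In rank one a single element g - 1 is inverted by the localization; in higher rank two
    independent directions give a regular sequence. *)
Lemma small_augmentation d (G : lmodType zp) (O : set (set G)) (I : set (cga zp O)) (z : zp) :
  lattice d O -> (0 < d)%N -> z != 0 -> (forall g, I (cga_delta zp O (z *: g) - 1)) -> small d I.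
Proof.
move=> L; have [[th [ht thK htK]] oO] := L => d0 z0 Iz; have dz := normal_dom (zp_normal pp).
have thI := can_inj thK; have thZ a g : th (a *: g) = a *: th g := linearZ_LR th a g.
pose e (k : 'I_d) : G := ht (delta_mx 0 k).
have ee k k' : th (e k) 0 k' = (k' == k)%:R by rewrite /e htK mxE eqxx.
have ze k : z *: e k != 0.
  apply/eqP => /(congr1 (fun g => th g 0 k)); rewrite thZ linear0 !mxE ee eqxx mulr1.
  exact/eqP.
rewrite /small; case: eqP => [d1|d1].
  exists (cga_delta zp O (z *: e (Ordinal d0)) - 1) => //.
  rewrite -[_ - _]mulr1; apply: mult_closureM; last exact: mult_closure1.
  by exists (z *: e (Ordinal d0)).
have d2 : (1 < d)%N by rewrite ltn_neqAle d0 andbT; apply/eqP => /esym.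
apply: (indep_grade2 L (g1 := z *: e (Ordinal d0)) (g2 := z *: e (Ordinal d2))) => //.
move=> a b /(congr1 (fun g => th g 0 (Ordinal d0))).
rewrite linearD linear0 !thZ !mxE !ee eqxx mulr1 mulr0 mulr0 addr0.
by case/dz.2 => // z0'; rewrite z0' eqxx in z0.
Qed.

Lemma lattice0_pid (G : lmodType zp) (O : set (set G)) (I : set (cga zp O)) : lattice 0 O ->
  is_ideal I -> exists2 c, I c & forall x, I x -> dvr c x.
Proof.
move=> L iI; have [j [i iK jK]] := lattice0_iso pp L.
have [|c Ic cP] := @zp_pid _ pp [set z | I (j z)].
  split; rewrite /= ?rmorph0; first exact: ideal0.
    by move=> x y; rewrite /= rmorphD; apply: idealD.
  by move=> x y; rewrite /= rmorphM; apply: idealM.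
exists (j c) => // x Ix; have [|e eE] := cP (i x); first by rewrite /= jK.
by exists (j e); rewrite -rmorphM -eE jK.
Qed.

(** The image of [Q] in the rank-zero algebra, a copy of Zp, is principal. As g0 - 1 is outside [Q],
    remainders of approximations stay in [Q], and a lift of the generator generates [Q]. In rank one
    this supplies the height one primes that failure of grade 2 supplies in higher rank. *)
Lemma lattice1_prime (G : lmodType zp) (O : set (set G)) (Q : set (cga zp O)) : lattice 1 O ->
  is_prime Q -> (forall g, g != 0 -> ~ Q (cga_delta zp O g - 1)) ->
  exists2 c, Q c & forall x, Q x -> dvr c x.
Proof.
move=> L pQ QS; have iQ := prime_ideal pQ.
have [g0 [r [[g00 rs rk] rO]]] := lattice_tail pp L.
have Hc := quotient_complete pp L (row_lattice p 0) rO g00 rs rk.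
set psh := @cga_push _ _ _ _ _ r rO in Hc.
have [|_ [c Qc <-] cP] := @lattice0_pid _ _ (psh @` Q) (row_lattice p 0).
  split; first by exists 0; [apply: ideal0|exact: rmorph0].
    move=> _ _ [x Px <-] [y Py <-]; exists (x + y); [exact: idealD|exact: rmorphD].
  move=> a _ [y Py <-]; have [x <-] := ca_surj Hc a.
  by exists (x * y); [exact: idealM|exact: rmorphM].
exists c => // x Qx; have [|e eE] := @complete_span _ _ _ _ Hc 1 (fun=> c) Q _ x Qx; last first.
  by exists (e ord0); rewrite eE big_ord1.
move=> y Qy; have [|e eE] := cP (psh y); first by exists y.
have [f fE] := ca_surj Hc e.
have [|z zE] := @ca_eq _ _ _ _ Hc y (f * c).
  by rewrite (rmorphM psh) fE.
exists (fun=> f), z; rewrite big_ord1; split=> //.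
case: pQ => _ _ /(_ (cga_delta zp O g0 - 1) z); case=> [|/(QS _ g00)|] //.
have -> : (cga_delta zp O g0 - 1) * z = y - f * c by rewrite [RHS]addrC zE addKr.
by apply: idealB => //; apply: idealM.
Qed.

(** * Generic quotients *)

Section Generic.
Variables (d d' : nat) (G : lmodType zp) (O : set (set G)).
Hypotheses (L : lattice d O) (d'0 : (0 < d')%N).

Variable th : {linear G -> 'rV[zp]_d}.
Hypothesis thb : bijective th.

(** The g with g - 1 in [P] form a Zp-submodule of G: g - 1 divides a g - 1 for every p-adic [a]. *)
Lemma fixer_dichotomy (P : set (cga zp O)) (ht : 'rV[zp]_d -> G) : is_ideal P ->
  cancel th ht -> cancel ht th ->
  (exists l : 'I_d -> zp, (exists j, l j != 0) /\
    forall v, P (cga_delta zp O (ht v) - 1) -> dual l v = 0) \/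
  (exists2 c : zp, c != 0 & forall g, P (cga_delta zp O (c *: g) - 1)).
Proof.
move=> iP thK htK; have La := lattice_is_lat pp L.
pose D (v : 'rV[zp]_d) : cga zp O := cga_delta zp O (ht v) - 1.
have htE v w : ht (v + w) = ht v + ht w.
  by apply: (can_inj thK); rewrite linearD /= !htK.
have htZ a v : ht (a *: v) = a *: ht v.
  by apply: (can_inj thK); rewrite (linearZ_LR th) /= !htK.
have [|||[l [l0 lP]]|[c c0 cP]] := @sub_or_full _ (normal_dom (zp_normal pp)) d [set v | P (D v)].
- rewrite /= /D (_ : ht 0 = 0); last by apply: (can_inj thK); rewrite htK linear0.
  by rewrite delta0 subrr; apply: ideal0.
- move=> v w Pv Pw; rewrite /= /D htE deltaD.
  set x := cga_delta _ _ _; set y := cga_delta _ _ _.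
  have -> : x * y - 1 = x * (y - 1) + (x - 1) by ring.
  by apply: idealD => //; apply: idealM.
- move=> a v Pv; have [b bE] : dvr (D v) (D (a *: v)).
    apply: (delta_kernel pp La) => U Uv; apply: delta_lev; rewrite subr0 htZ.
    exact: (osub_scale pp L).
  by rewrite /= bE; apply: idealM.
- by left; exists l.
- by right; exists c => // g; have := cP (th g); rewrite /= /D htZ thK.
Qed.

(** In the noetherian induction a nonprime ideal is handled by a product of two larger ones. For a
    prime [P], either g0 - 1 is outside [P] once [g0] avoids one hyperplane, and [height1_image]
    applies, or [P] contains c g - 1 for all g. *)
Lemma generic_small (A : set (cga zp O)) : is_ideal A -> grade2 A ->
  exists s : seq ('I_d -> zp), (forall l, l \in s -> exists j, l j != 0) /\
  forall (H : lmodType zp) (O' : set (set H)) g0 (r : {linear G -> H})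
    (rO : forall U, O' U -> O (r @^-1` U)), lattice d' O' ->
    quotient_by g0 r -> (forall l, l \in s -> dual l (th g0) != 0) ->
    small d' (@cga_push zp _ _ _ _ r rO @` A).
Proof.
move=> iA gA; apply: contrapT => bad; have gL := lattice_normal pp L.
pose ok (I : set (cga zp O)) := exists s : seq ('I_d -> zp),
  (forall l, l \in s -> exists j, l j != 0) /\
  forall (H : lmodType zp) (O' : set (set H)) g0 (r : {linear G -> H})
    (rO : forall U, O' U -> O (r @^-1` U)), lattice d' O' ->
    quotient_by g0 r -> (forall l, l \in s -> dual l (th g0) != 0) ->
    small d' (@cga_push zp _ _ _ _ r rO @` I).
have [P [iP [gP nP] mP]] := @noeth_max _ (fun I => grade2 I /\ ~ ok I) A (normal_noeth gL) iA (conj gA bad).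
have max a : ~ P a -> ok (adj P a).
  move=> nPa; apply: contrapT => nok; apply: nPa; apply: (mP (adj P a)).
  - exact: adj_ideal.
  - by split=> //; apply: grade2S gP; apply: sub_adj.
  - exact: sub_adj.
  - exact: mem_adj.
apply: nP; have [P1|nP1] := pselect (P 1).
  by exists [::]; split=> // H O' g0 r rO _ _ _; apply: small1; exists 1 => //; exact: rmorph1.
have [pP|npP] := pselect (is_prime P); last first.
  have [a [b [Pab na nb]]] : exists a b, [/\ P (a * b), ~ P a & ~ P b].
    apply: contrapT => no; apply: npP; split=> // a b Pab.
    by apply: contrapT => /not_orP[na nb]; apply: no; exists a, b.
  have [s [s0 sP]] := max a na; have [t [t0 tP]] := max b nb.
  exists (s ++ t); split=> [l|H O' g0 r rO L' q lst]; first by rewrite mem_cat => /orP[/s0|/t0].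
  apply: smallM (sP H O' g0 r rO L' q _) (tP H O' g0 r rO L' q _) _ => [l ls|l lt|].
  - by apply: lst; rewrite mem_cat ls.
  - by apply: lst; rewrite mem_cat lt orbT.
  - move=> _ _ [x ax <-] [y ay <-]; exists (x * y); first exact: adj_mul Pab ax ay.
    exact: (rmorphM (@cga_push zp _ _ _ _ r rO)).
have [ht thK htK] := thb.
have [[l [l0 lP]]|[c c0 cP]] := fixer_dichotomy iP thK htK.
- exists [:: l]; split=> [l'|H O' g0 r rO L' [g00 rs rk] lg]; first by rewrite inE => /eqP->.
  have gL' := lattice_normal pp L'.
  set psh := @cga_push _ _ _ _ _ r rO.
  have Hc := quotient_complete pp L L' rO g00 rs rk.
  have nPT : ~ P (cga_delta zp O g0 - 1).
    move=> PT; have := lg l (mem_head _ _); rewrite lP ?eqxx //.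
    by rewrite thK.
  apply: contrapT; rewrite /small; case: eqP => [d1|_ /(not_grade2 (normal_dom gL') (normal_noeth gL') (normal_cic gL'))]; last first.
    move=> [Q [c [u [PQ h]]]]; apply: (height1_image Hc gL gL' pP gP nPT h).
    by move=> x Px; apply: PQ; exists x.
  move=> no.
  (* In rank one, failure gives a prime [Q] that contains the image and misses all inverted
     elements. It is principal and nonzero, so it has height one, certified with u = 1. *)
  have [||||Q [pQ PQ QS]] := @max_disjoint_prime _ (mult_closure (@augmentations H O')) (psh @` P).
  + exact: mult_closure1.
  + exact: mult_closure_mul.
  + split; first by exists 0; [apply: ideal0|exact: rmorph0].
      move=> _ _ [x Px <-] [y Py <-]; exists (x + y); [exact: idealD|exact: rmorphD].
    move=> a _ [y Py <-]; have [x <-] := ca_surj Hc a.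
    by exists (x * y); [exact: idealM|exact: rmorphM].
  + by move=> x Px mx; apply: no; exists x.
  have L1 : lattice 1 O' by rewrite -d1.
  have [g g0'|c Qc cQ] := lattice1_prime L1 pQ.
    move=> /QS; apply; rewrite -[_ - _]mulr1; apply: mult_closureM; last exact: mult_closure1.
    by exists g.
  have [x Px px] := prime_image_neq0 Hc gL' pP gP nPT.
  apply: (height1_image (Q := Q) (c := c) (u := 1) Hc gL gL' pP gP nPT); last by move=> y Py; apply: PQ; exists y.
  split=> //; [by case: pQ| |by move=> a /cQ; rewrite mul1r].
  apply/eqP => c0; have [e] := cQ (psh x) (PQ _ (ex_intro2 _ _ x Px erefl)).
  by rewrite c0 mulr0; exact/eqP.
(* No condition on [g0] is needed: the image contains c h - 1 for every h in H. *)
- exists [::]; split=> // H O' g0 r rO L' [_ rs _] _.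
  apply: (small_augmentation L' d'0 c0) => h; have [g <-] := rs h.
  exists (cga_delta zp O (c *: g) - 1); first exact: cP.
  rewrite (rmorphB (@cga_push zp _ _ _ _ r rO)) (rmorph1 (@cga_push zp _ _ _ _ r rO)).
  have -> : c *: r g = r (c *: g) by rewrite (linearZ_LR r).
  by congr (_ - _); exact: (push_delta rO).
Qed.

(** If f maps to 0, then g0 - 1 divides it, and the height one prime (g0 - 1) is one of the finitely
    many primes whose product lies in (f). Off finitely many hyperplanes such a prime contains c g -
    1 for all g; then c kills H, which is impossible in positive rank. *)
Lemma generic_neq0 (f : cga zp O) : f != 0 ->
  exists s : seq ('I_d -> zp), (forall l, l \in s -> exists j, l j != 0) /\
  forall (H : lmodType zp) (O' : set (set H)) g0 (r : {linear G -> H})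
    (rO : forall U, O' U -> O (r @^-1` U)), lattice d' O' ->
    quotient_by g0 r -> (forall l, l \in s -> dual l (th g0) != 0) ->
    @cga_push zp _ _ _ _ r rO f != 0.
Proof.
move=> f0; have gL := lattice_normal pp L.
have [ht thK htK] := thb; have La := lattice_is_lat pp L.
have [s0 [s0P s0f]] := prime_product (normal_noeth gL) (princ_ideal f).
have [s [sl sP]] : exists s : seq ('I_d -> zp), (forall l, l \in s -> exists j, l j != 0) /\
    forall g, (forall l, l \in s -> dual l (th g) != 0) -> forall P, List.In P s0 ->
      P (cga_delta zp O g - 1) ->
      exists2 c : zp, c != 0 & forall g, P (cga_delta zp O (c *: g) - 1).
  elim: s0 s0f {s0P} => [|P s0 IH] s0f; first by exists [::].
  have [P' sP'|s [sl sP]] := IH; first by apply: s0f; right.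
  have [pP _] := s0f P (or_introl erefl).
  have [[l [l0 lP]]|full] := fixer_dichotomy (prime_ideal pP) thK htK; last first.
    by exists s; split=> // g gs P' [<-|sP'] // ; apply: sP.
  exists (l :: s); split=> [l'|g gs P']; first by rewrite inE => /orP[/eqP->|/sl].
  move=> [<- Pg|sP']; last by apply: sP => // l' ls; apply: gs; rewrite inE ls orbT.
  by have := gs l (mem_head _ _); rewrite lP ?eqxx // thK.
exists s; split=> // H O' g0 r rO L' [g00 rs rk] gs; apply/eqP => f0'.
have gL' := lattice_normal pp L'.
have Hc := quotient_complete pp L L' rO g00 rs rk; set T := cga_delta zp O g0 - 1 in Hc.
have nT1 : ~ dvr T 1.
  by move/(ca_ker Hc); rewrite rmorph1; apply/eqP; case: (normal_dom gL').
have pT : is_prime (dvr T).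
  by split=> //; [exact: princ_ideal|move=> a b; apply: (T_prime Hc); case: gL'].
have T0 : T != 0.
  by apply/eqP => T0; case: (normal_dom gL) => + _; apply/negP; rewrite negbK; apply/eqP/(ca_reg Hc); rewrite T0 mul0r.
have [|P [Ps PT]] := prodin_prime s0P pT.
  by move=> x fx; apply: dvr_trans fx; apply/(ca_ker Hc).
have [pP fP] := s0f P Ps; have Pf : P f by apply: fP.
have h1 : height1_at (dvr T) T 1.
  by split=> // a; rewrite mul1r.
have TP := height1_min (normal_cic gL) h1 pP Pf f0 PT.
have [c c0 cP] := sP g0 gs P Ps (TP T (dvr_refl _)).
have [[th' [ht' thK' htK']] _] := L'.
have [g gE] := rs (ht' (delta_mx 0 (Ordinal d'0))).
have /PT/(ca_ker Hc) := cP g; rewrite rmorphB rmorph1 /=.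
have -> : cga_push rO (cga_delta zp O (c *: g)) = cga_delta zp O' (c *: r g).
  by rewrite -(linearZ_LR r); exact: (push_delta rO).
move=> /eqP; rewrite subr_eq0 => /eqP E.
have cg0 : c *: r g = 0.
  apply: (lat_sep (lattice_is_lat pp L')) => n; rewrite -(subr0 (c *: r g)).
  apply/(pnE (lattice_is_lat pp L'))/opiP; have := congr1 (fun a : cga zp O' => a (pn (lattice_is_lat pp L') n) (opi _ 0)) E.
  rewrite /= eqxx; case: eqP => [->//|_] /= /esym/eqP.
  by case: (normal_dom (zp_normal pp)) => /negPf ->.
have := congr1 (fun h => th' h 0 (Ordinal d'0)) cg0.
by rewrite (linearZ_LR th') linear0 gE htK' !mxE !eqxx mulr1; exact/eqP.
Qed.
End Generic.
End Small.

Lemma mk_linear (R : pzRingType) (M N : lmodType R) (f : M -> N) :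
  (forall a x y, f (a *: x + y) = a *: f x + f y) -> exists g : {linear M -> N}, g =1 f.
Proof.
move=> lf; pose g : {linear M -> N} := HB.pack f (GRing.isLinear.Build _ _ _ _ f lf).
by exists g.
Qed.

(** * Pseudo-null modules and base change *)

Section Modules.
Variable R : comPzRingType.
Implicit Types M N : lmodType R.

Definition spans n M (g : 'I_n -> M) (N : set M) :=
  forall x, N x -> exists c : 'I_n -> R, x = \sum_j c j *: g j.

Lemma spans_fin (J : finType) M (g : J -> M) (N : set M) : (forall j, N (g j)) ->
  (forall x, N x -> exists c : J -> R, x = \sum_j c j *: g j) ->
  exists n (u : 'I_n -> M), (forall j, N (u j)) /\ spans u N.
Proof.
move=> Ng gN; exists #|J|, (fun j => g (enum_val j)); split=> // x /gN[c ->].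
exists (fun j => c (enum_val j)).
rewrite [RHS](reindex (@enum_rank J)) /=; last exact/onW_bij/enum_rank_bij.
by apply: eq_bigr => j _; rewrite enum_rankK.
Qed.

Lemma noeth_module M n (g : 'I_n -> M) (N : set M) : noeth R -> N 0 ->
  (forall x y, N x -> N y -> N (x + y)) -> (forall a x, N x -> N (a *: x)) ->
  spans g N -> exists m (u : 'I_m -> M), (forall j, N (u j)) /\ spans u N.
Proof.
move=> nR; elim: n g N => [|n IH] g N N0 ND NZ gN.
  exists 0%N, (fun=> 0); split; first by case.
  by move=> x /gN[c ->]; exists (fun=> 0); rewrite !big_ord0.
pose rest x := exists c : 'I_n -> R, x = \sum_j c j *: g (lift ord0 j).
pose I : set R := [set a | exists x, N x /\ rest (x - a *: g ord0)].
have restD x y : rest x -> rest y -> rest (x + y).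
  move=> [c ->] [e ->]; exists (fun j => c j + e j); rewrite -big_split.
  by apply: eq_bigr => j _; rewrite scalerDl.
have restZ a x : rest x -> rest (a *: x).
  move=> [c ->]; exists (fun j => a * c j); rewrite scaler_sumr.
  by apply: eq_bigr => j _; rewrite scalerA.
have rest0 : rest 0.
  by exists (fun=> 0); rewrite big1 // => j _; rewrite scale0r.
have iI : is_ideal I.
  split; first by exists 0; rewrite scale0r subr0.
    move=> a b [x [Nx rx]] [y [Ny ry]]; exists (x + y); split; first exact: ND.
    by rewrite scalerDl opprD addrACA; apply: restD.
  move=> a b [y [Ny ry]]; exists (a *: y); split; first exact: NZ.
  by rewrite -scalerA -scalerBr; apply: restZ.
have [k [a [Ia aI]]] := nR I iI; have /choice[v vP] := Ia.
have [||||m [u [Nu uN]]] := IH (fun j => g (lift ord0 j)) [set x | N x /\ rest x].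
- by [].
- by move=> x y [Nx rx] [Ny ry]; split; [apply: ND|apply: restD].
- by move=> b x [Nx rx]; split; [apply: NZ|apply: restZ].
- by move=> x [_ [c ->]]; exists c.
apply: (@spans_fin ('I_k + 'I_m)%type M (fun j => match j with inl j => v j | inr j => u j end)).
  by case=> j; [case: (vP j)|case: (Nu j)].
move=> x Nx; have [c xE] := gN x Nx.
have [|e eE] := aI (c ord0).
  exists x; split=> //; exists (fun j => c (lift ord0 j)).
  by rewrite xE big_ord_recl addrC addKr.
have NsumZ : forall w : 'I_k -> M, (forall j, N (w j)) -> N (\sum_j w j).
  by move=> w Nw; apply: big_ind.
have restsum : forall w : 'I_k -> M, (forall j, rest (w j)) -> rest (\sum_j w j).
  by move=> w rw; apply: (big_ind rest).
have [|f fE] := uN (x - \sum_j e j *: v j).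
  split.
    rewrite -scaleN1r; apply/ND/NZ/NsumZ => // j; apply/NZ.
    by case: (vP j).
  have -> : x - \sum_j e j *: v j = (x - c ord0 *: g ord0) + \sum_j (- e j) *: (v j - a j *: g ord0).
    rewrite eE scaler_suml -addrA; congr (_ + _); rewrite -!sumrN -big_split /=.
    by apply: eq_bigr => j _; rewrite scalerBr scalerA mulNr !scaleNr opprK addrCA addNr addr0.
  apply: restD; first by exists (fun j => c (lift ord0 j)); rewrite xE big_ord_recl addrC addKr.
  by apply: restsum => j; apply: restZ; case: (vP j).
exists (fun j => match j with inl j => e j | inr j => f j end).
by rewrite big_sumType /= -fE addrC subrK.
Qed.

Section KernelsCokernels.
Variables (M M' : lmodType R) (h : {linear M -> M'}).

Definition kills_ker : set R := [set b | forall m, h m = 0 -> b *: m = 0].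
Definition kills_coker : set R := [set b | forall y, exists m, b *: y = h m].

Lemma kills_ker_ideal : is_ideal kills_ker.
Proof.
split=> [m _|a b ha hb m m0|a b hb m m0]; first by rewrite scale0r.
- by rewrite scalerDl ha // hb // addr0.
- by rewrite -scalerA hb // scaler0.
Qed.

Lemma kills_coker_ideal : is_ideal kills_coker.
Proof.
split=> [y|a b ha hb y|a b hb y]; first by exists 0; rewrite linear0 scale0r.
- by have [m mE] := ha y; have [m' m'E] := hb y; exists (m + m'); rewrite scalerDl mE m'E linearD.
- by have [m mE] := hb y; exists (a *: m); rewrite -scalerA mE linearZ.
Qed.

Lemma ker_val (u : ker h) : h (val u) = 0.
Proof. by case: u => x /=; rewrite /sub_pred unfold_in => /eqP. Qed.

Lemma ker_annihilator : annihilator (ker h) = kills_ker.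
Proof.
apply/seteqP; split=> a; last first.
  by move=> ka u; apply: val_inj; rewrite linearZ /= ka ?linear0 //; apply: ker_val.
move=> ka m m0; have mk : m \in sub_pred (ker_pred h) by rewrite /sub_pred unfold_in m0.
have := congr1 val (ka (exist _ m mk)); by rewrite linearZ.
Qed.

Lemma coker_eq0 (x : M') : (quot_pi (im_pred h) x = 0) <-> exists m, x = h m.
Proof.
have -> : (0 : quot_mod (im_pred h)) = quot_pi (im_pred h) 0.
  by apply: (addIr (quot_pi (im_pred h) 0)); rewrite add0r -quot_piD addr0.
rewrite quot_piP subr0 /sub_pred unfold_in; split=> [/asboolP[m _ <-]|[m ->]]; first by exists m.
by apply/asboolP; exists m.
Qed.

Lemma coker_annihilator : annihilator (coker h) = kills_coker.
Proof.
apply/seteqP; split=> a ka.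
  move=> y; apply/coker_eq0; rewrite -quot_scaleE; exact: ka.
by elim/quot_mod_elim => y; have /coker_eq0 := ka y; rewrite -quot_scaleE.
Qed.

Lemma coker_fin_gen : fin_gen M' -> fin_gen (coker h).
Proof.
move=> [n [g gM]]; exists n, (fun j => quot_pi (im_pred h) (g j)); elim/quot_mod_elim => x.
have [c ->] := gM x; exists c.
have : forall s : seq 'I_n, quot_pi (im_pred h) (\sum_(j <- s) c j *: g j) =
    \sum_(j <- s) c j *: (quot_pi (im_pred h) (g j) : coker h).
  elim=> [|j s IH]; first by rewrite !big_nil; apply/coker_eq0; exists 0; rewrite linear0.
  by rewrite !big_cons quot_piD IH -quot_scaleE.
exact.
Qed.

Lemma ker_fin_gen : noeth R -> fin_gen M -> fin_gen (ker h).
Proof.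
move=> nR [n [g gM]].
have [||||m [u [Nu uN]]] := @noeth_module M n g [set x | h x = 0] nR.
- exact: linear0.
- by move=> x y /= hx hy; rewrite linearD hx hy addr0.
- by move=> a x /= hx; rewrite linearZ /= hx scaler0.
- by move=> x _; apply: gM.
have uk j : u j \in sub_pred (ker_pred h) by rewrite /sub_pred unfold_in (Nu j).
exists m, (fun j => exist _ (u j) (uk j)) => x.
have [c cE] := uN (val x) (ker_val x); exists c; apply: val_inj.
by rewrite cE linear_sum; apply: eq_bigr => j _; rewrite linearZ.
Qed.

(* Multiplication by c factors through h on both sides. *)
Lemma quasi_inverse c : kills_ker c -> kills_coker c ->
  exists g : {linear M' -> M}, (forall m, g (h m) = c ^+ 2 *: m) /\
    (forall y, h (g y) = c ^+ 2 *: y).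
Proof.
move=> ck cc; have /choice[x xE] := cc.
have wd m m' : h m = h m' -> c *: m = c *: m'.
  move=> e; apply/eqP; rewrite -subr_eq0 -scalerBr; apply/eqP/ck.
  by rewrite linearB /= e subrr.
have [|g gE] := @mk_linear R M' M (fun y => c *: x y).
  move=> a y z; rewrite scalerA mulrC -scalerA -scalerDr; apply: wd.
  by rewrite linearP /= -!xE scalerDr !scalerA mulrC.
exists g; split=> [m|y]; rewrite gE.
  by rewrite expr2 -scalerA; apply: wd; rewrite -xE linearZ.
by rewrite linearZ /= -xE scalerA.
Qed.
End KernelsCokernels.

Lemma zero_pseudo_null M : (forall x : M, x = 0) -> pseudo_null M.
Proof.
move=> M0; split; first by exists 0%N, (fun=> 0) => x; exists (fun=> 0); rewrite big_ord0.
by move=> P [_ P1 _] AP; case: P1; apply: AP => x; rewrite (M0 x) scaler0.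
Qed.

Hypothesis gR : normal_ring R.
Variable t0 : R.
Hypotheses (t00 : t0 != 0) (nt0 : ~ dvr t0 1).

Lemma pseudo_null_coker M M' (h : {linear M -> M'}) :
  fin_gen M' -> grade2 (kills_coker h) -> pseudo_null (coker h).
Proof.
move=> fM g2; split; first exact: coker_fin_gen.
by rewrite coker_annihilator; case: gR => d n c; apply: (grade_height d n t00 nt0).
Qed.

Lemma pseudo_null_ker M M' (h : {linear M -> M'}) :
  fin_gen M -> grade2 (kills_ker h) -> pseudo_null (ker h).
Proof.
case: gR => d n c fM g2; split; first exact: ker_fin_gen.
by rewrite ker_annihilator; apply: (grade_height d n t00 nt0).
Qed.

(** Choose [c] in [B] regular modulo [F] and let [g] be the quasi-inverse for c^2. Kernel and
    cokernel of [g] are killed by c^2, and by b F for all b in [B]; since c^2 and F form a regular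
    sequence, the ideal generated has grade 2. *)
Lemma pseudo_inverse M M' (h : {linear M -> M'}) (B : set R) (F : R) :
  is_ideal B -> grade2 B -> F != 0 -> B `<=` kills_ker h -> B `<=` kills_coker h ->
  (forall b m, B b -> (b * F) *: (m : M) = 0) ->
  (forall b y, B b -> (b * F) *: (y : M') = 0) ->
  exists g : {linear M' -> M}, grade2 (kills_ker g `&` kills_coker g).
Proof.
move=> iB gB F0 Bk Bc BFM BFM'; have [dR nR cR] := gR.
have [c Bcc reg] := grade2_regular dR nR cR F0 iB gB.
have [g [gh hg]] := quasi_inverse (Bk _ Bcc) (Bc _ Bcc).
exists g => x y x0 xy; apply: gB => // b Bb.
have dc : dvr x (c ^+ 2 * y).
  apply: xy; split=> [m m0|m]; first by rewrite -hg m0 linear0.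
  by exists (h m); rewrite gh.
have dF : dvr x (b * F * y).
  apply: xy; split=> [m _|m]; first exact: BFM'.
  by exists 0; rewrite linear0 BFM.
have g2 : grade2 [set c ^+ 2; F].
  apply: (regular_grade2 dR (c := c ^+ 2) (F := F)) => //; [by left|by right|move=> z].
  by rewrite expr2 -mulrA => /reg/reg.
apply: g2 => // _ [->|->]; first by rewrite mulrCA; apply: dvr_mull.
by rewrite mulrCA mulrA.
Qed.
End Modules.

(** * Finite sums of cyclic modules *)

Section SumCyclic.
Variable R : comPzRingType.

Definition cyc t (f : 'I_t -> R) (r : 'I_t -> R) : sum_cyclic f :=
  fun l => quot_pi (principal (f l)) (r l : R^o).

Lemma cyc_surj t (f : 'I_t -> R) (y : sum_cyclic f) : exists r, y = cyc f r.
Proof.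
have /choice[r rE] : forall l, exists r : R^o, y l = quot_pi (principal (f l)) r.
  by move=> l; elim/quot_mod_elim: (y l) => r; exists r.
by exists r; apply: functional_extensionality_dep.
Qed.

Lemma cycP t (f : 'I_t -> R) r s : cyc f r = cyc f s <-> forall l, dvr (f l) (r l - s l).
Proof.
split=> [e l|h].
  have /quot_piP := congr1 (fun y : sum_cyclic f => y l) e.
  by rewrite /sub_pred unfold_in => /asboolP.
apply: functional_extensionality_dep => l; apply/quot_piP.
by rewrite /sub_pred unfold_in; apply/asboolP; apply: h.
Qed.

Lemma cycD t (f : 'I_t -> R) r s : cyc f r + cyc f s = cyc f (fun l => r l + s l).
Proof. by apply: functional_extensionality_dep => l; apply/esym/quot_piD. Qed.

Lemma cycZ t (f : 'I_t -> R) a r : a *: cyc f r = cyc f (fun l => a * r l).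
Proof. by apply: functional_extensionality_dep => l; apply: quot_scaleE. Qed.

Lemma cyc0 t (f : 'I_t -> R) : 0 = cyc f (fun=> 0).
Proof. by rewrite -(scale0r (cyc f (fun=> 0))) cycZ; congr cyc; apply/funext => l; rewrite mul0r. Qed.

Definition cyc_gen t (f : 'I_t -> R) l : sum_cyclic f := cyc f (fun l' => (l' == l)%:R).

Lemma cyc_sum t (f : 'I_t -> R) r : cyc f r = \sum_l r l *: cyc_gen f l.
Proof.
have E : forall s : seq 'I_t, \sum_(l <- s) r l *: cyc_gen f l =
    cyc f (fun l' => \sum_(l <- s) r l * (l' == l)%:R).
  elim=> [|l s IH]; first by rewrite big_nil cyc0; congr cyc; apply/funext => l; rewrite big_nil.
  by rewrite big_cons IH cycZ cycD; congr cyc; apply/funext => l'; rewrite big_cons.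
rewrite E; congr cyc; apply/funext => l.
by rewrite (bigD1 l) //= eqxx mulr1 big1 ?addr0 // => l' /negPf; rewrite eq_sym => ->; rewrite mulr0.
Qed.

Lemma cyc_fin_gen t (f : 'I_t -> R) : fin_gen (sum_cyclic f).
Proof.
by exists t, (cyc_gen f) => y; have [r ->] := cyc_surj y; exists r; apply: cyc_sum.
Qed.

Lemma cyc_annihilated t (f : 'I_t -> R) (y : sum_cyclic f) : (\prod_l f l) *: y = 0.
Proof.
have [r ->] := cyc_surj y; rewrite cycZ cyc0; apply/cycP => l.
rewrite subr0 (bigD1 l) //= mulrC; exists (r l * \prod_(i | i != l) f i); ring.
Qed.

Lemma cyc_lift t (f : 'I_t -> R) (M : lmodType R) (x : 'I_t -> M) :
  (forall l, f l *: x l = 0) ->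
  exists g : {linear sum_cyclic f -> M}, forall r, g (cyc f r) = \sum_l r l *: x l.
Proof.
move=> fx; have /choice[rep repE] := @cyc_surj t f.
have wd r s : cyc f r = cyc f s -> \sum_l r l *: x l = \sum_l s l *: x l.
  move=> /cycP h; apply: eq_bigr => l _; have [d dE] := h l.
  by rewrite -[r l](subrK (s l)) scalerDl dE -scalerA fx scaler0 add0r.
have [|g gE] := @mk_linear R (sum_cyclic f) M (fun y => \sum_l rep y l *: x l).
  move=> a y z; rewrite scaler_sumr -big_split /=.
  rewrite (wd _ (fun l => a * rep y l + rep z l)); first by apply: eq_bigr => l _; rewrite scalerDl scalerA.
  by rewrite -repE {1}(repE y) {1}(repE z) cycZ cycD.
by exists g => r; rewrite gE; apply: wd; rewrite -repE.
Qed.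
End SumCyclic.

(** * Tensor products and localized modules *)

Section Tensor.
Variables (R A : comPzRingType) (j : {rmorphism R -> A}) (X : lmodType R).

Definition pure a (x : X) : tens j X := \pi_(tens j X) [:: (a, x)].

Lemma pureP (u : tens j X) : exists s : seq (A * X), u = \sum_(z <- s) pure z.1 z.2.
Proof.
elim/tens_elim: u => s; exists s; elim: s => [|[a x] s IH]; first by rewrite big_nil.
by rewrite big_cons -IH /= -[RHS]/(tens_add _ _) tens_addE.
Qed.

Lemma pureDr a x y : pure a (x + y) = pure a x + pure a y.
Proof.
rewrite -[RHS]/(tens_add _ _) tens_addE; apply/tensP => Y c [_ c2 _].
by rewrite big_cat /= !big_seq1 c2.
Qed.
Lemma pureJ a r x : pure (a * j r) x = pure a (r *: x).
Proof. by apply/tensP => Y c [_ _ c3]; rewrite !big_seq1 c3. Qed.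
Lemma pureZ a b x : a *: pure b x = pure (a * b) x.
Proof. exact: tens_scaleE. Qed.
Lemma pure0 a : pure a 0 = 0.
Proof. by apply: (addIr (pure a 0)); rewrite -pureDr !add0r. Qed.

Lemma tens_map (Y : lmodType A) (b : X -> Y) : (forall x y, b (x + y) = b x + b y) ->
  (forall r x, b (r *: x) = j r *: b x) ->
  exists g : {linear tens j X -> Y}, forall a x, g (pure a x) = a *: b x.
Proof.
move=> bD bZ; pose c (z : A * X) := z.1 *: b z.2.
have cb : balanced j c.
  split=> [a a' x|a x x'|a r x]; rewrite /c /= ?scalerDl ?bD ?scalerDr //.
  by rewrite bZ scalerA.
have gE s : \sum_(z <- repr (\pi_(tens j X) s)) c z = \sum_(z <- s) c z by apply: tens_repr.
have [|g gG] := @mk_linear A (tens j X) Y (fun u => \sum_(z <- repr u) c z).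
  move=> a; elim/tens_elim => s; elim/tens_elim => s'.
  rewrite -[_ + _]/(tens_add (tens_scale a _) _) tens_scaleE tens_addE !gE big_cat big_map scaler_sumr.
  by congr (_ + _); apply: eq_bigr => z _; rewrite /c /= scalerA.
by exists g => a x; rewrite gG gE big_seq1.
Qed.
End Tensor.

Section TensorId.
Variables (R : comPzRingType) (X : lmodType R).
Local Notation j := (idfun : {rmorphism R -> R}).

Lemma pure1_surj (u : tens j X) : exists x, u = pure j 1 x.
Proof.
have [s ->] := pureP u; elim: s => [|[a x] s [y yE]].
  by exists 0; rewrite big_nil pure0.
exists (a *: x + y); rewrite big_cons yE pureDr /=; congr (_ + _).
by rewrite -pureJ mul1r.
Qed.

Lemma pure1_linear : exists g : {linear X -> tens j X}, g =1 pure j 1.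
Proof.
by apply: mk_linear => a x y; rewrite pureDr -pureJ pureZ mulrC.
Qed.

Lemma tens_id_linear : exists g : {linear tens j X -> X}, forall x, g (pure j 1 x) = x.
Proof.
have [//|//|g gE] := @tens_map _ _ j X X id.
by exists g => x; rewrite gE scale1r.
Qed.
End TensorId.

Section Fractions.
Variables (R : comPzRingType) (S : set R) (X : lmodType R).
Local Notation j := (@to_loc R S).
Local Notation msc := (@mult_closure R S).

Lemma loc_inv s : msc s -> exists v : loc S, v * j s = 1.
Proof.
move=> ms; exists (\pi_(loc S) (1, Denom ms)); rewrite -[LHS]/(loc_mul _ _) loc_mulE.
by apply/locP; exists (den1 S) => /=; ring.
Qed.

Lemma loc_frac (a : loc S) : exists r s, msc s /\ a * j s = j r.
Proof.
elim/loc_elim: a => -[r [s ms]]; exists r, s; split=> //.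
rewrite -[LHS]/(loc_mul _ _) loc_mulE.
by apply/locP; exists (den1 S) => /=; ring.
Qed.

Lemma tens_frac (u : tens j X) : exists s x, msc s /\ j s *: u = pure j 1 x.
Proof.
have [l ->] := pureP u; elim: l => [|[a x] l [s [y [ms yE]]]].
  by exists 1, 0; split; [apply: mult_closure1|rewrite big_nil scaler0 pure0].
have [r [t [mt tE]]] := loc_frac a.
exists (s * t), (s *: (r *: x) + t *: y); split; first exact: mult_closure_mul.
rewrite big_cons scalerDr pureDr; congr (_ + _).
  rewrite pureZ rmorphM -mulrA [j t * _]mulrC tE -[RHS]pureJ -pureJ; congr pure; ring.
by rewrite rmorphM mulrC -scalerA yE pureZ mulr1 -[in RHS]pureJ mul1r.
Qed.
End Fractions.

(** * Haar measure *)

Section Truncn.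
Variables (R : realType) (q : nat).
Hypothesis q_gt0 : (0 < q)%N.

Lemma truncn_div (x : R) (m : nat) : 0 <= x ->
  (Num.truncn (x * (m * q)%:R) %/ q)%N = Num.truncn (x * m%:R).
Proof.
move=> x0; apply/esym/truncn_def.
have /andP[h1 h2] := truncn_itv (mulr_ge0 x0 (ler0n R (m * q))).
set k := Num.truncn (x * (m * q)%:R) in h1 h2 *.
have q0 : 0 < q%:R :> R by rewrite ltr0n.
rewrite -(ler_pM2r q0) -[X in _ && X](ltr_pM2r q0) -!mulrA -!natrM; apply/andP; split.
  by apply: le_trans h1; rewrite ler_nat leq_trunc_div.
by apply: lt_le_trans h2 _; rewrite ler_nat -ltn_divLR.
Qed.

End Truncn.

(** * The uniform measure on the branches of a regular tree *)

Section TreeMeasure.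
Variables (T : pointedType) (R : realType) (G : set (set T)).
Variables (c : nat -> T -> nat) (N0 q : nat).
Let cyl n j : set T := [set g | c n g = j].
Let N n := (N0 * q ^ n)%N.
Hypotheses (N0_gt0 : (0 < N0)%N) (q_gt0 : (0 < q)%N).
Hypothesis c_lt : forall n g, (c n g < N n)%N.
Hypothesis c_div : forall n g, (c n.+1 g %/ q)%N = c n g.
Hypothesis c_complete : forall j : nat -> nat, (j 0%N < N0)%N ->
  (forall n, (j n.+1 %/ q)%N = j n) -> exists g, forall n, c n g = j n.
Hypothesis G_cyl : forall n j, G (cyl n j).
Hypothesis G_open : forall V, G V -> forall g, V g -> exists n, forall h, c n h = c n g -> V h.
Let TG := g_sigma_algebraType G.

Let N_gt0 n : (0 < N n)%N. Proof. by rewrite muln_gt0 N0_gt0 expn_gt0 q_gt0. Qed.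

Lemma tree_open V : G V ->
  V = \bigcup_n \bigcup_(j in [set j | cyl n j `<=` V]) cyl n j.
Proof.
move=> GV; apply/seteqP; split=> [g Vg|g [n _ [j jV]]]; last exact: jV.
have [n nV] := G_open GV Vg.
by exists n => //; exists (c n g) => // h; apply: nV.
Qed.

Lemma tree_iter n m g : c n g = (c (n + m) g %/ q ^ m)%N.
Proof.
elim: m => [|m IH]; first by rewrite addn0 expn0 divn1.
by rewrite IH addnS expnS divnMA c_div.
Qed.

(** The cylinders together with the empty set are stable under intersection and generate the
    sigma-algebra. *)
Lemma tree_measure_unique (mu nu : {measure set TG -> \bar R}) :
  (forall n j, mu (cyl n j) = nu (cyl n j)) -> (forall j, (mu (cyl 0 j) < +oo)%E) ->
  forall A, measurable A -> mu A = nu A.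
Proof.
move=> E fin; pose P := [set A | A = set0 \/ exists n j, A = cyl n j].
apply: (@measure_unique _ R TG P (cyl 0)) => //.
- have sub (A B : set (set T)) : A `<=` <<s B >> -> <<s A >> `<=` <<s B >>.
    by move=> AB; apply: smallest_sub => //; apply: smallest_sigma_algebra.
  apply/seteqP; split; apply: sub => A.
    move=> /tree_open ->; apply: sigma_algebra_bigcup => n.
    have -> (B : set nat) (F : nat -> set T) : \bigcup_(j in B) F j =
        \bigcup_j (if j \in B then F j else set0).
      apply/seteqP; split=> [x [j Bj Fj]|x [j _]]; first by exists j => //; rewrite mem_set.
      by case: ifP => // /set_mem Bj Fj; exists j.
    apply: sigma_algebra_bigcup => j; apply: sub_sigma_algebra.
    by case: ifP => _; [right; exists n, j|left].
  by move=> [->|[n [j ->]]]; [apply: sigma_algebra0|have h := @sub_sigma_algebra T setT G _ (G_cyl n j); exact: h].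
- move=> _ B [->|[n [j ->]]]; first by rewrite set0I; left.
  move=> [->|[m [k ->]]]; first by rewrite setI0; left.
  (* Two cylinders are nested or disjoint: the ancestor at level n of node k at level m is k divided
     by q^(m - n). *)
  wlog le_nm : n m j k / (n <= m)%N => [W|].
    by have /orP[h|h] := leq_total n m; [apply: W|rewrite setIC; apply: W].
  case: (eqVneq j (k %/ q ^ (m - n))%N) => [->|jk].
    right; exists m, k; apply/seteqP; split=> [g []//|g gk]; split=> //.
    by rewrite /cyl /= (tree_iter n (m - n)) subnKC // gk.
  left; apply/seteqP; split=> // g [gj gk]; case/eqP: jk.
  by rewrite -gj -gk [LHS](tree_iter n (m - n)) subnKC.
- by move=> j; right; exists 0%N, j.
- by apply/seteqP; split=> // g _; exists (c 0%N g).
- by move=> _ [->|[n [j ->]]]; rewrite ?measure0.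
Qed.

Let I01 : set R := `[0, 1[%classic.

Lemma cell_ex (x : R) : I01 x ->
  exists g, forall n, c n g = Num.truncn (x * (N n)%:R).
Proof.
rewrite /I01 /= in_itv /= => /andP[x0 x1].
apply: c_complete => [|n].
  rewrite /N expn0 muln1 -(ltr_nat R); apply: (le_lt_trans (y := x * N0%:R)).
    by rewrite truncn_le mulr_ge0.
  by rewrite -[ltRHS]mul1r ltr_pM2r // ltr0n.
by rewrite /N expnSr mulnA truncn_div.
Qed.

(* [cell] pushes Lebesgue measure on [0, 1[ to the measure for which all the classes
   of level [n] have mass [1 / N n]. *)
Definition cell (x : R) : TG :=
  if pselect (I01 x) is left h then projT1 (cid (cell_ex h)) else point.

Lemma cellE x n : I01 x -> c n (cell x) = Num.truncn (x * (N n)%:R).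
Proof.
by move=> h; rewrite /cell; case: pselect => // h'; case: cid.
Qed.

Lemma cell_cyl n j : (j < N n)%N ->
  I01 `&` cell @^-1` (cyl n j) = `[j%:R / (N n)%:R, j.+1%:R / (N n)%:R[%classic.
Proof.
move=> jN; have n0 : 0 < (N n)%:R :> R by rewrite ltr0n.
apply/seteqP; split=> [x [Ix]|x] /=.
  rewrite /cyl /= cellE // in_itv /= ler_pdivrMr // ltr_pdivlMr // => <-.
  by apply: truncn_itv; move: Ix; rewrite /I01 /= in_itv /= => /andP[x0 _]; rewrite mulr_ge0.
rewrite in_itv /= ler_pdivrMr // ltr_pdivlMr // => /andP[h1 h2].
have Ix : I01 x.
  rewrite /I01 /= in_itv /=; apply/andP; split.
    by rewrite -(pmulr_lge0 _ n0); apply: le_trans h1.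
  rewrite -(ltr_pM2r n0) mul1r; apply: lt_le_trans h2 _.
  by rewrite ler_nat.
by split=> //; rewrite /cyl /= cellE //; apply: truncn_def; rewrite h1.
Qed.

Lemma cyl_empty n j : (N n <= j)%N -> cyl n j = set0.
Proof.
move=> jN; apply/seteqP; split=> // g /= e.
by have := c_lt n g; rewrite e ltnNge jN.
Qed.

Lemma cell_measurable : measurable_fun I01 (cell : measurableTypeR R -> TG).
Proof.
apply: (@measurability _ _ (measurableTypeR R) TG I01 cell G) => // _ [V GV <-].
rewrite (tree_open GV) preimage_bigcup setI_bigcupr.
apply: bigcupT_measurable => n; rewrite preimage_bigcup setI_bigcupr.
apply: bigcup_measurable => j _; case: (ltnP j (N n)) => jN.
  by rewrite cell_cyl //; apply: measurable_itv.
by rewrite cyl_empty // preimage_set0 setI0.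
Qed.

Let mI01 : measurable (I01 : set (measurableTypeR R)).
Proof. exact: measurable_itv. Qed.
Let cell' : measurableTypeR R -> TG := cell \_ I01.
Let mcell' : measurable_fun setT cell'.
Proof. exact: (proj1 (@measurable_restrictT _ _ (measurableTypeR R) TG I01 cell mI01) cell_measurable). Qed.
Let tmu : {measure set TG -> \bar R} :=
  @measure_function_pushforward__canonical__measure_function_Measure _ _ (measurableTypeR R) TG R (mrestr (@lebesgue_measure R) mI01) cell' mcell'.

Let tmuE A : tmu A = lebesgue_measure (I01 `&` cell @^-1` A).
Proof.
rewrite /tmu /pushforward /mrestr; congr lebesgue_measure.
apply/seteqP; split=> x [] /=.
  by rewrite /cell' patchE => + Ix; rewrite mem_set.
by move=> Ix cA; split=> //; rewrite /cell' patchE mem_set.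
Qed.

Let tmuT : tmu setT = 1%E.
Proof.
by rewrite tmuE preimage_setT setIT /I01 lebesgue_measure_itv /= lte_fin ltr01 sube0.
Qed.

Lemma tree_measure_ex : exists mu : probability TG R,
  forall n j, (j < N n)%N -> mu (cyl n j) = ((N n)%:R^-1)%:E.
Proof.
pose P : probability TG R := HB.pack (tmu : set TG -> \bar R)
  (Measure.on tmu) (Measure_isProbability.Build _ _ _ tmu tmuT).
exists P => n j jN; rewrite -[LHS]/(tmu _) tmuE cell_cyl // lebesgue_measure_itv /=.
rewrite lte_fin ltr_pM2r ?invr_gt0 ?ltr0n // ltr_nat ltnSn.
by rewrite -EFinB -mulrBl -natrB // subSnn mul1r.
Qed.

End TreeMeasure.

(** * Digits of p-adic integers *)

Section Digits.
Variable p : nat.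
Hypothesis pp : prime p.
Local Notation zp := (padic p).
Implicit Types x y : zp.

Definition zp_res n x : nat := `|x n|%N.

Lemma zp_resE n x : (zp_res n x)%:Z = x n.
Proof. by have /andP[h _] := zp_range pp x n; rewrite /zp_res gez0_abs. Qed.

Lemma zp_res_lt n x : (zp_res n x < p ^ n)%N.
Proof. by have /andP[_] := zp_range pp x n; rewrite -zp_resE ltz_nat. Qed.

Lemma zp_res_mod n x : (zp_res n.+1 x %% p ^ n)%N = zp_res n x.
Proof.
by apply/eqP; rewrite -eqz_nat -modz_nat !zp_resE (zp_le x (leqnSn n)).
Qed.

Lemma zp_digit_lt n x : (zp_res n.+1 x %/ p ^ n < p)%N.
Proof. by rewrite ltn_divLR ?expn_gt0 ?prime_gt0 // -expnS zp_res_lt. Qed.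

Definition zp_digit n x : 'I_p := Ordinal (zp_digit_lt n x).

Lemma zp_resS n x : zp_res n.+1 x = (zp_digit n x * p ^ n + zp_res n x)%N.
Proof. by rewrite -(zp_res_mod n x) /= -divn_eq. Qed.

Lemma zp_digitP n x y : x n = y n <-> forall m, (m < n)%N -> zp_digit m x = zp_digit m y.
Proof.
split=> [E m mn|E].
  apply/val_inj; rewrite /= ; congr (_ %/ _)%N; rewrite /zp_res.
  by rewrite (zp_le x mn) (zp_le y mn) E.
rewrite -!zp_resE; congr Posz; elim: n E => [|n IH] E.
  by have := zp_res_lt 0 x; have := zp_res_lt 0 y; rewrite expn0 !ltnS !leqn0 => /eqP -> /eqP ->.
by rewrite !zp_resS E // IH // => m mn; apply/E/ltnW.
Qed.

Lemma zp_digit_ex (e : nat -> 'I_p) : exists x, forall n, zp_digit n x = e n.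
Proof.
pose s n := (\sum_(m < n) e m * p ^ m)%N.
have s_lt n : (s n < p ^ n)%N.
  elim: n => [|n IH]; rewrite /s; first by rewrite big_ord0.
  rewrite big_ord_recr /= -/(s n) -addSn; apply: (@leq_trans (p ^ n + e n * p ^ n)%N).
    by rewrite leq_add2r.
  by rewrite -mulSn expnS leq_mul2r ltn_ord orbT.
have s_res n : ((s n)%:R : zp) n = s n by rewrite zp_nat modz_small // ltz_nat s_lt.
have [|x xE] := @zp_limit p (fun n => (s n)%:R).
  move=> n; rewrite s_res zp_nat modz_nat /s big_ord_recr /= addnC modnMDl modn_small //; apply: s_lt.
exists x => n; apply/val_inj; rewrite /= /zp_res xE s_res /= /s big_ord_recr /= -/(s n).
by rewrite addnC divnMDl ?expn_gt0 ?prime_gt0 // divn_small ?addn0.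
Qed.
End Digits.

(** * Haar measure on Aut(M) and null hyperplanes *)

Section Automorphisms.
Variables (p d : nat).
Hypothesis pp : prime p.
Local Notation zp := (padic p).
Variables (M : lmodType zp) (th : {linear M -> 'rV[zp]_d}) (ht : 'rV[zp]_d -> M).
Hypotheses (thK : cancel th ht) (htK : cancel ht th).
Implicit Types g h : aut M.

Let thI : injective th. Proof. exact: can_inj thK. Qed.

Lemma ht_linear a v w : ht (a *: v + w) = a *: ht v + ht w.
Proof. by apply: thI; rewrite linearP !htK. Qed.

Definition mat (g : M -> M) : 'M[zp]_d := \matrix_a th (g (ht (delta_mx 0 a))).

Lemma mat_row (g : {linear M -> M}) x : th (g x) = th x *m mat g.
Proof.
have [h hE] := mk_linear ht_linear.
rewrite -{1}[x]thK {1}[th x]row_sum_delta -hE linear_sum linear_sum linear_sum mulmx_sum_row.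
by apply: eq_bigr => a _; rewrite !linearZ /= rowK hE.
Qed.

Lemma mat_comp (g h : {linear M -> M}) : mat (g \o h) = mat h *m mat g.
Proof. by apply/row_matrixP => a; rewrite row_mul rowK /= mat_row rowK. Qed.

Lemma mat_id : mat id = 1%:M.
Proof. by apply/row_matrixP => a; rewrite rowK htK row1. Qed.

Lemma aut_ext g h : g =1 h -> g = h.
Proof.
case: g h => [[f [[m] [s]]] gb] [[f' [[m'] [s']]] hb] /= E.
have ff : f = f' by apply/funext => x; apply: E.
subst f'; have <- : m = m' by apply: Prop_irrelevance.
move: hb; have <- : s = s' by apply: Prop_irrelevance.
by move=> hb; congr Aut; apply: Prop_irrelevance.
Qed.

Lemma aut_inverse g : exists h, cancel g h /\ cancel h g.
Proof.
have [h gK hK] := aut_bij g; have lh a x y : h (a *: x + y) = a *: h x + h y.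
  by apply: (can_inj gK); rewrite linearP !hK.
have [h' E] := mk_linear lh.
have hb : bijective h' by exists g => x; rewrite E.
by exists (Aut hb); split=> x /=; rewrite E.
Qed.

Lemma aut_comp g h : exists f : aut M, f =1 g \o h.
Proof.
by exists (@Aut _ _ (g \o h : {linear M -> M}) (bij_comp (aut_bij g) (aut_bij h))).
Qed.

Lemma aut_mat (A : 'M[zp]_d) : (exists B, A *m B = 1%:M /\ B *m A = 1%:M) ->
  exists g, mat g = A.
Proof.
move=> [B [AB BA]]; have lin (C : 'M[zp]_d) a x y :
    ht (th (a *: x + y) *m C) = a *: ht (th x *m C) + ht (th y *m C).
  by rewrite linearP mulmxDl -scalemxAl ht_linear.
have [g gE] := mk_linear (lin A); have gb : bijective g.
  exists (fun x => ht (th x *m B)) => x; rewrite gE htK -mulmxA ?AB ?BA mulmx1 thK //.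
exists (Aut gb); apply/row_matrixP => a; rewrite rowK /= gE !htK rowE.
by [].
Qed.

Lemma mat_unit g : exists B, mat g *m B = 1%:M /\ B *m mat g = 1%:M.
Proof.
have [h [gK hK]] := aut_inverse g; exists (mat h).
rewrite -!mat_comp -mat_id; by split; congr mat; apply/funext => x; rewrite /= ?gK ?hK.
Qed.

Lemma mat_near g h n : (forall x, ppow_dvd n (h x - g x)) <->
  forall a b, mat g a b n = mat h a b n.
Proof.
have E x : th (h x - g x) = th x *m (mat h - mat g).
  by rewrite linearB !mat_row mulmxBr.
split=> [gh a b|gh x].
  have := gh (ht (delta_mx 0 a)); move=> /(ppow_linear th)/ppow_row/(_ b).
  rewrite E htK -rowE mxE => H; apply/esym/zp_sub0/(zp_dvdP pp).
  by move: H; rewrite !mxE.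
have [t tE] := mk_linear ht_linear.
rewrite -[h x - g x]thK -tE; apply: ppow_linear; rewrite E; apply/ppow_row => b.
rewrite mxE; elim/big_ind: _ => [|y z [u ->] [v ->]|a _]; first by exists 0; rewrite mul0r.
  by exists (u + v); rewrite mulrDl.
have /zp_sub0/(zp_dvdP pp)[u uE] : mat h a b n = mat g a b n by [].
by exists (th x 0 a * u); rewrite !mxE -mulrA -uE !mxE.
Qed.

(** The determinant is a unit modulo p, hence a unit. *)
Lemma zp_mx_unit (A B : 'M[zp]_d) g : (forall a b, A a b 1%N = mat g a b 1%N) ->
  exists B, A *m B = 1%:M /\ B *m A = 1%:M.
Proof.
move=> AE; have [C [gC _]] := mat_unit g.
have dA : zp_Fp (\det A) = zp_Fp (\det (mat g)).
  have h a b : zp_Fp (A a b) = zp_Fp (mat g a b) by rewrite /zp_Fp AE.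
  by rewrite -!det_map_mx; congr (\det _); apply/matrixP => a b; rewrite [LHS]mxE [RHS]mxE; apply: h.
have [|c cA] := @zp_unit p pp (\det A).
  apply/eqP => /(zp_dvdP pp); rewrite expn1 => /(zp_Fp0 pp); rewrite dA => d0.
  have : zp_Fp (\det (mat g)) * zp_Fp (\det C) = 1 by rewrite -rmorphM -det_mulmx gC det1 rmorph1.
  by rewrite d0 mul0r => /eqP; rewrite eq_sym oner_eq0.
exists (c *: \adj A); rewrite -scalemxAr -scalemxAl mul_mx_adj mul_adj_mx.
by rewrite -mul_scalar_mx -scalar_mxM cA.
Qed.

Let D := {ffun 'I_d * 'I_d -> 'I_p}.
Definition digit_mx n g : D := [ffun ab => zp_digit pp n (mat g ab.1 ab.2)].

Lemma digit_mxP n g h : (forall x, ppow_dvd n (h x - g x)) <->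
  forall m, (m < n)%N -> digit_mx m g = digit_mx m h.
Proof.
rewrite mat_near; split=> [E m mn|E a b].
  by apply/ffunP => -[a b]; rewrite !ffunE /=; apply: (proj1 (zp_digitP pp n _ _) (E a b)).
apply/(zp_digitP pp) => m /E/ffunP/(_ (a, b)); by rewrite !ffunE.
Qed.

Let S1 : seq D := [seq x <- enum {: D} | `[< exists g, digit_mx 0 g = x >]].
Let q := #|{: D}|.

(** Numbers the classes of automorphisms modulo p^(n + 1). Invertibility restricts only the first
    digits, which range over [S1]; all later digits are free, so every node of the tree has exactly
    [q] children. *)
Fixpoint cell_num n g : nat :=
  if n is m.+1 then (q * cell_num m g + enum_rank (digit_mx m.+1 g))%N
  else index (digit_mx 0 g) S1.

Lemma mem_S1 g : digit_mx 0 g \in S1.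
Proof. by rewrite mem_filter mem_enum andbT; apply/asboolP; exists g. Qed.

Lemma cell_q : (0 < q)%N.
Proof. by apply/card_gt0P; exists (digit_mx 0 (aut_id M)). Qed.

Lemma cell_div n g : (cell_num n.+1 g %/ q)%N = cell_num n g.
Proof. by rewrite /= mulnC divnMDl ?cell_q // divn_small ?addn0 // ltn_ord. Qed.

Lemma cell_lt n g : (cell_num n g < size S1 * q ^ n)%N.
Proof.
elim: n => [|n IH]; first by rewrite expn0 muln1 index_mem mem_S1.
by rewrite expnSr mulnA -ltn_divLR ?cell_q // cell_div.
Qed.

Lemma cell_eq n g h : cell_num n g = cell_num n h <->
  (forall x, ppow_dvd n.+1 (h x - g x)).
Proof.
rewrite digit_mxP; elim: n => [|n IH].
  split=> [/= E m|E]; last by rewrite /= E.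
  rewrite ltnS leqn0 => /eqP ->.
  by rewrite -(nth_index (digit_mx 0 g) (mem_S1 g)) E nth_index // mem_S1.
split=> [E m|E].
  rewrite ltnS leq_eqVlt => /orP[/eqP ->|mn]; last first.
    by move: m mn; apply/(proj1 IH); rewrite -(cell_div n g) -(cell_div n h) E.
  have := congr1 (modn^~ q) E; rewrite /=.
  by rewrite ![(q * _)%N]mulnC !modnMDl !modn_small ?ltn_ord // => /ord_inj/enum_rank_inj.
by rewrite /= E // (proj2 IH) // => m mn; apply/E/ltnW.
Qed.

Lemma cell_complete (j : nat -> nat) : (j 0%N < size S1)%N ->
  (forall n, (j n.+1 %/ q)%N = j n) -> exists g, forall n, cell_num n g = j n.
Proof.
move=> j0 jS; pose x0 := digit_mx 0 (aut_id M).
have lt_q n : (j n.+1 %% q < q)%N by rewrite ltn_pmod ?cell_q.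
pose e n : D := if n is m.+1 then enum_val (Ordinal (lt_q m)) else nth x0 S1 (j 0%N).
have /choice[A AE] : forall ab : 'I_d * 'I_d, exists x : zp, forall n, zp_digit pp n x = e n ab.
  by move=> ab; apply: zp_digit_ex.
have /asboolP[g0 g0E] : `[< exists g, digit_mx 0 g = e 0%N >].
  by have := mem_nth x0 j0; rewrite mem_filter => /andP[].
have [g gE] : exists g, mat g = \matrix_(a, b) A (a, b).
  apply/aut_mat/(@zp_mx_unit _ 1%:M g0) => a b; rewrite mxE; apply/(zp_digitP pp) => m.
  by rewrite ltnS leqn0 => /eqP ->; rewrite AE -g0E ffunE.
have gD n : digit_mx n g = e n.
  by apply/ffunP => -[a b]; rewrite ffunE gE mxE AE.
exists g; elim=> [|n IH].
  by rewrite /= gD /= index_uniq // filter_uniq // enum_uniq.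
by rewrite /cell_num -/cell_num gD IH -jS enum_valK /= mulnC -divn_eq.
Qed.

Lemma cell_open n j : aut_open [set g | cell_num n g = j].
Proof. by move=> g gj; exists n.+1 => h /cell_eq /= <-. Qed.

Lemma open_cell (V : set (aut M)) : aut_open V -> forall g, V g -> exists n,
  forall h, cell_num n h = cell_num n g -> V h.
Proof.
move=> oV g /oV[n nV]; exists n => h /esym/cell_eq gh; apply: nV => x.
exact: ppow_le (gh x).
Qed.

Variable R : realType.
Local Notation BM := (borel_aut M).

Lemma aut_trans_measurable g : exists L : BM -> BM,
  [/\ measurable_fun setT L, forall (a : BM) (x : M), (a : aut M) x = g ((L a : aut M) x) &
      forall A, [set h : BM | exists2 a : aut M, A a & forall x, (h : aut M) x = g (a x)] = L @^-1` A].
Proof.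
have [g' [gK g'K]] := aut_inverse g.
have /choice[L LE] : forall a : aut M, exists b : aut M, b =1 g' \o a by move=> a; apply: aut_comp.
exists L; split.
- apply: (@measurability _ _ BM BM setT L (@open (aut M))) => // _ [V oV <-].
  rewrite setTI; have h := @sub_sigma_algebra (aut M) setT (@open (aut M)) (L @^-1` V); apply: h.
  move=> a Va; have [n nV] := oV _ Va; exists n => b ab; apply: nV => x.
  by rewrite !LE /= -linearB; apply: ppow_linear.
- by move=> a x; rewrite LE /= g'K.
- move=> A; apply/seteqP; split=> [h [a Aa ha]|h Ah] /=.
    by have -> : L h = a by apply: aut_ext => x; rewrite LE /= ha gK.
  by exists (L h) => // x; rewrite LE /= g'K.
Qed.

(** In the uniform measure all cells of one level have the same mass, and translation by an
    automorphism permutes them. *)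
Lemma haar_ex : exists mu : probability BM R, is_haar mu.
Proof.
have [|mu muE] := @tree_measure_ex (aut M) R (@open (aut M)) cell_num (size S1) q
  _ cell_q cell_lt cell_complete open_cell.
  by have := mem_S1 (aut_id M); rewrite -index_mem; apply: leq_ltn_trans.
exists mu => g A mA; have [L [mL LE AE]] := aut_trans_measurable g; rewrite AE.
pose nu : {measure set BM -> \bar R} :=
  @measure_function_pushforward__canonical__measure_function_Measure _ _ BM BM R mu L mL.
rewrite -[LHS]/(nu A); apply: (tree_measure_unique cell_div cell_open open_cell _ _ mA).
  move=> n j; have [jN|jN] := leqP (size S1 * q ^ n)%N j.
    have -> : [set h : BM | cell_num n h = j] = set0; last by rewrite !measure0.
    by apply/seteqP; split=> // h hj; move: (cell_lt n h); rewrite hj ltnNge jN.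
  have [b bj] : exists b : aut M, cell_num n b = j.
    apply: contrapT => no; have := muE n j jN.
    have -> : [set h : BM | cell_num n h = j] = set0.
      by apply/seteqP; split=> // h hj; apply: no; exists h.
    rewrite measure0 => /eqP; rewrite eqe eq_sym invr_eq0 pnatr_eq0.
    by rewrite -leqn0 leqNgt (leq_ltn_trans _ jN).
  have [gb gbE] := aut_comp g b.
  apply: etrans (_ : mu [set h | cell_num n h = cell_num n gb] = _); last first.
    exact: etrans (muE n _ (cell_lt n gb)) (esym (muE n j jN)).
  have [g' [gK g'K]] := aut_inverse g.
  rewrite /nu /= /pushforward; congr (mu _); rewrite -bj.
  apply/seteqP; split=> h /= /esym/cell_eq H; apply/esym/cell_eq => x.
    by rewrite LE gbE /= -linearB; apply: ppow_linear.
  have := ppow_linear g' (H x).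
  by rewrite linearB LE gbE /= !gK.
move=> j; apply: (@le_lt_trans _ _ 1%E); last exact: ltry.
rewrite /nu /= /pushforward; apply: probability_le1.
rewrite -[X in measurable X]setTI; apply: (mL _) => //.
have h := @sub_sigma_algebra (aut M) setT (@open (aut M)) _ (@cell_open 0%N j); exact: h.
Qed.

Variable mu : probability BM R.
Hypothesis haar : is_haar mu.

Lemma aut_near_dual (l : 'I_d -> zp) v g h n : (forall x, ppow_dvd n (h x - g x)) ->
  dual l (th (h v)) n = dual l (th (g v)) n.
Proof.
move=> gh; apply/zp_sub0/(zp_dvdP pp).
have /(ppow_linear th)[w wE] := gh v.
by exists (dual l w); rewrite -[X in X - _]addr0 -(subrK (th (g v)) (th (h v))) -linearB wE dualD dualZ addr0 addrK mulrC.
Qed.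

Lemma dual_open (l : 'I_d -> zp) v n (P : set int) :
  aut_open [set g : aut M | P (dual l (th (g v)) n)].
Proof. by move=> g Pg; exists n => h /(aut_near_dual l v) /= ->. Qed.

Lemma dual_neq0_open (l : 'I_d -> zp) v : aut_open [set g : aut M | dual l (th (g v)) != 0].
Proof.
move=> g g0; have [n ng] : exists n, dual l (th (g v)) n != 0.
  apply: contrapT => no; case/eqP: g0; apply: padic_eq => n; rewrite zp0.
  by apply/eqP/negPn/negP => h; apply: no; exists n.
have [m mP] := @dual_open l v n [set z | z != 0] g ng.
by exists m => h /mP /= /eqP hn; apply/eqP => h0; apply: hn; rewrite h0 zp0.
Qed.

Lemma open_measurable_aut (V : set (aut M)) : aut_open V -> measurable (V : set BM).
Proof. by move=> oV; have h := @sub_sigma_algebra (aut M) setT (@open (aut M)) V oV; exact: h. Qed.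

(** Any number of translates are disjoint and of equal mass inside a space of mass 1. *)
Lemma disjoint_translates_null (A : set BM) (u : nat -> aut M) : measurable A ->
  (forall a b c c', A a -> A b -> (forall x, u c ((a : aut M) x) = u c' ((b : aut M) x)) -> c = c') ->
  mu A = 0%E.
Proof.
move=> mA disj.
pose F c := [set h : BM | exists2 a : aut M, A a & forall x, (h : aut M) x = u c (a x)].
have mF c : measurable (F c).
  have [L [mL _ /(_ A) LA]] := aut_trans_measurable (u c).
  have -> : F c = L @^-1` A by exact: LA.
  by rewrite -[X in measurable X]setTI; apply: mL.
have tF : trivIset setT F.
  apply/trivIsetP => c c' _ _ cc'; apply/seteqP; split=> // h [[a Aa ha] [b Ab hb]].
  by case/eqP: cc'; apply: (disj a b) => // x; rewrite -ha -hb.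
have muF c : mu (F c) = mu A by apply: haar.
have fA : mu A \is a fin_num by apply: fin_num_measure.
have le1 n : (fine (mu A)) *+ n <= 1.
  rewrite -lee_fin.
  have -> : (fine (mu A) *+ n)%:E = mu (\big[setU/set0]_(c < n) F c).
    rewrite measure_bigsetU //; elim: n => [|n IH]; first by rewrite big_ord0 mulr0n.
    by rewrite big_ord_recr /= mulrSr EFinD IH fineK // muF.
  by apply: probability_le1; apply: bigsetU_measurable.
have m0 : 0 <= fine (mu A) by apply: fine_ge0.
rewrite -[mu A]fineK //; congr (_%:E); apply/eqP; rewrite eq_le m0 andbT leNgt.
apply/negP => mA0; have := le1 (Num.truncn (fine (mu A))^-1).+1.
have /andP[_ +] := truncn_itv (ltW (etrans (invr_gt0 _) mA0)).
rewrite -(ltr_pM2r mA0) mulVf ?gt_eqF // mulr_natl => h1 h2; have := lt_le_trans h1 h2.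
by rewrite ltxx.
Qed.

Lemma unipotent (j k : 'I_d) (z : zp) : k != j ->
  exists g : aut M, forall x, th (g x) = th x + (z * th x 0 j) *: delta_mx 0 k.
Proof.
move=> kj; have lin c (a : zp) x y : ht (th (a *: x + y) + (c * th (a *: x + y) 0 j) *: delta_mx 0 k) =
    a *: ht (th x + (c * th x 0 j) *: delta_mx 0 k) + ht (th y + (c * th y 0 j) *: delta_mx 0 k).
  rewrite -ht_linear; congr ht; rewrite linearP scalerDr addrACA; congr (_ + _).
  by rewrite !mxE mulrDr scalerDl scalerA; congr (_ *: _ + _); ring.
have [g gE] := mk_linear (lin z); have [h hE] := mk_linear (lin (- z)).
have inv c x : let y := ht (th x + (c * th x 0 j) *: delta_mx 0 k) in
    ht (th y + (- c * th y 0 j) *: delta_mx 0 k) = x.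
  rewrite /= !htK !mxE eqxx /= eq_sym (negPf kj) mulr0 addr0.
  by rewrite -addrA -scalerDl mulNr subrr scale0r addr0 thK.
have gb : bijective g.
  exists h => x; rewrite hE gE; first exact: inv.
  by have := inv (- z) x; rewrite /= opprK.
by exists (Aut gb) => x; rewrite /= gE htK.
Qed.

(** The image of a basis vector is primitive, so some coordinate j of it is a unit; the piece [E j]
    where this happens is treated separately. If [l] has a nonzero coefficient k other than j,
    adding c times coordinate j to coordinate k changes the value of [l] by a nonzero multiple of c,
    so the translates for different c are disjoint. If not, [l] is supported at j and [E j] is
    empty. *)
Lemma dual_null (l : 'I_d -> zp) (e : 'I_d) : (exists j, l j != 0) ->
  mu.-negligible [set g : BM | dual l (th ((g : aut M) (ht (delta_mx 0 e)))) = 0].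
Proof.
move=> [j0 lj0]; set v := ht _; pose E j := [set g : BM |
  dual l (th ((g : aut M) v)) = 0 /\ th ((g : aut M) v) 0 j 1%N != 0].
have dom := normal_dom (zp_normal pp).
have coord j (g : aut M) : th (g v) 0 j = dual (fun b => (b == j)%:R) (th (g v)).
  rewrite /dual (bigD1 j) //= eqxx mul1r big1 ?addr0 // => b /negPf ->.
  by rewrite mul0r.
have mE j : measurable (E j).
  have -> : E j = ~` [set g : BM | dual l (th ((g : aut M) v)) != 0] `&`
      [set g : BM | [set z : int | z != 0] (dual (fun b => (b == j)%:R) (th ((g : aut M) v)) 1%N)].
    apply/seteqP; split=> g /=; first by move=> [-> h]; rewrite eqxx -coord.
    by move=> [/negP/negPn/eqP h0 h1]; split=> //; rewrite coord.
  apply: (@measurableI _ BM); last exact: open_measurable_aut (@dual_open _ v 1%N _).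
  by apply: (@measurableC _ BM); apply: open_measurable_aut (@dual_neq0_open l v).
have E0 j : mu.-negligible (E j).
  have [[k [kj lk]]|no] := pselect (exists k, k != j /\ l k != 0); last first.
    have -> : E j = set0; last exact: negligible_set0.
    apply/seteqP; split=> // g [d0 g1]; case/eqP: g1.
    suff -> : th ((g : aut M) v) 0 j = 0 by rewrite zp0.
    have lz b : b != j -> l b = 0.
      by move=> bj; apply/eqP/negPn/negP => lb; apply: no; exists b.
    have j0j : j0 = j by apply/eqP/negPn/negP => h; rewrite lz ?eqxx in lj0.
    move: d0; rewrite /dual (bigD1 j) //= big1 ?addr0 => [|b /lz ->]; last by rewrite mul0r.
    move=> h; apply/eqP/negPn/negP => t0; have := dom_mul0 dom _ t0.
    by move=> /(_ (l j)); rewrite h -j0j eqxx => /(_ lj0).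
  apply/negligibleP => //.
  have /choice[u uE] := fun c : nat => unipotent c%:R kj.
  apply: (disjoint_translates_null (u := u) (mE j)) => a b c c' [a0 a1] [b0 b1] ab.
  have := congr1 th (ab v); rewrite !uE => thab.
  have abj : th ((a : aut M) v) 0 j = th ((b : aut M) v) 0 j.
    by have := congr1 (fun w : 'rV_d => w 0 j) thab; rewrite !mxE eq_sym (negPf kj) !mulr0 !addr0.
  have := congr1 (dual l) thab; rewrite !dualD !dualZ a0 b0 !add0r -abj.
  have -> : dual l (delta_mx 0 k) = l k.
    rewrite /dual (bigD1 k) //= mxE !eqxx mulr1 big1 ?addr0 // => b' /negPf h.
    by rewrite mxE h andbF mulr0.
  set t := th _ 0 j in a1 *; have t0 : t != 0.
    by apply/eqP => h; rewrite h zp0 eqxx in a1.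
  move=> /eqP; rewrite -subr_eq0 -!mulrA -mulrBl => h.
  have cc0 : (c%:R : zp) - c'%:R = 0.
    apply/eqP/negPn/negP => cc.
    by move: (dom_mul0 dom cc (dom_mul0 dom t0 lk)); rewrite h.
  (* Both numbers are at most N, hence below p^N, and are recovered from their residues at level
     N. *)
  set N := (c + c')%N; have lt n : (n <= N)%N -> (n%:R : zp) N = n.
    move=> nN; rewrite zp_nat modz_small // ltz_nat.
    exact/(leq_ltn_trans nN)/ltn_expl/prime_gt1.
  by move: cc0 => /subr0_eq/(congr1 (fun x : zp => x N)); rewrite !lt ?leq_addl ?leq_addr // => -[].
pose F n := if insub n is Some j then E j else set0.
apply: (@negligibleS _ _ _ _ (\bigcup_n F n)); last first.
  by apply: negligible_bigcup => n; rewrite /F; case: insubP => // *; apply: negligible_set0.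
move=> g g0; have [j gj] : exists j, th ((g : aut M) v) 0 j 1%N != 0.
  apply: contrapT => no; have [h [gK _]] := aut_inverse g.
  have : ppow_dvd 1 (th ((g : aut M) v)).
    apply/ppow_row => j; apply/(zp_dvdP pp)/eqP/negPn/negP => gj; apply: no; by exists j.
  have [t tE] := mk_linear ht_linear.
  move=> /(ppow_linear t)/(ppow_linear h)/(ppow_linear th)/ppow_row/(_ e).
  rewrite tE thK gK htK mxE !eqxx => /(zp_dvdP pp).
  have -> : (true && true)%:R = 1%:R :> zp by [].
  by rewrite zp_nat modz_small // ltz_nat expn1 prime_gt1.
by exists j => //; rewrite /F valK.
Qed.

End Automorphisms.

(** * Closed null sets of the Grassmannian *)

Section Grassmann.
Variables (p : nat) (pp : prime p).
Local Notation zp := (padic p).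

Lemma ker_Gr (M : lmodType zp) i (r : {linear M -> 'rV[zp]_i}) :
  (forall w, exists x, r x = w) -> Gr i [set x | r x = 0].
Proof.
move=> rs; exists (ker_pred r : submodClosed M).
  by apply/seteqP; split=> x /=; rewrite unfold_in => /eqP.
pose f (u : quot_mod (ker_pred r)) := r (repr u).
have fE x : f (quot_pi _ x) = r x.
  have : quot_pi (ker_pred r) (repr (quot_pi (ker_pred r) x)) = quot_pi (ker_pred r) x.
    by rewrite /quot_pi reprK.
  move=> /quot_piP h; have : r (repr (quot_pi (ker_pred r) x) - x) == 0 by exact: h.
  by rewrite linearB subr_eq0 => /eqP.
have lf a x y : f (a *: x + y) = a *: f x + f y.
  elim/quot_mod_elim: x => x; elim/quot_mod_elim: y => y.
  by rewrite [_ *: _]quot_scaleE -quot_piD !fE linearP.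
have [f' f'E] := mk_linear lf; exists f'.
have /choice[g gE] := rs.
exists (fun w => quot_pi _ (g w)) => [|w]; last by rewrite f'E fE.
elim/quot_mod_elim => x; rewrite f'E fE; apply/quot_piP.
suff : r (g (r x) - x) == 0 by [].
by rewrite linearB gE subrr.
Qed.

(** With the line through [v] as base point, the preimage in Aut(M) is the finite union over [l] of
    the sets where [l] kills g v, each closed and null. *)
Lemma closed_null_functionals (R : realType) i (M : lmodType zp)
    (th : {linear M -> 'rV[zp]_i.+1}) (s : seq ('I_i.+1 -> zp)) : bijective th ->
  (forall l, l \in s -> exists j, l j != 0) ->
  closed_null R i [set N | Gr i N /\
    exists2 l, l \in s & forall v, N v -> dual l (th v) = 0].
Proof.
move=> [ht thK htK] s0; have [mu haar] := haar_ex pp thK htK R.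
pose v := ht (delta_mx 0 0); pose N0 := [set x | exists z : zp, x = z *: v].
have [t tE] := mk_linear (ht_linear thK htK).
have lr a (x y : M) : \row_(j < i) th (a *: x + y) 0 (lift ord0 j) =
    a *: (\row_j th x 0 (lift ord0 j)) + \row_j th y 0 (lift ord0 j).
  by rewrite linearP; apply/rowP => j; rewrite !mxE.
have [r rE] := mk_linear lr.
have rs w : exists x, r x = w.
  exists (ht (cons_row 0 w)); rewrite rE htK; apply/rowP => j.
  by rewrite !mxE liftK.
have N0E : N0 = [set x | r x = 0].
  apply/seteqP; split=> [_ [z ->]|x /= rx].
    rewrite /= rE; apply/rowP => j; rewrite linearZ /v htK !mxE /=.
    by rewrite mulr0.
  exists (th x 0 0); apply: (can_inj thK); rewrite linearZ /v htK.
  apply/rowP => j; rewrite !mxE /=; case: (unliftP ord0 j) => [k ->|->].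
    have := congr1 (fun w : 'rV_i => w 0 k) rx; rewrite rE !mxE => ->.
    by rewrite mulr0.
  by rewrite mulr1.
have GrN g : Gr i (aut_fun g @` N0).
  have [h [gK hK]] := aut_inverse g.
  have -> : aut_fun g @` N0 = [set x | (r \o h) x = 0].
    rewrite N0E; apply/seteqP; split=> [_ [x /= rx <-]|x /= rx]; first by rewrite gK.
    by exists (h x).
  by apply: ker_Gr => w; have [x <-] := rs w; exists (g x); rewrite /= gK.
pose B (l : 'I_i.+1 -> zp) := [set g : aut M | dual l (th (g v)) = 0].
have preimE : orbit_preim N0 [set N | Gr i N /\
    exists2 l, l \in s & forall v, N v -> dual l (th v) = 0] =
    [set g | exists2 l, l \in s & B l g].
  apply/seteqP; split=> [g [_ [l ls lg]]|g [l ls lg]].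
    by exists l => //; apply: lg; exists v => //; exists 1; rewrite scale1r.
  split; first exact: GrN.
  exists l => // _ [_ [z ->] <-]; rewrite !linearZ dualZ lg mulr0.
  by [].
have UE : [set g | exists2 l, l \in s & B l g] =
    \bigcup_(n in `I_(size s)) B (nth (fun=> 0) s n).
  apply/seteqP; split=> [g [l ls lg]|g [n ns lg]].
    by exists (index l s); rewrite /= ?index_mem // nth_index.
  by exists (nth (fun=> 0) s n) => //; apply: mem_nth.
have BC l : open (~` B l).
    have := @dual_neq0_open p _ pp M th l v.
    suff -> : ~` B l = [set g : aut M | dual l (th (g v)) != 0] by [].
    by apply/seteqP; split=> g /= /eqP.
exists mu, N0; rewrite preimE; split=> //; first by rewrite N0E; apply: ker_Gr.
  rewrite UE; apply: closed_bigcup => [|n _]; first exact: finite_II.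
  by rewrite -[B _]setCK; apply/open_closedC/BC.
have mB l : measurable (B l : set (borel_aut M)).
  by rewrite -[B l]setCK; apply: (@measurableC _ (borel_aut M)); apply: open_measurable_aut; apply: BC.
rewrite UE; apply: (@measure_negligible _ (borel_aut M)).
  by apply: (@bigcup_measurable _ (borel_aut M)) => n _; apply: mB.
rewrite bigcup_mkcond; apply: (@negligible_bigcup _ (borel_aut M)) => n.
case: ifP => [/set_mem/= ns|_]; last exact: negligible_set0.
exact: (dual_null pp thK htK haar _ (s0 _ (mem_nth _ ns))).
Qed.
End Grassmann.

Notation Caut := {rmorphism algC -> algC}.
Local Notation pQtoC := (map_poly (ratr : rat -> algC)).

(** * Places and automorphisms of algC *)

Section Ultralimits.

Lemma conj_finite (x : algC) : exists s : seq algC, forall u : Caut, u x \in s.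
Proof.
have [q [Dq mq] dq] := minCpolyP x.
have [r Dr] := closed_field_poly_normal (pQtoC q).
exists r => u; have q0 : pQtoC q != 0 by rewrite map_poly_eq0 monic_neq0.
have : root (pQtoC q) (u x).
  have -> : pQtoC q = map_poly u (pQtoC q).
    by rewrite -map_poly_comp; apply: eq_map_poly => a /=; rewrite fmorph_rat.
  by rewrite fmorph_root dq.
by rewrite Dr rootZ ?lead_coef_eq0 // root_prod_XsubC.
Qed.

Lemma conj_finite_seq (xs : seq algC) : exists s : seq (seq algC),
  forall u : Caut, map u xs \in s.
Proof.
elim: xs => [|x xs [s sP]]; first by exists [:: [::]] => u; rewrite inE.
have [r rP] := conj_finite x.
exists [seq y :: ys | y <- r, ys <- s] => u; apply/allpairsP; exists (u x, map u xs).
by split; [apply: rP|apply: sP|].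
Qed.

(** The values at a given x are conjugates of x, finite in number, so the ultrafilter selects one of
    them. This is the compactness of the absolute Galois group of Q. *)
Lemma ulim_aut (F : set_system nat) (s : nat -> Caut) : UltraFilter F ->
  exists u : Caut, forall x, F [set n | s n x = u x].
Proof.
move=> FU.
have lim x : exists y, F [set n | s n x = y].
  have [r rP] := conj_finite x; have [|y [_ yP]] := @ultra_fin _ F FU _ (fun n => s n x) r.
    by apply: filterS filterT => n _ /=.
  by exists y.
pose u x := projT1 (cid (lim x)).
have uP x : F [set n | s n x = u x] := projT2 (cid (lim x)).
have uB : zmod_morphism u.
  move=> x y.
  have [n [[/= <- <-] <-]] := filter_ex (filterI (filterI (uP x) (uP y)) (uP (x - y))).
  exact: rmorphB.
have uM : monoid_morphism u.
  split; first by have [n /= <-] := filter_ex (uP 1); rewrite rmorph1.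
  move=> x y.
  have [n [[/= <- <-] <-]] := filter_ex (filterI (filterI (uP x) (uP y)) (uP (x * y))).
  exact: rmorphM.
pose u1 := GRing.isZmodMorphism.Build algC algC u uB.
pose u2 := GRing.isMonoidMorphism.Build algC algC u uM.
pose u3 : Caut := HB.pack u u1 u2.
by exists u3.
Qed.

(** As [algC] is countable, a property obtained on each finite set [first_C n] by some automorphism
    passes to a limit automorphism on the whole field. *)
Definition first_C n : seq algC := pmap unpickle (iota 0 n).

Lemma mem_first_C x : exists m, forall n, (m <= n)%N -> x \in first_C n.
Proof.
exists (pickle x).+1 => n xn; rewrite mem_pmap; apply/mapP; exists (pickle x).
  by rewrite mem_iota.
by rewrite pickleK.
Qed.

(** An automorphism is injective and maps the finite orbit into itself, so it permutes it. *)
Lemma orbit_seq (D : set Caut) (xs : seq algC) : D idfun ->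
  (forall u v : Caut, D u -> D v -> D (u \o v)) ->
  exists o : seq (seq algC), [/\ uniq o, xs \in o,
    forall y, y \in o -> exists2 u : Caut, D u & y = map u xs &
    forall u, D u -> perm_eq (map (map u) o) o].
Proof.
move=> D1 DM; have [s sP] := conj_finite_seq xs.
pose o := undup [seq y <- s | `[<exists2 u : Caut, D u & y = map u xs>]].
have oP y : y \in o <-> exists2 u : Caut, D u & y = map u xs.
  rewrite mem_undup mem_filter; split=> [/andP[/asboolP//]|h]; apply/andP; split; first exact/asboolP.
  by have [u _ ->] := h; apply: sP.
exists o; split=> [||y /oP//|u Du].
- exact: undup_uniq.
- by apply/oP; exists idfun => //; rewrite map_id.
have um : uniq (map (map u) o).
  by rewrite map_inj_uniq ?undup_uniq //; apply/inj_map/fmorph_inj.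
apply: uniq_perm => //; first exact: undup_uniq.
have h : {subset map (map u) o <= o}.
  move=> y /mapP[_ /oP[v Dv ->] ->]; apply/oP; exists (u \o v); first exact: DM.
  by rewrite -map_comp.
by have [|_ e] := uniq_min_size um h; rewrite ?size_map // => y; rewrite e.
Qed.

Lemma orbit1 (D : set Caut) (x : algC) : D idfun ->
  (forall u v : Caut, D u -> D v -> D (u \o v)) ->
  exists o : seq algC, [/\ x \in o,
    forall y, y \in o -> exists2 u : Caut, D u & y = u x &
    forall u, D u -> perm_eq (map u o) o].
Proof.
move=> D1 DM; have [ob [uo xo oD oP]] := orbit_seq [:: x] D1 DM.
have E y : y \in ob -> y = [:: head 0 y] by move=> /oD[u _ ->].
exists (map (head 0) ob); split=> [|_ /mapP[y /oD[u Du ->] ->]|u Du].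
- by apply/mapP; exists [:: x].
- by exists u.
rewrite -map_comp; suff <- : map (head 0 \o map u) ob = map (u \o head 0) ob.
  by rewrite map_comp; apply/perm_map/oP.
by apply/eq_in_map => y /E ->.
Qed.

Lemma perm_prod_fixed (u : Caut) (o : seq algC) : perm_eq (map u o) o ->
  map_poly u (\prod_(y <- o) ('X - y%:P)) = \prod_(y <- o) ('X - y%:P).
Proof.
move=> pu; rewrite -[RHS](perm_big _ pu) /= big_map rmorph_prod.
by apply: eq_bigr => y _; rewrite rmorphB /= map_polyX map_polyC.
Qed.

End Ultralimits.

(** * Galois theory of subfields of [algC] *)

Section FixedFields.

Lemma splitting_fixed_horner (L : splittingFieldType rat) (LC : {rmorphism L -> algC}) (z x : L) :
  (forall u : Caut, u (LC z) = LC z -> u (LC x) = LC x) ->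
  exists q : {poly rat}, LC x = (pQtoC q).[LC z].
Proof.
move=> zx; pose K : {subfield L} := <<1; z>>%AS.
have gK : galois K {:L}.
  rewrite /galois subvf normalFieldf andbT /=.
  apply/separableP => y _; apply: pcharf0_separable => n.
  apply/negP => /andP[/prime_gt0 n0].
  by rewrite -(rmorph_nat (in_alg L)) fmorph_eq0 pnatr_eq0 eqn0Ngt n0.
have : x \in fixedField ('Gal({:L} / K))%g.
  apply/fixedFieldP; rewrite ?memvf // => g gG.
  have gz : g z = z by apply: (fixed_gal (subvf _) gG); apply: memv_adjoin.
  have gm : monoid_morphism (g : L -> L) by split=> [|a b]; rewrite ?rmorph1 ?rmorphM.
  pose g1 := GRing.isMonoidMorphism.Build _ _ (g : L -> L) gm.
  pose g2 : {rmorphism L -> L} := HB.pack (fun_of_lfun (gal_repr g)) g1.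
  have [nu Dnu] := extend_algC_subfield_aut LC g2.
  have Ez : nu (LC z) = LC z.
    by have <- : LC (g z) = nu (LC z) := Dnu z; rewrite gz.
  have Ex : LC (g x) = nu (LC x) := Dnu x.
  by apply: (fmorph_inj LC); rewrite Ex zx.
rewrite (galois_fixedField gK) => /Fadjoin_polyP[s s1 Dx].
have aP i : exists a, s`_i = a%:A.
  by have /vlineP[a ->] : s`_i \in 1%VS by [apply: (polyOverP s1)]; exists a.
pose a i := projT1 (cid (aP i)); have aE i : s`_i = (a i)%:A := projT2 (cid (aP i)).
exists (\poly_(i < size s) a i).
rewrite Dx -horner_map; congr (_.[_]); apply/polyP => i.
rewrite !coef_map coef_poly /=; case: ltnP => h; last by rewrite nth_default ?rmorph0 //.
by rewrite aE alg_num_field fmorph_rat.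
Qed.

(** Both elements lie in a splitting field over Q, where finite Galois theory applies; its
    automorphisms extend to [algC]. *)
Lemma fixed_horner (z x : algC) :
  (forall u : Caut, u z = z -> u x = x) -> exists q : {poly rat}, x = (pQtoC q).[z].
Proof.
move=> zx; have [qz [_ mz] rz] := minCpolyP z; have [qx [_ mx] rx] := minCpolyP x.
pose q := qz * qx; have mq : q \is monic by rewrite monicMr.
have [r Dr] := closed_field_poly_normal (pQtoC q : {poly algC}).
rewrite lead_coef_map (monicP mq) rmorph1 scale1r in Dr.
have zr : z \in r by rewrite -root_prod_XsubC -Dr rmorphM rootM rz dvdpp.
have xr : x \in r by rewrite -root_prod_XsubC -Dr rmorphM rootM (rx qx) dvdpp orbT.
have [Qr [QrC [rr Drr genQr]]] := num_field_exists r.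
move: zr xr; rewrite -Drr => /mapP[zz _ Dz] /mapP[xx _ Dx].
have spl : splitting_field_axiom Qr.
  exists (map_poly (in_alg Qr) q).
    by apply/polyOverP=> i; rewrite coef_map memvZ ?memv_line.
  exists rr => //; congr (_ %= _): (eqpxx (map_poly (in_alg Qr) q)).
  apply/(map_poly_inj QrC); rewrite -map_poly_comp.
  rewrite (@eq_map_poly _ _ _ (ratr : rat -> algC)) => [|a /=]; last first.
    by rewrite alg_num_field fmorph_rat.
  rewrite Dr -Drr big_map rmorph_prod /=; apply: eq_bigr => y _.
  by rewrite map_polyXsubC.
pose Lm := FieldExt_isSplittingField.Build rat Qr spl.
pose L : splittingFieldType rat := HB.pack Qr Lm.
by rewrite Dx Dz; apply: (@splitting_fixed_horner L QrC zz xx); rewrite -Dx -Dz.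
Qed.

Lemma ratr_pred (L : divringClosed algC) a : ratr a \in L.
Proof. by rewrite rpred_div ?rpred_int. Qed.

Lemma horner_pred (L : divringClosed algC) (q : {poly algC}) z : q \is a polyOver L -> z \in L -> q.[z] \in L.
Proof. by move=> qL zL; apply: rpred_horner. Qed.

Lemma pQ_over (L : divringClosed algC) (q : {poly rat}) : pQtoC q \is a polyOver L.
Proof. by apply/polyOverP => i; rewrite coef_map ratr_pred. Qed.

Lemma primitive_first (L : divringClosed algC) n : exists2 z, z \in L &
  forall x, x \in first_C n -> x \in L -> exists q, x = (pQtoC q).[z].
Proof.
have [z [a Dz] [ps Ds]] := algC_PET [seq x <- first_C n | x \in L].
exists z => [|x xn xL].
  rewrite Dz; apply: rpred_sum => i _; apply: rpredMn.
  by have := mem_nth 0 (ltn_ord i); rewrite mem_filter => /andP[].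
have : x \in [seq x <- first_C n | x \in L] by rewrite mem_filter xL.
by rewrite Ds => /mapP[q _ ->]; exists q.
Qed.

Definition fixer (L : {pred algC}) : set Caut := [set u : Caut | {in L, u =1 id}].

Lemma fixer1 L : fixer L idfun. Proof. by []. Qed.
Lemma fixerM L (u v : Caut) : fixer L u -> fixer L v -> fixer L (u \o v).
Proof. by move=> uL vL x xL /=; rewrite vL ?uL. Qed.
Lemma fixerV L (u v : Caut) : fixer L u -> cancel u v -> fixer L v.
Proof. by move=> uL uv x xL; rewrite -[in LHS](uL x xL) uv. Qed.

Lemma aut_inv (u : Caut) : exists v : Caut, cancel u v /\ cancel v u.
Proof. by exists (algC_invaut u); split; [apply: algC_autK|apply: algC_invautK]. Qed.

Lemma rmorph_horner_pred (L : divringClosed algC) (s : algC -> algC) (q : {poly rat}) z :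
  s 1 = 1 -> {in L &, {morph s : x y / x + y}} -> {in L &, {morph s : x y / x * y}} ->
  z \in L -> s (pQtoC q).[z] = (pQtoC q).[s z].
Proof.
move=> s1 sD sM zL.
have s0 : s 0 = 0 by apply: (addrI (s 0)); rewrite -sD ?rpred0 // !addr0.
have sN x : x \in L -> s (- x) = - s x.
  by move=> xL; apply: (addrI (s x)); rewrite -sD ?rpredN // !subrr s0.
have sn n : s n%:R = n%:R.
  by elim: n => [//|n IH]; rewrite mulrSr sD ?IH ?s1 ?rpred1 ?rpred_nat.
have si (m : int) : s m%:~R = m%:~R.
  by case: m => n; rewrite ?NegzE -?pmulrn ?sn // rmorphN sN ?rpred_nat // sn.
have sr a : s (ratr a) = ratr a.
  have d0 : (denq a)%:~R != 0 :> algC by rewrite intr_eq0 denq_neq0.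
  apply: (mulIf d0); rewrite -[in LHS](si (denq a)) -sM ?ratr_pred ?rpred_int //.
  by rewrite /ratr mulfVK ?si // -/(ratr a).
elim/poly_ind: q => [|q c IH]; first by rewrite rmorph0 !horner0 s0.
have E w : (pQtoC (q * 'X + c%:P)).[w] = (pQtoC q).[w] * w + ratr c.
  by rewrite rmorphD rmorphM /= map_polyX map_polyC hornerMXaddC.
have qL : (pQtoC q).[z] \in L by rewrite horner_pred // pQ_over.
by rewrite !E sD ?ratr_pred ?rpredM // sM // IH sr.
Qed.

Lemma aut_horner (u : Caut) (q : {poly rat}) z : u (pQtoC q).[z] = (pQtoC q).[u z].
Proof.
rewrite -horner_map -map_poly_comp; congr (_.[_]).
by apply: eq_map_poly => a /=; rewrite fmorph_rat.
Qed.

(** If [x] is outside [L], then for each n some automorphism fixes the elements of [L] among the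
    first n numbers, all in Q(z) for one z in [L], and moves [x]. A limit fixes [L] and still moves
    [x], as its value at [x] is attained. *)
Lemma fixed_mem (L : divringClosed algC) x : (forall u, fixer L u -> u x = x) -> x \in L.
Proof.
move=> Lx; apply: contrapT => /negP xL.
have h n : exists u : Caut, (forall y, y \in first_C n -> y \in L -> u y = y) /\ u x != x.
  have [z zL zP] := primitive_first L n.
  have /existsNP[u /not_implyP[uz /eqP ux]] : ~ (forall u : Caut, u z = z -> u x = x).
    move=> /fixed_horner[q xE]; case/negP: xL; rewrite xE.
    by rewrite horner_pred // pQ_over.
  by exists u; split=> // y yn yL; have [q ->] := zP y yn yL; rewrite aut_horner uz.
have [F [FU Fc]] := free_ultra.
have [u uP] := ulim_aut (fun n => projT1 (cid (h n))) FU.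
have hP n := projT2 (cid (h n)).
have uL : fixer L u.
  move=> y yL; have [m mP] := mem_first_C y.
  have [n [/= mn <-]] := filter_ex (filterI (Fc m) (uP y)).
  by apply: (hP n).1 => //; apply: mP.
have [n /= e] := filter_ex (uP x).
by have := (hP n).2; rewrite e Lx ?eqxx.
Qed.

Lemma rational_fixed x : (forall u : Caut, u x = x) -> exists a, x = ratr a.
Proof.
move=> h; have [|q ->] := @fixed_horner 0 x; first by move=> u _; apply: h.
by exists q`_0; rewrite horner_coef0 coef_map.
Qed.

(** On finitely many elements, all in Q(z), an extension is an automorphism sending [z] to s z; it
    exists because s z is a root of the rational polynomial whose roots are the conjugates of
    [z]. *)
Lemma extend_aut (L : divringClosed algC) (s : algC -> algC) :
  s 1 = 1 -> {in L &, {morph s : x y / x + y}} -> {in L &, {morph s : x y / x * y}} ->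
  exists u : Caut, {in L, u =1 s}.
Proof.
move=> s1 sD sM.
have h n : exists u : Caut, forall y, y \in first_C n -> y \in L -> u y = s y.
  have [z zL zP] := primitive_first L n.
  have [ob [zo oP op]] := @orbit1 setT z Logic.I (fun _ _ _ _ => Logic.I).
  pose q := \prod_(y <- ob) ('X - y%:P).
  have qr i : exists a, q`_i = ratr a.
    apply: rational_fixed => u.
    by have /polyP/(_ i) := perm_prod_fixed (op u Logic.I); rewrite coef_map.
  pose a i := projT1 (cid (qr i)); have aE i : q`_i = ratr (a i) := projT2 (cid (qr i)).
  have qE : q = pQtoC (\poly_(i < size q) a i).
    apply/polyP => i; rewrite coef_map coef_poly /=; case: ltnP => h; first exact: aE.
    by rewrite nth_default ?rmorph0.
  have : root q (s z).
    rewrite /root qE -(rmorph_horner_pred _ s1 sD sM zL) -qE.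
    have /eqP -> : root q z by rewrite root_prod_XsubC.
    by apply/eqP/(addrI (s 0)); rewrite -sD ?rpred0 // !addr0.
  rewrite root_prod_XsubC => /oP[u _ uz]; exists u => y yn yL.
  by have [r ->] := zP y yn yL; rewrite aut_horner -uz (rmorph_horner_pred _ s1 sD sM zL).
have [F [FU Fc]] := free_ultra.
have [u uP] := ulim_aut (fun n => projT1 (cid (h n))) FU.
exists u => y yL; have [m mP] := mem_first_C y.
have [n [/= mn <-]] := filter_ex (filterI (Fc m) (uP y)).
by apply: (projT2 (cid (h n))) => //; apply: mP.
Qed.

Lemma extend_gal (F L : divringClosed algC) (s : galT F L) :
  exists2 u : Caut, {in L, u =1 s} & {subset F <= L} -> fixer F u.
Proof.
have [sF sD sM _ _] := galP s.
have [u uP] := extend_aut (sF 1 (rpred1 F)) sD sM.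
by exists u => // FL x xF; rewrite uP ?FL ?sF.
Qed.

Definition stable (L : {pred algC}) (u : Caut) := forall x, x \in L -> u x \in L.

Lemma restrict_aut (F : {pred algC}) (L : divringClosed algC) (u v : Caut) : fixer F u -> {subset F <= L} ->
  cancel v u -> stable L u -> stable L v ->
  exists s : galT F L, {in L, s =1 u}.
Proof.
move=> uF FL vu uL vL; pose s x := if x \in L then u x else x.
suff sP : is_gal F L s by exists (GalT sP) => x xL /=; rewrite /s xL.
have sE x : x \in L -> s x = u x by rewrite /s => ->.
split=> [x xF|x y xL yL|x y xL yL||x /negPf].
- by rewrite sE ?uF ?FL.
- by rewrite !sE ?rmorphD ?rpredD.
- by rewrite !sE ?rmorphM ?rpredM.
- apply/seteqP; split=> [_ [x xL <-]|x xL] /=; first by rewrite sE //; apply: uL.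
  by exists (v x); [apply: vL|rewrite sE ?vu //; apply: vL].
by rewrite /s => ->.
Qed.

End FixedFields.

Local Notation pZtoC := (map_poly (intr : int -> algC)).

(** * Integrality of tails of integer polynomials *)

Section AlgebraicIntegers.

(** [x] is an eigenvalue of an integer matrix, whose characteristic polynomial is monic and
    integral. *)
Lemma int_stable_Aint n (Y : 'I_n -> algC) x : (exists i, Y i != 0) ->
  (forall i, exists c : 'I_n -> int, x * Y i = \sum_j (c j)%:~R * Y j) -> x \in Aint.
Proof.
move=> [i0 Yi0] h; pose c i := projT1 (cid (h i)).
have cE i : x * Y i = \sum_j (c i j)%:~R * Y j := projT2 (cid (h i)).
pose A := \matrix_(i, j < n) c j i; pose v := \row_j Y j.
pose q := char_poly (map_mx (intr : int -> algC) A).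
have qZ : q \is a polyOver Num.int.
  by rewrite /q -map_char_poly; apply/polyOverP => k; rewrite coef_map /= rpred_int.
apply: root_monic_Aint (char_poly_monic _) qZ.
rewrite -eigenvalue_root_char; apply/eigenvalueP; exists v.
  by apply/rowP => j; rewrite !mxE cE; apply: eq_bigr => i _; rewrite !mxE mulrC.
by apply/eqP => /rowP/(_ i0); rewrite !mxE => /eqP; rewrite (negPf Yi0).
Qed.

Definition tail_value (c : {poly int}) (x : algC) k := (pZtoC (drop_poly k c)).[x].

Lemma tail_valueE c x k : tail_value c x k = (c`_k)%:~R + x * tail_value c x k.+1.
Proof.
rewrite /tail_value; have -> : drop_poly k c = drop_poly k.+1 c * 'X + (c`_k)%:P.
  apply/polyP => i; rewrite coefD coefMX coefC !coef_drop_poly.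
  by case: i => [|i]; rewrite ?add0r ?addr0 // addSn addnS.
by rewrite rmorphD rmorphM /= map_polyX map_polyC hornerMXaddC addrC mulrC.
Qed.

(* Multiplication by [tail_value c x k] preserves the lattice spanned by the
   powers [x ^+ j] with [j < deg c]. *)
Lemma tail_value_Aint c x k : c != 0 -> root (pZtoC c) x -> tail_value c x k \in Aint.
Proof.
move=> c0 cx; set n := (size c).-1.
have sc : size c = n.+1 by rewrite /n prednK // lt0n size_poly_eq0.
have n0 : (0 < n)%N.
  rewrite lt0n; apply/eqP => nz; move: cx; rewrite (size1_polyC (_ : (size c <= 1)%N)) ?sc ?nz //.
  rewrite map_polyC rootC intr_eq0 => /eqP c00; move: c0.
  by rewrite (size1_polyC (_ : (size c <= 1)%N)) ?sc ?nz // c00 eqxx.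
have key j : (j < n)%N -> exists q : {poly int}, (size q <= n)%N /\ tail_value c x k * x ^+ j = (pZtoC q).[x].
  move=> jn; case: (ltnP j k) => jk.
    exists (drop_poly k c * 'X^j); split.
      have [->|d0] := eqVneq (drop_poly k c) 0; first by rewrite mul0r size_poly0.
      rewrite size_mulXn // size_drop_poly sc.
      have kn : (k <= n)%N by move: d0; rewrite -size_poly_eq0 size_drop_poly sc subn_eq0 -ltnNge.
      by rewrite subSn // addnS -addSn -[X in (_ <= X)%N](subnKC kn) leq_add2r.
    by rewrite rmorphM /= map_polyXn hornerM hornerXn.
  exists (- take_poly k c * 'X^(j - k)); split.
    have [->|d0] := eqVneq (- take_poly k c) 0; first by rewrite mul0r size_poly0.
    rewrite size_mulXn // size_polyN; apply: leq_trans (_ : (j - k + k <= n)%N).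
      by rewrite leq_add2l size_take_poly.
    by rewrite subnK // ltnW.
  rewrite rmorphM rmorphN /= map_polyXn hornerM hornerXn hornerN -[in LHS](subnK jk) exprD mulrA mulrAC.
  congr (_ * _); apply/eqP; rewrite -subr_eq0 opprK addrC; apply/eqP.
  have /eqP <- := cx; rewrite -[c in RHS](poly_take_drop k) rmorphD rmorphM /= map_polyXn.
  by rewrite hornerD hornerM hornerXn.
apply: (@int_stable_Aint n (fun j => x ^+ j)).
  by exists (Ordinal n0); rewrite expr0 oner_eq0.
move=> i; have [q [sq ->]] := key i (ltn_ord i); exists (fun j => q`_j).
rewrite (@horner_coef_wide _ n) //; last by rewrite map_polyE (leq_trans (size_Poly _)) // size_map.
by apply: eq_bigr => j _; rewrite coef_map.
Qed.

Lemma primitive_root (x : algC) : exists c : {poly int}, [/\ c != 0, root (pZtoC c) x &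
  zcontents c = 1].
Proof.
have [q [_ mq] rq] := minCpolyP x; have [r [a a0 qE]] := rat_poly_scale q.
have r0 : r != 0.
  by apply/eqP => r0; move: (monic_neq0 mq); rewrite qE r0 rmorph0 scaler0 eqxx.
exists (zprimitive r); split; rewrite ?zprimitive_eq0 ?zcontents_primitive ?r0 //.
have : root (map_poly ratr q) x by rewrite rq dvdpp.
rewrite qE map_polyZ /= rootZ ?fmorph_eq0 ?invr_eq0 ?intr_eq0 // -map_poly_comp.
rewrite (@eq_map_poly _ _ _ (intr : int -> algC)) => [|m /=]; last by rewrite rmorph_int.
rewrite [in X in X -> _](zpolyEprim r) map_polyZ /= rootZ //.
by rewrite intr_eq0 zcontents_eq0.
Qed.

End AlgebraicIntegers.

(** * Rings of integers localized at a prime *)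

Section PrimesOfIntegers.
Variables (L : divringClosed algC) (P : set algC).
Hypothesis hP : prime_of_integers L P.
Let OL (x : algC) := x \in L /\ x \in Aint.

Lemma poi_int x : P x -> OL x. Proof. by have [[h _] _ _ _ _] := hP; apply: h. Qed.
Lemma poiD x y : P x -> P y -> P (x + y). Proof. by have [_ h _ _ _] := hP; apply: h. Qed.
Lemma poiM a x : OL a -> P x -> P (a * x).
Proof. by case=> aL aA; have [_ _ h _ _] := hP; apply: h. Qed.
Lemma poi1 : ~ P 1. Proof. by have [] := hP. Qed.
Lemma poi_prime a b : OL a -> OL b -> P (a * b) -> P a \/ P b.
Proof. by case=> aL aA [bL bA]; have [_ _ _ _ h] := hP; apply: h. Qed.
Lemma poi0 : P 0.
Proof.
have [[_ [x Px _]] _ _ _ _] := hP.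
by rewrite -(mul0r x); apply: poiM => //; split; [apply: rpred0|apply: Aint0].
Qed.
Lemma OL_int (m : int) : OL m%:~R. Proof. by split; rewrite ?rpred_int ?Aint_int. Qed.
Lemma OL_D x y : OL x -> OL y -> OL (x + y). Proof. by move=> [? ?] [? ?]; split; apply: rpredD. Qed.
Lemma OL_M x y : OL x -> OL y -> OL (x * y). Proof. by move=> [? ?] [? ?]; split; apply: rpredM. Qed.
Lemma OL_N x : OL x -> OL (- x). Proof. by move=> [? ?]; split; rewrite rpredN. Qed.
Lemma poiN x : P x -> P (- x).
Proof. by move=> Px; rewrite -mulN1r; apply: poiM => //; exact: (OL_int (-1)). Qed.

(** The constant term of an integer polynomial killing a nonzero [x] of [P], once powers of X are
    removed, is a nonzero integer in [P]. The least positive integer in [P] is then prime. *)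
Lemma poi_char : exists2 l, prime l & P l%:R.
Proof.
have [[_ [x Px x0]] _ _ _ _] := hP; have [xL xA] := poi_int Px.
have [c [c0 cx _]] := primitive_root x.
have [m m0 Pm] : exists2 m : int, m != 0 & P m%:~R.
  have : minCpoly x \is a polyOver Num.int := xA.
  have [q [Dq mq] rq] := minCpolyP x; move=> qZ.
  have qx : root (minCpoly x) x by rewrite Dq rq dvdpp.
  have [r Dr] := floorpP qZ.
  have r0 : r != 0.
    by apply/eqP => r0; move: (minCpoly_monic x); rewrite Dr r0 rmorph0 => /monic_neq0; rewrite eqxx.
  have [k [s [s0 rE]]] : exists k (s : {poly int}), s`_0 != 0 /\ r = s * 'X^k.
    have h : exists i, r`_i != 0 by exists (size r).-1; rewrite -lead_coefE lead_coef_eq0.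
    have [k k0 kmin] := ex_minnP h; exists k, (drop_poly k r).
    rewrite coef_drop_poly add0n; split=> //; rewrite -[LHS](poly_take_drop k).
    rewrite (_ : take_poly k r = 0) ?add0r //; apply/polyP => i; rewrite coef_take_poly coef0.
    by case: ltnP => // ik; apply/eqP; apply: contraTT ik => /kmin; rewrite -leqNgt.
  move: qx; rewrite Dr rE rmorphM /= map_polyXn rootM /root hornerXn expf_eq0 (negPf x0) andbF orbF.
  move=> /eqP sx; exists s`_0 => //; rewrite (_ : _%:~R = - (x * tail_value s x 1)).
    apply: poiN; rewrite mulrC; apply: poiM => //; split.
      apply: rpred_horner => //; apply/polyOverP => i; rewrite coef_map rpred_int //.
    rewrite /tail_value; apply: rpred_horner => //.
    by apply/polyOverP => i; rewrite coef_map rpred_int.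
  apply/eqP; rewrite -addr_eq0 -tail_valueE /tail_value drop_poly0l; exact/eqP.
have h : exists n : nat, (0 < n)%N && `[<P n%:R>].
  exists `|m|%N; rewrite absz_gt0 m0 /=; apply/asboolP; case: m m0 Pm => n _ //.
  by rewrite NegzE mulrNz => /poiN; rewrite opprK.
have [l /andP[l0 /asboolP Pl] lmin] := ex_minnP h; exists l => //.
have small n : (0 < n)%N -> P n%:R -> (l <= n)%N by move=> n0 Pn; apply: lmin; rewrite n0; apply/asboolP.
apply/primeP; split.
  rewrite ltn_neqAle l0 andbT; apply/eqP => l1; apply: poi1; by rewrite -l1 in Pl.
move=> d /dvdnP[e lE]; move: Pl; rewrite lE natrM => /(poi_prime (OL_int e) (OL_int d)).
have [e0 d0] : (0 < e)%N /\ (0 < d)%N by move: l0; rewrite lE muln_gt0 => /andP.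
move=> [Pe|Pd].
  have := small e e0 Pe; rewrite lE -[X in (_ <= X)%N]muln1 leq_pmul2l // => d1.
  by rewrite eqn_leq d1 d0.
have := small d d0 Pd; rewrite lE -[X in (_ <= X)%N]mul1n leq_pmul2r // => e1.
have -> : e = 1%N by apply/eqP; rewrite eqn_leq e1 e0.
by rewrite mul1n eqxx orbT.
Qed.

Lemma poi_intP l (m : int) : prime l -> P l%:R -> P m%:~R -> (l %| m)%Z.
Proof.
move=> pl Pl Pm; apply: contrapT => /negP nd.
have cop : coprimez l m.
  by rewrite /coprimez /gcdz eqz_nat -/(coprime _ _) prime_coprime // absz_nat.
have [[u v] /= e] : exists uv : int * int, uv.1 * l + uv.2 * m = 1.
  by have [u [v e]] := Bezoutz l m; exists (u, v); rewrite /= e; apply/eqP.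
apply: poi1; have -> : (1 : algC) = u%:~R * l%:R + v%:~R * m%:~R.
  by rewrite -[l%:R]/((l : int)%:~R) -!rmorphM -rmorphD e.
by apply: poiD; apply: poiM => //; apply: OL_int.
Qed.

(** The local ring at [P] is a valuation ring. For a root [x] of a primitive integer polynomial with
    coefficients c_k, the tails b_k are integral and x b_(k+1) = b_k - c_k. If some tail is outside
    [P], it serves as a denominator of [x]; if all are in [P], some c_k is not, so x b_(k+1) is
    outside and serves for the inverse. *)
Lemma poi_pruefer x : x \in L ->
  (exists a b, [/\ OL a, OL b, ~ P b & x * b = a]) \/
  (exists a b, [/\ P a, OL b, ~ P b & x * a = b]).
Proof.
move=> xL; have [c [c0 cx c1]] := primitive_root x.
have [l pl Pl] := poi_char.
have OLb k : OL (tail_value c x k).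
  split; last exact: tail_value_Aint.
  apply: rpred_horner => //; apply/polyOverP => i; rewrite coef_map rpred_int //.
have b0 : tail_value c x 0 = 0 by rewrite /tail_value drop_poly0l; apply/eqP.
have xb k : x * tail_value c x k.+1 = tail_value c x k - (c`_k)%:~R.
  by rewrite [tail_value c x k]tail_valueE addrC addKr.
have [[k nPb]|allP] := pselect (exists k, ~ P (tail_value c x k)).
  left; case: k nPb => [|k] nPb; first by rewrite b0 in nPb; case: nPb; apply: poi0.
  exists (tail_value c x k - (c`_k)%:~R), (tail_value c x k.+1); split=> //.
  by apply: OL_D => //; apply/OL_N/OL_int.
right; have Pb k : P (tail_value c x k) by apply: contrapT => nP; apply: allP; exists k.
have [k nPc] : exists k, ~ P (c`_k)%:~R.
  apply: contrapT => no; have : (l %| zcontents c)%Z.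
    rewrite dvdz_contents; apply/polyOverP => i; apply: (poi_intP pl Pl).
    by apply: contrapT => nP; apply: no; exists i.
  by rewrite c1 dvdzE /= dvdn1 => /eqP l1; rewrite l1 in pl.
exists (tail_value c x k.+1), (x * tail_value c x k.+1); split=> //.
  by rewrite xb; apply: OL_D => //; apply/OL_N/OL_int.
rewrite xb => h; apply: nPc.
by have := poiD (Pb k) (poiN h); rewrite opprB addrC subrK.
Qed.

Lemma poi_compare x y : P x -> P y -> exists s, [/\ OL s, ~ P s &
  (exists2 a, OL a & s * x = a * y) \/ (exists2 a, OL a & s * y = a * x)].
Proof.
move=> Px Py; have [xL xA] := poi_int Px; have [yL yA] := poi_int Py.
have [->|y0] := eqVneq y 0.
  by exists 1; split; [exact: (OL_int 1)|apply: poi1|right; exists 0; [exact: (OL_int 0)|rewrite mulr0 mul0r]].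
have [[a [b [Oa Ob nPb e]]]|[a [b [Pa Ob nPb e]]]] := poi_pruefer (rpred_div xL yL).
  by exists b; split=> //; left; exists a => //; rewrite -e mulrAC mulfVK // mulrC.
exists b; split=> //; right; exists a; first exact: poi_int.
by rewrite -e mulrAC mulfVK // mulrC.
Qed.

End PrimesOfIntegers.

(** * Places *)

Definition AintT := {x : algC | x \in Aint}.
HB.instance Definition _ := SubChoice.on AintT.
HB.instance Definition _ := [SubChoice_isSubComNzRing of AintT by <:].

Definition to_AintT (x : algC) : AintT := insubd (0 : AintT) x.

Lemma to_AintTK x : x \in Aint -> val (to_AintT x) = x.
Proof. by move=> xA; rewrite /to_AintT insubdK. Qed.
Lemma AintT_valP (a : AintT) : val a \in Aint. Proof. exact: valP. Qed.

Lemma AintT_valD (a b : AintT) : val (a + b) = val a + val b. Proof. by []. Qed.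
Lemma AintT_valM (a b : AintT) : val (a * b) = val a * val b. Proof. by []. Qed.

Lemma aut_int_proof (u : Caut) (a : AintT) : u (val a) \in Aint.
Proof. by rewrite Aint_aut; apply: valP. Qed.
Definition aut_int (u : Caut) (a : AintT) : AintT := Sub (u (val a)) (aut_int_proof u a).
Fact aut_int_zmod u : zmod_morphism (aut_int u).
Proof. by move=> a b; apply: val_inj; rewrite /= !raddfB. Qed.
Fact aut_int_monoid u : monoid_morphism (aut_int u).
Proof. by split=> [|a b]; apply: val_inj; rewrite /= ?rmorph1 ?rmorphM. Qed.
HB.instance Definition _ u := GRing.isZmodMorphism.Build AintT AintT (aut_int u) (aut_int_zmod u).
HB.instance Definition _ u := GRing.isMonoidMorphism.Build AintT AintT (aut_int u) (aut_int_monoid u).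

(** A nonzero prime of the ring of all algebraic integers: it chooses compatible primes in all
    subfields at once, so that inertia and decomposition are conditions on automorphisms of
    [algC]. *)
Record place := Place {
  plI :> AintT -> Prop;
  plP : is_prime (plI : set AintT);
  pl_char : exists2 l, prime l & plI l%:R }.

Section Residue.
Variable v : place.

Lemma pl_ideal : is_ideal (v : set AintT). Proof. by case: (plP v). Qed.
Lemma pl1 : ~ v 1. Proof. by case: (plP v). Qed.
Lemma pl_prime a b : v (a * b) -> v a \/ v b. Proof. by case: (plP v) => _ _; apply. Qed.

Definition place_pred : {pred AintT} := fun a => `[<v a>].
Fact place_pred_closed : idealr_closed place_pred.
Proof.
split=> [||a]; first exact/asboolP/(ideal0 pl_ideal).
  by apply/negP => /asboolP/pl1.
move=> x y /asboolP vx /asboolP vy; apply/asboolP.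
by apply: (idealD pl_ideal) => //; apply: (idealM _ pl_ideal).
Qed.
HB.instance Definition _ := isIdealr.Build AintT place_pred place_pred_closed.
Fact place_pred_prime : prime_idealr_closed place_pred.
Proof. by move=> a b /asboolP/pl_prime[h|h]; apply/orP; [left|right]; apply/asboolP. Qed.
HB.instance Definition _ := isPrimeIdealrClosed.Build AintT place_pred place_pred_prime.

Definition residue : comNzRingType := {ideal_quot place_pred}.
Definition red : {rmorphism AintT -> residue} := \pi_({ideal_quot place_pred}).

Lemma red0 a : red a = 0 <-> v a.
Proof.
rewrite -(rmorph0 red); split=> [/eqP|va]; last first.
  by apply/eqP; rewrite /red /= -Quotient.idealrBE subr0; apply/asboolP.
by rewrite /red /= -Quotient.idealrBE subr0 => /asboolP.
Qed.

Lemma red_surj (x : residue) : exists a, red a = x.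
Proof. by exists (repr x); rewrite /red /= reprK. Qed.

Lemma residue_dom (x y : residue) : x * y = 0 -> x = 0 \/ y = 0.
Proof.
have [a <-] := red_surj x; have [b <-] := red_surj y.
by rewrite -rmorphM => /red0/pl_prime[/red0|/red0]; [left|right].
Qed.
End Residue.

(** * Conjugacy of places and of residue homomorphisms *)

Section HomLift.
Variable k : comNzRingType.
Hypothesis domk : forall x y : k, x * y = 0 -> x = 0 \/ y = 0.

Lemma poly_domain (f g : {poly k}) : f * g = 0 -> f = 0 \/ g = 0.
Proof.
have [->|f0] := eqVneq f 0; first by left.
move=> fg; right; have lf : GRing.lreg f.
  apply/lreg_lead => x y e; apply/eqP; rewrite -subr_eq0; apply/eqP.
  have /domk[/eqP|//] : lead_coef f * (x - y) = 0 by rewrite mulrBr e subrr.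
  by rewrite lead_coef_eq0 (negPf f0).
by apply: lf; rewrite mulr0.
Qed.

Lemma poly_prod0 (T : eqType) (s : seq T) (f : T -> {poly k}) :
  \prod_(y <- s) f y = 0 -> exists2 y, y \in s & f y = 0.
Proof.
elim: s => [|y s IH]; first by rewrite big_nil => /eqP; rewrite oner_eq0.
rewrite big_cons => /poly_domain[h|/IH[z zs h]]; first by exists y; rewrite ?mem_head.
by exists z; rewrite ?inE ?zs ?orbT.
Qed.

Definition int_poly (xs : seq algC) : {poly AintT} := Poly (map to_AintT xs).

Lemma int_poly_aut (u : Caut) (xs : seq algC) : {in xs, forall x, x \in Aint} ->
  int_poly (map u xs) = map_poly (aut_int u) (int_poly xs).
Proof.
move=> xA; apply/polyP => i; rewrite coef_map !coef_Poly -map_comp.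
have [h|h] := ltnP i (size xs); last first.
    have -> : (map to_AintT xs)`_i = 0 by rewrite nth_default ?size_map.
    by rewrite nth_default ?size_map // raddf0.
have xiA := xA _ (mem_nth 0 h).
apply: val_inj; rewrite !(nth_map 0) //=.
by rewrite to_AintTK ?to_AintTK // Aint_aut.
Qed.

(* Galois group elements permute the conjugates of the polynomial with
   coefficients [xs]; its roots in [k[T]] detect the wanted automorphism on the
   finite set [xs], and a limit gives all of the ring. *)
Lemma hom_lift (D : set Caut) (h1 h2 : {rmorphism AintT -> k}) (xs : seq algC) : D idfun ->
  (forall u w : Caut, D u -> D w -> D (u \o w)) ->
  (forall c, (forall u, D u -> aut_int u c = c) -> h1 c = h2 c) ->
  {in xs, forall x, x \in Aint} ->
  exists2 u, D u & forall a : AintT, val a \in xs -> h2 a = h1 (aut_int u a).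
Proof.
move=> D1 DM h12 xA; have [ob [uo xo oD oP]] := orbit_seq xs D1 DM.
pose G : {poly {poly AintT}} := \prod_(ys <- ob) ('X - (int_poly ys)%:P).
have Gfix u : D u -> map_poly (map_poly (aut_int u)) G = G.
  move=> Du; rewrite rmorph_prod /= -[RHS](perm_big _ (oP u Du)) big_map /=.
  rewrite [LHS]big_seq_cond [RHS]big_seq_cond; apply: eq_bigr => ys /andP[/oD[w Dw ->] _].
  rewrite rmorphB /= map_polyX map_polyC (int_poly_aut u) // => _ /mapP[x /xA xAi ->].
  by rewrite Aint_aut.
have hG : map_poly (map_poly h1) G = map_poly (map_poly h2) G.
  apply/polyP => i; apply/polyP => j; rewrite !coef_map; apply: h12 => u Du.
  by have /polyP/(_ i)/polyP/(_ j) := Gfix u Du; rewrite !coef_map.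
have : (map_poly (map_poly h1) G).[map_poly h2 (int_poly xs)] = 0.
  rewrite hG rmorph_prod /= horner_prod (big_rem xs) //= rmorphB /= map_polyX map_polyC.
  by rewrite hornerXsubC subrr mul0r.
rewrite rmorph_prod /= horner_prod => /poly_prod0[ys yo].
rewrite rmorphB /= map_polyX map_polyC hornerXsubC => /eqP; rewrite subr_eq0 => /eqP e.
have [u Du yE] := oD ys yo; exists u => // a axs.
have [i ix ai] := nthP 0 axs; have : (map_poly h2 (int_poly xs))`_i = (map_poly h1 (int_poly ys))`_i by rewrite e.
rewrite yE (int_poly_aut u) // !coef_map /= coef_Poly (nth_map 0) // ai.
by rewrite /to_AintT valKd.
Qed.

(** The product [g] of the conjugates of the polynomial with coefficients [xs] has coefficients in
    [Q] fixed by [D], so [h] kills it. Polynomials over the domain [k] have no zero divisors, so one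
    conjugate is killed. *)
Lemma norm_lift (D : set Caut) (Q : set AintT) (h : {rmorphism AintT -> k}) (xs : seq algC) : D idfun ->
  (forall u w : Caut, D u -> D w -> D (u \o w)) -> is_ideal Q ->
  (forall c, Q c -> (forall u, D u -> aut_int u c = c) -> h c = 0) ->
  {in xs, forall x, x \in Aint /\ Q (to_AintT x)} ->
  exists2 u, D u & forall a : AintT, val a \in xs -> h (aut_int u a) = 0.
Proof.
move=> D1 DM iQ hQ xQ; have xA : {in xs, forall x, x \in Aint} by move=> x /xQ[].
have [ob [uo xo oD oP]] := orbit_seq xs D1 DM.
pose g : {poly AintT} := \prod_(ys <- ob) int_poly ys.
have gfix u : D u -> map_poly (aut_int u) g = g.
  move=> Du; rewrite rmorph_prod /= -[RHS](perm_big _ (oP u Du)) big_map /=.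
  rewrite [LHS]big_seq_cond [RHS]big_seq_cond; apply: eq_bigr => ys /andP[/oD[w Dw ->] _].
  rewrite (int_poly_aut u) // => _ /mapP[x /xA xAi ->].
  by rewrite Aint_aut.
have gQ i : Q g`_i.
  rewrite /g (big_rem xs) //= coefM; apply: (ideal_sum iQ) => j; apply: (idealMr _ iQ).
  rewrite coef_Poly; have [hj|hj] := ltnP j (size xs); last by rewrite nth_default ?size_map //; apply: ideal0.
  by rewrite (nth_map 0) //; case: (xQ _ (mem_nth 0 hj)).
have : map_poly h g = 0.
  apply/polyP => i; rewrite coef_map coef0; apply: hQ => // u Du.
  by have /polyP/(_ i) := gfix u Du; rewrite coef_map.
rewrite rmorph_prod => /poly_prod0[ys /oD[u Du ->]] e; exists u => // a axs.
have [i ix ai] := nthP 0 axs; have : (map_poly h (int_poly (map u xs)))`_i = 0 by rewrite -[RHS](coef0 _ i) -e.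
rewrite (int_poly_aut u) // !coef_map /= coef_Poly (nth_map 0) // ai.
by rewrite /to_AintT valKd.
Qed.
End HomLift.

Lemma ulim_fixer (L : {pred algC}) (F : set_system nat) (s : nat -> Caut) (u : Caut) :
  UltraFilter F -> (forall x, F [set n | s n x = u x]) -> (forall n, fixer L (s n)) -> fixer L u.
Proof. by move=> FU su sL x xL; have [n <-] := filter_ex (su x); apply: sL. Qed.

Definition first_A n : seq algC := [seq x <- first_C n | x \in Aint].

Lemma mem_first_A (a : AintT) : exists m, forall n, (m <= n)%N -> val a \in first_A n.
Proof.
have [m mP] := mem_first_C (val a); exists m => n /mP h.
by rewrite mem_filter AintT_valP.
Qed.

Lemma aut_int_lim (F : set_system nat) (s : nat -> Caut) (u : Caut) (a : AintT) :
  (forall x, F [set n | s n x = u x]) -> UltraFilter F ->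
  F [set n | aut_int (s n) a = aut_int u a].
Proof. by move=> su FU; apply: filterS (su (val a)) => n /= e; apply: val_inj. Qed.

Lemma fixed_in_field (L : divringClosed algC) (c : AintT) :
  (forall u, fixer L u -> aut_int u c = c) -> val c \in L.
Proof. by move=> h; apply: fixed_mem => u /h/(congr1 val). Qed.

Lemma fixer_comp L (u w : Caut) : fixer L u -> fixer L w -> fixer L (u \o w).
Proof. exact: fixerM. Qed.

Lemma hom_conjugate (k : comNzRingType) (L : divringClosed algC)
    (h1 h2 : {rmorphism AintT -> k}) :
  (forall x y : k, x * y = 0 -> x = 0 \/ y = 0) ->
  (forall c : AintT, val c \in L -> h1 c = h2 c) ->
  exists2 u, fixer L u & forall a, h2 a = h1 (aut_int u a).
Proof.
move=> domk h12.
have st n : exists2 u, fixer L u & forall a : AintT, val a \in first_A n -> h2 a = h1 (aut_int u a).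
  apply: hom_lift => //; first exact: fixer_comp.
    by move=> c /fixed_in_field/h12.
  by move=> x; rewrite mem_filter => /andP[].
have [F [FU Fc]] := free_ultra; pose s n := projT1 (cid2 (st n)).
have [u su] := ulim_aut s FU; exists u.
  by apply: ulim_fixer su _ => n; rewrite /s; case: cid2.
move=> a; have [m mP] := mem_first_A a.
have [n [/= mn <-]] := filter_ex (filterI (Fc m) (aut_int_lim a su FU)).
by rewrite /s; case: cid2 => /= w _; apply; apply: mP.
Qed.

(** Transitivity of the Galois group over [L] on the primes above a given one: [norm_lift] on finite
    sets, then a limit. *)
Lemma subplace_conjugate (v : place) (L : divringClosed algC) (Q : set AintT) : is_ideal Q ->
  (forall c : AintT, Q c -> val c \in L -> v c) ->
  exists2 u, fixer L u & forall a, Q a -> v (aut_int u a).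
Proof.
move=> iQ hQ.
have st n : exists2 u, fixer L u & forall a : AintT, Q a -> val a \in first_A n -> v (aut_int u a).
  have [] := @norm_lift _ (@residue_dom v) (fixer L) Q (red v)
    [seq x <- first_A n | `[<Q (to_AintT x)>]] _ _ iQ _ _ => //.
  - exact: fixer_comp.
  - by move=> c Qc /fixed_in_field cL; apply/red0/hQ.
  - by move=> x; rewrite !mem_filter => /andP[/asboolP Qx /andP[xA _]].
  move=> u uL uP; exists u => // a Qa an; apply/red0/uP; rewrite mem_filter an andbT.
  by apply/asboolP; rewrite /to_AintT valKd.
have [F [FU Fc]] := free_ultra; pose s n := projT1 (cid2 (st n)).
have [u su] := ulim_aut s FU; exists u.
  by apply: ulim_fixer su _ => n; rewrite /s; case: cid2.
move=> a Qa; have [m mP] := mem_first_A a.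
have [n [/= mn <-]] := filter_ex (filterI (Fc m) (aut_int_lim a su FU)).
by rewrite /s; case: cid2 => /= w _ wP; apply: wP => //; apply: mP.
Qed.

Lemma iter_aut (u : Caut) n : exists w : Caut, forall x, w x = iter n u x.
Proof.
elim: n => [|n [w wE]]; first by exists idfun.
by exists (u \o w) => x /=; rewrite wE.
Qed.

Lemma aut_finite_order (u : Caut) (xs : seq algC) :
  exists2 n, (0 < n)%N & forall x, x \in xs -> iter n u x = x.
Proof.
have [s sP] := conj_finite_seq xs.
pose f n := map (iter n u) xs.
have fs n : f n \in s.
  by have [w wE] := iter_aut u n; rewrite /f -(eq_map wE); apply: sP.
have [i [j [ij e]]] : exists i j, (i < j)%N /\ f i = f j.
  apply: contrapT => no; have inj : injective (fun i : 'I_(size s).+1 => f i).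
    move=> i j e; apply: contrapT => /eqP; rewrite -val_eqE neq_ltn => /orP[h|h].
      by apply: no; exists i, j.
    by apply: no; exists j, i.
  have := @uniq_leq_size _ [seq f i | i : 'I_(size s).+1] s.
  rewrite map_inj_uniq ?enum_uniq // size_map size_enum_ord ltnn => h.
  by have : false by apply: h => // _ /mapP[i _ ->].
exists (j - i)%N; first by rewrite subn_gt0.
move=> x xs_; have : iter i u x = iter j u x by move/eq_in_map: e; apply.
rewrite -[in iter j](subnKC (ltnW ij)) iterD => /esym.
have inj m : injective (iter m u) by elim: m => [|m IH] // y z /= /fmorph_inj/IH.
exact: inj.
Qed.

(** Reduction, and reduction followed by the l-power map, agree on the integers; so they differ by
    an automorphism of [algC]. *)
Lemma frobenius (v : place) : exists l (u : Caut), prime l /\ forall a, v (aut_int u a - a ^+ l).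
Proof.
have [l pl vl] := pl_char v.
have lk : l \in [pchar (residue v)].
  by apply/andP; split=> //; apply/eqP; rewrite -(rmorph_nat (red v)); apply/red0.
pose h2 : {rmorphism AintT -> residue v} := pFrobenius_aut lk \o red v.
have [c cQ|u _ uP] := @hom_conjugate _ Crat (red v) h2 (@residue_dom v).
  have /intrP[m cE] := Cint_rat_Aint cQ (AintT_valP c).
  have -> : c = m%:~R by apply: val_inj; rewrite cE rmorph_int.
  by rewrite !rmorph_int.
exists l, u; split=> // a; apply/red0; rewrite rmorphB rmorphXn /= -uP /= pFrobenius_autE.
by rewrite subrr.
Qed.

Lemma frobenius_iter (v : place) l (u : Caut) (a : AintT) m :
  (forall b, v (aut_int u b - b ^+ l)) -> red v (iter m (aut_int u) a) = red v a ^+ (l ^ m).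
Proof.
move=> h; elim: m => [//|m IH].
rewrite iterS expnSr exprM -IH -rmorphXn; apply/eqP; rewrite -subr_eq0 -rmorphB.
exact/eqP/red0/h.
Qed.

Lemma iter_aut_int (u : Caut) m a : val (iter m (aut_int u) a) = iter m u (val a).
Proof. by elim: m => //= m ->. Qed.

(** Nonzero primes are maximal: some iterate of a Frobenius fixes [a], so the residue of [a] equals
    a proper power of itself and a (1 - a^(q+1)) lies in [v]. *)
Lemma place_max (v w : place) : (forall a, v a -> w a) -> forall a, w a -> v a.
Proof.
move=> vw a wa; have [l [u [pl lu]]] := frobenius v.
have [n n0 nP] := aut_finite_order u [:: val a].
have : red v a = red v a ^+ (l ^ n).
  by rewrite -(frobenius_iter _ _ lu); congr (red v _); apply: val_inj; rewrite iter_aut_int nP ?mem_head.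
have : (1 < l ^ n)%N by rewrite -(expn0 l) ltn_exp2l ?prime_gt1.
case: (l ^ n)%N => [//|[//|q]] _ e.
have : v (a * (1 - a ^+ q.+1)).
  by apply/red0; rewrite mulrBr mulr1 -exprS rmorphB rmorphXn /= -e subrr.
case/pl_prime => // /vw w1; case: (@pl1 w).
by rewrite -[1](subrK (a ^+ q.+1)); apply: (idealD (pl_ideal w)) => //; rewrite exprSr; apply: (idealM _ (pl_ideal w)).
Qed.

Definition trace (v : place) (L : {pred algC}) : set algC :=
  [set x | x \in L /\ exists2 a, val a = x & v a].

Lemma traceP (v : place) (L : {pred algC}) (a : AintT) : trace v L (val a) <-> val a \in L /\ v a.
Proof.
split=> [[aL [b bE vb]]|[aL va]]; first by rewrite -(val_inj bE) in aL *.
by split=> //; exists a.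
Qed.

Lemma trace_prime v (L : divringClosed algC) : prime_of_integers L (trace v L).
Proof.
have [l pl vl] := pl_char v; have vI := pl_ideal v; split.
- split; first by move=> x [xL [a aE _]]; split=> //; rewrite -aE; apply: AintT_valP.
  exists l%:R; last by rewrite pnatr_eq0 -lt0n prime_gt0.
  by split; [apply: rpred_nat|exists l%:R => //; rewrite rmorph_nat].
- move=> x y [xL [a aE va]] [yL [b bE vb]]; split; first exact: rpredD.
  by exists (a + b); [rewrite /= aE bE|apply: (idealD vI)].
- move=> x y xL xA [bL [b bE vb]]; split; first exact: rpredM.
  by exists (to_AintT x * b); [rewrite /= to_AintTK ?bE|apply: (idealM _ vI)].
- by move=> [_ [a a1 va]]; case: (@pl1 v); rewrite (_ : 1 = a) //; apply: val_inj; rewrite a1.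
- move=> x y xL xA yL yA [_ [c cE vc]]; have vxy : v (to_AintT x * to_AintT y).
    by rewrite (_ : _ * _ = c) //; apply: val_inj; rewrite /= !to_AintTK.
  by case/pl_prime: vxy => h; [left|right]; (split=> //; (exists (to_AintT x) + exists (to_AintT y)) => //; rewrite to_AintTK).
Qed.

(** [I] is the extension of [P] to all integers, localized at [P]. It is closed under addition with
    a single generator from [P] because, by the valuation property, any two elements of [P] are
    comparable. A prime containing [I] and disjoint from the complement of [P] lies over [P]. *)
Lemma lying_over (L : divringClosed algC) (P : set algC) : prime_of_integers L P ->
  exists v : place, forall a : AintT, val a \in L -> (v a <-> P (val a)).
Proof.
move=> hP; pose O (x : algC) := x \in L /\ x \in Aint.
pose I : set AintT := [set a | exists s q (b : AintT), [/\ O s, ~ P s, P q & s * val a = q * val b]].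
pose S : set AintT := [set a | val a \in L /\ ~ P (val a)].
have nPM s t : O s -> O t -> ~ P s -> ~ P t -> ~ P (s * t).
  by move=> Os Ot ns nt /(poi_prime hP Os Ot)[].
have iI : is_ideal I.
  split.
  - by exists 1, 0, 0; split; [exact: (OL_int _ 1)|exact: (poi1 hP)|exact: (poi0 hP)|rewrite mulr0 mul0r].
  - move=> a b [s [x [a' [Os nPs Px ea]]]] [t [y [b' [Ot nPt Py eb]]]].
    have [r [Or nPr [[c [cL cA] e]|[c [cL cA] e]]]] := poi_compare hP Px Py.
      exists (s * t * r), y, (to_AintT (t * c) * a' + to_AintT (s * r) * b').
      have [[[sL sA] [tL tA]] [rL rA]] := (Os, Ot, Or).
      split=> //; [by apply: OL_M => //; apply: OL_M|by apply: (nPM _ _ _ _ (nPM _ _ _ _ nPs nPt)) => //; apply: OL_M|].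
      rewrite !(AintT_valD, AintT_valM) !to_AintTK ?rpredM // !mulrDr.
      rewrite (_ : s * t * r * val a = t * r * (s * val a)); last by ring.
      rewrite (_ : s * t * r * val b = s * r * (t * val b)); last by ring.
      rewrite ea eb (_ : t * r * (x * _) = t * (r * x) * val a'); last by ring.
      by rewrite e; ring.
    exists (s * t * r), x, (to_AintT (t * r) * a' + to_AintT (s * c) * b').
    have [[[sL sA] [tL tA]] [rL rA]] := (Os, Ot, Or).
    split=> //; [by apply: OL_M => //; apply: OL_M|by apply: (nPM _ _ _ _ (nPM _ _ _ _ nPs nPt)) => //; apply: OL_M|].
    rewrite !(AintT_valD, AintT_valM) !to_AintTK ?rpredM // !mulrDr.
    rewrite (_ : s * t * r * val a = t * r * (s * val a)); last by ring.
    rewrite (_ : s * t * r * val b = s * r * (t * val b)); last by ring.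
    rewrite ea eb (_ : s * r * (y * _) = s * (r * y) * val b'); last by ring.
    by rewrite e; ring.
  - move=> c a [s [x [a' [Os nPs Px ea]]]]; exists s, x, (c * a'); split=> //.
    by rewrite /= mulrCA ea mulrCA.
have PI (a : AintT) : P (val a) -> I a.
  by move=> Pa; exists 1, (val a), 1; split; [exact: (OL_int _ 1)|exact: (poi1 hP)|done|rewrite mul1r mulr1].
have disj a : I a -> ~ S a.
  move=> [s [x [b [Os nPs Px e]]]] [aL nPa].
  have Oa : O (val a) by split=> //; apply: AintT_valP.
  apply: (nPM _ _ Os Oa nPs nPa); have [x0|x0] := eqVneq x 0.
    by rewrite e x0 mul0r; apply: (poi0 hP).
  rewrite e mulrC; apply: (poiM hP) => //; split; last exact: AintT_valP.
  have [xL _] := poi_int hP Px; rewrite (_ : val b = s * val a / x) ?rpred_div ?rpredM //; first by case: Os.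
  by rewrite e mulrAC divff // mul1r.
have [|a b [aL na] [bL nb]|Q [primeQ IQ QS]] := @max_disjoint_prime AintT S I _ _ iI disj.
- by split; [apply: rpred1|apply: (poi1 hP)].
- split; first exact: rpredM.
  by apply: nPM => //; split=> //; apply: AintT_valP.
have [l pl Pl] := poi_char hP.
have Ql : Q l%:R by apply/IQ/PI; rewrite rmorph_nat.
exists (@Place Q primeQ (ex_intro2 _ _ l pl Ql)) => a aL /=; split=> [Qa|/PI/IQ//].
by apply: contrapT => nPa; apply: (QS a Qa).
Qed.

Lemma twist_prime (u : Caut) (v : place) : is_prime [set a | v (aut_int u a)].
Proof.
split.
- split=> [|a b va vb|a b vb] /=.
  + by rewrite (rmorph0 (aut_int u)); exact: (ideal0 (pl_ideal v)).
  + by rewrite (rmorphD (aut_int u)); apply: (idealD (pl_ideal v)).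
  + by rewrite (rmorphM (aut_int u)); apply: (idealM _ (pl_ideal v)).
- by rewrite /= rmorph1; apply: pl1.
- by move=> a b /=; rewrite rmorphM => /pl_prime.
Qed.
Lemma twist_char (u : Caut) (v : place) : exists2 l, prime l & v (aut_int u l%:R).
Proof. by have [l pl vl] := pl_char v; exists l => //; rewrite rmorph_nat. Qed.
Definition twist (u : Caut) (v : place) := @Place [set a | v (aut_int u a)] (twist_prime u v) (twist_char u v).

(** * Inertia, decomposition and the valuation ring of a place *)

Definition inertia (v : place) : set Caut := [set u : Caut | forall a, v (aut_int u a - a)].
Definition decomp (v : place) : set Caut := [set u : Caut | forall a, v (aut_int u a) <-> v a].

Lemma inertia_decomp v u : inertia v u -> decomp v u.
Proof.
move=> iu a; have vI := pl_ideal v; split=> h.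
  by rewrite -[a](subKr (aut_int u a)); apply: (idealB vI) => //; apply: iu.
by rewrite -[aut_int u a](subrK a); apply: (idealD vI) => //; apply: iu.
Qed.

Lemma inertiaM v u w : inertia v u -> inertia v w -> inertia v (u \o w).
Proof.
move=> iu iw a; have vI := pl_ideal v.
have -> : aut_int (u \o w) a = aut_int u (aut_int w a) by apply: val_inj.
by rewrite -[_ - a](subrKA (aut_int w a)); apply: (idealD vI).
Qed.
Lemma inertiaV v (u w : Caut) : inertia v u -> cancel w u -> inertia v w.
Proof.
move=> iu wu a; have := iu (aut_int w a).
have -> : aut_int u (aut_int w a) = a by apply: val_inj => /=; apply: wu.
by move/(idealN (pl_ideal v)); rewrite opprB.
Qed.

Section ValuationRing.
Variable v : place.
Let vI := pl_ideal v.

(* [maxv], [unitv], [onev]: the maximal ideal, the units and the principal units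
   of the valuation ring of [v]. *)
Definition maxv (x : algC) := exists a b : AintT, [/\ v a, ~ v b & x * val b = val a].
Definition unitv (x : algC) := exists a b : AintT, [/\ ~ v a, ~ v b & x * val b = val a].
Definition onev (x : algC) := exists a b : AintT, [/\ ~ v b, v (a - b) & x * val b = val a].

Lemma pl_not_mul a b : ~ v a -> ~ v b -> ~ v (a * b).
Proof. by move=> na nb /pl_prime[]. Qed.

Lemma nv0 (a : AintT) : ~ v a -> val a != 0.
Proof.
move=> na; apply/eqP => a0; apply: na; rewrite (_ : a = 0); first exact: (ideal0 vI).
exact: val_inj.
Qed.

Lemma valuation_cases (x : algC) : [\/ maxv x, unitv x | maxv x^-1].
Proof.
(* The valuation property is applied to [algC] as a subfield of itself. *)
pose full : {pred algC} := fun _ => true.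
have fullP : divring_closed full by [].
pose full1 := GRing.isDivringClosed.Build algC full fullP.
pose L : divringClosed algC := HB.pack full full1.
have [[a [b [[_ aA] [_ bA] nb e]]]|[a [b [Pa [_ bA] nb e]]]] := poi_pruefer (trace_prime v L) (isT : x \in L).
  have {}nb : ~ v (to_AintT b).
    by move=> h; apply: nb; rewrite -(to_AintTK bA); apply/traceP.
  have [va|nva] := pselect (v (to_AintT a)).
    by apply: Or31; exists (to_AintT a), (to_AintT b); rewrite !to_AintTK.
  by apply: Or32; exists (to_AintT a), (to_AintT b); rewrite !to_AintTK.
move: Pa => [_ [a' aE va]]; apply: Or33; exists a', (to_AintT b).
have {}nb : ~ v (to_AintT b).
  by move=> h; apply: nb; rewrite -(to_AintTK bA); apply/traceP.
split=> //; rewrite to_AintTK // -e aE mulKf //; apply/eqP => x0.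
by have := nv0 nb; rewrite to_AintTK // -e x0 mul0r eqxx.
Qed.

Lemma maxvM x y : maxv x -> maxv y -> maxv (x * y).
Proof.
move=> [a [b [va nb e]]] [c [d [vc nd e']]]; exists (a * c), (b * d).
by split; [apply: (idealM _ vI)|apply: pl_not_mul|rewrite /= -e -e' mulrACA].
Qed.
Lemma maxv1 : ~ maxv 1.
Proof. by move=> [a [b [va nb]]]; rewrite mul1r => /val_inj e; apply: nb; rewrite e. Qed.
Lemma maxv_aut (u : Caut) x : decomp v u -> maxv x -> maxv (u x).
Proof.
move=> du [a [b [va nb e]]]; exists (aut_int u a), (aut_int u b).
by split; [apply/du|move=> /du|rewrite /= -e rmorphM].
Qed.

(** If u x / x were in the maximal ideal, so would be the product of its conjugates under powers of
    [u], namely u^n x / x; this is 1 when u^n fixes [x]. *)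
Lemma not_maxv_ratio (u : Caut) (x : algC) : decomp v u -> x != 0 -> ~ maxv (u x / x).
Proof.
move=> du x0 h; have [n n0 nP] := aut_finite_order u [:: x].
have key m : maxv (iter m.+1 u x / x).
  elim: m => [//|m IH]; rewrite (_ : _ / x = u (iter m.+1 u x / x) * (u x / x)).
    by apply: maxvM => //; apply: maxv_aut.
  by rewrite fmorph_div mulrA mulfVK // fmorph_eq0.
have := key n.-1; rewrite prednK // nP ?mem_head // divff //; exact: maxv1.
Qed.

Lemma unitv_ratio (u : Caut) (x : algC) : decomp v u -> x != 0 -> unitv (u x / x).
Proof.
move=> du x0; have [h|//|h] := valuation_cases (u x / x).
  by case: (not_maxv_ratio du x0 h).
case: (@not_maxv_ratio u x^-1 du); rewrite ?invr_eq0 //.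
by rewrite fmorphV invrK mulrC -invf_div.
Qed.

Lemma onev1 : onev 1.
Proof. by exists 1, 1; rewrite subrr; split; [exact: pl1|exact: (ideal0 vI)|rewrite mul1r]. Qed.
Lemma onevM x y : onev x -> onev y -> onev (x * y).
Proof.
move=> [a [b [nb vab e]]] [c [d [nd vcd e']]]; exists (a * c), (b * d).
split; [exact: pl_not_mul| |by rewrite /= -e -e' mulrACA].
have -> : a * c - b * d = (a - b) * c + b * (c - d) by ring.
by apply: (idealD vI); [apply: (idealMr _ vI)|apply: (idealM _ vI)].
Qed.
Lemma onevV x : onev x -> onev x^-1.
Proof.
move=> [a [b [nb vab e]]]; have na : ~ v a.
  by move=> va; apply: nb; rewrite -[b](subKr a); apply: (idealB vI).
exists b, a; split=> //; first by rewrite -opprB; apply: (idealN vI).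
by rewrite -e mulKf //; apply/eqP => x0; have := nv0 na; rewrite -e x0 mul0r eqxx.
Qed.
Lemma onev_div_trans x y z : y != 0 -> onev (x / y) -> onev (y / z) -> onev (x / z).
Proof. by move=> y0 h h'; have := onevM h h'; rewrite mulrA mulfVK. Qed.

(* [phi y] is congruent to [y ^+ q] when [phi] induces the [q]-power map on the
   residue field; the case [q = 1] is that of inertia. *)
Lemma onev_frobenius (phi : Caut) q y : (forall a, v (aut_int phi a - a ^+ q)) -> unitv y ->
  onev (phi y / y ^+ q).
Proof.
move=> hq [a [b [na nb e]]].
have np c : ~ v c -> ~ v (c ^+ q).
  move=> nc; elim: (q) => [|m IH]; first by rewrite expr0; exact: pl1.
  by rewrite exprS; apply: pl_not_mul.
have nphi : ~ v (aut_int phi b).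
  move=> vb; apply: (np b nb); rewrite -[_ ^+ q](subKr (aut_int phi b)).
  by apply: (idealB vI).
have y0 : y != 0 by apply/eqP => y0; have := nv0 na; rewrite -e y0 mul0r eqxx.
exists (aut_int phi a * b ^+ q), (aut_int phi b * a ^+ q); split.
- exact/pl_not_mul/np.
- have -> : aut_int phi a * b ^+ q - aut_int phi b * a ^+ q =
    (aut_int phi a - a ^+ q) * b ^+ q - (aut_int phi b - b ^+ q) * a ^+ q by ring.
  by apply: (idealB vI); apply: (idealMr _ vI).
- rewrite !rmorphM !rmorphXn /= -e rmorphM exprMn; field.
  by rewrite expf_neq0.
Qed.

(** Each summand is 1 in the residue field, so the sum reduces to [n]. *)
Lemma onev_sum0 n (e : nat -> algC) : (forall j, onev (e j)) -> \sum_(j < n) e j = 0 -> v n%:R.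
Proof.
move=> eP; suff [a [b [nb vab E]]] : exists a b : AintT, [/\ ~ v b, v (a - n%:R * b) &
    (\sum_(j < n) e j) * val b = val a].
  move=> s0; have a0 : a = 0 by apply: val_inj; rewrite -E s0 mul0r.
  move: vab; rewrite a0 sub0r => /(idealN vI); rewrite opprK => /pl_prime[] //.
elim: n => [|n [a [b [nb vab E]]]].
  by exists 0, 1; rewrite big_ord0 mul0r mul0r subrr; split; [exact: pl1|exact: (ideal0 vI)|].
have [c [d [nd vcd E']]] := eP n; exists (a * d + b * c), (b * d); split.
- exact: pl_not_mul.
- have -> : a * d + b * c - n.+1%:R * (b * d) = (a - n%:R * b) * d + b * (c - d).
    by rewrite -natr1; ring.
  by apply: (idealD vI); [apply: (idealMr _ vI)|apply: (idealM _ vI)].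
- by rewrite big_ord_recr !(AintT_valD, AintT_valM) -E -E' /=; ring.
Qed.
End ValuationRing.

Lemma onev_aut v (u : Caut) x : decomp v u -> onev v x -> onev v (u x).
Proof.
move=> du [a [b [nb vab e]]]; exists (aut_int u a), (aut_int u b); split.
- by move/du.
- by rewrite -rmorphB; apply/du.
- by rewrite /= -e rmorphM.
Qed.

Lemma onevX v x n : onev v x -> onev v (x ^+ n).
Proof. by move=> h; elim: n => [|n IH]; [exact: onev1|rewrite exprS; apply: onevM]. Qed.

(* Frobenius conjugation raises the tame character of an inertial [s] to the
   [Q]-th power and fixes it since [K/k] is abelian; so [s ^+ (Q - 1)] is wild,
   hence trivial, being of [p]-power order. *)
Lemma tame_inertia (v : place) (k K : divringClosed algC) p (s : Caut) : prime p -> ~ v p%:R ->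
  (exists bs : seq algC, forall u : Caut, (forall b, b \in bs -> u b = b) -> fixer k u) ->
  (forall u w, fixer k u -> fixer k w -> forall x, x \in K -> u (w x) = w (u x)) ->
  (forall u, fixer k u -> stable K u) ->
  (forall u, fixer k u -> forall x, x \in K -> exists m, iter (p ^ m) u x = x) ->
  (forall u n, fixer k u -> (0 < n)%N -> (forall x, x \in K -> iter n u x = x) ->
     forall x, x \in K -> u x = x) ->
  fixer k s -> inertia v s -> forall x, x \in K -> s x = x.
Proof.
move=> pp nvp [bs bsP] comm st pow tf sk sI; have sD := inertia_decomp sI.
have [l [u [pl lu]]] := frobenius v; have [m m0 mP] := aut_finite_order u bs.
have [phi phiE] := iter_aut u m.
have phik : fixer k phi by apply: bsP => b bb; rewrite phiE mP.
have phiI a : aut_int phi a = iter m (aut_int u) a.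
  by apply: val_inj; rewrite iter_aut_int /= phiE.
have [q Q q0] : exists2 q, (l ^ m)%N = q.+1 & (0 < q)%N.
  have : (1 < l ^ m)%N by rewrite -(expn0 l) ltn_exp2l ?prime_gt1.
  by case: (l ^ m)%N => [//|[//|q]] _; exists q.+1.
have hphi a : v (aut_int phi a - a ^+ q.+1).
  by apply/red0; rewrite rmorphB phiI (frobenius_iter _ _ lu) rmorphXn -Q subrr.
have phiD : decomp v phi.
  move=> a; have vI := pl_ideal v; split=> h.
    have : v (a ^+ q.+1) by rewrite -[_ ^+ _](subKr (aut_int phi a)); apply: (idealB vI).
    by elim: (q.+1) => [/pl1//|n IH]; rewrite exprS => /pl_prime[].
  rewrite -[aut_int phi a](subrK (a ^+ q.+1)); apply: (idealD vI) => //.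
  by rewrite exprSr; apply: (idealM _ vI).
have sI1 a : v (aut_int s a - a ^+ 1) by rewrite expr1; apply: sI.
have sq x : x \in K -> x != 0 -> onev v (iter q s x / x).
  move=> xK x0; set y := s x / x.
  have yU : unitv v y by apply: unitv_ratio.
  have y0 : y != 0 by rewrite mulf_neq0 ?invr_eq0 ?fmorph_eq0.
  have wU : unitv v (phi x / x) by apply: unitv_ratio.
  (* Commutation of [s] and [phi] at [x] reads s w / w = phi y / y with w = phi x / x. The left side
     is a principal unit by inertia, and phi y is congruent to y^(q+1). *)
  have yq : onev v (y ^+ q).
    have h1 := onev_frobenius sI1 wU; have h2 := onevV (onev_frobenius hphi yU).
    suff -> : y ^+ q = s (phi x / x) / (phi x / x) ^+ 1 * (phi y / y ^+ q.+1)^-1.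
      exact: onevM.
    have -> : phi y = phi (s x) / phi x by rewrite fmorph_div.
    rewrite expr1 exprS fmorph_div (comm s phi) // {2}/y.
    have : y ^+ q != 0 by rewrite expf_neq0.
    move: (y ^+ q) => z z0; field.
    by rewrite z0 !fmorph_eq0 x0.
  have En n : onev v (iter n s x / x / y ^+ n).
    elim: n => [|n IH]; first by rewrite expr0 divr1 divff //; exact: onev1.
    have h := onevX n (onev_frobenius sI1 yU).
    suff -> : iter n.+1 s x / x / y ^+ n.+1 = s (iter n s x / x / y ^+ n) * (s y / y ^+ 1) ^+ n.
      exact: onevM (onev_aut sD IH) h.
    have sxE : s x = y * x by rewrite /y mulfVK.
    clearbody y; rewrite (fmorph_div s (_ / x)) (fmorph_div s _ x) (rmorphXn s) sxE expr1.
    rewrite expr_div_n iterS (exprS y).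
    have : y ^+ n != 0 by rewrite expf_neq0.
    have : s y ^+ n != 0 by rewrite expf_neq0 ?fmorph_eq0.
    move: (y ^+ n) (s y ^+ n) => z w w0 z0; field.
    by rewrite w0 z0 x0 y0.
  by have := onevM (En q) yq; rewrite mulfVK // expf_neq0.
have [s' s'E] := iter_aut s q.
have s'k : fixer k s'.
  by move=> x xk; rewrite s'E; elim: (q) => //= n ->; apply: sk.
have iterK n x : x \in K -> iter n s' x \in K.
  by move=> xK; elim: n => //= n IH; apply: st.
apply: (tf s q) => // x xK; rewrite -s'E; apply: contrapT => /eqP; rewrite -subr_eq0 => u0.
have uK : s' x - x \in K by rewrite rpredB // st.
have [N NP] := pow s' s'k x xK.
have iB n a b : iter n s' (a - b) = iter n s' a - iter n s' b.
  by elim: n => //= n ->; rewrite rmorphB.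
have i0 n : iter n s' (s' x - x) != 0 by elim: n => //= n IH; rewrite fmorph_eq0.
have onej j : onev v (iter j s' (s' x - x) / (s' x - x)).
  elim: j => [|j IH] /=; first by rewrite divff //; exact: onev1.
  apply: onev_div_trans IH => //; rewrite s'E; apply: sq => //; exact: iterK.
(* The iterates of s' x - x telescope to 0 over a full period p^N, while their ratios to s' x - x
   are principal units; hence [v] would contain p^N. *)
have : \sum_(j < p ^ N) iter j s' (s' x - x) / (s' x - x) = 0.
  have tele n : \sum_(j < n) iter j s' (s' x - x) = iter n s' x - x.
    elim: n => [|n IH]; first by rewrite big_ord0 /= subrr.
    by rewrite big_ord_recr /= IH iB -iterSr /= addrC subrKA.
  by rewrite -mulr_suml tele NP subrr mul0r.
move/(onev_sum0 (e := fun j => iter j s' (s' x - x) / (s' x - x)) onej) => vp.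
by elim: N vp {NP} => [/pl1//|N IH]; rewrite expnS natrM => /pl_prime[].
Qed.

Section FiniteGroups.
Import fingroup.fingroup cyclic pgroup.

Lemma ordinal_group_powers N (mul : 'I_N -> 'I_N -> 'I_N) (one : 'I_N) (inv : 'I_N -> 'I_N) :
  associative mul -> left_id one mul -> left_inverse one inv mul ->
  (forall x, iter N (mul x) one = one) /\
  (forall q, prime q -> (q %| N)%N -> exists2 x, x <> one & iter q (mul x) one = one).
Proof.
move=> mA m1 mV; pose m := Finite_isGroup.Build 'I_N mA m1 mV.
pose gT : finGroupType := HB.pack 'I_N m.
have E n (x : gT) : iter n (mul x) one = (x ^+ n)%g.
  by elim: n => [|n IH] //=; rewrite IH expgS.
have c : #|[set: gT]%G| = N by rewrite cardsT card_ord.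
split=> [x|q pq qN].
  by rewrite (E N x) -[N in (_ ^+ N)%g]c expg_cardG // finset.inE.
have [|x _ xq] := @Cauchy _ q [set: gT]%G pq; first by rewrite c.
exists x; last by rewrite (E q x) -xq expg_order.
by move=> x1; move: xq; rewrite x1 order1 => q1; rewrite -q1 in pq.
Qed.

(** Lagrange's and Cauchy's theorems, transported along a bijection with the ordinals below [N]. *)
Lemma finite_group_powers (T : Type) N (mul : T -> T -> T) (one : T) (inv : T -> T) :
  ([set: T] #= `I_N)%card ->
  associative mul -> left_id one mul -> left_inverse one inv mul ->
  (forall x, iter N (mul x) one = one) /\
  (forall q, prime q -> (q %| N)%N -> exists2 x, x <> one & iter q (mul x) one = one).
Proof.
move=> /card_set_bijP[f [fI finj fsurj]] mA m1 mV.
have fN x : (f x < N)%N by exact: (fI x).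
pose r x := Ordinal (fN x).
have hs (i : 'I_N) : exists x, f x = i by have [x _ xi] := fsurj i (ltn_ord i); exists x.
pose h i := projT1 (cid (hs i)).
have hK i : r (h i) = i by apply: val_inj => /=; rewrite /h; case: cid.
have rK x : h (r x) = x.
  have e : f (h (r x)) = f x := congr1 (@nat_of_ord N) (hK (r x)).
  exact: (finj _ _ (mem_set Logic.I) (mem_set Logic.I) e).
have [||| h1 h2] := @ordinal_group_powers N (fun i j => r (mul (h i) (h j))) (r one) (fun i => r (inv (h i))).
- by move=> i j k; rewrite !rK mA.
- by move=> i; rewrite rK m1 hK.
- by move=> i; rewrite rK mV.
have E n x : iter n (mul x) one = h (iter n (fun j => r (mul (h (r x)) (h j))) (r one)).
  by elim: n => [|n IH] /=; rewrite ?IH !rK.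
split=> [x|q pq qN]; first by rewrite E (h1 (r x)) rK.
have [i i1 iq] := h2 q pq qN; exists (h i); first by move=> e; apply: i1; rewrite -e hK.
by rewrite E hK iq rK.
Qed.

Lemma ppower_of_cauchy p N : prime p -> (0 < N)%N ->
  (forall q, prime q -> (q %| N)%N -> q = p) -> exists n, N = (p ^ n)%N.
Proof.
move=> pp N0 h; exists (logn p N); apply/esym/eqP; rewrite -p_part.
apply/eqP/part_pnat_id; apply/pnatP => // q pq qN; rewrite inE; exact/eqP/h.
Qed.
End FiniteGroups.

(** * The maximal unramified abelian pro-p extension, elementwise *)

Section LmaxElements.
Variables (p : nat) (F : divringClosed algC).

(* Membership in the maximal unramified abelian pro-p extension of [F], in terms of
   the automorphisms of [algC] over [F]. *)
Definition lmax_elt (x : algC) :=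
  [/\ forall u w, fixer F u -> fixer F w -> u (w x) = w (u x),
      forall u, fixer F u -> exists m, iter (p ^ m) u x = x,
      forall v u, fixer F u -> inertia v u -> u x = x &
      forall nu u : Caut, fixer F u -> (forall y, nu (u y) = (nu y)^*%C) -> u x = x].

Definition lmax_elt_pred : {pred algC} := fun x => `[<lmax_elt x>].

Lemma iter_fixM (T : Type) (u : T -> T) x a b : iter a u x = x -> iter (a * b) u x = x.
Proof. by move=> h; elim: b => [|b IH]; rewrite ?muln0 // mulnS iterD IH. Qed.

Lemma iter_morph2 (u : Caut) (op : algC -> algC -> algC) n x y :
  (forall w : Caut, forall x y, w (op x y) = op (w x) (w y)) ->
  iter n u (op x y) = op (iter n u x) (iter n u y).
Proof. by move=> h; elim: n => //= n ->; rewrite h. Qed.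

Lemma lmax_elt_op (op : algC -> algC -> algC) x y :
  (forall w : Caut, forall x y, w (op x y) = op (w x) (w y)) ->
  lmax_elt x -> lmax_elt y -> lmax_elt (op x y).
Proof.
move=> h [x1 x2 x3 x4] [y1 y2 y3 y4]; split.
- by move=> u w uF wF; rewrite (h w x y) (h u x y) (h u (w x)) (h w (u x)) x1 // y1.
- move=> u uF; have [m mP] := x2 u uF; have [n nP] := y2 u uF; exists (m + n)%N.
  rewrite iter_morph2 // expnD (iter_fixM _ mP) mulnC (iter_fixM _ nP) //.
- by move=> v u uF uv; rewrite h (x3 v) ?(y3 v).
- by move=> nu u uF un; rewrite h (x4 nu) ?(y4 nu).
Qed.

Lemma lmax_elt_base x : x \in F -> lmax_elt x.
Proof.
move=> xF; have fx u : fixer F u -> u x = x by apply.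
split=> [u w uF wF|u uF|v u uF _|nu u uF _]; rewrite ?fx //.
by exists 0%N => /=; apply: fx.
Qed.

Fact lmax_elt_closed : divring_closed lmax_elt_pred.
Proof.
split; first by apply/asboolP/lmax_elt_base/rpred1.
  by move=> x y /asboolP gx /asboolP gy; apply/asboolP/(@lmax_elt_op (fun x y => x - y)) => // w a b; rewrite rmorphB.
by move=> x y /asboolP gx /asboolP gy; apply/asboolP/(@lmax_elt_op (fun x y => x / y)) => // w a b; rewrite fmorph_div.
Qed.
HB.instance Definition _ := GRing.isDivringClosed.Build algC lmax_elt_pred lmax_elt_closed.

(** Conjugation by [u] turns the conditions on u x at [v] and [nu] into conditions on [x] at
    [twist u v] and [nu \o u]. *)
Lemma lmax_elt_aut (u w : Caut) x : cancel u w -> cancel w u -> stable F u -> stable F w ->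
  lmax_elt x -> lmax_elt (u x).
Proof.
move=> uw wu uF wF [x1 x2 x3 x4].
have cj s : fixer F s -> fixer F (w \o s \o u) by move=> sF y yF /=; rewrite sF ?uw //; apply: uF.
have E (s : Caut) y : s (u y) = u ((w \o s \o u) y) by rewrite /= wu.
split.
- by move=> s t sF tF; rewrite !E x1 //; apply: cj.
- move=> s sF; have [m mP] := x2 _ (cj s sF); exists m.
  suff -> n : iter n s (u x) = u (iter n (w \o s \o u) x) by rewrite mP.
  by elim: n => //= n ->; rewrite wu.
- move=> v s sF sv; rewrite E; congr (u _); apply: (x3 (twist u v) (w \o s \o u) (cj s sF)).
  move=> a; change (v (aut_int u (aut_int (w \o s \o u) a - a))).
  rewrite (_ : aut_int u _ = aut_int s (aut_int u a) - aut_int u a); first exact: sv.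
  by apply: val_inj; rewrite /= rmorphB /= wu.
- move=> nu s sF sn; rewrite E; congr (u _); apply: (x4 (nu \o u) (w \o s \o u) (cj s sF)).
  by move=> y /=; rewrite wu sn.
Qed.

Lemma lmax_elt_fixer (u : Caut) : fixer F u -> stable lmax_elt_pred u.
Proof.
move=> uF x /asboolP gx; have [w [uw wu]] := aut_inv u.
have wF := fixerV uF uw.
by apply/asboolP/(lmax_elt_aut uw wu) => // y yF; rewrite ?uF ?wF.
Qed.

Lemma galois_of_stable (L : divringClosed algC) : {subset F <= L} ->
  (forall u, fixer F u -> stable L u) -> galois_ext F L.
Proof.
move=> FL st; split=> // x xL.
have [ob [xo oP op]] := @orbit1 (fixer F) x (@fixer1 F) (@fixerM F).
exists (\prod_(y <- ob) ('X - y%:P)); split.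
- apply/polyOverP => i; apply: fixed_mem => u uF.
  by have /polyP/(_ i) := perm_prod_fixed (op u uF); rewrite coef_map.
- exact/monic_neq0/monic_prod_XsubC.
- by rewrite root_prod_XsubC.
- by move=> y; rewrite root_prod_XsubC => /oP[u uF ->]; apply: st.
Qed.

Lemma stable_of_galois (L : divringClosed algC) u : galois_ext F L -> fixer F u -> stable L u.
Proof.
move=> [FL nL] uF x xL; have [q [qF q0 qx qL]] := nL x xL; apply: qL.
rewrite (_ : q = map_poly u q) ?fmorph_root //; apply/polyP => i.
by apply/esym; rewrite coef_map; apply/uF/(polyOverP qF).
Qed.

Lemma restrict_gal (L : divringClosed algC) u : galois_ext F L -> fixer F u ->
  exists s : galT F L, {in L, s =1 u}.
Proof.
move=> gL uF; have [w [uw wu]] := aut_inv u; have wF := fixerV uF uw.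
by apply: (restrict_aut uF _ wu); [case: gL|apply: stable_of_galois gL _..].
Qed.

Lemma galT_iter (L : divringClosed algC) (s : galT F L) (u : Caut) n x : {in L, s =1 u} -> x \in L ->
  iter n (gal_comp s) (Defs.gal_id F L) x = iter n u x /\ iter n u x \in L.
Proof.
move=> su xL; elim: n => [|n [IH1 IH2]] /=; first by [].
by rewrite IH1 su //; split=> //; rewrite -su //; apply: gal_stable.
Qed.

Lemma gal_inverse (L : divringClosed algC) (s : galT F L) : {subset F <= L} ->
  exists t : galT F L, gal_comp t s = Defs.gal_id F L.
Proof.
move=> FL; have [u us uF] := extend_gal s; have [w [uw wu]] := aut_inv u.
have wL : stable L w.
  move=> x xL; have [_ _ _ sL _] := galP s.
  by have [y yL <-] : (s @` [set` L]) x by [rewrite sL]; rewrite -us // uw.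
have uL : stable L u by move=> x xL; rewrite us //; apply: gal_stable.
have [t tw] := restrict_aut (fixerV (uF FL) uw) FL uw wL uL.
exists t; apply: gal_eq => x /=; have [xL|xL] := boolP (x \in L); last by rewrite !gal_out.
by rewrite tw ?gal_stable // -us // uw.
Qed.

Lemma lmax_elt_unramified : prime p -> unramified_abelian_pro_p p F lmax_elt_pred.
Proof.
move=> pp; have FG : {subset F <= lmax_elt_pred} by move=> x xF; apply/asboolP/lmax_elt_base.
have gG : galois_ext F lmax_elt_pred by apply: galois_of_stable => // u /lmax_elt_fixer.
split=> //.
- move=> s t x /=; have [xG|xG] := boolP (x \in lmax_elt_pred); last by rewrite !gal_out.
  have [u us /(_ FG) uF] := extend_gal s; have [w wt /(_ FG) wF] := extend_gal t.
  rewrite -us ?gal_stable // -wt // -wt ?gal_stable // -us //.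
  by have /asboolP[h _ _ _] := xG; apply: h.
- move=> M MG gM /finite_setP[N cN]; have FM : {subset F <= M} by case: gM.
  have [|||h1 h2] := @finite_group_powers _ _ (@gal_comp F M) (Defs.gal_id F M)
    (fun s => projT1 (cid (gal_inverse s FM))) cN.
  - by move=> a b c; apply: gal_eq.
  - by move=> a; apply: gal_eq.
  - by move=> a; case: cid.
  have N0 : (0 < N)%N.
    move: cN => /card_set_bijP[f [fI _ _]].
    by have : (f (Defs.gal_id F M) < N)%N := fI _ Logic.I; case: (N).
  suff [n NE] : exists n, N = (p ^ n)%N by exists n; rewrite -NE.
  (* If a prime q other than p divided the order, an element of order q would exist; each x is fixed
     by its q-th power and by a p-power of it, hence by the element itself. *)
  apply: ppower_of_cauchy => // q pq qN; have [s s1 sq] := h2 q pq qN.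
  apply: contrapT => /eqP qp; apply: s1; apply: gal_eq => x.
  have [xM|xM] := boolP (x \in M); last by rewrite !gal_out.
  have [u us /(_ FM) uF] := extend_gal s.
  have /asboolP[_ /(_ u uF)[m mP] _ _] := MG x xM.
  have uq : iter q u x = x by have [|<- _] := @galT_iter M s u q x _ xM; [move=> y /us ->|rewrite sq].
  have /coprimeP : coprime q (p ^ m) by rewrite coprimeXr // prime_coprime // dvdn_prime2.
  move=> /(_ (prime_gt0 pq))[[c d] /= e].
  have : iter (c * q) u x = x by rewrite mulnC; apply: iter_fixM.
  have -> : (c * q = (d * p ^ m).+1)%N by lia.
  by rewrite iterS mulnC (iter_fixM _ mP) us.
split.
- move=> P hP s sI x; have [xG|xG] := boolP (x \in lmax_elt_pred); last by rewrite gal_out.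
  have [v vP] := lying_over hP; have [u us /(_ FG) uF] := extend_gal s.
  (* On integers of the field, reduction before and after [u] agree, so they differ by some [t]
     fixing the field. Then [u] composed with the inverse of [t] lies in the inertia group of [v]
     and still restricts to [s]. *)
  pose h2 : {rmorphism AintT -> residue v} := red v \o aut_int u.
  have [c cG|t tG tP] := @hom_conjugate _ lmax_elt_pred (red v) h2 (@residue_dom v).
    apply/esym/eqP; rewrite -subr_eq0 -[h2 c]/(red v (aut_int u c)) -(rmorphB (red v)).
    apply/eqP/red0/vP => /=.
      by rewrite us // rpredB // gal_stable.
    by rewrite us //; apply: sI => //; apply: AintT_valP.
  have [w [tw wt]] := aut_inv t; have wG := fixerV tG tw.
  have /asboolP[_ _ h _] := xG; have <- : (u \o w) x = s x by rewrite /= wG // us.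
  apply: (h v) => [y yF|a]; first by rewrite /= wG ?uF ?FG.
  apply/red0; rewrite rmorphB; apply/eqP; rewrite subr_eq0; apply/eqP.
  have -> : aut_int (u \o w) a = aut_int u (aut_int w a) by apply: val_inj.
  have := tP (aut_int w a); rewrite /h2 /= => ->; congr (red v _); apply: val_inj => /=.
  exact: wt.
- move=> nu s sn x; have [xG|xG] := boolP (x \in lmax_elt_pred); last by rewrite gal_out.
  have [nu' [nK nK']] := aut_inv nu.
  pose c : Caut := nu' \o Num.conj \o nu.
  have cs : {in lmax_elt_pred, c =1 s} by move=> y yG; rewrite /= -sn // nK.
  have /asboolP[_ _ _ h] := xG; rewrite -cs //; apply: (h nu).
    by move=> y yF; rewrite cs ?FG //; have [h' _ _ _ _] := galP s; apply: h'.
  by move=> y; rewrite /= nK'.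
Qed.

Definition fixed_by (D : set Caut) : {pred algC} := fun x => `[<forall u, D u -> u x = x>].
Fact fixed_by_closed D : divring_closed (fixed_by D).
Proof.
split; first by apply/asboolP => u _; rewrite rmorph1.
  by move=> x y /asboolP hx /asboolP hy; apply/asboolP => u Du; rewrite rmorphB hx ?hy.
by move=> x y /asboolP hx /asboolP hy; apply/asboolP => u Du; rewrite fmorph_div hx ?hy.
Qed.
HB.instance Definition _ D := GRing.isDivringClosed.Build algC (fixed_by D) (fixed_by_closed D).

Lemma unramified_lmax_elt (L : divringClosed algC) x : unramified_abelian_pro_p p F L -> x \in L -> lmax_elt x.
Proof.
move=> [gL abL ppL [inL arL]] xL; have [FL _] := gL; split.
- move=> u w uF wF; have [s su] := restrict_gal gL uF; have [t tw] := restrict_gal gL wF.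
  have wx : w x \in L by apply: stable_of_galois gL wF _ xL.
  have ux : u x \in L by apply: stable_of_galois gL uF _ xL.
  by have := abL s t x; rewrite /= (tw x xL) (su x xL) (su _ wx) (tw _ ux).
- move=> u uF; have [ob [xo oP op]] := @orbit1 (fixer F) x (@fixer1 F) (@fixerM F).
  (* The automorphisms fixing all conjugates of [x]; their fixed field [M] is a finite Galois
     extension of F containing [x], to which the pro-p condition applies. *)
  pose D : set Caut := [set w : Caut | fixer F w /\ {in ob, w =1 id}].
  pose M : divringClosed algC := fixed_by D.
  have oL y : y \in ob -> y \in L by move=> /oP[w wF ->]; apply: stable_of_galois gL wF _ xL.
  have ML : {subset M <= L}.
    move=> y /asboolP yD; apply: fixed_mem => w wL; apply: yD; split=> [z zF|z /oL zL].
      by apply/wL/FL.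
    exact: wL.
  have FM : {subset F <= M} by move=> y yF; apply/asboolP => w [wF _]; apply: wF.
  have oM y : y \in ob -> y \in M by move=> yo; apply/asboolP => w [_]; apply.
  have gM : galois_ext F M.
    apply: galois_of_stable => // w wF y /asboolP yD; apply/asboolP => t [tF to].
    have [w' [ww' w'w]] := aut_inv w; have w'F := fixerV wF ww'.
    have : (w' \o t \o w) y = y.
      apply: yD; split=> [z zF|z zo] /=; first by rewrite wF // tF // w'F.
      rewrite to ?ww' // -(perm_mem (op w wF)); exact: map_f.
    by move=> /(congr1 w) /=; rewrite w'w.
  have fM : finite_set [set: galT F M].
    have [cs csP] := conj_finite_seq ob.
    pose f y : galT F M := xget (Defs.gal_id F M) [set s : galT F M | map s ob = y].
    apply: sub_finite_set (finite_image f (finite_seq cs)) => s _.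
    have [w ws /(_ FM) wF] := extend_gal s.
    have so : map s ob = map w ob by apply/eq_in_map => y yo; rewrite ws // oM.
    exists (map s ob); first by rewrite /= so; apply: csP.
    have fo : map (f (map s ob)) ob = map s ob.
      by apply: (@xgetPex _ _ [set s' : galT F M | map s' ob = map s ob]); exists s.
    apply: gal_eq => y; have [yM|yM] := boolP (y \in M); last by rewrite !gal_out.
    have [t ts /(_ FM) tF] := extend_gal (f (map s ob)).
    have [w' [ww' w'w]] := aut_inv w; have w'F := fixerV wF ww'.
    have /asboolP yD := yM; have : (w' \o t) y = y.
      apply: yD; split=> [z zF|z zo] /=; first by rewrite tF // w'F.
      have -> : t z = w z by rewrite ts ?ws ?oM //; move/eq_in_map: fo; apply.
      exact: ww'.
    by move=> /(congr1 w) /=; rewrite w'w ts // ws.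
  have [n cn] := ppL M ML gM fM; exists n.
  have [|||h1 _] := @finite_group_powers _ _ (@gal_comp F M) (Defs.gal_id F M)
    (fun s => projT1 (cid (gal_inverse s FM))) cn.
  + by move=> a b c; apply: gal_eq.
  + by move=> a; apply: gal_eq.
  + by move=> a; case: cid.
  have [s su] := restrict_gal gM uF.
  by have [<- _] := galT_iter (p ^ n) su (oM x xo); rewrite h1.
- move=> v u uF uv; have [s su] := restrict_gal gL uF; rewrite -su //.
  apply: (inL _ (trace_prime v L)) => y yL yA; rewrite su //.
  split; first by rewrite rpredB // -su // gal_stable.
  by exists (aut_int u (to_AintT y) - to_AintT y); [rewrite /= to_AintTK|apply: uv].
- move=> nu u uF un; have [s su] := restrict_gal gL uF; rewrite -su //.
  by apply: (arL nu) => y yL; rewrite su.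
Qed.

Lemma LmaxP x : prime p -> (x \in Lmax p F) <-> lmax_elt x.
Proof.
move=> pp; split=> [/asboolP[L uL xL]|gx]; first exact: unramified_lmax_elt uL xL.
by apply/asboolP; exists (lmax_elt_pred : divringClosed algC); [apply: lmax_elt_unramified|apply/asboolP].
Qed.
End LmaxElements.

Local Notation gal := Defs.gal.

(** * Density of group elements and the line Gal(K/K') *)

Section GroupElements.
Variables (p : nat) (G : lmodType (padic p)) (O : set (set G)).
Hypotheses (pp : prime p) (L : is_lat O).
Local Notation Lam := (cga (padic p) O).
Local Notation delta := (cga_delta (padic p) O).

(** Coefficients modulo p^n can be taken to be natural numbers, so sums of group elements with
    repetition suffice and no p-adic scalars occur. *)
Lemma group_dense (a : Lam) (U : open_sub O) n : exists s : seq G,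
  lvn U n (\sum_(g <- s) delta g - a).
Proof.
have /choice[m mP] : forall c, exists m : nat, dvr ((p ^ n)%:R : padic p) (m%:R - a U c).
  move=> c; have [m [h _]] := zp_approx pp (a U c) n; exists m.
  by rewrite -opprB; apply: idealN h; apply: princ_ideal.
pose s := flatten [seq nseq (m c) (repr c : G) | c <- elts U]; exists s => c.
suff E : (\sum_(g <- s) delta g : Lam) U c = (m c)%:R.
  by rewrite (_ : (_ - a) U c = (\sum_(g <- s) delta g : Lam) U c - a U c) // E.
transitivity (\sum_(d \in [set: oquot U]) (if d == c then (m d)%:R else 0 : padic p)).
  rewrite fsum_elts /s big_flatten /= big_map cga_sumE; apply: eq_bigr => d _.
  rewrite big_nseq; have -> : iter (m d) (+%R (delta (repr d))) 0 = delta (repr d) *+ m d.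
    by elim: (m d) => //= j ->; rewrite -mulrS.
  have -> : (delta (repr d) *+ m d) U c = delta (repr d) U c *+ m d.
    by elim: (m d) => //= j IH; rewrite !mulrS -IH.
  rewrite /= opi_repr eq_sym; case: eqP => _ //; exact: mul0rn.
exact: (fsum_delta c (fun d => (m d)%:R)).
Qed.
End GroupElements.

Section KernelLine.
Variables (p d : nat) (G H : lmodType (padic p)).
Hypothesis pp : prime p.
Local Notation zp := (padic p).
Variables (th : {linear G -> 'rV[zp]_d.+1}) (th' : {linear H -> 'rV[zp]_d}).
Hypotheses (thb : bijective th) (thb' : bijective th').
Variable r : {linear G -> H}.
Hypothesis rsurj : forall h, exists g, r g = h.

Let domZ := normal_dom (zp_normal pp).

Lemma vec_tf (x : zp) (g : G) : x != 0 -> x *: g = 0 -> g = 0.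
Proof.
move=> x0 xg; apply: (bij_inj thb); rewrite linear0; apply/rowP => j; rewrite mxE.
have := congr1 (fun g => th g 0 j) xg; rewrite linearZ linear0 !mxE => e.
by apply/eqP; apply: contraT => h; have := dom_mul0 domZ x0 h; rewrite e eqxx.
Qed.

(* [v |-> v - section (r v)] is a projection onto the kernel of [r]; its trace is 1,
   so one of its diagonal coefficients is a unit. *)
Lemma kernel_line : exists g0, quotient_by g0 r.
Proof.
have [ht thK htK] := thb; have [ht' thK' htK'] := thb'.
have htZ c v : ht (c *: v) = c *: ht v by apply: (can_inj thK); rewrite linearZ /= !htK.
have htD v w : ht (v + w) = ht v + ht w by apply: (can_inj thK); rewrite linearD !htK.
have /choice[e eE] : forall j : 'I_d, exists g, th' (r g) = delta_mx 0 j.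
  by move=> j; have [g gE] := rsurj (ht' (delta_mx 0 j)); exists g; rewrite gE htK'.
pose pr (g : G) : G := g - \sum_j th' (r g) 0 j *: e j.
have r_pr g : r (pr g) = 0.
  apply: (can_inj thK'); rewrite linear0 !linearB /= linear_sum /= linear_sum /=.
  apply/eqP; rewrite subr_eq0; apply/eqP/rowP => i; rewrite summxE (bigD1 i) //= big1.
    by rewrite linearZ /= linearZ /= eE !mxE !eqxx /= mulr1 addr0.
  by move=> j ji; rewrite linearZ /= linearZ /= eE !mxE eqxx eq_sym (negPf ji) mulr0.
have pr_id g : r g = 0 -> pr g = g.
  by move=> rg; rewrite /pr big1 ?subr0 // => j _; rewrite rg linear0 mxE scale0r.
pose b j := ht (delta_mx 0 j).
have thb0 i j : th (b i) 0 j = (i == j)%:R by rewrite htK mxE eqxx /= eq_sym.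
have gE g : g = \sum_i th g 0 i *: b i.
  apply: (can_inj thK); rewrite linear_sum; apply/rowP => j; rewrite summxE (bigD1 j) //= big1.
    by rewrite linearZ mxE thb0 eqxx mulr1 addr0.
  by move=> i ij; rewrite linearZ mxE thb0 (negPf ij) mulr0.
have tr : \sum_j th (pr (b j)) 0 j = 1.
  rewrite (eq_bigr (fun j => 1 - \sum_k th' (r (b j)) 0 k * th (e k) 0 j)); last first.
    move=> j _; rewrite /pr linearB linear_sum !mxE summxE thb0 eqxx; congr (_ - _).
    by apply: eq_bigr => k _; rewrite linearZ mxE.
  rewrite sumrB exchange_big /= sumr_const card_ord.
  rewrite (eq_bigr (fun=> 1)) => [|k _].
    by rewrite sumr_const card_ord mulrSr addrC addKr.
  transitivity (th' (r (e k)) 0 k); last by rewrite eE mxE !eqxx.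
  rewrite [in RHS](gE (e k)) !linear_sum summxE; apply: eq_bigr => j _.
  by rewrite !linearZ /= mxE mulrC.
clearbody pr; have [j [y yE]] : exists j, exists y, y * th (pr (b j)) 0 j = 1.
  apply: contrapT => no.
  have dv j : dvr ((p ^ 1)%:R : zp) (th (pr (b j)) 0 j).
    apply/zp_dvdP => //; apply: contrapT => /eqP h.
    by have [y yE] := zp_unit pp h; apply: no; exists j, y.
  have := ideal_sum (princ_ideal _) dv; rewrite tr.
  move=> /(zp_dvdP pp).
  rewrite (zp_nat p 1) expn1 modz_small ?ltz_nat ?prime_gt1 //.
pose g0 := pr (b j).
have g00 : g0 != 0.
  apply/eqP => g00; case: domZ => /eqP + _; apply; rewrite -yE -/g0 g00 linear0 mxE mulr0.
  by [].
exists g0; split=> // g; split=> [rg|[z ->]]; last by rewrite linearZ /= r_pr scaler0.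
pose z := th g 0 j * y; exists z.
pose w := g - z *: g0.
have rw : r w = 0 by rewrite linearB linearZ /= rg r_pr scaler0 subr0.
have wj : th w 0 j = 0.
  by rewrite linearB linearZ !mxE /z -mulrA yE mulr1 subrr.
suff w0 : w = 0 by apply/eqP; rewrite -subr_eq0; apply/eqP.
clearbody w.
(* The d + 2 vectors g0, w and e_k in rank d + 1 are dependent. Applying [r] kills the coefficients
   of the e_k, and coordinate j that of g0, so a nonzero scalar kills w. *)
pose fam (i : 'I_d.+2) : G := match unlift ord0 i with None => g0 | Some i' =>
  match unlift ord0 i' with None => w | Some k => e k end end.
have [c [[i ci] c0]] := dependent_family domZ (fun i k => th (fam i) 0 k).
have S0 : \sum_i c i *: fam i = 0.
  apply: (can_inj thK); rewrite linear_sum linear0; apply/rowP => k.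
  rewrite summxE mxE -[RHS](c0 k); apply: eq_bigr => i' _; by rewrite linearZ mxE.
have f0 : fam ord0 = g0 by rewrite /fam unlift_none.
have f1 : fam (lift ord0 ord0) = w by rewrite /fam liftK unlift_none.
have f2 k : fam (lift ord0 (lift ord0 k)) = e k by rewrite /fam !liftK.
move: S0; rewrite big_ord_recl big_ord_recl f0 f1.
rewrite (eq_bigr (fun k => c (lift ord0 (lift ord0 k)) *: e k)); last by move=> k _; rewrite f2.
move=> S0; have ck k : c (lift ord0 (lift ord0 k)) = 0.
  have := congr1 (fun g => th' (r g) 0 k) S0.
  have rS x1 x2 S : r (x1 *: g0 + (x2 *: w + S)) = r S.
    rewrite linearD linearD; have -> : r (x1 *: g0) = 0 by rewrite linearZ /= r_pr scaler0.
    by have -> : r (x2 *: w) = 0; [rewrite linearZ /= rw scaler0|rewrite !add0r].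
  rewrite rS linear_sum linear_sum summxE.
  rewrite (bigD1 k) //= big1 ?addr0; last first.
    by move=> k' kk; rewrite !linearZ /= eE !mxE eqxx eq_sym (negPf kk) mulr0.
  by rewrite !linearZ /= eE !mxE !eqxx mulr1 linear0 linear0 mxE.
move: S0; rewrite big1 ?addr0; last by move=> k _; rewrite ck scale0r.
move=> S0; have := congr1 (fun g => th g 0 j) S0.
rewrite linearD !linearZ linear0 !mxE wj mulr0 addr0 => e0.
have c00 : c ord0 = 0 by rewrite -[c ord0]mulr1 -yE mulrCA e0 mulr0.
move: S0; rewrite c00 scale0r add0r; apply: vec_tf.
apply/eqP => c10; move: ci; case: (unliftP ord0 i) => [i' ->|->]; last by rewrite c00 eqxx.
by case: (unliftP ord0 i') => [k ->|->]; rewrite ?ck ?c10 eqxx.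
Qed.
End KernelLine.

(** * Iwasawa modules *)

Section ZpExtensions.
Variables (p d : nat) (k : divringClosed algC) (K : zp_ext p d k).
Hypothesis pp : prime p.
Local Notation O := (@krull_open k K : set (set (gal K))).

Lemma theta_linear : exists t : {linear gal K -> 'rV[padic p]_d}, t =1 @theta p d k K.
Proof.
by apply: mk_linear => [a s u]; rewrite theta_add theta_invK.
Qed.

Lemma gal_lattice : lattice d O.
Proof.
have [t tE] := theta_linear; have tb : bijective t by have [h h1 h2] := theta_bij K; exists h => x; rewrite tE ?h1 ?h2.
split; first by exists t.
have [ht tK htK] := tb.
have ppt n (s : gal K) : ppow_dvd n (theta s) -> ppow_dvd n s.
  by move=> [w wE]; exists (ht w); apply: (can_inj tK); rewrite linearZ /= htK tE.
have ptp n (s : gal K) : ppow_dvd n s -> ppow_dvd n (theta s) by move=> /(ppow_linear t); rewrite tE.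
have tB (s u : gal K) : theta (s - u) = theta s - theta u by rewrite -!tE linearB.
have [_ _ c1 c2] := thetaP K.
move=> U; split=> oU s Us.
  have [xs xsK xsU] := oU s Us; have [n nP] := c2 s xs xsK; exists n => u su.
  by apply/xsU/nP; rewrite -tB; apply: ptp.
have [n nP] := oU s Us; have [xs xsK xsP] := c1 s n; exists xs => // u su.
by apply/nP/ppt; rewrite tB; apply: xsP.
Qed.

Lemma gal_is_lat : is_lat O. Proof. exact: lattice_is_lat gal_lattice. Qed.

Lemma gal_addE (s u : gal K) x : (s + u) x = s (u x). Proof. by []. Qed.
Lemma gal_MnE (s : gal K) n x : (s *+ n) x = iter n s x.
Proof. by elim: n => [|n IH] //; rewrite mulrS gal_addE IH. Qed.

Lemma gal_small x : x \in K -> exists n, forall s : gal K, ppow_dvd n s -> s x = x.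
Proof.
move=> xK; have [_ _ _ c2] := thetaP K.
have [n nP] := c2 (0 : gal K) [:: x] (fun y => ltac:(by rewrite inE => /eqP ->)).
exists n => s sn; apply: (nP s) => //; last by rewrite inE.
have [t tE] := theta_linear; rewrite -!tE linear0 subr0; exact: ppow_linear.
Qed.

Lemma zp_tf (a : padic p) n : (0 < n)%N -> a *+ n = 0 -> a = 0.
Proof.
move=> n0 an; have domZ := normal_dom (zp_normal pp).
have nz : (n%:R : padic p) != 0.
  apply/eqP => /(congr1 (fun x : padic p => x n)); rewrite zp_nat zp0 modz_small.
    by case: (n) n0.
  by rewrite ltz_nat ltn_expl ?prime_gt1.
apply/eqP; apply: contraT => a0; have := dom_mul0 domZ a0 nz.
by rewrite -mulr_natr in an; rewrite an eqxx.
Qed.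

Lemma gal_torsion_free (s : gal K) n : (0 < n)%N -> s *+ n = 0 -> s = 0.
Proof.
move=> n0 sn; have [t tE] := theta_linear; apply: (@theta_inj p d k K); rewrite -!tE linear0.
apply/rowP => j; rewrite mxE; apply: (zp_tf n0).
by have := congr1 (fun s => t s 0 j) sn; rewrite raddfMn mulmxnE linear0 mxE.
Qed.

Lemma zp_ext_base : {subset k <= K}. Proof. by case: (zgalois K). Qed.

Definition gres (u : Caut) : gal K := xget 0 [set s : gal K | {in K, s =1 u}].

Lemma gresP u : fixer k u -> {in K, gres u =1 u}.
Proof.
move=> uk; apply: (@xgetPex _ _ [set s : gal K | {in K, s =1 u}]).
exact: restrict_gal (zgalois K) uk.
Qed.

Lemma gal_eq_in (s t : gal K) : {in K, s =1 t} -> s = t.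
Proof.
move=> h; apply: gal_eq => x; have [/h//|xK] := boolP (x \in K); by rewrite !gal_out.
Qed.

Lemma gres_eq (s : gal K) u : fixer k u -> {in K, s =1 u} -> gres u = s.
Proof. by move=> uk h; apply: gal_eq_in => x xK; rewrite gresP // h. Qed.

Lemma zp_stable u : fixer k u -> stable K u.
Proof. exact: stable_of_galois (zgalois K). Qed.

Lemma gresM u w : fixer k u -> fixer k w -> gres (u \o w) = gres u + gres w.
Proof.
move=> uk wk; apply: gres_eq => [|x xK]; first exact: fixerM.
by rewrite gal_addE /= !gresP //; apply: zp_stable.
Qed.

Lemma gres0 u : fixer K u -> gres u = 0.
Proof. by move=> uK; apply: gres_eq => [x /zp_ext_base/uK|x /uK ->]. Qed.

Lemma fixer_ext u : fixer k u -> gres u = 0 -> fixer K u.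
Proof. by move=> uk u0 x xK; rewrite -gresP // u0. Qed.

Lemma fixer_base u : fixer K u -> fixer k u.
Proof. by move=> uK x /zp_ext_base/uK. Qed.

Lemma gres_lift (s : gal K) : exists2 u, fixer k u & gres u = s.
Proof.
have [u us /(_ zp_ext_base) uk] := extend_gal s; exists u => //.
by apply: gres_eq => // x xK; rewrite us.
Qed.

Lemma gres_iter u n : fixer k u -> {in K, gres u *+ n =1 iter n u}.
Proof.
move=> uk x xK; rewrite gal_MnE; elim: n => //= n ->.
rewrite gresP //; elim: n => //= n; exact: zp_stable.
Qed.

Lemma zp_pow u : fixer k u -> forall x, x \in K -> exists m, iter (p ^ m) u x = x.
Proof.
move=> uk x xK; have [m mP] := gal_small xK; exists m.
by rewrite -gres_iter // mP //; apply: ppow_mul.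
Qed.

Lemma zp_torsion u n : fixer k u -> (0 < n)%N -> (forall x, x \in K -> iter n u x = x) -> fixer K u.
Proof.
move=> uk n0 un; apply: fixer_ext => //; apply: (gal_torsion_free n0).
by apply: gal_eq_in => x xK; rewrite gres_iter // un.
Qed.

Lemma zp_comm u w : fixer k u -> fixer k w -> forall x, x \in K -> u (w x) = w (u x).
Proof.
move=> uk wk x xK; have st := zp_stable.
have E s t : fixer k s -> fixer k t -> s (t x) = (gres s + gres t) x.
  by move=> sk tk; rewrite gal_addE !gresP ?st.
by rewrite (E u w) // (E w u) // addrC.
Qed.

(** Zp-extensions are unramified away from p. Finitely many generators of k let a power of Frobenius
    fix k, as the tame argument requires. *)
Lemma zp_tame (v : place) (s : Caut) : number_field k -> ~ v p%:R ->
  fixer k s -> inertia v s -> fixer K s.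
Proof.
move=> [n [b bk]] nvp sk sI x xK.
apply: (tame_inertia pp nvp _ zp_comm zp_stable zp_pow _ sk sI xK).
- exists (codom b) => u ub y /bk[c ->]; rewrite rmorph_sum; apply: eq_bigr => j _.
  by rewrite rmorphM fmorph_rat ub ?codom_f.
- by move=> u m uk m0 um; apply: zp_torsion uk m0 um.
Qed.
End ZpExtensions.

Lemma lmax_elt_sub p (F F' : divringClosed algC) x : {subset F <= F'} -> lmax_elt p F x -> lmax_elt p F' x.
Proof.
move=> FF; have h u : fixer F' u -> fixer F u by move=> uF y /FF/uF.
move=> [x1 x2 x3 x4]; split.
- by move=> u w /h uF /h wF; apply: x1.
- by move=> u /h; apply: x2.
- by move=> v u /h; apply: x3.
- by move=> nu u /h; apply: x4.
Qed.

Notation invC u := (algC_invaut u).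

Lemma invCK (u : Caut) : cancel u (invC u). Proof. exact: algC_autK. Qed.
Lemma invCKV (u : Caut) : cancel (invC u) u. Proof. exact: algC_invautK. Qed.
Lemma invC_comp (u w : Caut) x : invC (u \o w) x = invC w (invC u x).
Proof. by have e : u (w (invC (u \o w) x)) = x := invCKV (u \o w) x; rewrite -{2}e !invCK. Qed.
Lemma invC_inv (u : Caut) x : invC (invC u) x = u x.
Proof. by have e := invCKV (invC u) x; apply: (can_inj (invCKV u)); rewrite e invCK. Qed.
Lemma fixer_inv L (u : Caut) : fixer L u -> fixer L (invC u).
Proof. by move=> h; apply: fixerV h (invCK u). Qed.

Definition commC (t s : Caut) : Caut := t \o s \o invC t \o invC s.

(** * Elements of X(K) as automorphisms of [algC] *)

Section OneModule.
Variables (p d : nat) (k : divringClosed algC) (K : zp_ext p d k) (X : iwasawa_module K).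
Hypothesis pp : prime p.
Local Notation LM := (Lmax p K).
Local Notation La := (gal_is_lat K pp).

Lemma LmaxE : LM = lmax_elt_pred p K.
Proof.
apply/funext => x; apply/idP/idP => [h|/asboolP h]; first by apply/asboolP/(LmaxP K x pp).
exact/(LmaxP K x pp).
Qed.

Lemma LM_elt x : x \in LM <-> lmax_elt p K x. Proof. exact: LmaxP. Qed.
Lemma sub_LM : {subset K <= LM}.
Proof. by move=> x xK; apply/LM_elt/lmax_elt_base. Qed.

Lemma LM_stable u : fixer k u -> stable LM u.
Proof.
move=> uk x /LM_elt gx; apply/LM_elt/(lmax_elt_aut (invCK u) (invCKV u)) => //.
  exact: zp_stable.
exact/zp_stable/fixer_inv.
Qed.

Lemma iw_lift (x : X) : exists2 u, fixer K u & {in LM, iw_gal x =1 u}.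
Proof.
move: (iw_gal x) sub_LM; rewrite LmaxE => s h; have [u us /(_ h) uK] := extend_gal s.
by exists u => // y yL; rewrite us.
Qed.

(** Classes of automorphisms of the whole of [algC], so that conjugates and commutators with lifts
    from k are formed by plain composition. *)
Definition cls (u : Caut) : X := xget 0 [set x : X | {in LM, iw_gal x =1 u}].

Lemma clsP u : fixer K u -> {in LM, iw_gal (cls u) =1 u}.
Proof.
move=> uK; apply: (@xgetPex _ _ [set x : X | {in LM, iw_gal x =1 u}]).
have [s su] : exists s : galT K LM, {in LM, s =1 u}.
  rewrite LmaxE; apply: restrict_gal uK; by have [] := @lmax_elt_unramified p K pp.
by have [g _ gK] := iw_bij X; exists (g s) => z zL; rewrite gK su.
Qed.

Lemma iw_inj (x y : X) : {in LM, iw_gal x =1 iw_gal y} -> x = y.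
Proof.
move=> h; apply: (bij_inj (iw_bij X)); apply: gal_eq => z.
by have [/h//|zL] := boolP (z \in LM); rewrite !gal_out.
Qed.

Lemma cls_eq u (x : X) : fixer K u -> {in LM, iw_gal x =1 u} -> cls u = x.
Proof. by move=> uK h; apply: iw_inj => z zL; rewrite clsP // h. Qed.

Lemma cls_ext (u w : Caut) : fixer K u -> {in LM, w =1 u} -> cls w = cls u.
Proof.
move=> uK h; apply: cls_eq; last by move=> z zL; rewrite clsP // h.
by move=> z zK; rewrite h ?uK //; apply: sub_LM.
Qed.

Lemma clsM u w : fixer K u -> fixer K w -> cls (u \o w) = cls u + cls w.
Proof.
move=> uK wK; apply: cls_eq => [|z zL]; first exact: fixerM.
by rewrite iw_add /= !clsP //; apply: LM_stable (fixer_base wK) _ zL.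
Qed.

Lemma cls0 (u : Caut) : {in LM, u =1 id} -> cls u = 0.
Proof.
move=> h; have uK : fixer K u by move=> z /sub_LM/h.
apply: (addIr (cls u)); rewrite add0r -clsM //; apply: cls_ext => // z zL /=.
by rewrite h ?h.
Qed.

Lemma clsV u : fixer K u -> cls (invC u) = - cls u.
Proof.
move=> uK; apply: (addIr (cls u)); rewrite addNr -clsM //; last exact: fixer_inv.
by apply: cls0 => z _ /=; rewrite invCK.
Qed.

Lemma cls_surj (x : X) : exists2 u, fixer K u & cls u = x.
Proof. by have [u uK xu] := iw_lift x; exists u => //; apply: cls_eq. Qed.

Lemma conj_fixer t u : fixer k t -> fixer K u -> fixer K (t \o u \o invC t).
Proof.
move=> tk uK x xK /=; rewrite uK ?invCKV //.
by apply: zp_stable xK; apply: fixer_inv.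
Qed.

Lemma cls_conj t u : fixer k t -> fixer K u ->
  group_elt (gres K t) *: cls u = cls (t \o u \o invC t).
Proof.
move=> tk uK; apply/esym/cls_eq => [|z zL]; first exact: conj_fixer.
have kL : {subset k <= LM} by move=> y /(@zp_ext_base _ _ _ K y)/sub_LM.
have [s st] : exists s : galT k LM, {in LM, s =1 t}.
  have st1 := LM_stable tk; have st2 := LM_stable (fixer_inv tk).
  move: kL st1 st2; rewrite LmaxE => kL st1 st2.
  exact: restrict_aut tk kL (invCKV t) st1 st2.
have sg : {in K, s =1 gres K t} by move=> y yK; rewrite st ?gresP ?sub_LM.
have z'L := LM_stable (fixer_inv tk) zL.
have := iw_conj (cls u) sg (invC t z); rewrite /= st // invCKV => ->.
by rewrite clsP // st //; apply: LM_stable (fixer_base uK) _ _.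
Qed.

Section Limits.
Variable F : set_system nat.
Hypothesis FU : UltraFilter F.
Implicit Types (xs ys : nat -> X) (x y : X) (a : Lambda K).

Definition xlim xs x := forall z, z \in LM -> F [set n | iw_gal (xs n) z = iw_gal x z].

Lemma xlim_ex xs : exists x, xlim xs x.
Proof.
pose s n := projT1 (cid2 (iw_lift (xs n))).
have sK n : fixer K (s n) by rewrite /s; case: cid2.
have sx n : {in LM, iw_gal (xs n) =1 s n} by rewrite /s; case: cid2.
have [u su] := ulim_aut s FU; have uK := ulim_fixer FU su sK.
exists (cls u) => z zL; apply: filterS (su z) => n /= e.
by rewrite clsP // sx // e.
Qed.

Lemma xlim_unique xs x y : xlim xs x -> xlim xs y -> x = y.
Proof.
move=> hx hy; apply: iw_inj => z zL.
by have [n [/= <- <-]] := filter_ex (filterI (hx z zL) (hy z zL)).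
Qed.

Lemma xlim_eq xs ys x : F [set n | xs n = ys n] -> xlim xs x -> xlim ys x.
Proof. by move=> e h z zL; apply: filterS (filterI e (h z zL)) => n [/= <-]. Qed.

Lemma xlim_scale a xs x : xlim xs x -> xlim (fun n => a *: xs n) (a *: x).
Proof.
move=> h z zL; have [U [n [zs [zsL zsP]]]] := iw_cont a x zL.
have : F [set m | forall w, w \in zs -> [set m | w \in LM -> iw_gal (xs m) w = iw_gal x w] m].
  apply: filter_all => // w wzs; have wL : w \in LM by apply: zsL.
  by apply: filterS (h w wL) => m /= e _.
apply: filterS => m hm /=; apply: zsP => [c|w wzs]; first by exists 0; rewrite mulr0 subrr.
by apply: hm => //; apply: zsL.
Qed.

Lemma near_lvn (U : open_sub (@krull_open k K : set (set (gal K)))) n (a b : Lambda K) :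
  lvn U n (a - b) -> Lambda_near U n a b.
Proof. by move=> h c; have [e eE] := h c; exists e; rewrite mulrC -eE. Qed.

Lemma xlim_scalar (b : nat -> Lambda K) a x : ulimto F b a -> xlim (fun n => b n *: x) (a *: x).
Proof.
move=> h z zL; have [U [n [zs [zsL zsP]]]] := iw_cont a x zL.
by apply: filterS (h U n) => m /= hm; apply: zsP => //; apply: near_lvn.
Qed.

Lemma xlim_cls (s : nat -> Caut) (u : Caut) : (forall n, fixer K (s n)) ->
  (forall z, F [set n | s n z = u z]) -> xlim (fun n => cls (s n)) (cls u).
Proof.
move=> sK su z zL; have uK := ulim_fixer FU su sK.
by apply: filterS (su z) => n /= e; rewrite !clsP.
Qed.

(** The image a X is closed, by compactness of X and continuity of the action. *)
Lemma xlim_image (a : Lambda K) xs x : (forall n, exists y, xs n = a *: y) -> xlim xs x ->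
  exists y, x = a *: y.
Proof.
move=> /choice[y yE] h; have [y0 y0P] := xlim_ex y; exists y0.
apply: (xlim_unique h); apply: xlim_eq (xlim_scale a y0P).
by apply: filterS filterT => n _ /=; rewrite yE.
Qed.
End Limits.
End OneModule.

(** * Restriction from X(K) to X(K') *)

Section ModuleRestriction.
Variables (p d d' : nat) (k : divringClosed algC) (K : zp_ext p d k) (K' : zp_ext p d' k).
Variable sK : {subset K' <= K}.
Variables (X : iwasawa_module K) (X' : iwasawa_module K').
Hypothesis pp : prime p.
Local Notation LM := (Lmax p K).
Local Notation LM' := (Lmax p K').

Lemma LM_sub : {subset LM' <= LM}.
Proof. by move=> x /(LM_elt _ pp) h; apply/(LM_elt _ pp)/(lmax_elt_sub sK). Qed.

Lemma fixer_sub u : fixer K u -> fixer K' u. Proof. by move=> h x /sK/h. Qed.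

Lemma gres_res t : fixer k t -> gres K' t = gal_res sK (gres K t).
Proof.
move=> tk; apply: gres_eq => // x xK'; rewrite /= xK' gresP //; exact: sK.
Qed.

Definition rho (x : X) : X' := xget 0 [set x' : X' | {in LM', iw_gal x' =1 iw_gal x}].

Lemma rho_cls u : fixer K u -> rho (cls X u) = cls X' u.
Proof.
move=> uK; apply: iw_inj => // z zL.
have h : {in LM', iw_gal (cls X' u) =1 iw_gal (cls X u)}.
  by move=> w wL; rewrite (clsP X' pp (fixer_sub uK) wL) (clsP X pp uK (LM_sub wL)).
pose A : set X' := [set x' : X' | {in LM', iw_gal x' =1 iw_gal (cls X u)}].
have /(@xgetPex _ 0) AP : exists x', A x' by exists (cls X' u).
by rewrite (AP z zL) h.
Qed.

Lemma rhoD x y : rho (x + y) = rho x + rho y.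
Proof.
have [u uK <-] := cls_surj pp x; have [w wK <-] := cls_surj pp y.
by rewrite -clsM // !rho_cls ?clsM //; [apply: fixer_sub|apply: fixer_sub|apply: fixerM].
Qed.

Lemma rho_group g x : rho (group_elt g *: x) = group_elt (gal_res sK g) *: rho x.
Proof.
have [u uK <-] := cls_surj pp x; have [t tk <-] := gres_lift g.
rewrite cls_conj // !rho_cls //; last exact: conj_fixer.
by rewrite -gres_res // cls_conj //; apply: fixer_sub.
Qed.

Lemma rho0 : rho 0 = 0.
Proof. by apply: (addIr (rho 0)); rewrite -rhoD !add0r. Qed.

(** Both actions are continuous, so [a] may be replaced by a nearby sum of group elements, close
    enough both for [a] on X and for its image on X'. *)
Lemma rhoZ (a : Lambda K) x : rho (a *: x) = Lambda_res sK a *: rho x.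
Proof.
have La := gal_is_lat K pp; have La' := gal_is_lat K' pp.
have rho_iw y z : z \in LM' -> iw_gal (rho y) z = iw_gal y z.
  have [u uK <-] := cls_surj pp y => zL.
  by rewrite rho_cls // (clsP X' pp (fixer_sub uK) zL) (clsP X pp uK (LM_sub zL)).
apply: iw_inj => // z zL; rewrite rho_iw //; have zL' := LM_sub zL.
have [U [n [zs [_ zsP]]]] := iw_cont a x zL'.
have [U' [n' [zs' [_ zsP']]]] := iw_cont (Lambda_res sK a) (rho x) zL.
have [m1 m1P] := osub_pn La U; have [m2 m2P] := osub_pn La (preim_sub (@gal_res_open _ _ _ _ K K' sK) U').
pose V := pn La (m1 + m2).
have VU : osub V `<=` osub U.
  by move=> g /pnE h; apply: m1P; apply: ppow_le h; apply: leq_addr.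
have VU' : osub V `<=` osub (preim_sub (@gal_res_open _ _ _ _ K K' sK) U').
  by move=> g /pnE h; apply: m2P; apply: ppow_le h; apply: leq_addl.
have [s sP] := group_dense pp a V (n + n').
have lv_le (W : open_sub (@krull_open k K : set (set (gal K)))) m m' (y : Lambda K) :
    (m <= m')%N -> lvn W m' y -> lvn W m y.
  move=> mm h c; apply: dvr_trans (h c); exists ((p ^ (m' - m))%:R).
  by rewrite -natrM -expnD subnK.
pose b : Lambda K := \sum_(g <- s) group_elt g.
have ba : lvn V (n + n') (b - a) := sP.
rewrite -(zsP b x) //; last first.
  by apply: near_lvn; apply: lvn_le VU _; apply: lv_le ba; apply: leq_addr.
rewrite -(zsP' (Lambda_res sK b) (rho x)) //; last first.
  apply: near_lvn; rewrite -rmorphB; apply: push_lvn.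
  by apply: lvn_le VU' _; apply: lv_le ba; apply: leq_addl.
rewrite -rho_iw //; congr (iw_gal _ z); rewrite /b.
have r0 : Lambda_res sK 0 = 0 := rmorph0 _.
have rD (y z : Lambda K) : Lambda_res sK (y + z) = Lambda_res sK y + Lambda_res sK z := rmorphD _ _ _.
elim: (s) => [|g s' IH]; first by rewrite !big_nil r0 !scale0r rho0.
rewrite !big_cons rD !scalerDl rhoD IH rho_group; congr (_ *: _ + _).
by rewrite /Lambda_res push_delta.
Qed.
End ModuleRestriction.

(** * Kernel and cokernel of restriction *)

Section GaloisDescent.
Variables (p d d' : nat) (k : divringClosed algC) (K : zp_ext p d k) (K' : zp_ext p d' k).
Variable sK : {subset K' <= K}.
Variables (X : iwasawa_module K) (X' : iwasawa_module K').
Hypothesis pp : prime p.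
Local Notation LM := (Lmax p K).
Local Notation LM' := (Lmax p K').
Local Notation rho := (rho (X := X) X').

Variable g0 : gal K.
Hypothesis g0P : forall g : gal K, gal_res sK g = 0 <-> exists z, g = z *: g0.

Lemma commC_fixer t s : fixer k t -> fixer k s -> fixer K (commC t s).
Proof.
move=> tk sk x xK; rewrite /commC /=.
have s'x : invC s x \in K by apply: zp_stable xK; apply: fixer_inv.
by rewrite (zp_comm (K := K) (fixer_inv tk) (fixer_inv sk) xK) !invCKV.
Qed.

Lemma gres_line u : fixer K' u -> exists z, gres K u = z *: g0.
Proof.
by move=> uK'; apply/g0P; rewrite -(gres_res sK (fixer_base uK')) gres0.
Qed.

(** (g' - 1) applied to the class of [u] is the class of the commutator of a lift of g' with [u],
    which fixes K because Gal(K/k) is abelian. *)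
Lemma rho_coker g' (x' : X') : exists x, (group_elt g' - 1) *: x' = rho x.
Proof.
have [u uK' <-] := cls_surj pp x'; have [t tk <-] := gres_lift g'.
have uk := fixer_base uK'; have cK := commC_fixer tk uk; exists (cls X (commC t u)).
rewrite (rho_cls sK) // scalerBl scale1r cls_conj // -clsV // -clsM //.
- exact: conj_fixer.
- exact: fixer_inv.
Qed.

(** The extra generator is the class of a lift [u] of [g0]. An element over K' acts on K as z g0; a
    limit of natural powers of [u] acts the same way, and the quotient of the two fixes K. *)
Lemma rho_generated : exists x0 : X', forall x', exists x a, x' = rho x + a *: x0.
Proof.
have La := gal_is_lat K pp.
have [u uk ug] := gres_lift g0; have uK' : fixer K' u.
  apply: fixer_ext => //; rewrite (gres_res sK) // ug; apply/g0P; exists 1; exact: esym (scale1r _).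
exists (cls X' u) => x'; have [w wK' <-] := cls_surj pp x'.
have [z zE] := gres_line wK'.
pose m n := projT1 (cid (zp_approx pp z n)).
have mP n : dvr ((p ^ n)%:R : padic p) (z - (m n)%:R) by rewrite /m; case: cid => ? [].
have [F [FU Fc]] := free_ultra.
pose s n := projT1 (cid (iter_aut u (m n))).
have sE n x : s n x = iter (m n) u x by rewrite /s; case: cid.
have [v sv] := ulim_aut s FU.
have sK' n : fixer K' (s n).
  by move=> x xK'; rewrite sE; elim: (m n) => //= j ->; apply: uK'.
have vK' := ulim_fixer FU sv sK'.
have vz : gres K v = z *: g0.
  apply: gres_eq => [|x xK]; first exact: fixer_base vK'.
  have [N NP] := gal_small xK.
  have [n [/= Nn <-]] := filter_ex (filterI (Fc N) (sv x)).
  rewrite sE -(gres_iter (m n) uk xK) ug; have -> : z *: g0 = g0 *+ m n + (z - (m n)%:R) *: g0.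
    by rewrite -scaler_nat scalerBl addrC subrK.
  rewrite gal_addE; congr (gal_fun _ _); apply: NP; have [c ->] := mP n.
  by apply: (ppow_le Nn); exists (c *: g0); rewrite scalerA mulrC.
have [a aP] := ulim_ex pp (fun n => (m n)%:R : Lambda K') FU.
have va : cls X' v = a *: cls X' u.
  have h1 := xlim_scalar FU (cls X' u) aP; have h2 := xlim_cls X' pp FU sK' sv.
  apply: (xlim_unique FU h2); apply: xlim_eq h1; apply: filterS filterT => n _ /=.
  rewrite scaler_nat; elim: (m n) (s n) (sE n) (sK' n) => [|j IH] t tE tK'.
    by rewrite mulr0n cls0 // => x _; rewrite tE.
  have [t0 t0E] := iter_aut u j; rewrite mulrS (IH t0 t0E) -?clsM //; last 2 first.
  - by move=> x xK'; rewrite t0E; elim: (j) => //= i ->; apply: uK'.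
  - by move=> x xK'; rewrite t0E; elim: (j) => //= i ->; apply: uK'.
  by apply: cls_ext => // x _; rewrite tE /= t0E.
have qK : fixer K (w \o invC v).
  apply: fixer_ext; first by apply: fixerM; [exact: fixer_base wK'|exact/fixer_inv/(fixer_base vK')].
  rewrite gresM; [|exact: fixer_base wK'|exact/fixer_inv/(fixer_base vK')].
  have : gres K v + gres K (invC v) = 0.
    rewrite -gresM; [|exact: fixer_base vK'|exact/fixer_inv/(fixer_base vK')].
    by apply: gres0 => x _ /=; rewrite invCKV.
  by rewrite vz zE.
exists (cls X (w \o invC v)), a; rewrite (rho_cls sK) // -va -clsM //; last first.
  exact: fixer_sub qK.
by apply/esym/cls_ext => // x _ /=; rewrite invCK.
Qed.

Local Notation T := (group_elt g0 - 1 : Lambda K).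
Definition TX : set X := [set x | exists y, x = T *: y].

Lemma TX0 : TX 0. Proof. by exists 0; rewrite scaler0. Qed.
Lemma TXD x y : TX x -> TX y -> TX (x + y).
Proof. by move=> [a ->] [b ->]; exists (a + b); rewrite scalerDr. Qed.
Lemma TXZ a x : TX x -> TX (a *: x).
Proof. by move=> [b ->]; exists (a *: b); rewrite !scalerA mulrC. Qed.
Lemma TXN x : TX x -> TX (- x).
Proof. by move=> h; rewrite -scaleN1r; apply: TXZ. Qed.
Lemma TX_group u x : fixer K' u -> TX (group_elt (gres K u) *: x - x).
Proof.
move=> uK'; have [z ->] := gres_line uK'.
have La := gal_is_lat K pp.
have [c cE] : dvr (T : Lambda K) (group_elt (z *: g0) - 1).
  apply: (delta_kernel pp La) => U Ug0; rewrite -(delta0 (p := p)).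
  by apply: delta_lev; rewrite subr0; apply: (osub_scale pp (gal_lattice K)).
by exists (c *: x); rewrite scalerA mulrC -cE scalerBl scale1r.
Qed.

Local Notation chi t s := (cls X (commC t s)).

(** The commutator identity for a product conjugates one term by [s], and [s] acts on X through a
    power of [g0], hence trivially modulo [TX]. *)
Lemma chiM t s s2 : fixer k t -> fixer K' s -> fixer K' s2 ->
  TX (chi t (s \o s2) - (chi t s + chi t s2)).
Proof.
move=> tk /[dup] sK' /fixer_base sk /fixer_base s2k.
have E : {in LM, commC t (s \o s2) =1 commC t s \o (s \o commC t s2 \o invC s)}.
  by move=> x _; rewrite /commC /= !invCK invC_comp.
rewrite (cls_ext X pp _ E); last first.
  by apply: fixerM; [exact: commC_fixer|apply: conj_fixer => //; exact: commC_fixer].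
rewrite clsM //; [|exact: commC_fixer|by apply: conj_fixer => //; exact: commC_fixer].
rewrite -cls_conj //; last exact: commC_fixer.
by rewrite opprD addrACA subrr add0r; apply: TX_group.
Qed.

Lemma chi_cocycle t t2 s : fixer k t -> fixer k t2 -> fixer k s ->
  chi (t \o t2) s = group_elt (gres K t) *: chi t2 s + chi t s.
Proof.
move=> tk t2k sk.
have E : {in LM, commC (t \o t2) s =1 (t \o commC t2 s \o invC t) \o commC t s}.
  by move=> x _; rewrite /commC /= !invCK invC_comp.
rewrite (cls_ext X pp _ E); last first.
  by apply: fixerM; [apply: conj_fixer => //|]; exact: commC_fixer.
rewrite clsM //; [|by apply: conj_fixer => //; exact: commC_fixer|exact: commC_fixer].
by rewrite cls_conj //; exact: commC_fixer.
Qed.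

(** The class is that of [t] minus its conjugate by [s], and [s] acts trivially modulo [TX]. *)
Lemma chi_left t s : fixer K t -> fixer K' s -> TX (chi t s).
Proof.
move=> tK /[dup] sK' /fixer_base sk; have tk := fixer_base tK.
rewrite (cls_ext X pp _ (w := commC t s) (u := t \o (s \o invC t \o invC s))) //; last first.
  by apply: fixerM => //; apply: conj_fixer => //; exact: fixer_inv.
rewrite clsM //; last by apply: conj_fixer => //; exact: fixer_inv.
rewrite -cls_conj ?clsV //; last exact: fixer_inv.
by rewrite scalerN -opprB; apply/TXN/TX_group.
Qed.

Lemma chi_right t s : fixer k t -> fixer K s -> chi t s = (group_elt (gres K t) - 1) *: cls X s.
Proof.
move=> tk sK0; rewrite (cls_ext X pp _ (w := commC t s) (u := (t \o s \o invC t) \o invC s)) //.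
  by rewrite clsM ?clsV -?cls_conj ?scalerBl ?scale1r //; [exact: conj_fixer|exact: fixer_inv].
by apply: fixerM; [exact: conj_fixer|exact: fixer_inv].
Qed.

Lemma chi_lim (F : set_system nat) (s : nat -> Caut) (u : Caut) t b : UltraFilter F ->
  fixer k t -> (forall n, fixer K' (s n)) -> (forall z, F [set n | s n z = u z]) ->
  (forall n, TX (b *: chi t (s n))) -> TX (b *: chi t u).
Proof.
move=> FU tk sK' su h; have cK n : fixer K (commC t (s n)) by apply: commC_fixer => //; exact: fixer_base (sK' n).
have lim : xlim F (fun n => chi t (s n)) (chi t u).
  apply: (xlim_cls X pp FU cK) => z; rewrite /commC /=.
  apply: filterS (filterI (su (invC u z)) (su (invC t (invC u z)))) => n /= [e1 e2].
  have -> : invC (s n) z = invC u z by rewrite -[z in LHS](invCKV u) -e1 invCK.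
  by rewrite e2.
exact: (xlim_image pp FU h (xlim_scale FU b lim)).
Qed.

(** The commutator of [e] with [s] is inertial and fixes K, so its class is 0. The cocycle rule for
    e t then gives e times chi t s, while e t = [e, t] t e gives chi t s plus a term with first
    argument fixing K, which is in [TX]. *)
Lemma chi_decomp v e t s : fixer k e -> decomp v e -> fixer k t -> fixer K' s -> inertia v s ->
  TX ((group_elt (gres K e) - 1) *: chi t s).
Proof.
move=> ek ve tk /[dup] sK' /fixer_base sk sv.
have e0 : chi e s = 0.
  apply: cls0 => // x /(LM_elt _ pp)[_ _ h _]; apply: (h v); first exact: commC_fixer.
  apply: inertiaM; last exact: inertiaV sv (invCKV s).
  move=> a; have -> : aut_int (e \o s \o invC e) a - a =
      aut_int e (aut_int s (aut_int (invC e) a) - aut_int (invC e) a).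
    by apply: val_inj; rewrite /= rmorphB /= invCKV.
  by apply/ve/sv.
have h1 := chi_cocycle ek tk sk; rewrite e0 addr0 in h1.
rewrite scalerBl scale1r -h1.
have nK := commC_fixer ek tk; have nk := fixer_base nK.
have tek : fixer k (t \o e) by exact: fixerM.
have -> : chi (e \o t) s = chi (commC e t \o (t \o e)) s.
  apply: cls_ext => //; first by apply: commC_fixer => //; exact: fixerM.
  by move=> x _; rewrite /commC /= !(invC_comp, invC_inv, invCK, invCKV).
rewrite (chi_cocycle nk tek sk) (gres0 nK) (chi_cocycle tk ek sk) e0 scaler0 add0r.
have -> : group_elt 0 *: chi t s = chi t s := scale1r _.
by rewrite addrAC subrr add0r; apply: chi_left.
Qed.

Definition annihilates_inertia (b : Lambda K) := forall (v : place) (s t : Caut),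
  v p%:R -> fixer K' s -> inertia v s -> fixer k t -> TX (b *: chi t s).

Section Kernel.
Variable b : Lambda K.
Hypotheses (nfk : number_field k) (hb : annihilates_inertia b).

Definition JB : set Caut := [set s : Caut | fixer K' s /\ forall t, fixer k t -> TX (b *: chi t s)].

Lemma chiM_b t s s2 : fixer k t -> fixer K' s -> fixer K' s2 ->
  exists2 x, TX x & b *: chi t (s \o s2) = b *: chi t s + b *: chi t s2 + x.
Proof.
move=> tk s1 s2K; have h := TXZ b (chiM tk s1 s2K).
exists (b *: (chi t (s \o s2) - (chi t s + chi t s2))) => //.
by rewrite -!scalerDr addrC subrK.
Qed.

Lemma JB1 : JB idfun.
Proof.
split=> // t tk; rewrite cls0 ?scaler0 //; first exact: TX0.
move=> x _; rewrite /commC /=.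
have -> : invC idfun x = x by have := invCK idfun x.
exact: invCKV.
Qed.

Lemma JBM (s s2 : Caut) : JB s -> JB s2 -> JB (s \o s2).
Proof.
move=> [s1 h1] [s2K h2]; split=> [|t tk]; first exact: fixerM.
have [x Tx ->] := chiM_b tk s1 s2K; apply: TXD => //.
by apply: TXD; [apply: h1|apply: h2].
Qed.

Lemma chiV t s : fixer k t -> fixer K' s -> TX (chi t s + chi t (invC s)).
Proof.
move=> tk s1; have := TXN (chiM tk s1 (fixer_inv s1)); rewrite opprB (_ : chi t (s \o invC s) = 0) ?subr0 //.
by apply: cls0 => // x _; rewrite /commC /= invCKV invC_comp invC_inv !invCKV.
Qed.

Lemma JB_commC (s s2 : Caut) : fixer K' s -> fixer K' s2 -> JB (commC s s2).
Proof.
move=> s1 s2K; have s1V := fixer_inv s1; have s2V := fixer_inv s2K; split=> [|t tk].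
  exact: (fixerM (fixerM (fixerM s1 s2K) s1V) s2V).
have M u w : fixer K' u -> fixer K' w -> TX (chi t (u \o w) - (chi t u + chi t w)).
  exact: chiM.
apply: TXZ; set a := chi t s; set c := chi t s2.
have h1 := M _ _ (fixerM (fixerM s1 s2K) s1V) s2V.
have h2 := M _ _ (fixerM s1 s2K) s1V.
have h3 := M _ _ s1 s2K; have h4 := chiV tk s1; have h5 := chiV tk s2K.
have step x y z : TX (x - y) -> TX (y + z) -> TX (x + z).
  by move=> xy yz; have -> : x + z = (x - y) + (y + z); [rewrite addrA subrK|apply: TXD].
rewrite -[chi t (commC s s2)]addr0; apply: (step _ _ _ h1); rewrite addr0; apply: (step _ _ _ h2).
by rewrite -addrA; apply: (step _ _ _ h3); rewrite addrACA; apply: TXD.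
Qed.

Lemma JB_lim (F : set_system nat) (s : nat -> Caut) (u : Caut) : UltraFilter F ->
  (forall n, JB (s n)) -> (forall z, F [set n | s n z = u z]) -> JB u.
Proof.
move=> FU hs su; have sK' n : fixer K' (s n) by case: (hs n).
split=> [|t tk]; first exact: ulim_fixer FU su sK'.
by apply: (chi_lim FU tk sK' su) => n; have [_] := hs n; apply.
Qed.

(** The four conditions over K' are checked one by one: commutators lie in [JB], powers of an
    element over K' approach one over K, inertia lies in [JB] above p and fixes K elsewhere, and
    complex conjugations fix K. *)
Lemma JB_fixed x : x \in LM -> (forall s, JB s -> s x = x) -> x \in LM'.
Proof.
move=> /[dup] xLM /(LM_elt _ pp)[_ x2 x3 x4] xJ; apply/(LM_elt _ pp); split.
- move=> u w uK wK; have := xJ _ (JB_commC (fixer_inv uK) (fixer_inv wK)).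
  rewrite /commC /= !invC_inv => h.
  by rewrite -[RHS](congr1 (w \o u) h) /= !invCKV.
- move=> u uK'; have uk := fixer_base uK'.
  (* The powers u^(p^j) have a limit [v] fixing K. On the finitely many conjugates of x some u^(p^j)
     agrees with [v], a p-power of which fixes x. *)
  have [F [FU Fc]] := free_ultra; pose s j := projT1 (cid (iter_aut u (p ^ j))).
  have sE j y : s j y = iter (p ^ j) u y by rewrite /s; case: cid.
  have [v sv] := ulim_aut s FU.
  have vK : fixer K v.
    move=> y yK; have [m mP] := zp_pow uk yK.
    have [j [/= mj <-]] := filter_ex (filterI (Fc m) (sv y)).
    by rewrite sE -(subnKC mj) expnD; apply: iter_fixM.
  have [m mP] := x2 v vK; have [cs csP] := conj_finite x.
  have [j /= jP] := filter_ex (filter_all FU (fun y (_ : y \in cs) => sv y)).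
  exists (j + m)%N; rewrite expnD -[RHS]mP.
  elim: (p ^ m)%N => [|i IH]; first by rewrite muln0.
  rewrite mulnS iterD IH /= -sE jP // -IH.
  by have [w <-] := iter_aut u (p ^ j * i); apply: csP.
- move=> v u uK' uv; have [vp|nvp] := pselect (v p%:R).
    by apply: xJ; split=> // t tk; apply: hb vp uK' uv tk.
  by apply: (x3 v) => //; apply: (zp_tame pp nfk nvp (fixer_base uK') uv).
(* Here [u] is an involution, and Gal(K/k) has no 2-torsion, so [u] fixes K. *)
- move=> nu u uK' un; apply: (x4 nu) => //.
  apply: (zp_torsion pp (n := 2) (fixer_base uK')) => // y _ /=.
  by apply: (fmorph_inj nu); rewrite !un conjCK.
Qed.

(* The [s] over [K'] whose commutators are killed by [b] modulo [TX] form a closed group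
   containing commutators and inertia, so what it fixes in [Lmax p K] lies in
   [Lmax p K']; Galois theory puts every [s] trivial on [Lmax p K'] in it. *)
Lemma rho_kernel x g : rho x = 0 -> TX (b *: ((group_elt g - 1) *: x)).
Proof.
have [s sK0 <-] := cls_surj pp x; rewrite (rho_cls sK) // => s0.
have sLM' : {in LM', s =1 id}.
  move=> z zL; rewrite -(clsP X' pp (fixer_sub sK sK0) zL) s0.
  have := clsP X' pp (u := idfun) (fun z _ => erefl) zL.
  by rewrite (cls0 X' pp (u := idfun)).
have [t tk <-] := gres_lift g.
have st n : exists s', JB s' /\ forall y, y \in first_C n -> y \in LM -> s' y = s y.
  have [z zL zP] := primitive_first (lmax_elt_pred p K) n.
  have zLM : z \in LM by rewrite LmaxE.
  have [ob [zo oP op]] := @orbit1 JB z JB1 JBM.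
  have oL y : y \in ob -> y \in lmax_elt_pred p K.
    move=> /oP[w [wK _] ->]; rewrite -(LmaxE K pp); apply: LM_stable zLM => //.
    exact: fixer_base wK.
  pose q := \prod_(y <- ob) ('X - y%:P).
  (* The conjugates of z under [JB] are the roots of a polynomial over Lmax(K'), which [s] fixes; so
     s z is one of them. *)
  have qL i : q`_i \in LM'.
    apply: JB_fixed => [|w wJ].
      rewrite LmaxE //; apply: polyOverP; rewrite /q big_seq_cond; apply: rpred_prod => y /andP[yo _].
      by rewrite polyOverXsubC oL.
    by have /polyP/(_ i) := perm_prod_fixed (op w wJ); rewrite coef_map.
  have : root q (s z).
    rewrite (_ : q = map_poly s q) ?fmorph_root ?root_prod_XsubC //.
    by apply/polyP => i; apply/esym; rewrite coef_map; apply/sLM'/qL.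
  rewrite root_prod_XsubC => /oP[w wJ wz]; exists w; split=> // y yn yL.
  have yG : y \in lmax_elt_pred p K by rewrite -(LmaxE K pp).
  have [r ->] := zP y yn yG.
  by rewrite !aut_horner wz.
have [F [FU Fc]] := free_ultra; pose w n := projT1 (cid (st n)).
have wP n := projT2 (cid (st n)).
have [v wv] := ulim_aut w FU.
have vJ : JB v by apply: JB_lim FU _ wv => n; case: (wP n).
have vs : {in LM, v =1 s}.
  move=> y yL; have [m mP] := mem_first_C y.
  have [n [/= mn <-]] := filter_ex (filterI (Fc m) (wv y)).
  by have [_] := wP n; apply => //; apply: mP.
have vK : fixer K v by move=> y yK; rewrite vs ?sK0 //; apply: (sub_LM pp).
have [_ /(_ t tk)] := vJ; rewrite chi_right //.
by rewrite (cls_ext X pp sK0 vs).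
Qed.
End Kernel.
End GaloisDescent.

(** * Places above p and their decomposition groups *)

Section PlacesOverP.
Variables (p : nat) (k : divringClosed algC).
Hypotheses (pp : prime p) (nfk : number_field k).

Lemma place_char_int (v : place) (m : int) : v p%:R -> v m%:~R -> (p %| m)%Z.
Proof.
move=> vp vm; have tP := trace_prime v k.
have pE : val (p%:R : AintT) = p%:R by rewrite rmorph_nat.
have mE : val (m%:~R : AintT) = m%:~R by rewrite rmorph_int.
apply: (poi_intP tP pp).
  by rewrite -pE; apply/traceP; rewrite pE rpred_nat.
by rewrite -mE; apply/traceP; rewrite mE rpred_int.
Qed.

Lemma places_conjugate (v w : place) : v p%:R -> w p%:R ->
  exists u : Caut, forall a, w a <-> v (aut_int u a).
Proof.
move=> vp wp; have [c wc cQ|u _ uP] := @subplace_conjugate v Crat w (pl_ideal w).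
  have /intrP[m cE] := Cint_rat_Aint cQ (AintT_valP c).
  have {}cE : c = m%:~R by apply: val_inj; rewrite cE rmorph_int.
  have /dvdzP[q mE] := place_char_int wp (m := m) (eq_ind c w wc _ cE).
  by rewrite cE mE intrM; apply: (idealM _ (pl_ideal v)).
exists u => a; split; first exact: uP.
exact: (@place_max w (twist u v)).
Qed.

(** All places above p are conjugate over Q, and two automorphisms that agree on generators of k
    differ by one that fixes k; the generators have finitely many systems of conjugates. *)
Lemma finitely_many_places : exists n (v : 'I_n -> place), (forall j, v j p%:R) /\
  forall w : place, w p%:R -> exists j (t : Caut), fixer k t /\ forall a, w a <-> v j (aut_int t a).
Proof.
have [[v0 v0p]|no] := pselect (exists v : place, v p%:R); last first.
  have f0 : 'I_0 -> place by case.
  by exists 0%N, f0; split=> [[]//|w wp]; case: no; exists w.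
have [n [b bk]] := nfk; have [S SP] := conj_finite_seq (codom b).
pose lmax_elt_key key (u : Caut) := map u (codom b) = key.
pose f key : Caut := if pselect (exists u, lmax_elt_key key u) is left h then projT1 (cid h) else idfun.
have fP (u : Caut) : map (f (map u (codom b))) (codom b) = map u (codom b).
  rewrite /f; case: pselect => [h|[]]; last by exists u.
  exact: (projT2 (cid h)).
exists (size S), (fun j => twist (f (nth [::] S j)) v0); split=> [j|w wp] /=.
  by rewrite rmorph_nat.
have [u uP] := places_conjugate v0p wp.
have [j jS jE] := nthP [::] (SP u); exists (Ordinal jS), (invC (f (map u (codom b))) \o u).
rewrite jE; split.
  have e y : y \in codom b -> f (map u (codom b)) y = u y by move/eq_in_map: (fP u); apply.
  move=> y /bk[c ->]; rewrite rmorph_sum; apply: eq_bigr => i _.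
  by rewrite rmorphM fmorph_rat /= -e ?codom_f // invCK.
move=> a; rewrite uP; suff -> : aut_int (f (map u (codom b))) (aut_int (invC (f (map u (codom b))) \o u) a) = aut_int u a by [].
by apply: val_inj; rewrite /= invCKV.
Qed.
End PlacesOverP.

Section RamifiedPairs.
Variables (p d : nat) (k : divringClosed algC) (K : zp_ext p d k).
Hypotheses (pp : prime p) (nfk : number_field k).

Definition lifts_decomp (v : place) (g : gal K) := exists e : Caut, [/\ fixer k e, decomp v e & gres K e = g].

(** A lift [u] of [g] carries [v] to a place with the same trace on K. Transitivity over K gives an
    automorphism fixing K that corrects [u] into the decomposition group of [v]. *)
Lemma decomposition_lift (v : place) (g : gal K) :
  decomposition_group K (trace v K) g -> lifts_decomp v g.
Proof.
move=> gP; have [u uk ug] := gres_lift g; have uK x : x \in K -> u x = g x by move=> xK; rewrite -ug gresP.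
have [c vc cK|w wK wP] := @subplace_conjugate v K [set a | v (aut_int u a)] (pl_ideal (twist u v)).
  have : trace v K (val (aut_int u c)) by apply/traceP; split=> //; exact: zp_stable uk _ cK.
  rewrite -gP => -[x [xK [a aE va]]] /=; rewrite uK // => gx.
  have : c = a.
    by apply: val_inj; rewrite aE; apply: (fmorph_inj u); rewrite !uK.
  by move=> ->.
have wv a : v (aut_int u a) <-> v (aut_int w a).
  split; first exact: wP.
  exact: (@place_max (twist u v) (twist w v)).
have wk := fixer_base wK.
exists (u \o invC w); split.
- exact/fixerM/fixer_inv.
- move=> a; have -> : aut_int (u \o invC w) a = aut_int u (aut_int (invC w) a) by apply: val_inj.
  rewrite wv; suff -> : aut_int w (aut_int (invC w) a) = a by [].
  by apply: val_inj; rewrite /= invCKV.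
- by rewrite (gresM K uk (fixer_inv wk)) (gres0 (fixer_inv wK)) addr0.
Qed.

Lemma lifts_decomp_conj (v w : place) (t : Caut) g : fixer k t -> (forall a, w a <-> v (aut_int t a)) ->
  lifts_decomp v g -> lifts_decomp w g.
Proof.
move=> tk wv [e [ek ve eg]]; exists (invC t \o e \o t); split.
- by apply: fixerM => //; apply: fixerM => //; apply: fixer_inv.
- move=> a; rewrite !wv -[v (aut_int t a)](ve (aut_int t a)).
  suff -> : aut_int t (aut_int (invC t \o e \o t) a) = aut_int e (aut_int t a) by [].
  by apply: val_inj; rewrite /= invCKV.
- rewrite -eg; apply: gres_eq => [|x xK].
    by apply: fixerM => //; apply: fixerM => //; apply: fixer_inv.
  by rewrite gresP //= (zp_comm ek tk xK) invCK.
Qed.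

Lemma ramified_pairs :
  (forall q : set algC, prime_of_integers k q -> q p%:R ->
     forall P : set algC, prime_of_integers K P -> P `&` [set x | x \in k] = q ->
     rank_ge 2 (decomposition_group K P)) ->
  exists n (D : 'I_n -> 'I_2 -> gal K),
    (forall j (c : 'I_2 -> padic p), \sum_i c i *: D j i = 0 -> forall i, c i = 0) /\
    forall v : place, v p%:R -> exists j, forall i, lifts_decomp v (D j i).
Proof.
move=> rk; have [n [v [vp vs]]] := finitely_many_places pp nfk.
have /choice[D DP] : forall j, exists D : 'I_2 -> gal K, (forall i, lifts_decomp (v j) (D i)) /\
    forall c : 'I_2 -> padic p, \sum_i c i *: D i = 0 -> forall i, c i = 0.
  move=> j; have [D [DP Dc]] : rank_ge 2 (decomposition_group K (trace (v j) K)).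
    apply: (rk _ (trace_prime (v j) k) _ _ (trace_prime (v j) K)).
      rewrite -(rmorph_nat (val : AintT -> algC)); apply/traceP; split=> //.
      by rewrite rmorph_nat rpred_nat.
    apply/seteqP; split=> x /=.
      by move=> [[xK xv] xk]; split.
    by move=> [xk xv]; split=> //; split=> //; apply: zp_ext_base.
  by exists D; split=> // i; apply: decomposition_lift.
exists n, D; split=> [j|w wp]; first by case: (DP j).
have [j [t [tk wv]]] := vs w wp; exists j => i.
by apply: lifts_decomp_conj tk wv _; case: (DP j).
Qed.
End RamifiedPairs.

Section Annihilation.
Variables (p d d' : nat) (k : divringClosed algC) (K : zp_ext p d k) (K' : zp_ext p d' k).
Variable sK : {subset K' <= K}.
Variable X : iwasawa_module K.
Hypothesis pp : prime p.
Variable g0 : gal K.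
Hypothesis g0P : forall g : gal K, gal_res sK g = 0 <-> exists z, g = z *: g0.

Lemma pairs_annihilate n (D : 'I_n -> 'I_2 -> gal K) (e : 'I_n -> 'I_2) :
  (forall v : place, v p%:R -> exists j, forall i, lifts_decomp v (D j i)) ->
  annihilates_inertia K' X g0 (\prod_j (group_elt (D j (e j)) - 1)).
Proof.
move=> h v s t vp sK' sv tk; have [j jP] := h v vp.
have [u [uk vu ug]] := jP (e j).
rewrite (bigD1 j) //= mulrC -scalerA; apply: TXZ.
rewrite -ug; exact: (chi_decomp X pp g0P uk vu tk sK' sv).
Qed.
End Annihilation.

(** * Descent to the quotient *)

Section Extension.
Variable R : comPzRingType.

Lemma fin_gen_extension (M M' : lmodType R) (h : {linear M -> M'}) : noeth R ->
  fin_gen (ker h) -> fin_gen M' -> fin_gen M.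
Proof.
move=> nR [m [u uker]] [n [g gM']].
have [||||n' [v [vh vspan]]] := @noeth_module R M' n g [set y | exists x, y = h x] nR.
- by exists 0; rewrite linear0.
- by move=> _ _ [x ->] [y ->]; exists (x + y); rewrite linearD.
- by move=> a _ [x ->]; exists (a *: x); rewrite linearZ.
- by move=> y _; apply: gM'.
have /choice[w wE] := vh.
exists (m + n')%N, (fun j => match fintype.split j with inl a => val (u a) | inr b => w b end) => x.
have [c cE] := vspan (h x) (ex_intro _ x erefl).
pose y := x - \sum_j c j *: w j.
have y0 : h y = 0.
  rewrite linearB linear_sum cE.
  have -> : \sum_j h (c j *: w j) = \sum_j c j *: v j.
    by apply: eq_bigr => j _; rewrite linearZ wE.
  exact: subrr.
have yk : y \in sub_pred (ker_pred h) by rewrite /sub_pred unfold_in y0.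
have [e eE] := uker (exist _ y yk).
exists (fun j => match fintype.split j with inl a => e a | inr b => c b end).
rewrite big_split_ord /=.
under eq_bigr => j _ do rewrite (unsplitK (inl j)).
under [X in _ + X]eq_bigr => j _ do rewrite (unsplitK (inr j)).
have /(congr1 val) := eE; rewrite linear_sum /= => E.
rewrite -[x](subrK (\sum_j c j *: w j)); congr (_ + _).
exact: E.
Qed.

Lemma idealI (I J : set R) : is_ideal I -> is_ideal J -> is_ideal (I `&` J).
Proof.
move=> [I0 ID IM] [J0 JD JM]; split=> // [a b [Ia Ja] [Ib Jb]|a b [Ib Jb]].
  by split; [apply: ID|apply: JD].
by split; [apply: IM|apply: JM].
Qed.

Lemma grade2I (I J : set R) : is_ideal I -> is_ideal J -> grade2 I -> grade2 J -> grade2 (I `&` J).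
Proof.
move=> [_ _ IM] [_ _ JM] gI gJ; apply: grade2M gI gJ _ => a b Ia Jb; split.
  by rewrite mulrC; apply: IM.
exact: JM.
Qed.

Lemma inverse_to_cyclic t (f : 'I_t -> R) (M : lmodType R) (h : {linear M -> sum_cyclic f}) :
  normal_ring R -> \prod_l f l != 0 -> grade2 (kills_ker h) -> grade2 (kills_coker h) ->
  exists g : {linear sum_cyclic f -> M}, grade2 (kills_ker g `&` kills_coker g).
Proof.
move=> gR F0 gk gc.
apply: (pseudo_inverse gR (h := h) (B := kills_ker h `&` kills_coker h) _ _ F0).
- exact: idealI (kills_ker_ideal h) (kills_coker_ideal h).
- exact: grade2I (kills_ker_ideal h) (kills_coker_ideal h) gk gc.
- by move=> b [].
- by move=> b [].
- by move=> b m [bk _]; rewrite -scalerA; apply: bk; rewrite linearZ /= cyc_annihilated.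
- by move=> b y _; rewrite -scalerA cyc_annihilated scaler0.
Qed.

Lemma inverse_of_cyclic t (f : 'I_t -> R) (M : lmodType R) (h : {linear sum_cyclic f -> M}) :
  normal_ring R -> \prod_l f l != 0 -> grade2 (kills_ker h) -> grade2 (kills_coker h) ->
  exists g : {linear M -> sum_cyclic f}, grade2 (kills_ker g `&` kills_coker g).
Proof.
move=> gR F0 gk gc.
apply: (pseudo_inverse gR (h := h) (B := kills_ker h `&` kills_coker h) _ _ F0).
- exact: idealI (kills_ker_ideal h) (kills_coker_ideal h).
- exact: grade2I (kills_ker_ideal h) (kills_coker_ideal h) gk gc.
- by move=> b [].
- by move=> b [].
- by move=> b y _; rewrite -scalerA cyc_annihilated scaler0.
- move=> b m [_ bc]; have [s sE] := bc m.
  by rewrite mulrC -scalerA sE -linearZ cyc_annihilated linear0.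
Qed.
End Extension.

(** * Descent of homomorphisms from cyclic sums *)

Section Descent.
Variables (R R' : comPzRingType) (pi : {rmorphism R -> R'}).
Variables (X : lmodType R) (X' : lmodType R') (rho : X -> X') (T : R).
Hypotheses (pi_surj : forall a', exists a, pi a = a') (piT : pi T = 0).
Hypothesis rhoD : forall x y, rho (x + y) = rho x + rho y.
Hypothesis rhoZ : forall a x, rho (a *: x) = pi a *: rho x.
Variables (t : nat) (f : 'I_t -> R) (phi : {linear sum_cyclic f -> X}).

Let rho_sum (J : finType) (u : J -> X) : rho (\sum_j u j) = \sum_j rho (u j).
Proof.
have rho0 : rho 0 = 0 by apply: (addIr (rho 0)); rewrite -rhoD !add0r.
by rewrite (big_morph rho rhoD rho0).
Qed.

Lemma descent_map : exists psi : {linear sum_cyclic (pi \o f) -> X'},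
  forall r, psi (cyc (pi \o f) (pi \o r)) = rho (phi (cyc f r)).
Proof.
have [l|psi psiE] := @cyc_lift _ _ (pi \o f) X' (fun l => rho (phi (cyc_gen f l))).
  rewrite /= -rhoZ -linearZ cycZ.
  suff -> : cyc f (fun l' => f l * (l' == l)%:R) = 0 by rewrite linear0 -(scale0r 0) rhoZ rmorph0 scale0r.
  rewrite cyc0; apply/cycP => l'; rewrite subr0.
  by case: eqP => [->|_]; [exists 1; rewrite mulr1 mul1r|exists 0; rewrite mulr0 mul0r].
exists psi => r; rewrite psiE (cyc_sum f r) linear_sum rho_sum.
by apply: eq_bigr => l _; rewrite linearZ rhoZ.
Qed.

Variable psi : {linear sum_cyclic (pi \o f) -> X'}.
Hypothesis psiE : forall r, psi (cyc (pi \o f) (pi \o r)) = rho (phi (cyc f r)).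

Lemma descent_coker a j : kills_coker phi a -> (forall x', exists x, j *: x' = rho x) ->
  kills_coker psi (pi a * j).
Proof.
move=> ka kj x'; have [x xE] := kj x'; have [s sE] := ka x; have [r rE] := cyc_surj s.
by exists (cyc (pi \o f) (pi \o r)); rewrite psiE -rE -sE rhoZ -scalerA xE.
Qed.

(** For r in the kernel, c phi(r) = T y and a y = phi(s1), so [phi] kills a c r - T s1 and [b] kills
    it in the cyclic sum. Reduction along [pi] removes the term in [T]. *)
Lemma descent_ker a b c : kills_coker phi a -> kills_ker phi b ->
  (forall x, rho x = 0 -> exists y, c *: x = T *: y) -> kills_ker psi (pi a * pi b * pi c).
Proof.
move=> ka kb kc s'; have [r' ->] := cyc_surj s'; have /choice[r rE] := fun l => pi_surj (r' l).
have -> : r' = pi \o r by apply/funext => l; rewrite /= rE.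
rewrite psiE => /kc[y yE]; have [s1 s1E] := ka y; have [r1 r1E] := cyc_surj s1.
have : phi ((a * c) *: cyc f r - T *: s1) = 0.
  have E1 : phi ((a * c) *: cyc f r) = a *: (T *: y) by rewrite linearZ /= -scalerA yE.
  have E2 : phi (T *: s1) = T *: (a *: y) by rewrite linearZ /= s1E.
  by rewrite linearB E1 E2 !scalerA [T * a]mulrC subrr.
have -> : (a * c) *: cyc f r - T *: s1 = cyc f (fun l => a * c * r l + - T * r1 l).
  by rewrite r1E -scaleNr !cycZ cycD.
move=> /kb E; have {E}/cycP h : cyc f (fun l => b * (a * c * r l + - T * r1 l)) = cyc f (fun=> 0).
  by rewrite -cycZ E cyc0.
rewrite cycZ cyc0; apply/cycP => l; have [w wE] := h l.
exists (pi w); rewrite subr0 /= -(rmorphM pi w) -wE subr0.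
by rewrite !(rmorphM, rmorphD, rmorphN) piT; ring.
Qed.

Lemma descent_fin_gen : fin_gen X -> (exists x0, forall x', exists x a, x' = rho x + a *: x0) ->
  fin_gen X'.
Proof.
move=> [n [g gX]] [x0 x0E].
exists n.+1, (fun j => if unlift ord0 j is Some j' then rho (g j') else x0) => x'.
have [x [a ->]] := x0E x'; have [c ->] := gX x.
exists (fun j => if unlift ord0 j is Some j' then pi (c j') else a).
rewrite big_ord_recl /= unlift_none addrC rho_sum; congr (_ + _).
by apply: eq_bigr => j _; rewrite liftK rhoZ.
Qed.
End Descent.

Lemma pure1Z (R A : comPzRingType) (j : {rmorphism R -> A}) (X : lmodType R) r (x : X) :
  pure j 1 (r *: x) = j r *: pure j 1 x.
Proof. by rewrite -pureJ mul1r pureZ mulr1. Qed.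

Section LocalizedModules.
Variables (R : comPzRingType) (S : set R) (X : lmodType R).
Variables (t : nat) (f : 'I_t -> R) (psi : {linear sum_cyclic f -> X}).
Local Notation j := (@to_loc R S).
Let fj l := j (f l).

Lemma loc_annihilated c : mult_closure S c -> annihilator X c -> pseudo_null (tens j X).
Proof.
move=> mc Xc; apply: zero_pseudo_null => u.
have [s [x [ms sE]]] := tens_frac u.
have [v vE] := loc_inv ms; have [w wE] := loc_inv mc.
have x0 : pure j 1 x = 0.
  have := congr1 (fun a => a *: pure j 1 x) wE.
  by rewrite /= scale1r -scalerA -pure1Z Xc pure0 scaler0.
by rewrite -[u]scale1r -vE -scalerA sE x0 scaler0.
Qed.

Lemma loc_map : exists h : {linear sum_cyclic fj -> tens j X},
  forall r, h (cyc fj (j \o r)) = pure j 1 (psi (cyc f r)).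
Proof.
have [l|h hE] := @cyc_lift _ _ fj (tens j X) (fun l => pure j 1 (psi (cyc_gen f l))).
  rewrite -pure1Z -linearZ cycZ.
  suff -> : cyc f (fun l' => f l * (l' == l)%:R) = 0 by rewrite linear0 pure0.
  rewrite cyc0; apply/cycP => l'; rewrite subr0.
  by case: eqP => [->|_]; [exists 1; rewrite mulr1 mul1r|exists 0; rewrite mulr0 mul0r].
exists h => r; rewrite hE (cyc_sum f r) linear_sum.
have p1D : {morph (pure j 1 : X -> tens j X) : x y / x + y} by move=> x y; apply: pureDr.
rewrite (big_morph _ p1D (pure0 _ _ _)); apply: eq_bigr => l _.
by rewrite linearZ pure1Z.
Qed.

Lemma loc_cokernel c : mult_closure S c -> kills_coker psi c ->
  exists h : {linear sum_cyclic fj -> tens j X}, pseudo_null (coker h).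
Proof.
move=> mc kc; have [h hE] := loc_map; exists h; apply: zero_pseudo_null.
elim/quot_mod_elim => u; apply/coker_eq0.
have [s [x [ms sE]]] := tens_frac u.
have [v vE] := loc_inv ms; have [w wE] := loc_inv mc.
have [m mE] := kc x; have [r rE] := cyc_surj m.
exists (v *: (w *: cyc fj (j \o r))); rewrite !linearZ /= hE -rE -mE.
by rewrite pure1Z [w *: _]scalerA wE scale1r -sE scalerA vE scale1r.
Qed.

(** The quasi-inverse of [psi] for c^2 is extended to the localized modules, where c^2 is
    invertible; both compositions are then bijective. *)
Lemma loc_isomorphism c : mult_closure S c -> kills_ker psi c -> kills_coker psi c ->
  pseudo_iso (tens j X) (sum_cyclic fj).
Proof.
move=> mc kk kc; have [h hE] := loc_map; have [w wE] := loc_inv (mult_closure_mul mc mc).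
have [g [gpsi psig]] := quasi_inverse kk kc.
have /choice[rep repE] := @cyc_surj _ _ f.
pose kap (m : sum_cyclic f) := cyc fj (j \o rep m).
have kapE r : kap (cyc f r) = cyc fj (j \o r).
  apply/cycP => l; have := repE (cyc f r); move=> /cycP/(_ l)[a aE].
  by exists (- j a); rewrite /fj mulNr -rmorphM -aE /= rmorphB opprB.
have kapD m m' : kap (m + m') = kap m + kap m'.
  have [r ->] := cyc_surj m; have [r' ->] := cyc_surj m'.
  rewrite cycD !kapE cycD; congr cyc; apply/funext => l; exact: rmorphD.
have kapZ a m : kap (a *: m) = j a *: kap m.
  have [r ->] := cyc_surj m.
  rewrite cycZ !kapE cycZ; congr cyc; apply/funext => l; exact: rmorphM.
have [x y|a x|G GE] := @tens_map _ _ j X (sum_cyclic fj) (fun x => kap (g x)).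
- by rewrite linearD kapD.
- by rewrite linearZ kapZ.
have hk m : h (kap m) = pure j 1 (psi m).
  by have [r ->] := cyc_surj m; rewrite kapE hE.
exists G; split; apply: zero_pseudo_null.
  suff H u : G u = 0 -> u = 0.
    by move=> z; apply: val_inj; apply: H (ker_val z).
  move=> Gu.
  have [s [x [ms sE]]] := tens_frac u; have [v vE] := loc_inv ms.
  have g0 : kap (g x) = 0.
    have := congr1 G sE; rewrite linearZ Gu /= scaler0 GE scale1r.
    by move=> <-.
  have x0 : pure j 1 x = 0.
    have := hk (g x); rewrite g0 linear0 psig => /esym E.
    have := congr1 (fun a => a *: pure j 1 x) wE.
    by rewrite /= scale1r -scalerA -pure1Z -expr2 E scaler0.
  by rewrite -[u]scale1r -vE -scalerA sE x0 scaler0.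
elim/quot_mod_elim => y; apply/coker_eq0; have [r ->] := cyc_surj y.
have /choice[u uE] : forall l, exists u, cyc_gen fj l = G u.
  move=> l; exists (w *: pure j 1 (psi (cyc_gen f l))).
  rewrite linearZ GE scale1r gpsi kapZ /= scalerA expr2 wE scale1r.
  rewrite /cyc_gen kapE; congr cyc; apply/funext => l' /=.
  by case: eqP; rewrite ?rmorph1 ?rmorph0.
exists (\sum_l r l *: u l); rewrite linear_sum cyc_sum; apply: eq_bigr => l _.
by rewrite linearZ uE.
Qed.
End LocalizedModules.

Section TrivialBaseChange.
Variables (R : comPzRingType) (X : lmodType R).
Hypothesis gR : normal_ring R.
Variables (s0 : R).
Hypotheses (s00 : s0 != 0) (ns0 : ~ dvr s0 1).
Local Notation j := (idfun : {rmorphism R -> R}).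

Lemma tens_fin_gen : fin_gen X -> fin_gen (tens j X).
Proof.
move=> [n [g gX]]; exists n, (fun i => pure j 1 (g i)) => u.
have [x ->] := pure1_surj u; have [c ->] := gX x; exists c.
have [e eE] := pure1_linear X; rewrite -eE linear_sum.
by apply: eq_bigr => i _; rewrite linearZ eE.
Qed.

Lemma id_annihilated : fin_gen X -> grade2 (annihilator X) -> pseudo_null (tens j X).
Proof.
move=> fX gX; split; first exact: tens_fin_gen.
case: gR => dR nR _; apply: (grade_height dR nR s00 ns0); apply: grade2S gX => a aX u.
have [x ->] := pure1_surj u; have [e eE] := pure1_linear X.
by rewrite -eE -linearZ /= aX linear0.
Qed.

Variables (t : nat) (f : 'I_t -> R) (psi : {linear sum_cyclic f -> X}).

Lemma id_cokernel : fin_gen X -> grade2 (kills_coker psi) ->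
  exists h : {linear sum_cyclic f -> tens j X}, pseudo_null (coker h).
Proof.
move=> fX gX; have [e eE] := pure1_linear X; exists (e \o psi).
apply: (pseudo_null_coker gR s00 ns0); first exact: tens_fin_gen.
apply: grade2S gX => a aX u; have [x ->] := pure1_surj u.
by have [m mE] := aX x; exists m; rewrite /= -mE -eE linearZ.
Qed.

Lemma id_isomorphism : fin_gen X -> \prod_l f l != 0 -> grade2 (kills_ker psi) ->
  grade2 (kills_coker psi) -> pseudo_iso (tens j X) (sum_cyclic f).
Proof.
move=> fX F0 gk gc; have [g gg] := inverse_of_cyclic gR F0 gk gc.
have [e eE] := tens_id_linear X.
have eI u : e u = 0 -> u = 0.
  by have [x ->] := pure1_surj u; rewrite eE => ->; apply: pure0.
exists (g \o e); split.
  apply: (pseudo_null_ker gR s00 ns0); first exact: tens_fin_gen.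
  apply: grade2S gg => a [ka _] u /= /ka; rewrite -linearZ; exact: eI.
apply: (pseudo_null_coker gR s00 ns0); first exact: cyc_fin_gen.
apply: grade2S gg => a [_ ka] y; have [x xE] := ka y.
by exists (pure j 1 x); rewrite /= eE.
Qed.
End TrivialBaseChange.

Section LinearRestriction.
Variables (p d d' : nat) (k : divringClosed algC) (K : zp_ext p d k) (K' : zp_ext p d' k).
Hypotheses (pp : prime p) (sK : {subset K' <= K}).

(** Additivity suffices: modulo p^n a p-adic scalar is a natural number, and the error is divisible
    by p^n on both sides. *)
Lemma gal_resZ : scalable (gal_res sK).
Proof.
move=> z g; apply/subr0_eq/(lat_sep (gal_is_lat K' pp)) => n.
have [m [[c cE] _]] := zp_approx pp z n.
have -> : z = m%:R + (p ^ n)%:R * c by rewrite [_ * c]mulrC -cE addrC subrK.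
rewrite !scalerDl raddfD -!scalerA !scaler_nat !raddfMn opprD addrACA subrr add0r.
by exists (gal_res sK (c *: g) - c *: gal_res sK g); rewrite scaler_nat mulrnBl.
Qed.

Definition gal_res_lin : {linear gal K -> gal K'} :=
  HB.pack (gal_res sK) (GRing.isScalable.Build (padic p) (gal K) (gal K') *:%R (gal_res sK) gal_resZ).

Lemma gal_res_surj h : exists g, gal_res sK g = h.
Proof.
have [u uk <-] := gres_lift h; exists (gres K u).
by rewrite (gres_res sK).
Qed.

Lemma Lambda_res_surj (b : Lambda K') : exists a, Lambda_res sK a = b.
Proof. exact (@push_surj p _ _ _ _ _ (@gal_res_open _ _ _ _ K K' sK) pp (gal_is_lat K' pp) gal_res_surj b). Qed.

Lemma Lambda_res_elt g : Lambda_res sK (group_elt g) = group_elt (gal_res sK g).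
Proof. exact: push_delta. Qed.
End LinearRestriction.

Lemma gal_res_quotient p i (k : divringClosed algC) (K : zp_ext p i.+1 k) (K' : zp_ext p i k)
  (pp : prime p) (sK : {subset K' <= K}) : exists g0, quotient_by g0 (gal_res_lin pp sK).
Proof.
have [t tE] := theta_linear K; have [t' t'E] := theta_linear K'.
apply: (@kernel_line _ _ _ _ pp t t'); last exact: gal_res_surj.
  by apply: eq_bij (theta_bij K) _ _; move=> x; rewrite tE.
by apply: eq_bij (theta_bij K') _ _; move=> x; rewrite t'E.
Qed.

Lemma generic_functionals (R : realType) p i (k : divringClosed algC) (K : zp_ext p i.+1 k)
    (pp : prime p) (th : {linear gal K -> 'rV[padic p]_i.+1}) (s : seq ('I_i.+1 -> padic p))
    (P : forall K' : zp_ext p i k, {subset K' <= K} -> Prop) : bijective th ->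
  (forall l, l \in s -> exists j, l j != 0) ->
  (forall (K' : zp_ext p i k) (sK : {subset K' <= K}) g0,
    quotient_by g0 (gal_res_lin pp sK) -> (forall l, l \in s -> dual l (th g0) != 0) -> P K' sK) ->
  generic R P.
Proof.
move=> thb s0 sP; exists [set N | Gr i N /\
    exists2 l, l \in s & forall v, N v -> dual l (th v) = 0].
split; [by move=> N []|exact: closed_null_functionals|move=> K' sK nP].
have [g0 g0P] := gal_res_quotient pp sK; have [_ _ g0k] := g0P.
have NE : [set u : gal K | {in K', u =1 id}] = [set u | gal_res sK u = 0].
  apply/seteqP; split=> u /= uK.
    by apply: gal_eq => x /=; case: ifP => // /uK.
  by move=> x xK; have := congr1 (fun v : gal K' => v x) uK; rewrite /= xK.
rewrite NE; split.
  have [t' t'E] := theta_linear K'.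
  have -> : [set u | gal_res sK u = 0] = [set u | (t' \o gal_res_lin pp sK) u = 0].
    apply/seteqP; split=> u /= u0; first by rewrite u0 linear0.
    by apply: theta_inj; rewrite -!t'E u0 linear0.
  apply: ker_Gr => w; have [h hE] := theta_surj K' w; have [g gE] := gal_res_surj sK h.
  by exists g; rewrite /= gE t'E.
apply: contrapT => no; apply: nP; apply: (sP _ _ g0) => // l ls; apply/eqP => l0.
apply: no; exists l => // v /= /g0k [z ->].
by rewrite linearZ dualZ l0 mulr0.
Qed.

(** * Generic conditions and the final assembly *)

Section Pairs.
Variable R : comPzRingType.

Lemma grade2_prod n (I : 'I_n -> set R) : (forall j, grade2 (I j)) ->
  grade2 [set x | exists y, (forall j, I j (y j)) /\ x = \prod_j y j].
Proof.
elim: n I => [|n IH] I gI.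
  move=> x y x0 h; rewrite -[y]mul1r; apply: h; exists (fun=> 1).
  by split=> [[]//|]; rewrite big_ord0.
apply: grade2M (gI ord0) (IH (fun j => I (lift ord0 j)) _) _ => [j|a _ Ia [y [Iy ->]]].
  exact: gI.
exists (fun j => if unlift ord0 j is Some j' then y j' else a); split.
  by move=> j; case: unliftP => [j' ->|->].
rewrite big_ord_recl unlift_none; congr (_ * _).
by apply: eq_bigr => j _; rewrite liftK.
Qed.

(** The product of n ideals with two generators each; [e] selects one generator from each pair. *)
Definition pair_ideal n (x : 'I_n -> 'I_2 -> R) : set R :=
  [set b | exists a : {ffun 'I_n -> 'I_2} -> R, b = \sum_e a e * \prod_j x j (e j)].

Lemma pair_ideal_ideal n (x : 'I_n -> 'I_2 -> R) : is_ideal (pair_ideal x).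
Proof.
split.
- by exists (fun=> 0); rewrite big1 // => e _; rewrite mul0r.
- move=> _ _ [a ->] [b ->]; exists (fun e => a e + b e); rewrite -big_split.
  by apply: eq_bigr => e _; rewrite mulrDl.
- move=> c _ [a ->]; exists (fun e => c * a e); rewrite big_distrr.
  by apply: eq_bigr => e _; apply: mulrA.
Qed.

Lemma pair_ideal_grade2 n (x : 'I_n -> 'I_2 -> R) :
  (forall j, grade2 [set b | exists a, b = \sum_i a i * x j i]) -> grade2 (pair_ideal x).
Proof.
move=> /grade2_prod; apply: grade2S => _ [y [/choice[a aE] ->]].
exists (fun e => \prod_j a j (e j)).
under eq_bigr do rewrite aE.
rewrite bigA_distr_bigA; apply: eq_bigr => e _; exact: big_split.
Qed.
End Pairs.

(** [Lambda_dagger] is a ring chosen by a test on d, so statements about it are proved for ring and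
    map together, abstracted over the case. *)
Lemma dagger_ind p d (k : divringClosed algC) (K : zp_ext p d k)
  (P : forall A : comPzRingType, {rmorphism Lambda K -> A} -> Prop) :
  (d == 1%N -> P _ (@to_loc (Lambda K) (@dagger_set p d k K))) -> (d != 1%N -> P _ idfun) ->
  P _ (to_dagger K).
Proof.
move=> H1 H2; rewrite /to_dagger /Lambda_dagger.
by case: (d =P 1%N) => [/eqP d1|/eqP d1]; [apply: H1|apply: H2].
Qed.

Section Elements.
Variables (p d : nat) (k : divringClosed algC) (K : zp_ext p d k).
Hypotheses (pp : prime p) (d_gt0 : (0 < d)%N).

Lemma Lambda_normal : normal_ring (Lambda K).
Proof. exact (@lattice_normal p pp d _ _ (gal_lattice K)). Qed.

(** An augmentation g - 1, which vanishes at the level U = G where 1 does not; it is the nonunit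
    needed to pass from grade to height. *)
Lemma Lambda_nonunit : exists2 x : Lambda K, x != 0 & ~ dvr x 1.
Proof.
have [g gE] := theta_surj K (delta_mx 0 (Ordinal d_gt0)).
have dL := normal_dom Lambda_normal; have [dZ0 _] := normal_dom (zp_normal pp).
have g0 : g != 0.
  apply/eqP => g0; have [t tE] := theta_linear K; move: gE.
  rewrite g0 -tE linear0 => /(congr1 (fun w : 'rV_d => w 0 (Ordinal d_gt0))).
  by rewrite !mxE !eqxx => /esym/eqP; apply/negP.
exists (group_elt g - 1).
  apply/eqP => T0; case: dL => + _; apply/negP; rewrite negbK; apply/eqP.
  by apply: (augmentation_reg pp (gal_is_lat K pp) g0); rewrite mulr1.
move=> [y yE].
pose U := pn (gal_is_lat K pp) 0.
have : lev U (1 : Lambda K).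
  have [_ _ lM] := lev_ideal U; rewrite yE; apply: lM.
  apply: delta_lev; apply/pnE; exists (g - 0); by rewrite expn0 scale1r.
by move=> /(_ (opi U 0)) /=; rewrite eqxx => /eqP; apply/negP.
Qed.

Lemma augmentations_small : small d [set x : Lambda K | exists g, x = group_elt g - 1].
Proof.
apply: (@small_augmentation p pp d (gal K) _ _ 1 (gal_lattice K) d_gt0).
  by have [] := normal_dom (zp_normal pp).
by move=> g; exists g; rewrite scale1r.
Qed.

Lemma pairs_grade2 n (D : 'I_n -> 'I_2 -> gal K) :
  (forall j (c : 'I_2 -> padic p), \sum_i c i *: D j i = 0 -> forall i, c i = 0) ->
  grade2 (pair_ideal (fun j i => group_elt (D j i) - 1 : Lambda K)).
Proof.
move=> Dindep; apply: pair_ideal_grade2 => j.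
have [dZ0 _] := normal_dom (zp_normal pp).
have l1 : lift ord0 ord0 = 1 :> 'I_2 by apply/val_inj.
apply: (@indep_grade2 p pp d (gal K) _ _ (D j 0) (D j 1) (gal_lattice K)).
- move=> a b ab; apply: (Dindep j (fun i => if i == 0 then a else b) _ 0).
  by rewrite big_ord_recl big_ord1 /= l1.
- apply/eqP => D1; case/eqP: dZ0; apply: (Dindep j (fun i => (i == 1)%:R) _ 1).
  by rewrite big_ord_recl big_ord1 /= l1 D1 scaler0 scale0r addr0.
- exists (fun i => (i == 0)%:R); rewrite big_ord_recl big_ord1 /= mul1r mul0r addr0.
  by [].
- exists (fun i => (i == 1)%:R); rewrite big_ord_recl big_ord1 /= mul0r add0r mul1r.
  by rewrite l1.
Qed.
End Elements.

Lemma annihilates_inertia_ideal p d d' (k : divringClosed algC) (K : zp_ext p d k)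
  (K' : zp_ext p d' k) (X : iwasawa_module K) g0 : is_ideal (annihilates_inertia K' X g0).
Proof.
split.
- by move=> v s t _ _ _ _; exists 0; rewrite scale0r scaler0.
- move=> a b ha hb v s t vp sK' vs tk; have [y yE] := ha v s t vp sK' vs tk.
  have [z zE] := hb v s t vp sK' vs tk; exists (y + z).
  by rewrite scalerDl yE zE scalerDr.
- move=> a b hb v s t vp sK' vs tk; have [y yE] := hb v s t vp sK' vs tk.
  by exists (a *: y); rewrite -scalerA yE !scalerA mulrC.
Qed.

Section Eventually.
Variables (p i : nat) (k : divringClosed algC) (K : zp_ext p i.+1 k).
Hypotheses (pp : prime p) (i_gt0 : (0 < i)%N).
Local Notation family := (forall K' : zp_ext p i k, {subset K' <= K} -> gal K -> Prop).
Let th := projT1 (cid (theta_linear K)).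
Let thb : bijective th.
Proof.
rewrite /th; case: cid => t tE /=.
by apply: eq_bij (theta_bij K) _ _; move=> x; rewrite tE.
Qed.

(* [Gal(K/K')] is generated by [g0], so this excludes the [K'] whose Galois group
   lies in one of finitely many hyperplanes. *)
Definition eventually (P : family) := exists s : seq ('I_i.+1 -> padic p),
  (forall l, l \in s -> exists j, l j != 0) /\
  forall (K' : zp_ext p i k) (sK : {subset K' <= K}) g0, quotient_by g0 (gal_res_lin pp sK) ->
    (forall l, l \in s -> dual l (th g0) != 0) -> P K' sK g0.

Lemma eventually_and (P Q : family) : eventually P -> eventually Q ->
  eventually (fun K' sK g0 => P K' sK g0 /\ Q K' sK g0).
Proof.
move=> [s [s0 sP]] [t [t0 tQ]]; exists (s ++ t); split=> [l|K' sK g0 q st].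
  by rewrite mem_cat => /orP[/s0|/t0].
by split; [apply: sP|apply: tQ] => // l ls; apply: st; rewrite mem_cat ls ?orbT.
Qed.

Lemma eventually_generic (R : realType) (P : family)
    (Q : forall K' : zp_ext p i k, {subset K' <= K} -> Prop) : eventually P ->
  (forall (K' : zp_ext p i k) (sK : {subset K' <= K}) g0,
    quotient_by g0 (gal_res_lin pp sK) -> P K' sK g0 -> Q K' sK) -> generic R Q.
Proof.
move=> [s [s0 sP]] PQ; apply: (@generic_functionals R p i k K pp th s) => // K' sK g0 q gs.
by apply: (PQ _ _ _ q); apply: sP.
Qed.

Lemma eventually_small (A : set (Lambda K)) : is_ideal A -> grade2 A ->
  eventually (fun K' sK _ => small i (Lambda_res sK @` A)).
Proof.
move=> iA gA; have [s [s0 sP]] := generic_small pp (gal_lattice K) i_gt0 thb iA gA.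
exists s; split=> // K' sK g0 q gs.
exact: (sP (gal K') _ g0 (gal_res_lin pp sK) (@gal_res_open _ _ _ _ K K' sK) (gal_lattice K') q gs).
Qed.

Lemma eventually_neq0 (f : Lambda K) : f != 0 -> eventually (fun K' sK _ => Lambda_res sK f != 0).
Proof.
move=> f0; have [s [s0 sP]] := generic_neq0 pp (gal_lattice K) i_gt0 thb f0.
exists s; split=> // K' sK g0 q gs.
exact: (sP (gal K') _ g0 (gal_res_lin pp sK) (@gal_res_open _ _ _ _ K K' sK) (gal_lattice K') q gs).
Qed.

End Eventually.

Section ModuleDescent.
Variables (p i : nat) (k : divringClosed algC) (K : zp_ext p i.+1 k) (K' : zp_ext p i k).
Hypotheses (pp : prime p) (i_gt0 : (0 < i)%N) (sK : {subset K' <= K}).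
Variables (X : iwasawa_module K) (X' : iwasawa_module K') (g0 : gal K).
Hypothesis q : quotient_by g0 (gal_res_lin pp sK).
Let pi : {rmorphism Lambda K -> Lambda K'} := cga_push (@gal_res_open _ _ _ _ K K' sK).

Let kerP g : gal_res sK g = 0 <-> exists z, g = z *: g0.
Proof. by have [_ _ h] := q; apply: h. Qed.

Lemma iw_fin_gen : fin_gen X -> fin_gen X'.
Proof.
move=> fX; apply: (@descent_fin_gen _ _ pi X X' (@rho _ _ _ _ K K' X X')) fX _.
- exact: rhoD.
- exact: rhoZ.
- exact: (rho_generated X X' pp kerP).
Qed.

(** As (g - 1) X' lies in the image of rho, it is killed by the image of the annihilator of X; the
    augmentations g - 1 are themselves small. *)
Lemma annihilator_descent : small i (Lambda_res sK @` annihilator X) -> small i (annihilator X').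
Proof.
move=> sA; apply: smallM sA (augmentations_small K' pp i_gt0) _ => _ _ [a aX <-] [g ->] x'.
rewrite -scalerA; have [x xE] := @rho_coker _ _ _ _ _ _ sK X X' pp g x'; rewrite xE.
by rewrite -(rhoZ sK) // aX rho0.
Qed.

Variables (t : nat) (f : 'I_t -> Lambda K) (phi : {linear sum_cyclic f -> X}).
Hypothesis nfk : number_field k.
Let A := kills_ker phi `&` kills_coker phi.

(** [psi] does not depend on [B]: its cokernel is controlled unconditionally, and its kernel as soon
    as enough elements annihilate inertia, as in part (2). *)
Lemma cyclic_descent : small i (Lambda_res sK @` A) ->
  exists psi : {linear sum_cyclic (fun l => Lambda_res sK (f l)) -> X'},
    small i (kills_coker psi) /\
    forall B : set (Lambda K), B `<=` annihilates_inertia K' X g0 ->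
      small i (Lambda_res sK @` B) -> small i (kills_ker psi).
Proof.
move=> sA; have [||psi psiE] := @descent_map _ _ pi X X' (@rho _ _ _ _ K K' X X') _ _ t f phi.
- exact: rhoD.
- exact: rhoZ.
have piT : pi (group_elt g0 - 1) = 0.
  rewrite rmorphB rmorph1 -[pi _]/(Lambda_res sK _) Lambda_res_elt.
  have -> : gal_res sK g0 = 0 by apply/kerP; exists 1; rewrite scale1r.
  exact: subrr.
have sG := augmentations_small K' pp i_gt0.
exists psi; split=> [|B BI sB].
  apply: smallM sA sG _ => _ _ [a [_ ka] <-] [g ->].
  apply: (@descent_coker _ _ pi X X' (@rho _ _ _ _ K K' X X') _ t f phi psi psiE) => //.
    exact: rhoZ.
  by move=> x'; exact: (@rho_coker _ _ _ _ _ _ sK X X' pp g x').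
have sAA : small i [set x | exists a b, [/\ A a, A b & x = pi a * pi b]].
  by apply: (smallM sA sA) => _ _ [a Aa <-] [b Ab <-]; exists a, b.
have sBG : small i [set x | exists b g, B b /\ x = pi (b * (group_elt g - 1))].
  apply: smallM sB sG _ => _ _ [b Bb <-] [g' ->]; have [g <-] := gal_res_surj sK g'.
  exists b, g; split=> //; rewrite rmorphM rmorphB rmorph1 -[pi (group_elt g)]/(Lambda_res sK _).
  by rewrite Lambda_res_elt.
apply: smallM sAA sBG _ => _ _ [a [b [[_ ka] [kb _] ->]]] [c [g [Bc ->]]].
apply: (@descent_ker _ _ pi X X' (@rho _ _ _ _ K K' X X') _ _ piT t f phi psi psiE) => //.
  exact: Lambda_res_surj.
move=> x x0; rewrite -scalerA.
exact: (rho_kernel pp kerP nfk (BI _ Bc) g x0).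
Qed.
End ModuleDescent.

Lemma prod_neq0 (A : comPzRingType) t (f : 'I_t -> A) : is_domain A -> (forall l, f l != 0) ->
  \prod_l f l != 0.
Proof.
move=> dA f0; elim/big_ind: _ => // [|a b]; first by case: dA.
exact: dom_mul0.
Qed.

Section Daggers.
Variables (p d t : nat) (k : divringClosed algC) (K : zp_ext p d k) (X : lmodType (Lambda K)).
Variables (f : 'I_t -> Lambda K).
Hypotheses (pp : prime p) (d_gt0 : (0 < d)%N) (fX : fin_gen X).

Lemma dagger_null : small d (annihilator X) -> pseudo_null (dagger X).
Proof.
rewrite /dagger; apply: (dagger_ind (P := fun A j => small d (annihilator X) -> pseudo_null (tens j X))).
  by rewrite /small => -> /= [c mc Xc]; apply: loc_annihilated mc Xc.
rewrite /small => /negPf -> gX; have [s s0 ns] := Lambda_nonunit K pp d_gt0.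
exact: (id_annihilated (Lambda_normal K pp) s0 ns fX gX).
Qed.

Variable psi : {linear sum_cyclic f -> X}.

Lemma dagger_coker : small d (kills_coker psi) ->
  exists h : {linear sum_cyclic (fun l => to_dagger K (f l)) -> dagger X}, pseudo_null (coker h).
Proof.
rewrite /dagger; apply: (dagger_ind (P := fun A j => small d (kills_coker psi) ->
  exists h : {linear sum_cyclic (fun l => j (f l)) -> tens j X}, pseudo_null (coker h))).
  by rewrite /small => -> /= [c mc kc]; apply: loc_cokernel mc kc.
rewrite /small => /negPf -> gX; have [s s0 ns] := Lambda_nonunit K pp d_gt0.
exact: (id_cokernel (Lambda_normal K pp) s0 ns fX gX).
Qed.

Lemma dagger_iso : \prod_l f l != 0 -> small d (kills_ker psi) -> small d (kills_coker psi) ->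
  pseudo_iso (dagger X) (sum_cyclic (fun l => to_dagger K (f l))).
Proof.
move=> F0; rewrite /dagger; apply: (dagger_ind (P := fun A j => small d (kills_ker psi) ->
  small d (kills_coker psi) -> pseudo_iso (tens j X) (sum_cyclic (fun l => j (f l))))).
  move=> d1 sk sc; have := smallM (K := kills_ker psi `&` kills_coker psi) sk sc.
  rewrite /small d1 /= => -[|c mc [kk kc]]; last exact: loc_isomorphism mc kk kc.
  have [_ _ kM] := kills_ker_ideal psi; have [_ _ cM] := kills_coker_ideal psi.
  by move=> a b ka cb; split; [rewrite mulrC; apply: kM|apply: cM].
rewrite /small => /negPf -> gk gc; have [s s0 ns] := Lambda_nonunit K pp d_gt0.
exact: (id_isomorphism (Lambda_normal K pp) s0 ns fX F0 gk gc).
Qed.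
End Daggers.

Theorem theorem5p6 (R : realType) (p i t : nat) (k : divringClosed algC)
    (K : zp_ext p i.+1 k) (X : iwasawa_module K) (f : 'I_t -> Lambda K) :
  prime p -> number_field k -> (1 <= i)%N ->
  (forall l, f l != 0) -> pseudo_iso X (sum_cyclic f) ->
  [/\ generic R (fun (K' : zp_ext p i k) (sK : {subset K' <= K}) =>
        forall X' : iwasawa_module K',
          exists h : {linear
            sum_cyclic (fun l => to_dagger K' (Lambda_res sK (f l))) ->
            dagger X'},
          pseudo_null (coker h)),
      pseudo_null X ->
        generic R (fun (K' : zp_ext p i k) (sK : {subset K' <= K}) =>
          forall X' : iwasawa_module K', pseudo_null (dagger X')) &
      (forall q : set algC, prime_of_integers k q -> q p%:R ->
         forall P : set algC, prime_of_integers K P ->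
           P `&` [set x | x \in k] = q ->
           rank_ge 2 (decomposition_group K P)) ->
        generic R (fun (K' : zp_ext p i k) (sK : {subset K' <= K}) =>
          forall X' : iwasawa_module K',
            pseudo_iso (dagger X')
              (sum_cyclic (fun l => to_dagger K' (Lambda_res sK (f l)))))].
Proof.
move=> pp nfk i_gt0 f0 [h [[fker hker] [_ hcok]]].
have gL := Lambda_normal K pp; have [dL nL cL] := gL.
have fX : fin_gen X by apply: (fin_gen_extension nL fker); apply: cyc_fin_gen.
have F0 := prod_neq0 dL f0.
have gk : grade2 (kills_ker h) by rewrite -ker_annihilator; apply: height_grade.
have gc : grade2 (kills_coker h) by rewrite -coker_annihilator; apply: height_grade.
have [phi gphi] := inverse_to_cyclic gL F0 gk gc.
have iphi : is_ideal (kills_ker phi `&` kills_coker phi).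
  exact: idealI (kills_ker_ideal phi) (kills_coker_ideal phi).
have ephi := eventually_small pp i_gt0 iphi gphi.
split.
- apply: (eventually_generic R ephi) => K' sK g0 q sA X'.
  have [psi [cpsi _]] := cyclic_descent i_gt0 X' q nfk sA.
  exact: (dagger_coker pp i_gt0 (iw_fin_gen X' q fX) cpsi).
- move=> [_ hX]; have gX : grade2 (annihilator X) by apply: height_grade.
  have iX : is_ideal (annihilator X).
    split=> [x|a b aX bX x|a b bX x]; first by rewrite scale0r.
      by rewrite scalerDl aX bX addr0.
    by rewrite -scalerA bX scaler0.
  apply: (eventually_generic R (eventually_small pp i_gt0 iX gX)) => K' sK g0 q sA X'.
  exact: (dagger_null pp i_gt0 (iw_fin_gen X' q fX) (annihilator_descent pp i_gt0 X' sA)).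
- move=> /(ramified_pairs pp nfk)[n [D [Dindep Dlift]]].
  have eD := eventually_small pp i_gt0 (pair_ideal_ideal _) (pairs_grade2 pp Dindep).
  (* The restrictions of the f_l must also be nonzero, so that the cyclic sum over K' is torsion and
     [psi] can be reversed. *)
  apply: (eventually_generic R (eventually_and ephi (eventually_and eD (eventually_neq0 pp i_gt0 F0)))).
  move=> K' sK g0 q [sA [sD F0']] X'.
  have [psi [cpsi kpsi]] := cyclic_descent i_gt0 X' q nfk sA.
  have [_ _ kerP] := q.
  apply: (dagger_iso pp i_gt0 (iw_fin_gen X' q fX) _ (kpsi _ _ sD) cpsi).
    have E : Lambda_res sK (\prod_l f l) = \prod_l Lambda_res sK (f l).
      exact: (rmorph_prod (cga_push (@gal_res_open _ _ _ _ K K' sK))).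
    by rewrite -E.
  move=> _ [a ->]; have [I0 ID IM] := annihilates_inertia_ideal K' X g0.
  elim/big_ind: _ => // e _; apply: IM.
  exact: (pairs_annihilate X pp kerP e Dlift).
Qed.
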